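(* Assume that the problem $\det D^2u=f$ in $\Omega$, $u=g$ on $\partial\Omega$ has a smooth strictly convex solution $u$. Then for $h$ sufficiently small the discrete problem: find $u_h\in V^h$, $u_h=g_h$ on $\partial\Omega$, such that $$-\frac1n\int_\Omega(\operatorname{cof}D^2u_h)Du_h\cdot Dw_h\,dx=\int_\Omega f w_h\,dx\qquad\forall w_h\in V_0^h,$$ has a (locally unique) solution $u_h$ satisfying $\|u-u_h\|_1\le Ch^l$ with $C$ independent of $h$, and this solution belongs to $$X^h=\Big\{v_h\in V^h:\ v_h=g_h\text{ on }\partial\Omega,\ \|v_h-Q_hu\|_1<\tfrac{\delta h^{1+n/2}}{4}\Big\}$$ and hence is convex.
   Context: Let $n\in\{2,3\}$ and let $\Omega\subset\mathbb R^n$ be a bounded convex domain with polygonal (polyhedral) boundary. $\mathcal T_h$ is a family of shape-regular, quasi-uniform triangulations of $\Omega$ into simplices with maximal diameter $h$, $V^h=\{s\in C^1(\Omega): s|_K\in\mathcal P_d\ \forall K\in\mathcal T_h\}$ with $\mathcal P_d$ the polynomials of degree at most $d$, and $V_0^h=V^h\cap H_0^1(\Omega)$. $g_h$ is the interpolant in $V^h$ of a smooth extension of $g$. $\operatorname{cof}A$ is the matrix of cofactors of $A$. $\|\cdot\|_{k,p}$, $|\cdot|_{k,p}$ are the norm and seminorm of $W^{k,p}(\Omega)$, and $\|\cdot\|_k,|\cdot|_k$ those of $H^k(\Omega)$. Standing assumptions on $V^h$. (Approximation) There are a linear quasi-interpolation operator $Q_h:L^1(\Omega)\to V^h$ and a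 constant $C$ independent of $h$ with $\|v-Q_hv\|_{k,p}\le Ch^{l+1-k}|v|_{l+1,p}$ for $v\in W^{l+1,p}(\Omega)$, $1\le p\le\infty$, $0\le k\le l\le d$. (Inverse estimates) $\|v\|_{s,p}\le Ch^{l-s+\min(0,n/p-n/q)}\|v\|_{l,q}$ for all $v\in V^h$, $0\le l\le s$, $1\le p,q\le\infty$, norms being understood element by element when necessary. In particular $C_0>0$ denotes a constant independent of $h$ such that $|v|_{2,\infty}\le C_0h^{-1-n/2}\|v\|_1$ for all $v\in V^h$. The function $f$ satisfies $f\ge c_0>0$; $u\in W^{l+1,\infty}(\Omega)$ for some $3\le l\le d$ is strictly convex, and $m',M'>0$ are constants such that all eigenvalues of $D^2u(x)$ lie in $[m',M']$ for all $x\in\Omega$. The constant $\delta$ satisfies $0<\delta<\min\{1,m'/(2nC_0)\}$. *)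

(* Defs.v *)
From HB Require Import structures.
From mathcomp Require Import all_boot all_order all_algebra.
From mathcomp Require Import all_classical all_reals all_analysis.
Set Implicit Arguments.
Unset Strict Implicit.
Unset Printing Implicit Defensive.
Import Order.TTheory GRing.Theory Num.Theory.
Import numFieldNormedType.Exports.
Local Open Scope classical_set_scope.
Local Open Scope ring_scope.

(* 'rV[R]_n with the sigma-algebra generated by the coordinates, i.e. the Borel
   sigma-algebra of R^n. *)
Definition rV_display : measure_display -> measure_display.
Proof. exact. Qed.

Section measurable_rV.
Context {R : realType} {n : nat}.

Let coord (i : 'I_n) (x : 'rV[R]_n) : measurableTypeR R := x ord0 i.

Let rV_set0 : g_sigma_preimage coord set0.
Proof. exact: sigma_algebra0. Qed.

Let rV_setC A : g_sigma_preimage coord A -> g_sigma_preimage coord (~` A).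
Proof. exact: sigma_algebraC. Qed.

Let rV_bigcup (F : (set 'rV[R]_n)^nat) :
  (forall i, g_sigma_preimage coord (F i)) ->
  g_sigma_preimage coord (\bigcup_i F i).
Proof. exact: sigma_algebra_bigcup. Qed.

HB.instance Definition _ := @isMeasurable.Build (rV_display default_measure_display)
  'rV[R]_n (g_sigma_preimage coord) rV_set0 rV_setC rV_bigcup.

Lemma measurable_coord (i : 'I_n) :
  measurable_fun [set: 'rV[R]_n] (fun x : 'rV[R]_n => x ord0 i).
Proof.
move=> _ Y mY; rewrite setTI; apply: sub_sigma_algebra => /=.
rewrite -bigcup_seq/=; exists i => /=; first by rewrite mem_index_enum.
by exists Y => //; rewrite setTI.
Qed.

Lemma measurable_fun_rV d (T : measurableType d) (f : T -> 'rV[R]_n) :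
  (forall i, measurable_fun [set: T] (fun t => f t ord0 i)) ->
  measurable_fun [set: T] f.
Proof.
move=> mf; suff H : g_sigma_preimage (fun i => coord i \o f) `<=` measurable.
  by move=> _ A mA; rewrite setTI; apply: H; rewrite g_sigma_preimage_comp;
    exists A => //; rewrite setTI.
apply: smallest_sub; first exact: sigma_algebra_measurable.
rewrite -bigcup_seq/=; apply: bigcup_sub => i _ A [B mB <-].
exact: (mf i).
Qed.

End measurable_rV.

Section lebesgue_rV.
Context {R : realType}.

Definition rV_cons n (p : measurableTypeR R * 'rV[R]_n) : 'rV[R]_n.+1 :=
  row_mx (p.1%:M : 'rV[R]_1) p.2.

Definition rV_uncons n (v : 'rV[R]_n.+1) : measurableTypeR R * 'rV[R]_n :=
  (v ord0 ord0, rsubmx (v : 'rV[R]_(1 + n))).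

Lemma rV_consK n : cancel (@rV_cons n) (@rV_uncons n).
Proof.
case=> x v; rewrite /rV_cons /rV_uncons; congr pair; last by rewrite row_mxKr.
transitivity ((row_mx (x%:M : 'rV[R]_1) v) ord0 (lshift n (ord0 : 'I_1))).
  by congr (fun_of_matrix _ _ _); exact: val_inj.
by rewrite row_mxEl mxE eqxx.
Qed.

Lemma measurable_rV_cons n : measurable_fun setT (@rV_cons n).
Proof.
apply: measurable_fun_rV => i.
have [[j ->]|[j ->]] : (exists j : 'I_1, i = lshift n j) \/
    (exists j : 'I_n, i = rshift 1 j).
- by case: (splitP (i : 'I_(1 + n))) => j ij; [left|right]; exists j; exact: val_inj.
- apply: (@eq_measurable_fun _ _ _ _ _ fst) => [p _|]; last exact: measurable_fst.
  by rewrite [RHS]row_mxEl (ord1 j) mxE eqxx.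
- apply: (@eq_measurable_fun _ _ _ _ _
    (fun p : measurableTypeR R * 'rV[R]_n => p.2 ord0 j)) => [p _|].
    by rewrite [RHS]row_mxEr.
  by apply: (measurableT_comp (measurable_coord j)); exact: measurable_snd.
Qed.

Lemma measurable_rV_uncons n : measurable_fun setT (@rV_uncons n).
Proof.
apply/measurable_fun_pairP; split; first exact: measurable_coord.
apply: measurable_fun_rV => i.
apply: (@eq_measurable_fun _ _ _ _ _ (fun v : 'rV[R]_n.+1 => v ord0 (rshift 1 i))).
  by move=> v _; rewrite /= mxE.
exact: measurable_coord.
Qed.

(* The product of Lebesgue measure on R and of [mu], carried over to row vectors. *)
Definition lebesgue_rV_step n (mu : {sigma_finite_measure set 'rV[R]_n -> \bar R}) :=
  pushforward (lebesgue_measure \x mu)%E (@rV_cons n).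

Section step.
Variables (n : nat) (mu : {sigma_finite_measure set 'rV[R]_n -> \bar R}).

HB.instance Definition _ := Measure.copy (lebesgue_rV_step mu)
  (measure_function_pushforward__canonical__measure_function_Measure
     (lebesgue_measure \x mu)%E (@measurable_rV_cons n)).

Let sigma_finite_step : sigma_finite setT (lebesgue_rV_step mu).
Proof.
have /sigma_finiteP[F [TF ndF Foo]] :=
  sigma_finiteT (lebesgue_measure : {sigma_finite_measure set (measurableTypeR R) -> \bar R}).
have /sigma_finiteP[G [TG ndG Goo]] := sigma_finiteT mu.
exists (fun k => @rV_uncons n @^-1` (F k `*` G k)).
  rewrite -preimage_bigcup [X in _ @^-1` X](_ : _ = setT) ?preimage_setT//.
  rewrite -setXTT TF TG predeqE => -[x y]; split.
    by move=> [k _ []/= ? ?]; split; exists k.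
  move=> [/= [k _ Fkx] [m _ Gmy]]; exists (maxn k m) => //; split.
  - by move: x Fkx; exact/subsetPset/ndF/leq_maxl.
  - by move: y Gmy; exact/subsetPset/ndG/leq_maxr.
move=> k; have [mF Foo'] := Foo k; have [mG Goo'] := Goo k.
split.
  by rewrite -[X in measurable X]setTI; apply: measurable_rV_uncons => //; exact: measurableX.
rewrite /lebesgue_rV_step /pushforward -comp_preimage.
rewrite (_ : _ \o _ = idfun) ?preimage_id; last exact/funext/rV_consK.
by rewrite product_measure1E// lte_mul_pinfty// ge0_fin_numE.
Qed.

HB.instance Definition _ := Measure_isSigmaFinite.Build _ _ _
  (lebesgue_rV_step mu) sigma_finite_step.

End step.

Fixpoint lebesgue_rV n : {sigma_finite_measure set 'rV[R]_n -> \bar R} :=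
  if n is n'.+1 then lebesgue_rV_step (lebesgue_rV n') else \d_(0 : 'rV[R]_0).

End lebesgue_rV.

Section geometry.
Context {R : realType} {n : nat}.
Local Notation E := 'rV[R]_n.

(* The library norm of 'rV[R]_n is the sup norm. *)
Definition enorm (x : E) : R := Num.sqrt (\sum_i x ord0 i ^+ 2).

Definition diam (A : set E) : R :=
  sup [set enorm (xy.1 - xy.2) | xy in A `*` A].

Definition hull (s : seq E) : set E :=
  [set x | exists c : 'I_(size s) -> R,
    [/\ forall i, 0 <= c i, \sum_i c i = 1 & x = \sum_i c i *: s`_i]].

Definition convex_polyhedral_domain (Omega : set E) :=
  Omega !=set0 /\ exists s : seq E, Omega = (hull s)°.

Definition bdry (Omega : set E) : set E := closure Omega `\` Omega°.

Definition affinely_independent (K : n.+1.-tuple E) :=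
  row_free (\matrix_(i < n) (tnth K (lift ord0 i) - tnth K ord0)).

(* A simplex is given by its vertices. *)
Definition triangulation (Omega : set E) (T : seq (n.+1.-tuple E)) :=
  [/\ uniq T,
      forall K, K \in T -> affinely_independent K,
      closure Omega = \bigcup_(K in [set` T]) hull K,
      forall K K', K \in T -> K' \in T -> K != K' ->
        (hull K)° `&` (hull K')° = set0 &
      forall K K', K \in T -> K' \in T ->
        hull K `&` hull K' = hull [seq x <- K | x \in tval K']].

Definition mesh_size (T : seq (n.+1.-tuple E)) : R :=
  \big[Num.max/0]_(K <- T) diam (hull K).

Definition shape_regular (I : Type) (T : I -> seq (n.+1.-tuple E)) :=
  exists2 sigma : R, 0 < sigma & forall i K, K \in T i ->
    exists x : E, exists2 r : R, 0 < r &
      [set y | enorm (y - x) <= r] `<=` hull K /\ diam (hull K) <= sigma * r.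

Definition quasi_uniform (I : Type) (T : I -> seq (n.+1.-tuple E)) :=
  exists2 tau : R, 0 < tau & forall i K, K \in T i ->
    tau * mesh_size (T i) <= diam (hull K).

End geometry.

Section differential_operators.
Context {R : realType} {n : nat}.
Local Notation E := 'rV[R]_n.
Implicit Types (U : set E) (v : E -> R).

Definition partial (i : 'I_n) v : E -> R := 'D_(delta_mx ord0 i) v.

Definition mpartial (a : 'I_n -> nat) v : E -> R :=
  foldr (fun i w => iter (a i) (partial i) w) v (enum 'I_n).

Definition gradient v (x : E) : 'rV[R]_n := \row_i partial i v x.

Definition hessian v (x : E) : 'M[R]_n :=
  \matrix_(i, j) partial i (partial j v) x.

Definition cof (A : 'M[R]_n) : 'M[R]_n := \matrix_(i, j) cofactor A i j.

Definition C1 U v :=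
  forall x, U x -> differentiable v x /\ forall i, {for x, continuous (partial i v)}.

Definition C2 U v := C1 U v /\ forall i, C1 U (partial i v).

Definition test_function U v :=
  (forall (s : seq 'I_n) (x : E), differentiable (foldr partial v s) x) /\
  exists A : set E, [/\ compact A, A `<=` U & forall x, ~ A x -> v x = 0].

Definition strictly_convex U v := forall x y (t : R), U x -> U y -> x <> y ->
  0 < t < 1 -> v (t *: x + (1 - t) *: y) < t * v x + (1 - t) * v y.

End differential_operators.

Section sobolev.
Context {R : realType} {n : nat}.
Local Notation E := 'rV[R]_n.
Implicit Types (U : set E) (v w : E -> R) (p : \bar R).

Definition mindex (k : nat) := {ffun 'I_n -> 'I_k.+1}.

Definition mdeg (k : nat) (a : mindex k) : nat := \sum_i a i.

Definition locally_integrable_on U v := forall A : set E,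
  compact A -> A `<=` U -> (lebesgue_rV n).-integrable A (EFin \o v).

Definition weak_deriv U (a : 'I_n -> nat) v w :=
  [/\ locally_integrable_on U v, locally_integrable_on U w &
      forall phi, test_function U phi ->
        \int[lebesgue_rV n]_(x in U) (v x * mpartial a phi x) =
        (-1) ^+ (\sum_i a i) * \int[lebesgue_rV n]_(x in U) (w x * phi x)].

Definition Lpnorm U p v : \bar R := 'N[lebesgue_rV n]_p[EFin \o (v \_ U)].

(* Weak derivatives being unique up to negligible sets, this is the norm of
   the weak derivative; it is +oo if there is none. *)
Definition weak_deriv_norm U p v (a : 'I_n -> nat) : \bar R :=
  ereal_inf [set Lpnorm U p w | w in weak_deriv U a v].

Definition lpsum p (s : seq \bar R) : \bar R :=
  if p is r%:E then ((\sum_(x <- s) x `^ r) `^ r^-1)%E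
  else \big[maxe/0%E]_(x <- s) x.

Definition sob_norm U (k : nat) p v : \bar R :=
  lpsum p [seq weak_deriv_norm U p v (fun i => a i) |
            a : mindex k <- enum {: mindex k} & (mdeg a <= k)%N].

Definition sob_seminorm U (k : nat) p v : \bar R :=
  lpsum p [seq weak_deriv_norm U p v (fun i => a i) |
            a : mindex k <- enum {: mindex k} & mdeg a == k].

Definition sobolev U (k : nat) p v := (sob_norm U k p v < +oo)%E.

Definition H1norm U v := sob_norm U 1 2%:E v.

Definition H10 U v := sobolev U 1 2%:E v /\
  forall eps : R, 0 < eps ->
    exists2 phi, test_function U phi & (H1norm U (v \- phi)%R < eps%:E)%E.

(* Norms taken element by element. *)
Definition broken_norm (T : seq (n.+1.-tuple E)) (k : nat) p v : \bar R :=
  lpsum p [seq sob_norm (hull K)° k p v | K : n.+1.-tuple E <- T].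

Definition broken_seminorm (T : seq (n.+1.-tuple E)) (k : nat) p v : \bar R :=
  lpsum p [seq sob_seminorm (hull K)° k p v | K : n.+1.-tuple E <- T].

End sobolev.

Section finite_elements.
Context {R : realType} {n : nat}.
Local Notation E := 'rV[R]_n.
Implicit Types (Omega : set E) (T : seq (n.+1.-tuple E)) (v w u f : E -> R).

Definition poly_on (d : nat) (A : set E) v :=
  exists c : @mindex n d -> R, forall x, A x ->
    v x = \sum_(a : @mindex n d | (mdeg a <= d)%N) c a * \prod_i x ord0 i ^+ a i.

(* Polynomial on the closed simplices, so that boundary values are meaningful;
   the values outside the closure of Omega are irrelevant. *)
Definition spline_space Omega T (d : nat) : set (E -> R) :=
  [set v | C1 Omega v /\ forall K, K \in T -> poly_on d (hull K) v].

Definition spline_space0 Omega T d : set (E -> R) :=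
  spline_space Omega T d `&` H10 Omega.

(* The second derivatives of a spline exist element by element only. *)
Definition ma_form T u w : R :=
  - n%:R^-1 * \sum_(K <- T) \int[lebesgue_rV n]_(x in (hull K)°)
    ((gradient w x *m cof (hessian u x) *m (gradient u x)^T) ord0 ord0).

Definition discrete_solution Omega T d f (gh : E -> R) (uh : E -> R) :=
  [/\ spline_space Omega T d uh,
      forall x, bdry Omega x -> uh x = gh x &
      forall w, spline_space0 Omega T d w ->
        ma_form T uh w = \int[lebesgue_rV n]_(x in Omega) (f x * w x)].

Definition einv (p : \bar R) : R := if p is r%:E then r^-1 else 0.

Variables (Omega : set E) (I : Type) (T : I -> seq (n.+1.-tuple E)) (d : nat).
Let h i := mesh_size (T i).

Definition quasi_interpolation (Q : I -> (E -> R) -> (E -> R)) :=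
  let L1 v := (lebesgue_rV n).-integrable Omega (EFin \o v) in
  [/\ forall i v, L1 v -> spline_space Omega (T i) d (Q i v),
      forall i v w, L1 v -> L1 w ->
        {ae lebesgue_rV n, forall x, Omega x -> v x = w x} ->
        forall x, Omega x -> Q i v x = Q i w x,
      forall i (a : R) v w, L1 v -> L1 w -> forall x, Omega x ->
        Q i (fun y => a * v y + w y) x = a * Q i v x + Q i w x &
      forall (p : \bar R) (k l : nat), (1 <= p)%E -> (k <= l <= d)%N ->
        exists C : R, forall i v, sobolev Omega l.+1 p v ->
          (broken_norm (T i) k p (v \- Q i v)%R <=
             (C * h i ^+ (l.+1 - k))%:E * sob_seminorm Omega l.+1 p v)%E].

Definition inverse_estimates :=
  forall (p q : \bar R) (l s : nat), (1 <= p)%E -> (1 <= q)%E -> (l <= s)%N ->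
    exists C : R, forall i v, spline_space Omega (T i) d v ->
      (broken_norm (T i) s p v <=
         (C * h i `^ (l%:R - s%:R +
                      Num.min 0 (n%:R * einv p - n%:R * einv q)))%:E *
         broken_norm (T i) l q v)%E.

(* A function of W^{l+1,oo} with l >= 3 is twice continuously differentiable in
   Omega and continuous up to the boundary once the right representative is
   chosen; this choice is made explicit. *)
Definition smooth_on_closure (l : nat) v :=
  [/\ {within closure Omega, continuous v}, C2 Omega v & sobolev Omega l.+1 +oo%E v].

(* A spline interpolation operator on smooth functions: its boundary values only
   depend on those of the interpolated function, so that the interpolant of a
   smooth extension of boundary data is independent there of the extension. *)
Definition interpolation (l : nat) (J : I -> (E -> R) -> (E -> R)) :=
  [/\ forall i v, smooth_on_closure l v -> spline_space Omega (T i) d (J i v),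
      forall i v w, smooth_on_closure l v -> smooth_on_closure l w ->
        (forall x, bdry Omega x -> v x = w x) ->
        forall x, bdry Omega x -> J i v x = J i w x &
      forall k : nat, (k <= l)%N ->
        exists C : R, forall i v, smooth_on_closure l v ->
          (broken_norm (T i) k +oo%E (v \- J i v)%R <=
             (C * h i ^+ (l.+1 - k))%:E * sob_seminorm Omega l.+1 +oo%E v)%E].

Definition Xh (delta : R) (Q : I -> (E -> R) -> (E -> R)) u
    (gh : I -> E -> R) (i : I) : set (E -> R) :=
  [set v | [/\ spline_space Omega (T i) d v,
               forall x, bdry Omega x -> v x = gh i x &
               (H1norm Omega (v \- Q i u)%R <
                  (delta * h i `^ (1 + n%:R / 2) / 4)%:E)%E]].

End finite_elements.

(* Main.v *)
(* The rows of cof D^2 v are divergence free.  For a C^1 spline this holds across the faces of the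
   mesh as well: in integrated form it follows from the exact antisymmetry of central difference
   quotients, which commute, applied to the Lipschitz gradient.  As det is at most cubic along
   segments, Simpson's rule then turns the difference of the forms at v1 and v2 into the form
   linear in D(v1 - v2) whose coefficient is the Simpson mean of cof D^2 v1, cof D^2 ((v1 + v2)/2)
   and cof D^2 v2.

   These matrices are uniformly positive definite as long as the Hessians are close to D^2 u
   element by element, so on such splines the discrete operator is strongly monotone and Lipschitz
   in the energy norm |Dw|_{L^2}.  By the inverse estimate the ball of radius A h^l about the
   interpolant J u consists of such splines, because l > 1 + n/2.  The residual of J u is O(h^l),
   and a strongly monotone map with a small value at the centre of a ball vanishes inside: a
   minimiser of |F|^2 on the ball is a zero.  Monotonicity also gives local uniqueness.  Finally
   Du is strongly monotone and D(uh - u) has a small Lipschitz constant on the convex domain, so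
   Duh is monotone and uh is convex. *)

Require Import Defs.
From HB Require Import structures.
From mathcomp Require Import all_boot all_order all_algebra.
From mathcomp Require Import all_classical all_reals all_analysis.
From mathcomp Require Import measurable_realfun ess_sup_inf.
From mathcomp Require Import ring lra.
Set Implicit Arguments.
Unset Strict Implicit.
Unset Printing Implicit Defensive.
Import Order.TTheory GRing.Theory Num.Theory.
Import numFieldNormedType.Exports.
Local Open Scope classical_set_scope.
Local Open Scope ring_scope.

(** * Integration on row vectors *)

(** The statement speaks of weak derivatives, essential suprema and closures of test functions,
    while the argument is pointwise on the elements. Classical derivatives bound the norms above;
    lower bounds come from testing every weak derivative that competes in the infimum. The test
    space is defined by [H10] but boundary values are imposed pointwise, so the two descriptions of
    zero boundary values are shown to agree for splines, one direction by contracting the support,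
    the other by a test function that grows steeply along a segment leaving the domain.

    No surface integral occurs: integrals run over the union of the open simplices, whose complement
    in the domain is null, and Lipschitz gradients give dominated convergence of difference
    quotients. Approximation by smooth functions uses finite sums over a grid, so no integral has to
    be differentiated.

    Splines are functions on the whole space of which only the values in the domain count, so the
    energy product is degenerate and coordinates are taken modulo its null vectors. As n <= 3 <= l,
    every smallness condition retains a spare factor h^(1/2), which absorbs all constants. *)

Section rV_topology.
Context {R : realType} {n : nat}.
Local Notation E := 'rV[R]_n.

Lemma coord_norm_le (x : E) i : `|x ord0 i| <= `|x|.
Proof.
rewrite [leRHS]/Num.norm/= mx_normrE.
by apply/bigmax_geP; right => /=; exists (ord0, i).
Qed.

Lemma rV_norm_leP (x : E) (r : R) : 0 <= r ->
  `|x| <= r <-> forall i, `|x ord0 i| <= r.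
Proof.
move=> r0; split=> [h i|h]; first exact: (le_trans (coord_norm_le x i)).
rewrite [leLHS]/Num.norm/= mx_normrE; apply/bigmax_leP; split => // -[i j] _ /=.
by rewrite (ord1 i).
Qed.

Lemma rV_norm_ltP (x : E) (r : R) : 0 < r ->
  `|x| < r <-> forall i, `|x ord0 i| < r.
Proof.
move=> r0; split=> [h i|h]; first exact: (le_lt_trans (coord_norm_le x i)).
rewrite [ltLHS]/Num.norm/= mx_normrE; apply/bigmax_ltP; split => // -[i j] _ /=.
by rewrite (ord1 i).
Qed.

Lemma open_normP (U : set E) :
  open U <-> forall x, U x -> exists2 r : R, 0 < r &
     forall y, `|y - x| < r -> U y.
Proof.
rewrite openE; split=> [oU x /oU|H x /H[r r0 rU]].
  rewrite /interior => /nbhs_ballP[r r0 rU]; exists r => // y yx; apply: rU.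
  by rewrite -ball_normE /ball_/= distrC.
apply/nbhs_ballP; exists r => // y; rewrite -ball_normE /ball_/= distrC.
exact: rU.
Qed.

(** For r > 0 this is the ball of the sup norm; written by coordinates it is a finite intersection
    of preimages of intervals. *)
Definition rbox (a : E) (r : R) : set E := [set x | forall i, `|x ord0 i - a ord0 i| < r].

Lemma measurable_rbox a r : measurable (rbox a r).
Proof.
have -> : rbox a r = \bigcap_(i in [set: 'I_n])
    ((fun x : E => x ord0 i) @^-1` `]a ord0 i - r, a ord0 i + r[%classic).
  apply/seteqP; split => x /= h i.
  - by move=> _; rewrite /= in_itv/=; have := h i; rewrite ltr_distl.
  - by have := h i I; rewrite /= in_itv/= ltr_distl.
apply: fin_bigcap_measurable => // i _.
by rewrite -[X in measurable X]setTI; apply: measurable_coord => //; exact: measurable_itv.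
Qed.

(** The sigma-algebra is generated by the coordinates, not by the open sets, so an open set is
    exhibited as the countable union of the boxes with rational centres and radii 1/(k+1) that it
    contains. *)
Lemma open_rV_measurable (U : set E) : open U -> measurable U.
Proof.
move=> /open_normP oU.
pose F (p : {ffun 'I_n -> rat} * nat) : set E :=
  let b := rbox (\row_i ratr (p.1 i)) (p.2.+1%:R^-1) in
  if `[< b `<=` U >] then b else set0.
have -> : U = \bigcup_p F p.
  apply/seteqP; split => [x Ux|x [p _]]; last first.
    by rewrite /F; case: asboolP => // bU; exact: bU.
  have [r r0 rU] := oU _ Ux.
  have [k kr] : exists k : nat, k.+1%:R^-1 < r / 2.
    have r2 : 0 < r / 2 by rewrite divr_gt0.
    have [k _ /(_ k (leqnn k))] := near_infty_natSinv_lt (PosNum r2).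
    by exists k.
  have q_ex i : exists q : rat, `|x ord0 i - ratr q| < k.+1%:R^-1.
    have [q] : exists q : rat, ratr q \in `]x ord0 i - k.+1%:R^-1, x ord0 i + k.+1%:R^-1[.
      by apply: rat_in_itvoo; rewrite ltrD2l gt0_cp// invr_gt0 ltr0n.
    by rewrite in_itv/= -ltr_distl distrC => ?; exists q.
  pose q := [ffun i => sval (cid (q_ex i))].
  exists (q, k) => //; rewrite /F/=; case: asboolP; last first.
    move=> H; exfalso; apply: H => y yb; apply: rU.
    apply/rV_norm_ltP => // i; rewrite !mxE.
    have := yb i; rewrite !mxE ffunE; case: cid => p /= xp yp.
    have -> : y ord0 i - x ord0 i = (y ord0 i - ratr p) - (x ord0 i - ratr p).
      by rewrite opprB addrA subrK.
    rewrite (le_lt_trans (ler_normB _ _))// [ltRHS]splitr ltrD//; exact: lt_trans kr.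
  by move=> _ i; rewrite !mxE ffunE; case: cid.
apply: countable_bigcupT_measurable; first exact: countableP.
move=> p; rewrite /F; case: ifP => _; [exact: measurable_rbox|exact: measurable0].
Qed.

Lemma continuous_on_measurable (U : set E) (f : E -> R) : open U ->
  (forall x, U x -> {for x, continuous f}) -> measurable_fun U f.
Proof.
move=> oU cf; apply: (measurability _ (RGenOInfty.measurableE R)).
move=> /= _ [_ [a ->]] <-; apply: open_rV_measurable.
rewrite openE => x [Ux /= fx]; apply: filterI; first by move: oU; rewrite openE; exact.
apply: (cf x Ux); apply: open_nbhs_nbhs; split => //; exact: interval_open.
Qed.

Lemma continuous_rV_measurable (f : E -> R) : continuous f -> measurable_fun setT f.
Proof. by move=> cf; apply: continuous_on_measurable; [exact: openT|move=> x _; exact: cf]. Qed.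

End rV_topology.

(** * Translation invariance of Lebesgue measure *)

Section lebesgue_1d.
Context {R : realType}.
Local Notation leb := (@lebesgue_measure R).

Lemma measurable_shift (t : R) :
  measurable_fun [set: measurableTypeR R] (fun x : measurableTypeR R => (x + t : measurableTypeR R)).
Proof. exact: measurable_funD. Qed.

(** Lebesgue measure is characterised by its values on half-open intervals, and there it agrees with
    its pushforward under a translation. *)
Lemma lebesgue_shift (t : R) (A : set (measurableTypeR R)) : measurable A ->
  leb A = pushforward leb (fun x : measurableTypeR R => (x + t : measurableTypeR R)) A.
Proof.
move=> mA.
apply: (@lebesgue_measure_unique R
  (measure_function_pushforward__canonical__measure_function_Measure leb (measurable_shift t))) => // _ [[a b] _ <-] /=.
rewrite /pushforward.
have -> : (fun x : R => x + t) @^-1` `]a, b] = `]a - t, b - t]%classic.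
  by apply/seteqP; split=> x /=; rewrite !in_itv/= ltrBlDr lerBrDr.
rewrite !lebesgue_measure_itv/= !lte_fin ltrD2r; case: ifP => // _.
by rewrite -!EFinB; congr EFin; ring.
Qed.

Lemma integral_shift1 (t : R) (f : R -> \bar R) :
  measurable_fun [set: measurableTypeR R] f -> (forall x, 0 <= f x)%E ->
  (\int[leb]_x f (x + t)%R = \int[leb]_x f x)%E.
Proof.
move=> mf f0.
have := @ge0_integral_pushforward _ _ _ _ R _ (measurable_shift t) leb setT f measurableT mf (fun y _ => f0 y).
rewrite preimage_setT => <-.
apply: eq_measure_integral => [|mphi A mA _]; first exact: (measurable_shift t).
by rewrite [RHS](lebesgue_shift t).
Qed.

End lebesgue_1d.

Section tonelli_rV.
Context {R : realType}.
Local Open Scope ereal_scope.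

Lemma integral_rV_cons n (f : 'rV[R]_n.+1 -> \bar R) :
  measurable_fun setT f -> (forall x, 0 <= f x) ->
  \int[lebesgue_rV n.+1]_x f x =
  \int[lebesgue_measure]_t \int[lebesgue_rV n]_v f (rV_cons (t, v)).
Proof.
move=> mf f0.
transitivity (\int[lebesgue_measure \x lebesgue_rV n]_p f (rV_cons p)).
  rewrite -[RHS](@ge0_integral_pushforward _ _ _ _ R _ (@measurable_rV_cons R n) (lebesgue_measure \x lebesgue_rV n) setT f)//.
rewrite fubini_tonelli1//.
exact: (measurableT_comp mf (@measurable_rV_cons R n)).
Qed.

(** Induction on the dimension: Tonelli's theorem splits off the first coordinate, which is handled
    by [integral_shift1], and the induction hypothesis translates the others. In dimension 0 there
    is only one point. *)
Lemma integral_rV_shift n (y : 'rV[R]_n) (f : 'rV[R]_n -> \bar R) :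
  measurable_fun setT f -> (forall x, 0 <= f x) ->
  \int[lebesgue_rV n]_x f (x + y)%R = \int[lebesgue_rV n]_x f x.
Proof.
elim: n y f => [|n IH] y f mf f0.
  by apply: eq_integral => x _; congr f; apply/rowP; case.
have ms k (z : 'rV[R]_k) : measurable_fun setT (fun x : 'rV[R]_k => (x + z)%R).
  apply: measurable_fun_rV => i; apply: (eq_measurable_fun (fun t : 'rV[R]_k => (t ord0 i + z ord0 i)%R)).
    by move=> t _; rewrite mxE.
  by apply: measurable_funD => //; exact: measurable_coord.
rewrite (integral_rV_cons mf f0) integral_rV_cons; last 2 first.
- exact: (measurableT_comp mf (ms _ y)).
- by move=> x; exact: f0.
set z : 'rV[R]_n := rsubmx (y : 'rV_(1 + n)).
have consD t v : (rV_cons (t, v) + y = rV_cons (t + y ord0 ord0, v + z))%R.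
  apply/rowP => i; rewrite /rV_cons/= !mxE; case: splitP => k ik; rewrite !mxE.
    by rewrite ord1 eqxx; congr (_ + y _ _)%R; apply: val_inj; rewrite /= ik (ord1 k).
  by congr (_ + y _ _)%R; apply: val_inj; rewrite /= ik.
pose g t := \int[lebesgue_rV n]_v f (rV_cons (t, v)).
transitivity (\int[lebesgue_measure]_t g (t + y ord0 ord0)%R).
  apply: eq_integral => t _; rewrite /g.
  under eq_integral do rewrite consD.
  rewrite (IH z (fun v => f (rV_cons (_, v))))//.
  apply: measurableT_comp => //; apply: (measurableT_comp (@measurable_rV_cons R n)).
  exact: measurable_pair1.
rewrite integral_shift1//; last by move=> t; apply: integral_ge0.
apply: (@measurable_fun_fubini_tonelli_F _ _ _ _ R (lebesgue_rV n) (f \o @rV_cons R n)).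
  exact: (measurableT_comp mf (@measurable_rV_cons R n)).
by move=> p; exact: f0.
Qed.

End tonelli_rV.

Section lebesgue_rV_theory.
Context {R : realType} {n : nat}.
Local Notation E := 'rV[R]_n.
Local Notation mu := (@lebesgue_rV R n).

Lemma measurable_rV_shift (z : E) : measurable_fun setT (fun x : E => x + z).
Proof.
apply: measurable_fun_rV => i; apply: (eq_measurable_fun (fun t : E => t ord0 i + z ord0 i)).
  by move=> t _; rewrite mxE.
by apply: measurable_funD => //; exact: measurable_coord.
Qed.

Lemma integral_shift (y : E) (f : E -> \bar R) : measurable_fun setT f ->
  (\int[mu]_x f (x + y)%R = \int[mu]_x f x)%E.
Proof.
move=> mf; rewrite integralE [RHS]integralE; congr (_ - _)%E.
  rewrite -[RHS](integral_rV_shift y (measurable_funepos mf))//.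
  by apply: eq_integral => x _; rewrite !funeposE.
rewrite -[RHS](integral_rV_shift y (measurable_funeneg mf))//.
by apply: eq_integral => x _; rewrite !funenegE.
Qed.

Lemma Rintegral_shift (y : E) (f : E -> R) : measurable_fun setT f ->
  \int[mu]_x f (x + y) = \int[mu]_x f x.
Proof.
move=> mf; rewrite /Rintegral; congr fine.
by apply: (integral_shift y (f := EFin \o f)); apply/measurable_EFinP.
Qed.

Lemma measurable_shift_set (y : E) (A : set E) : measurable A ->
  measurable [set x | A (x + y)].
Proof. by move=> mA; rewrite -[X in measurable X]setTI; exact: measurable_rV_shift. Qed.

Lemma measure_shift (y : E) (A : set E) : measurable A -> mu [set x | A (x + y)] = mu A.
Proof.
move=> mA; have mA' := measurable_shift_set y mA.
rewrite -(setIT [set _ | _]) -integral_indic// -[in RHS](setIT A) -integral_indic//.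
by apply: (integral_shift y (f := EFin \o \1_A)); apply/measurable_EFinP; exact: measurable_indic.
Qed.

End lebesgue_rV_theory.

Section box_measure.
Context {R : realType}.

Lemma measure_rbox n (a : 'rV[R]_n) (r : R) : 0 < r ->
  lebesgue_rV n (rbox a r) = ((2 * r) ^+ n)%:E.
Proof.
elim: n a => [|n IH] a r0.
  have -> : lebesgue_rV 0 (rbox a r) = (@dirac _ _ (0 : 'rV[R]_0) R (rbox a r)) by [].
  by rewrite diracE expr0 mem_set// => -[].
have E : @rV_cons R n @^-1` (rbox a r) =
  `]a ord0 ord0 - r, a ord0 ord0 + r[%classic `*` rbox (rsubmx (a : 'rV_(1 + n))) r.
  apply/seteqP; split => -[t v] /=.
  - move=> h; split.
      have e : rV_cons (t, v) ord0 ord0 = t := congr1 fst (rV_consK (t, v)).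
      by have := h ord0; rewrite e in_itv/= -ltr_distl.
    move=> i; have := h (rshift 1 i).
    by rewrite /rV_cons/= !mxE; case: splitP => k //= ; rewrite ?ord1// add1n => -[] /val_inj ->.
  - move=> [/= ht hv] i; rewrite /rV_cons/= !mxE; case: splitP => k ik.
      rewrite (ord1 k) mxE eqxx/= (_ : i = ord0) ?ltr_distl//.
      by apply: val_inj; rewrite /= ik (ord1 k).
    have := hv k; rewrite mxE (_ : rshift 1 k = i)//; exact/val_inj.
rewrite [LHS]/= /lebesgue_rV_step /pushforward E product_measure1E//; last exact: measurable_rbox.
rewrite IH//.
have e : lebesgue_measure `](a ord0 ord0 - r)%R, (a ord0 ord0 + r)%R[%classic = (2 * r)%:E.
  rewrite lebesgue_measure_itv/= lte_fin ltrD2l gt0_cp// -EFinB; congr EFin.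
  by ring.
by apply: (etrans (congr1 (fun z => (z * _)%E) e)); rewrite -EFinM exprS.
Qed.

End box_measure.

(** * Bounded measurable functions *)

Section bounded_measurable.
Context d (T : measurableType d) (R : realType) (mu : {measure set T -> \bar R}).
Implicit Types (D N : set T) (f g : T -> R).

(** The class in which the integrands live: it is closed under the algebra operations and, on a set
    of finite measure, consists of integrable functions, so that integrability conditions follow
    from the shape of the integrand. *)
Definition bmeas D f :=
  measurable_fun D f /\ exists M : R, forall x, D x -> `|f x| <= M.

Lemma bmeas_integrable D f : measurable D -> (mu D < +oo)%E -> bmeas D f ->
  mu.-integrable D (EFin \o f).
Proof.
move=> mD D0 [mf [M fM]]; apply: measurable_bounded_integrable => //.
exists `|M|; split; first exact: num_real.
by move=> N MN x Dx /=; rewrite (le_trans (fM _ Dx))// (le_trans (ler_norm _))// ltW.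
Qed.

Lemma bmeasD D f g : bmeas D f -> bmeas D g -> bmeas D (fun x => f x + g x).
Proof.
move=> [mf [M fM]] [mg [N gN]]; split; first exact: measurable_funD.
by exists (M + N) => x Dx; rewrite (le_trans (ler_normD _ _))// lerD ?fM ?gN.
Qed.

Lemma bmeasN D f : bmeas D f -> bmeas D (fun x => - f x).
Proof.
move=> [mf [M fM]]; split; first exact: measurableT_comp.
by exists M => x Dx; rewrite normrN fM.
Qed.

Lemma bmeasB D f g : bmeas D f -> bmeas D g -> bmeas D (fun x => f x - g x).
Proof. by move=> bf bg; apply: bmeasD => //; exact: bmeasN. Qed.

Lemma bmeasM D f g : bmeas D f -> bmeas D g -> bmeas D (fun x => f x * g x).
Proof.
move=> [mf [M fM]] [mg [N gN]]; split; first exact: measurable_funM.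
by exists (M * N) => x Dx; rewrite normrM ler_pM ?fM ?gN.
Qed.

Lemma bmeas_cst D (c : R) : bmeas D (fun=> c).
Proof. by split; [exact: measurable_cst|exists `|c|]. Qed.

Lemma bmeasZ D (c : R) f : bmeas D f -> bmeas D (fun x => c * f x).
Proof. by move=> bf; apply: bmeasM => //; exact: bmeas_cst. Qed.

Lemma bmeas_sum D (I : Type) (s : seq I) (P : pred I) (F : I -> T -> R) :
  (forall i, P i -> bmeas D (F i)) -> bmeas D (fun x => \sum_(i <- s | P i) F i x).
Proof.
move=> bF; elim: s => [|i s IH].
  by under eq_fun do rewrite big_nil; exact: bmeas_cst.
have [Pi|Pi] := boolP (P i).
  by under eq_fun do rewrite big_cons Pi; apply: bmeasD => //; exact: bF.
by under eq_fun do rewrite big_cons (negbTE Pi).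
Qed.

Lemma bmeasS D D' f : measurable D -> D' `<=` D -> bmeas D f -> bmeas D' f.
Proof.
move=> mD DD' [mf [M fM]]; split; first exact: measurable_funS mf.
by exists M => x /DD' /fM.
Qed.

Lemma eq_bmeas D f g : (forall x, D x -> f x = g x) -> bmeas D f -> bmeas D g.
Proof.
move=> fg [mf [M fM]]; split; last by exists M => x Dx; rewrite -fg// fM.
by apply: eq_measurable_fun mf => x; rewrite inE => /fg.
Qed.

Section fixed_domain.
Variables (D : set T) (mD : measurable D) (D0 : (mu D < +oo)%E).
Local Notation "'I[ f ]" := (\int[mu]_(x in D) f x) (at level 0).

Lemma RintD f g : bmeas D f -> bmeas D g ->
  \int[mu]_(x in D) (f x + g x) = \int[mu]_(x in D) f x + \int[mu]_(x in D) g x.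
Proof. by move=> bf bg; rewrite RintegralD//; exact: bmeas_integrable. Qed.

Lemma RintB f g : bmeas D f -> bmeas D g ->
  \int[mu]_(x in D) (f x - g x) = \int[mu]_(x in D) f x - \int[mu]_(x in D) g x.
Proof. by move=> bf bg; rewrite RintegralB//; exact: bmeas_integrable. Qed.

Lemma RintZ (c : R) f : bmeas D f ->
  \int[mu]_(x in D) (c * f x) = c * \int[mu]_(x in D) f x.
Proof. by move=> bf; rewrite RintegralZl//; exact: bmeas_integrable. Qed.

Lemma RintN f : bmeas D f ->
  \int[mu]_(x in D) (- f x) = - \int[mu]_(x in D) f x.
Proof. by move=> bf; rewrite -mulN1r -RintZ//; apply: eq_Rintegral => x _; rewrite mulN1r. Qed.

Lemma Rint_sum (I : Type) (s : seq I) (P : pred I) (F : I -> T -> R) :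
  (forall i, P i -> bmeas D (F i)) ->
  \int[mu]_(x in D) (\sum_(i <- s | P i) F i x) =
  \sum_(i <- s | P i) \int[mu]_(x in D) F i x.
Proof.
move=> bF; elim: s => [|i s IH].
  rewrite big_nil; under eq_Rintegral do rewrite big_nil.
  by rewrite Rintegral_cst// mul0r.
rewrite big_cons; have [Pi|Pi] := boolP (P i).
  under eq_Rintegral do rewrite big_cons Pi.
  by rewrite RintD ?IH//; [exact: bF|exact: bmeas_sum].
by under eq_Rintegral do rewrite big_cons (negbTE Pi).
Qed.

Lemma le_Rint f g : bmeas D f -> bmeas D g -> (forall x, D x -> f x <= g x) ->
  \int[mu]_(x in D) f x <= \int[mu]_(x in D) g x.
Proof. by move=> bf bg fg; apply: le_Rintegral => //; exact: bmeas_integrable. Qed.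

Lemma Rint_bound f (M : R) : bmeas D f -> (forall x, D x -> `|f x| <= M) ->
  `|\int[mu]_(x in D) f x| <= M * fine (mu D).
Proof.
move=> bf fM; rewrite -Rintegral_cst//.
rewrite ler_norml; apply/andP; split.
  rewrite -RintN; last exact: bmeas_cst.
  by apply: le_Rint => //[|x /fM]; [exact: bmeas_cst|rewrite ler_norml => /andP[]].
by apply: le_Rint => //[|x /fM]; [exact: bmeas_cst|rewrite ler_norml => /andP[]].
Qed.

Lemma Rint_cauchy_schwarz f g : bmeas D f -> bmeas D g ->
  (\int[mu]_(x in D) (f x * g x)) ^+ 2 <=
  (\int[mu]_(x in D) (f x ^+ 2)) * (\int[mu]_(x in D) (g x ^+ 2)).
Proof.
move=> bf bg.
have bf2 : bmeas D (fun x => f x ^+ 2) by under eq_fun do rewrite expr2; exact: bmeasM.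
have bg2 : bmeas D (fun x => g x ^+ 2) by under eq_fun do rewrite expr2; exact: bmeasM.
set a := (\int[mu]_(x in D) (f x ^+ 2)); set b := (\int[mu]_(x in D) (f x * g x)).
set c := (\int[mu]_(x in D) (g x ^+ 2)).
have a0 : 0 <= a by apply: Rintegral_ge0 => x _; exact: sqr_ge0.
have c0 : 0 <= c by apply: Rintegral_ge0 => x _; exact: sqr_ge0.
have H (s t : R) : 0 <= s ^+ 2 * a + (2 * s * t) * b + t ^+ 2 * c.
  rewrite -!RintZ//; last exact: bmeasM.
  rewrite -RintD; [|by apply: bmeasZ|by apply: bmeasZ; exact: bmeasM].
  rewrite -RintD; [|by apply: bmeasD; [exact: bmeasZ|apply: bmeasZ; exact: bmeasM]|exact: bmeasZ].
  apply: Rintegral_ge0 => x _.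
  have -> : s ^+ 2 * f x ^+ 2 + 2 * s * t * (f x * g x) + t ^+ 2 * g x ^+ 2 =
    (s * f x + t * g x) ^+ 2 by ring.
  exact: sqr_ge0.
(* In place of a discriminant, the form is evaluated at (b, -a), which gives a (a c - b^2) >= 0; for
   a = 0 the point (c, -b) gives c b^2 <= 0, and for a = c = 0 the points (1, 1) and (1, -1) give b
   = 0. *)
have [a00|a00] := eqVneq a 0.
  have [c00|c00] := eqVneq c 0.
    by have := H 1 1; have := H 1 (-1); rewrite a00 c00 => *; nra.
  have cp : 0 < c by rewrite lt_def c00.
  have := H c (- b); rewrite a00 => h; rewrite mul0r.
  have : c * b ^+ 2 <= 0 by nra.
  by rewrite pmulr_rle0.
have ap : 0 < a by rewrite lt_def a00.
have := H b (- a) => h.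
have : 0 <= a * (a * c - b ^+ 2) by nra.
by rewrite pmulr_rge0// subr_ge0.
Qed.

Lemma Rint_null N f : measurable N -> mu N = 0%E -> bmeas D f ->
  \int[mu]_(x in D) f x = \int[mu]_(x in D `\` N) f x.
Proof.
move=> mN N0 bf; rewrite /Rintegral; congr fine; apply: negligible_integral => //.
exact: bmeas_integrable.
Qed.

(** Dominated convergence with a constant majorant. The first conclusion supplies the measurability
    of limits such as partial derivatives, which are not known to be continuous. *)
Lemma bounded_cvg (M : R) (F : nat -> T -> R) f :
  (forall k, measurable_fun D (F k)) -> (forall k x, D x -> `|F k x| <= M) ->
  (forall x, D x -> F ^~ x @ \oo --> f x) ->
  bmeas D f /\ (fun k => \int[mu]_(x in D) F k x) @ \oo --> \int[mu]_(x in D) f x.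
Proof.
move=> mF FM Ff.
have mf : measurable_fun D f by apply: measurable_fun_cvg Ff.
have fM x : D x -> `|f x| <= M.
  move=> Dx; have cv : (fun k => `|F k x|) @ \oo --> `|f x| by apply: cvg_norm; exact: Ff.
  rewrite -(cvg_lim _ cv)//; apply: limr_le; first by apply/cvg_ex; eexists; exact: cv.
  by apply: nearW => k; exact: FM.
have bf : bmeas D f by split => //; exists M.
split => //.
have [] := @dominated_convergence _ T R mu D mD (fun k x => (F k x)%:E) (EFin \o f) (fun=> M%:E).
- by move=> k; exact/measurable_EFinP.
- exact/measurable_EFinP.
- by apply: aeW => x Dx; apply: cvg_EFin; [exact: nearW|exact: Ff].
- by apply: (@bmeas_integrable D (fun=> M)) => //; exact: bmeas_cst.
- by apply: aeW => x k Dx; rewrite /= lee_fin FM.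
move=> intf _ cv.
rewrite /Rintegral; apply: fine_cvg; rewrite fineK//.
exact: (integrable_fin_num mD intf).
Qed.

End fixed_domain.
End bounded_measurable.

(** * Null sets and sets of positive measure *)

Section null_sets.
Context {R : realType} {n : nat}.
Local Notation E := 'rV[R]_n.
Local Notation mu := (@lebesgue_rV R n).

Lemma rbox_norm (a x : E) (r : R) : 0 < r -> rbox a r x <-> `|x - a| < r.
Proof.
move=> r0; rewrite rV_norm_ltP//.
by split=> h i; have := h i; rewrite !mxE.
Qed.

Lemma rbox_lt_pinfty (a : E) (r : R) : (mu (rbox a r) < +oo)%E.
Proof.
have [r0|r0] := ltP 0 r; first by rewrite measure_rbox// ltry.
rewrite (le_lt_trans (le_measure _ _ _ _) (_ : mu (rbox a 1) < +oo)%E)//.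
- by rewrite inE; exact: measurable_rbox.
- by rewrite inE; exact: measurable_rbox.
- by move=> x h i; rewrite (lt_le_trans (h i))// (le_trans r0).
- by rewrite measure_rbox// ltry.
Qed.

Lemma bounded_lt_pinfty (A : set E) (r : R) : measurable A ->
  (forall x, A x -> `|x| < r) -> (mu A < +oo)%E.
Proof.
move=> mA Ar; rewrite (le_lt_trans (le_measure _ _ _ _) (rbox_lt_pinfty 0 r))//.
- by rewrite inE.
- by rewrite inE; exact: measurable_rbox.
- by move=> x /Ar xr i; rewrite mxE subr0 (le_lt_trans (coord_norm_le _ _)).
Qed.

Lemma open_measure_gt0 (U : set E) : open U -> U !=set0 -> (0 < mu U)%E.
Proof.
move=> oU [a Ua]; have [r r0 rU] := (open_normP U).1 oU _ Ua.
apply: (@lt_le_trans _ _ (mu (rbox a r))).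
  by rewrite measure_rbox// lte_fin exprn_gt0// mulr_gt0.
apply: le_measure; rewrite ?inE; [exact: measurable_rbox|exact: open_rV_measurable|].
by move=> x /rbox_norm - /(_ r0) /rU.
Qed.

(** For every N the N + 1 translates of A by multiples of v / (N + 1) are disjoint, have equal
    measure and stay in a fixed box, so (N + 1) mu A is bounded independently of N. *)
Lemma null_translates (A : set E) (v : E) (r : R) : measurable A ->
  (forall x, A x -> `|x| < r) ->
  (forall x (t : R), A x -> A (x + t *: v) -> t = 0) -> mu A = 0%E.
Proof.
move=> mA Ar Av.
pose F (N k : nat) : set E := [set x | A (x + (k%:R / N.+1%:R) *: v)].
have mF N k : measurable (F N k) by exact: measurable_shift_set.
have tF N : trivIset setT (F N).
  apply/trivIsetP => i j _ _ ij; apply/seteqP; split => // x [Fi Fj].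
  have := Av _ ((j%:R - i%:R) / N.+1%:R) Fi.
  rewrite -addrA -scalerDl mulrBl (addrC (i%:R / _)) subrK => /(_ Fj).
  move/eqP; rewrite -mulrBl mulf_eq0 invr_eq0 pnatr_eq0 orbF subr_eq0 eqr_nat.
  by move=> /eqP ji; rewrite ji eqxx in ij.
have HN N : (mu A *+ N.+1 <= mu (rbox 0 (r + `|v|)%R))%E.
  have -> : (mu A *+ N.+1 = mu (\big[setU/set0]_(k < N.+1) F N k))%E.
    rewrite measure_bigsetU//.
    rewrite (eq_bigr (fun=> mu A)) ?sumr_const ?card_ord//.
    by move=> k _; exact: measure_shift.
  apply: le_measure; rewrite ?inE.
  - exact: bigsetU_measurable.
  - exact: measurable_rbox.
  - rewrite -bigcup_mkord => x [k /= kN /Ar xr] i.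
    rewrite mxE subr0 (le_lt_trans (coord_norm_le _ _))//.
    rewrite -[x](addrK ((k%:R / N.+1%:R) *: v)) (le_lt_trans (ler_normB _ _))//.
    rewrite ltr_leD// normrZ ger0_norm ?divr_ge0// ler_piMl// ler_pdivrMr ?ltr0n// mul1r.
    by rewrite ler_nat ltnW.
have fA : mu A \is a fin_num.
  by rewrite ge0_fin_numE//; exact: (bounded_lt_pinfty mA Ar).
have fB : mu (rbox 0 (r + `|v|)%R) \is a fin_num.
  by rewrite ge0_fin_numE//; exact: rbox_lt_pinfty.
rewrite -(fineK fA); congr EFin; apply/eqP; rewrite eq_le fine_ge0// andbT.
set a := fine (mu A); set b := fine (mu (rbox 0 (r + `|v|))).
have ab N : a *+ N.+1 <= b.
  by have := HN N; rewrite -(fineK fA) -(fineK fB) -EFin_natmul lee_fin.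
rewrite leNgt; apply/negP => a0.
have b0 : 0 <= b by rewrite fine_ge0.
have := ab (Num.truncn (b / a)).
rewrite leNgt => /negP; apply.
by rewrite -mulr_natr mulrC -ltr_pdivrMr// truncnS_gt.
Qed.

(** Translation by t a changes a . x by t |a|^2, so a point and its translate along the normal both
    lie in the hyperplane only for t = 0. *)
Lemma hyperplane_null (a : E) (b : R) (N : set E) (r : R) : a != 0 -> measurable N ->
  (forall x, N x -> `|x| < r) -> (forall x, N x -> \sum_i a ord0 i * x ord0 i = b) ->
  mu N = 0%E.
Proof.
move=> a0 mN Nr Nb; apply: (null_translates (v := a) mN Nr) => x t Nx /Nb.
under eq_bigr do rewrite !mxE mulrDr mulrCA.
rewrite big_split/= Nb// -mulr_sumr => /eqP; rewrite -subr_eq0 addrAC subrr add0r.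
rewrite mulf_eq0 => /orP[/eqP//|/eqP s0]; exfalso; move/eqP: a0; apply.
apply/rowP => i; rewrite mxE; apply/eqP; rewrite -sqrf_eq0 expr2.
move/eqP: s0; rewrite psumr_eq0; last by move=> j _; rewrite -expr2 sqr_ge0.
by move/allP => /(_ i); rewrite mem_index_enum => /(_ isT)/=.
Qed.

(** Otherwise f exceeds half of a positive value on a nonempty open set, and such a set has positive
    measure. *)
Lemma Rint_eq0_open (U : set E) (r : R) (f : E -> R) : open U ->
  (forall x, U x -> `|x| < r) -> (forall x, U x -> {for x, continuous f}) ->
  bmeas U f -> (forall x, U x -> 0 <= f x) -> \int[mu]_(x in U) f x = 0 ->
  forall x, U x -> f x = 0.
Proof.
move=> oU Ur cf bf f0 If x Ux; apply/eqP; rewrite eq_le f0// andbT leNgt; apply/negP => fx0.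
have mU := open_rV_measurable oU; have fU := bounded_lt_pinfty mU Ur.
pose V : set E := [set y | U y /\ f x / 2 < f y].
have oV : open V.
  rewrite openE => y [Uy fy]; apply: filterI; first by move: oU; rewrite openE; exact.
  exact: (cvgr_gt _ (cf y Uy)).
have mV := open_rV_measurable oV.
have V0 : (0 < mu V)%E.
  by apply: open_measure_gt0 => //; exists x; split => //; rewrite ltr_pdivrMr// mulr_natr mulr2n ltrDl.
have fV : (mu V < +oo)%E by apply: (bounded_lt_pinfty (r := r) mV) => y [/Ur].
have bV : bmeas V f by apply: bmeasS bf => // y [].
have : f x / 2 * fine (mu V) <= \int[mu]_(y in V) f y.
  rewrite -Rintegral_cst//; apply: le_Rint => //; first exact: bmeas_cst.
  by move=> y [_ /ltW].
have : \int[mu]_(y in V) f y <= \int[mu]_(y in U) f y.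
  rewrite /Rintegral; apply: fine_le.
  - by apply: integrable_fin_num => //; exact: bmeas_integrable.
  - by apply: integrable_fin_num => //; exact: bmeas_integrable.
  - apply: ge0_subset_integral => //; last by move=> y [].
    by apply/measurable_EFinP; case: bf.
move=> h1 h2; have := le_trans h2 h1; rewrite If leNgt => /negP; apply.
by rewrite mulr_gt0// ?divr_gt0// fine_gt0// V0.
Qed.

End null_sets.

(** * Smooth functions *)

Section smooth_1d.
Context {R : realType}.
Implicit Types (f g : R -> R) (q : {poly R}).

(** Derivatives are given by witnesses, so that closure under products and affine substitutions
    needs no formula for iterated derivatives. Only existence of the k-th derivative is recorded;
    quantification over all k in [smooth1] yields the continuity of each. *)
Fixpoint Ck (k : nat) f : Prop :=
  if k is k'.+1 then exists2 f', (forall x, is_derive x (1 : R) f (f' x)) & Ck k' f'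
  else True.

Definition smooth1 f := forall k, Ck k f.

Lemma CkS k f : Ck k.+1 f -> Ck k f.
Proof.
elim: k f => [//|k IH] f [f' ff' Cf']; exists f' => //; exact: IH.
Qed.

Lemma CkD k f g : Ck k f -> Ck k g -> Ck k (fun x => f x + g x).
Proof.
elim: k f g => [//|k IH] f g [f' ff' Cf] [g' gg' Cg].
exists (fun x => f' x + g' x); last exact: IH.
by move=> x; apply: is_deriveD.
Qed.

Lemma CkM k f g : Ck k f -> Ck k g -> Ck k (fun x => f x * g x).
Proof.
elim: k f g => [//|k IH] f g Cf Cg; have := Cf; have := Cg.
move=> -[g' gg' Cg'] [f' ff' Cf'].
exists (fun x => f x * g' x + g x * f' x).
  by move=> x; exact: is_deriveM.
by apply: CkD; apply: IH => //; exact: CkS.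
Qed.

Lemma Ck_cst k (c : R) : Ck k (fun=> c).
Proof.
elim: k c => [//|k IH] c; exists (fun=> 0) => // x; exact: is_derive_cst.
Qed.

Lemma is_derive_affine f (a b x l : R) : is_derive (a * x + b) (1 : R) f l ->
  is_derive x (1 : R) (fun t => f (a * t + b)) (l * a).
Proof.
move=> df; apply: (@is_derive1_comp _ f (fun t => a * t + b)) => //.
rewrite -[X in is_derive _ _ _ X]addr0; apply: is_deriveD.
have h : is_derive x (1 : R) (fun t : R => a * t) (a *: (1 : R)) := is_deriveZ _ _.
by apply: (is_derive_eq (h (is_derive_id _ _))); rewrite /GRing.scale/= mulr1.
Qed.

Lemma Ck_affine k f (a b : R) : Ck k f -> Ck k (fun x => f (a * x + b)).
Proof.
elim: k f => [//|k IH] f [f' ff' Cf'].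
exists (fun x => f' (a * x + b) * a).
  by move=> x; exact: is_derive_affine.
apply: CkM; [exact: IH|exact: Ck_cst].
Qed.

Lemma Ck_exprn k m : Ck k (fun x : R => x ^+ m).
Proof.
elim: m => [|m IH]; first by under eq_fun do rewrite expr0; exact: Ck_cst.
under eq_fun do rewrite exprS; apply: CkM => //.
case: k {IH} => [//|k]; exists (fun=> 1) => [x|]; [exact: is_derive_id|exact: Ck_cst].
Qed.

Lemma smooth1D f g : smooth1 f -> smooth1 g -> smooth1 (fun x => f x + g x).
Proof. by move=> sf sg k; exact: CkD. Qed.

Lemma smooth1M f g : smooth1 f -> smooth1 g -> smooth1 (fun x => f x * g x).
Proof. by move=> sf sg k; exact: CkM. Qed.

Lemma smooth1_cst (c : R) : smooth1 (fun=> c).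
Proof. by move=> k; exact: Ck_cst. Qed.

Lemma smooth1_affine f (a b : R) : smooth1 f -> smooth1 (fun x => f (a * x + b)).
Proof. by move=> sf k; exact: Ck_affine. Qed.

Lemma smooth1_exprn m : smooth1 (fun x : R => x ^+ m).
Proof. by move=> k; exact: Ck_exprn. Qed.

Lemma smooth1_antideriv f F : smooth1 f -> (forall x, is_derive x (1 : R) F (f x)) ->
  smooth1 F.
Proof. by move=> sf FF [|k]; [|exists f]. Qed.

Lemma smooth1_is_derive f x : smooth1 f -> is_derive x (1 : R) f ('D_1 f x).
Proof.
by move=> /(_ 1%N)[f' ff' _]; apply: derivableP; case: (ff' x).
Qed.

Lemma smooth1_derive f : smooth1 f -> smooth1 (fun x => 'D_1 f x).
Proof.
move=> sf k; have [f' ff' Cf] := sf k.+1.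
by suff -> : (fun x => 'D_1 f x) = f' by []; apply/funext => x; rewrite derive_val.
Qed.

Lemma is_derive_quadratic f (x l C : R) :
  (forall h, `|f (x + h) - f x - h * l| <= C * h ^+ 2) -> is_derive x (1 : R) f l.
Proof.
move=> H.
have C0 : 0 <= C by have := H 1; rewrite expr1n mulr1; exact: le_trans.
have cv : h^-1 *: (f (h *: 1 + x) - f x) @[h --> 0^'] --> l.
  apply/cvgrPdist_le => e e0.
  have d0 : 0 < e / (C + 1) by rewrite divr_gt0// ltr_wpDl.
  near=> h.
  have h0 : h != 0 by near: h; exact: nbhs_dnbhs_neq.
  have hd : `|h| < e / (C + 1) by near: h; apply: dnbhs0_lt.
  rewrite /GRing.scale/= mulr1 (addrC h).
  have -> : l - h^-1 * (f (x + h) - f x) = - (h^-1 * (f (x + h) - f x - h * l)).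
    by field.
  rewrite normrN normrM normfV ler_pdivrMl ?normr_gt0//.
  rewrite (le_trans (H h))// -real_normK ?num_real// expr2 mulrCA ler_wpM2l//.
  move: hd; rewrite ltr_pdivlMr ?ltr_wpDl// => /ltW; apply: le_trans.
  by rewrite mulrC ler_wpM2l// lerDl.
apply: DeriveDef; first by apply/cvg_ex; exists l.
exact: cvg_lim.
Unshelve. all: by end_near. Qed.

(** The rate e is arbitrary because the induction on the degree splits it between the two factors: s
    <= (2 / e) exp(e s / 2). *)
Lemma poly_expR_bound q (e : R) : 0 < e ->
  exists2 C : R, 0 <= C & forall s, 0 <= s -> `|q.[s]| <= C * expR (e * s).
Proof.
elim/poly_ind: q e => [|q c IH] e e0.
  by exists 0 => // s _; rewrite horner0 normr0 mul0r.
have e2 : 0 < e / 2 by rewrite divr_gt0.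
have [C C0 qC] := IH _ e2.
exists (C * (2 / e) + `|c|); first by rewrite addr_ge0// mulr_ge0// divr_ge0// ltW.
move=> s s0; rewrite hornerMXaddC (le_trans (ler_normD _ _))// mulrDl lerD//; last first.
  by rewrite ler_peMr// -expR0 ler_expR mulr_ge0// ltW.
rewrite normrM (ger0_norm s0).
have -> : expR (e * s) = expR (e / 2 * s) * expR (e / 2 * s) by rewrite -expRD; congr expR; field.
set X := expR _; have -> : C * (2 / e) * (X * X) = (C * X) * (2 / e * X) by ring.
rewrite ler_pM//; first exact: qC.
rewrite -(ler_pM2l e2) mulrA (_ : e / 2 * (2 / e) = 1); last by field; rewrite gt_eqF.
by rewrite mul1r (le_trans _ (expR_ge1Dx _))// lerDr.
Qed.

(** The functions q(1/t) exp(-1/t), extended by 0. The family is stable under differentiation, q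
    becoming X^2 (q - q'), so derivatives of all orders exist at once; q = 1 is the standard bump
    profile. *)
Definition efam q (t : R) : R := if 0 < t then q.[t^-1] * expR (- t^-1) else 0.

Lemma efam_bound q : exists C : R, forall t, `|efam q t| <= C * t ^+ 2.
Proof.
have [C C0 qC] := poly_expR_bound ('X^2 * q) ltr01.
exists C => t; rewrite /efam; case: ifPn => t0; last by rewrite normr0 mulr_ge0// sqr_ge0.
have := qC t^-1; rewrite invr_ge0 (ltW t0) => /(_ isT).
rewrite hornerM hornerXn normrM ger0_norm ?sqr_ge0// mul1r => h.
rewrite normrM (ger0_norm (expR_ge0 _)) expRN ler_pdivrMr ?expR_gt0//.
rewrite -(ler_pM2l (_ : 0 < t^-1 ^+ 2)) ?exprn_gt0 ?invr_gt0//.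
rewrite (le_trans h)// exprVn mulrCA mulrA.
by rewrite mulfK// sqrf_eq0 gt_eqF.
Qed.

Lemma efam_derive q t : is_derive t (1 : R) (efam q) (efam ('X^2 * (q - q^`())) t).
Proof.
have [t0|t0|->] := ltgtP t 0.
- apply: (@near_eq_is_derive _ _ _ (cst 0) _ t 1) => //; last 1 first.
    rewrite /efam (lt_gtF t0); exact: is_derive_cst.
  by near=> x; rewrite /efam ltNge (_ : x <= 0)//; apply: ltW; near: x; exact: lt_nbhsl.
- have t0' : t != 0 by rewrite gt_eqF.
  pose f (x : R) := q.[x^-1] * expR (- x^-1).
  apply: (@near_eq_is_derive _ _ _ f _ t 1) => //.
    by near=> x; rewrite /efam (_ : 0 < x)//; near: x; exact: lt_nbhsr.
  have dV : is_derive t (1 : R) (fun y : R => y^-1) (- t ^- 2).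
    by apply: (is_derive_eq (is_deriveV t0' (is_derive_id _ _))); rewrite scaler1.
  have dq : is_derive t (1 : R) (fun y : R => q.[y^-1]) (q^`().[t^-1] * (- t ^- 2)).
    have dh (s : R) : is_derive s (1 : R) (horner q) (q^`().[s]).
      split; first exact: derivable_horner.
      by rewrite -derive1E -derivE.
    exact: (@is_derive1_comp _ (horner q) (fun y : R => y^-1)).
  have de : is_derive t (1 : R) (fun y : R => expR (- y^-1)) (expR (- t^-1) * (t ^- 2)).
    apply: (@is_derive1_comp _ expR (fun y : R => - y^-1)).
    have hN : is_derive t (1 : R) (fun y : R => - y^-1) (- - t ^- 2) := is_deriveN dV.
    by apply: (is_derive_eq hN); rewrite opprK.
  apply: (is_derive_eq (is_deriveM dq de)).
  rewrite /efam t0 /GRing.scale/= hornerM hornerXn hornerD hornerN exprVn; ring.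
(* At 0 the bound C h^2, valid on the whole line, settles both sides together. *)
- rewrite [X in is_derive _ _ _ X](_ : _ = 0); last by rewrite /efam ltxx.
  have [C qC] := efam_bound q.
  apply: (@is_derive_quadratic _ _ _ C) => h.
  by rewrite add0r mulr0 subr0 [efam q 0]/efam ltxx subr0.
Unshelve. all: by end_near. Qed.

Lemma efam_smooth q : smooth1 (efam q).
Proof.
move=> k; elim: k q => [//|k IH] q; exists (efam ('X^2 * (q - q^`()))) => //.
exact: efam_derive.
Qed.

Definition ebump := efam 1.

Lemma ebumpE t : ebump t = if 0 < t then expR (- t^-1) else 0.
Proof. by rewrite /ebump /efam hornerC mul1r. Qed.

Lemma ebump_gt0 t : 0 < t -> 0 < ebump t.
Proof. by move=> t0; rewrite ebumpE t0 expR_gt0. Qed.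

Lemma ebump_le0 t : t <= 0 -> ebump t = 0.
Proof. by move=> t0; rewrite ebumpE ltNge t0. Qed.

Lemma ebump_ge0 t : 0 <= ebump t.
Proof. by rewrite ebumpE; case: ifP => // _; exact: expR_ge0. Qed.

Lemma ebump_smooth : smooth1 ebump. Proof. exact: efam_smooth. Qed.

(** Written as a logarithmic derivative; for t <= 0 both sides vanish with [ebump]. The logarithmic
    derivative of ebump(sigma a) in a is 1 / (sigma a^2), which [zero_trace_pos] makes large by a
    small sigma. *)
Lemma ebump_derive t : is_derive t (1 : R) ebump (t ^- 2 * ebump t).
Proof.
apply: (is_derive_eq (efam_derive 1 t)).
rewrite ebumpE /efam; case: ifP => _; last by rewrite mulr0.
by rewrite derivC subr0 mulr1 hornerXn exprVn.
Qed.

Lemma smooth1_continuous f : smooth1 f -> continuous f.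
Proof.
move=> sf x; apply: differentiable_continuous; apply/derivable1_diffP.
by case: (smooth1_is_derive x sf).
Qed.

(** Integration starts at a - 1, left of the support, so the primitive vanishes up to a and the
    fundamental theorem of calculus applies at every x >= a, the point a included. *)
Lemma antiderivative f (a : R) : continuous f -> (forall t, t <= a -> f t = 0) ->
  exists2 F : R -> R, (forall x, is_derive x (1 : R) F (f x)) &
    forall t, t <= a -> F t = 0.
Proof.
move=> cf fa.
pose F x : R := \int[lebesgue_measure]_(t in `[a - 1, x]) f t.
have Fa t : t <= a -> F t = 0.
  move=> ta; rewrite /F (_ : \int[_]_(_ in _) _ = \int[lebesgue_measure]_(t in `[a - 1, t]) (0 : R)).
    by rewrite /Rintegral integral0.
  by apply: eq_Rintegral => x; rewrite inE/= in_itv/= => /andP[_ xt]; rewrite fa// (le_trans xt).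
exists F => // x.
have [xa|ax] := ltP x a.
  apply: (@near_eq_is_derive _ _ _ (cst 0) _ x 1) => //; last first.
    by rewrite fa ?(ltW xa)//; exact: is_derive_cst.
  by near=> y; rewrite Fa//; apply: ltW; near: y; exact: lt_nbhsl.
have [] := @continuous_FTC1_closed R f (a - 1) x (x + 1) _ _ _ (cf x).
- by rewrite ltrDl.
- apply: continuous_compact_integrable; first exact: segment_compact.
  exact: continuous_subspaceT.
- by rewrite ltrBlDr (le_lt_trans ax)// ltrDl.
- by move=> dF <-; rewrite derive1E; exact: derivableP.
Unshelve. all: by end_near. Qed.

End smooth_1d.

(** * Partial derivatives and products of one-variable functions *)

Section calculus_rV.
Context {R : realType} {n : nat}.
Local Notation E := 'rV[R]_n.
Local Notation e_ i := (delta_mx (ord0 : 'I_1) i : E).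
Implicit Types (f g : E -> R) (x v : E).

Lemma partialE f x i : differentiable f x -> partial i f x = 'd f x (e_ i).
Proof. by move=> df; rewrite /partial deriveE. Qed.

Lemma diff_sum_partial f x v : differentiable f x ->
  'd f x v = \sum_i v ord0 i * partial i f x.
Proof.
move=> df; rewrite {1}(row_sum_delta v) linear_sum; apply: eq_bigr => i _.
by rewrite linearZ/= partialE.
Qed.

Lemma is_derive_line f x v (t : R) : differentiable f (x + t *: v) ->
  is_derive t (1 : R) (fun s => f (x + s *: v)) (\sum_i v ord0 i * partial i f (x + t *: v)).
Proof.
move=> df; rewrite -diff_sum_partial//.
have dl : is_diff t (fun s : R => x + s *: v) (fun s : R => s *: v).
  have -> : (fun s : R => s *: v) = (0 : R -> E) + ( *:%R^~ v).
    by apply/funext => s; rewrite /GRing.add/= add0r.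
  exact: is_diffD.
have dfl : differentiable (f \o (fun s : R => x + s *: v)) t.
  by apply: differentiable_comp => //; case: dl.
apply: DeriveDef; first by apply: diff_derivable.
rewrite deriveE//.
have -> : 'd (fun s : R => f (x + s *: v)) t = 'd f (x + t *: v) \o 'd (fun s : R => x + s *: v) t :> (R -> R).
  by apply: diff_comp => //; case: dl.
have e : 'd (fun s : R => x + s *: v) t = ( *:%R^~ v) :> (R -> E) by case: dl.
by rewrite /= e scale1r.
Qed.

Lemma eq_near_partial f g x i : (\forall y \near x, f y = g y) ->
  partial i f x = partial i g x.
Proof. by move=> fg; apply: near_eq_derive => //; near: x. Qed.

Lemma partialD f g x i : differentiable f x -> differentiable g x ->
  partial i (fun y => f y + g y) x = partial i f x + partial i g x.
Proof. by move=> df dg; apply: deriveD; exact: diff_derivable. Qed.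

Lemma partialB f g x i : differentiable f x -> differentiable g x ->
  partial i (fun y => f y - g y) x = partial i f x - partial i g x.
Proof. by move=> df dg; apply: deriveB; exact: diff_derivable. Qed.

Lemma partialM f g x i : differentiable f x -> differentiable g x ->
  partial i (fun y => f y * g y) x = f x * partial i g x + g x * partial i f x.
Proof. by move=> df dg; apply: deriveM; exact: diff_derivable. Qed.

Lemma partialZ (c : R) f x i : differentiable f x ->
  partial i (fun y => c * f y) x = c * partial i f x.
Proof. by move=> df; apply: deriveZ; exact: diff_derivable. Qed.

Lemma partial_cst (c : R) x i : partial i (fun=> c) x = 0.
Proof. exact: derive_cst. Qed.

Lemma partial_sum (I : Type) (s : seq I) (P : pred I) (F : I -> E -> R) x i :
  (forall k, P k -> differentiable (F k) x) ->
  differentiable (fun y => \sum_(k <- s | P k) F k y) x /\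
  partial i (fun y => \sum_(k <- s | P k) F k y) x =
  \sum_(k <- s | P k) partial i (F k) x.
Proof.
move=> dF; elim: s => [|k s [IH1 IH2]].
  rewrite big_nil; under eq_fun do rewrite big_nil.
  by split; [exact: differentiable_cst|exact: partial_cst].
rewrite big_cons; have [Pk|Pk] := boolP (P k).
  under eq_fun do rewrite big_cons Pk.
  split; first by apply: differentiableD => //; exact: dF.
  by rewrite partialD ?IH2//; exact: dF.
by under eq_fun do rewrite big_cons (negbTE Pk).
Qed.

Definition tensor (g : 'I_n -> R -> R) : E -> R := fun x => \prod_i g i (x ord0 i).

Lemma differentiable_coord_comp (h : R -> R) x i :
  is_derive (x ord0 i) (1 : R) h ('D_1 h (x ord0 i)) ->
  differentiable (fun y : E => h (y ord0 i)) x.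
Proof.
move=> dh; apply: (@differentiable_comp _ _ _ _ (fun y : E => y ord0 i) h).
  exact: differentiable_coord.
by apply/derivable1_diffP; case: dh.
Qed.

Lemma differentiable_prod (I : Type) (s : seq I) (F : I -> E -> R) x :
  (forall k, differentiable (F k) x) ->
  differentiable (fun y => \prod_(k <- s) F k y) x.
Proof.
move=> dF; elim: s => [|k s IH].
  by under eq_fun do rewrite big_nil; exact: differentiable_cst.
by under eq_fun do rewrite big_cons; exact: differentiableM.
Qed.

Lemma differentiable_tensor (g : 'I_n -> R -> R) x : (forall i, smooth1 (g i)) ->
  differentiable (tensor g) x.
Proof.
move=> sg; apply: differentiable_prod => i; apply: differentiable_coord_comp.
exact: smooth1_is_derive.
Qed.

Definition dtensor (j : 'I_n) (g : 'I_n -> R -> R) : 'I_n -> R -> R :=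
  fun i => if i == j then (fun t => 'D_1 (g i) t) else g i.

Lemma dtensor_smooth (j : 'I_n) (g : 'I_n -> R -> R) : (forall i, smooth1 (g i)) -> forall i, smooth1 (dtensor j g i).
Proof.
by move=> sg i; rewrite /dtensor; case: eqP => // _; exact: smooth1_derive.
Qed.

(** Along the j-th axis a single factor varies; the derivative of the restriction to this line is
    computed in two ways. *)
Lemma partial_tensor (j : 'I_n) (g : 'I_n -> R -> R) x : (forall i, smooth1 (g i)) ->
  partial j (tensor g) x = tensor (dtensor j g) x.
Proof.
move=> sg; have dt := @differentiable_tensor g x sg.
pose c := \prod_(i | i != j) g i (x ord0 i).
have h : is_derive (0 : R) (1 : R) (fun s => tensor g (x + s *: e_ j))
    (partial j (tensor g) x).
  have dt' : differentiable (tensor g) (x + (0 : R) *: e_ j) by rewrite scale0r addr0.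
  apply: (is_derive_eq (is_derive_line dt')).
  rewrite (bigD1 j)//= big1 ?addr0 => [|i ij].
    by rewrite mxE !eqxx mul1r scale0r addr0.
  by rewrite mxE eqxx (negbTE ij) mul0r.
have h' : is_derive (0 : R) (1 : R) (fun s => tensor g (x + s *: e_ j))
    (tensor (dtensor j g) x).
  have -> : (fun s => tensor g (x + s *: e_ j)) = (fun s : R => c * g j (1 * s + x ord0 j)).
    apply/funext => s; rewrite /tensor (bigD1 j)//= mulrC; congr (_ * _).
      apply: eq_bigr => i ij; congr (g i _).
      by rewrite !mxE eqxx (negbTE ij) mulr0 addr0.
    by congr (g j _); rewrite !mxE !eqxx mulr1 mul1r addrC.
  have -> : tensor (dtensor j g) x = c * 'D_1 (g j) (1 * 0 + x ord0 j).
    rewrite /tensor (bigD1 j)//= mulrC /dtensor eqxx mulr0 add0r; congr (_ * _).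
    by apply: eq_bigr => i ij; rewrite (negbTE ij).
  have ha : is_derive (0 : R) (1 : R) (fun s => g j (1 * s + x ord0 j))
      ('D_1 (g j) (1 * 0 + x ord0 j) * 1).
    by apply: is_derive_affine; exact: smooth1_is_derive.
  rewrite mulr1 in ha.
  have hz : is_derive (0 : R) (1 : R) (fun s => c * g j (1 * s + x ord0 j))
    (c *: 'D_1 (g j) (1 * 0 + x ord0 j)) := is_deriveZ _ _.
  exact: hz.
by rewrite -(@derive_val _ _ _ _ _ _ _ h) (@derive_val _ _ _ _ _ _ _ h').
Qed.

Definition cinf f := forall (s : seq 'I_n) x, differentiable (foldr partial f s) x.

Lemma cinf_tensor (g : 'I_n -> R -> R) : (forall i, smooth1 (g i)) -> cinf (tensor g).
Proof.
move=> sg s x.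
suff [h sh ->] : exists2 h, (forall i, smooth1 (h i)) & foldr partial (tensor g) s = tensor h.
  exact: differentiable_tensor.
elim: s => [|j s [h sh IH]]; first by exists g.
exists (dtensor j h); first exact: dtensor_smooth.
by rewrite /= IH; apply/funext => y; exact: partial_tensor.
Qed.

Lemma foldr_partialD f g s : cinf f -> cinf g ->
  foldr partial (fun y => f y + g y) s = (fun y => foldr partial f s y + foldr partial g s y).
Proof.
move=> cf cg; elim: s => [//|i s IH] /=; rewrite IH.
by apply/funext => x; apply: partialD; [exact: cf|exact: cg].
Qed.

Lemma cinfD f g : cinf f -> cinf g -> cinf (fun y => f y + g y).
Proof.
move=> cf cg s x; rewrite foldr_partialD//.
by apply: differentiableD; [exact: cf|exact: cg].
Qed.

Lemma foldr_partialZ (c : R) f s : cinf f ->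
  foldr partial (fun y => c * f y) s = (fun y => c * foldr partial f s y).
Proof.
move=> cf; elim: s => [//|i s IH] /=; rewrite IH.
by apply/funext => x; rewrite partialZ//; exact: cf.
Qed.

Lemma cinfZ (c : R) f : cinf f -> cinf (fun y => c * f y).
Proof.
by move=> cf s x; rewrite foldr_partialZ//; apply: differentiableZ; exact: cf.
Qed.

Lemma cinf_cst (c : R) : cinf (fun=> c).
Proof.
move=> s x; suff [d ->] : exists d : R, foldr partial (fun=> c) s = (fun=> d).
  exact: differentiable_cst.
elim: s => [|i s [d IH]]; first by exists c.
by exists 0 => /=; rewrite IH; apply/funext => y; exact: partial_cst.
Qed.

Lemma cinf_sum (I : Type) (s : seq I) (F : I -> E -> R) :
  (forall k, cinf (F k)) -> cinf (fun y => \sum_(k <- s) F k y).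
Proof.
move=> cF; elim: s => [|k s IH].
  by under eq_fun do rewrite big_nil; exact: cinf_cst.
by under eq_fun do rewrite big_cons; exact: cinfD.
Qed.

Lemma cinf_partial f i : cinf f -> cinf (partial i f).
Proof. by move=> cf s x; rewrite -foldr_rcons; exact: cf. Qed.

Lemma cinf_differentiable f x : cinf f -> differentiable f x.
Proof. by move=> /(_ [::] x). Qed.

Lemma cinf_continuous f : cinf f -> continuous f.
Proof. by move=> cf x; apply: differentiable_continuous; exact: cinf_differentiable. Qed.

Lemma cinf_C1 f U : cinf f -> C1 U f.
Proof.
move=> cf x _; split; first exact: cinf_differentiable.
by move=> i; apply: cinf_continuous; exact: cinf_partial.
Qed.

End calculus_rV.

(** * Lipschitz functions and difference quotients *)

Lemma cvg_seq_cst_eq (R : realType) (a l : R) : (fun=> a) @ \oo --> l -> l = a.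
Proof.
by move=> cv; rewrite -(cvg_lim (@Rhausdorff R) cv); apply: lim_cst; exact: Rhausdorff.
Qed.

Section lipschitz.
Context {R : realType} {n : nat}.
Local Notation E := 'rV[R]_n.
Local Notation e_ i := (delta_mx (ord0 : 'I_1) i : E).
Implicit Types (f g : E -> R) (x v : E) (U : set E) (L : R).

Lemma near_normP x (P : set E) :
  (\forall y \near x, P y) <-> exists2 r : R, 0 < r & forall y, `|y - x| < r -> P y.
Proof.
split=> [/nbhs_ballP[r r0 rP]|[r r0 rP]].
  by exists r => // y yx; apply: rP; rewrite -ball_normE /ball_/= distrC.
by apply/nbhs_ballP; exists r => // y; rewrite -ball_normE /ball_/= distrC; exact: rP.
Qed.

Lemma continuous_epsP f x : {for x, continuous f} <->
  forall e : R, 0 < e -> exists2 r : R, 0 < r &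
    forall y, `|y - x| < r -> `|f y - f x| < e.
Proof.
split=> [cf e e0|H].
  move/cvgrPdist_lt : cf => cf.
  have [r r0 rP] := (near_normP _ _).1 (cf e e0).
  by exists r => // y /rP; rewrite distrC.
move=> B /nbhs_ballP[e /= e0 eB]; have [r r0 rP] := H e e0.
apply: (near_normP x (f @^-1` B)).2; exists r => // y /rP h; apply: eB.
by rewrite -ball_normE /ball_/= distrC.
Qed.

Lemma differentiable_eps f x : differentiable f x ->
  forall e : R, 0 < e -> exists2 r : R, 0 < r &
    forall v, `|v| < r ->
      `|f (x + v) - f x - \sum_i v ord0 i * partial i f x| <= e * `|v|.
Proof.
move=> df e e0.
have [_ /eqaddoP h] := (diff_locallyP _ _).1 df.
have /near_normP[r r0 rP] := h e e0.
exists r => // v vr; rewrite -diff_sum_partial//.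
have := rP v; rewrite subr0 => /(_ vr).
have -> : (f \o shift x - (cst (f x) + 'd f x)) v = f (v + x) - (f x + 'd f x v) by [].
by rewrite opprD addrA (addrC v).
Qed.

Definition lip_on U L f := forall x y, U x -> U y -> `|f x - f y| <= L * `|x - y|.
Definition lip L f := lip_on setT L f.

Lemma lip_continuous L f : lip L f -> continuous f.
Proof.
move=> lf x; apply/continuous_epsP => e e0.
have L0 : 0 < `|L| + 1 by rewrite ltr_wpDl.
exists (e / (`|L| + 1)) => [|y]; first by rewrite divr_gt0.
rewrite ltr_pdivlMr// mulrC => yx; apply: le_lt_trans yx.
rewrite (le_trans (lf _ _ I I))// ler_wpM2r// (le_trans (ler_norm L))// lerDl//.
Qed.

Lemma lip_bmeas L f U r : measurable U -> (forall x, U x -> `|x| < r) ->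
  lip L f -> bmeas U f.
Proof.
move=> mU Ur lf; split.
  by apply: measurable_funTS; apply: continuous_rV_measurable; exact: lip_continuous lf.
exists (`|L| * r + `|f 0|) => x Ux.
rewrite -[f x](subrK (f 0)) (le_trans (ler_normD _ _))// lerD2r.
rewrite (le_trans (lf _ _ I I))// subr0.
rewrite (le_trans (ler_wpM2r _ (ler_norm L)))// ler_wpM2l// ltW//; exact: Ur.
Qed.

Lemma lip_shift L f v : lip L f -> lip L (fun x => f (x + v)).
Proof.
move=> lf x y _ _; rewrite (le_trans (lf _ _ I I))//.
by rewrite opprD addrACA subrr addr0.
Qed.

(** The McShane extension. Difference quotients evaluate functions outside the domain, where a
    spline or u carries no information. *)
Lemma mcshane U L f : U !=set0 -> 0 <= L -> lip_on U L f ->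
  exists2 g, lip L g & forall x, U x -> g x = f x.
Proof.
move=> [a Ua] L0 lf.
pose S x : set R := [set f y + L * `|x - y| | y in U].
have lbS x : lbound (S x) (f a - L * `|x - a|).
  move=> _ [y Uy <-]; rewrite lerBlDr -addrA -mulrDr -lerBlDl.
  rewrite (le_trans (ler_norm _))// (le_trans (lf _ _ Ua Uy))// ler_wpM2l//.
  rewrite -[a - y](_ : - (x - a) + (x - y) = _); last by rewrite opprB addrA subrK.
  by rewrite (le_trans (ler_normD _ _))// normrN addrC.
have iS x : has_inf (S x).
  split; first by exists (f a + L * `|x - a|); exists a.
  by exists (f a - L * `|x - a|).
have key x y : inf (S x) - inf (S y) <= L * `|x - y|.
  rewrite lerBlDl -lerBlDr; apply: lb_le_inf; first by have [] := iS y.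
  move=> _ [z Uz <-]; rewrite lerBlDr.
  apply: (@le_trans _ _ (f z + L * `|x - z|)).
    by apply: ge_inf; [exists (f a - L * `|x - a|)|exists z].
  rewrite -addrA lerD2l -mulrDr ler_wpM2l//.
  have -> : x - z = (y - z) + (x - y) by rewrite [RHS]addrC addrA subrK.
  exact: ler_normD.
exists (fun x => inf (S x)).
  move=> x y _ _; rewrite ler_norml key andbT lerNl opprB.
  by rewrite distrC key.
move=> x Ux; apply/eqP; rewrite eq_le; apply/andP; split.
  apply: ge_inf; first by exists (f a - L * `|x - a|).
  by exists x => //; rewrite subrr normr0 mulr0 addr0.
apply: lb_le_inf; first by have [] := iS x.
move=> _ [y Uy <-]; rewrite -lerBlDl (le_trans (ler_norm _))//.
exact: lf.
Qed.

(** Symmetric quotients: under translation-invariant integration the adjoint of [Dc t i] is exactly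
    its negative, without an error term, and quotients in different directions commute. *)
Definition Dc (t : R) (i : 'I_n) f x : R :=
  (f (x + t *: e_ i) - f (x - t *: e_ i)) / (2 * t).

Lemma norm_delta (i : 'I_n) : `|e_ i| = 1 :> R.
Proof.
apply/eqP; rewrite eq_le; apply/andP; split.
  by apply/rV_norm_leP => // j; rewrite mxE eqxx/=; case: eqP; rewrite ?normr1 ?normr0.
by rewrite (le_trans _ (coord_norm_le _ i))// mxE !eqxx normr1.
Qed.

Lemma Dc_le L (t : R) i f x : 0 < t -> lip L f -> `|Dc t i f x| <= L.
Proof.
move=> t0 lf; rewrite /Dc normrM normfV (gtr0_norm (_ : 0 < 2 * t)) ?mulr_gt0//.
rewrite ler_pdivrMr ?mulr_gt0// (le_trans (lf _ _ I I))//.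
rewrite opprD addrACA subrr add0r opprK -scalerDl normrZ norm_delta mulr1.
by rewrite gtr0_norm ?addr_gt0// mulr2n mulrDl mul1r.
Qed.

Lemma Dc_lip L (t : R) i f : 0 < t -> lip L f -> lip (L / t) (Dc t i f).
Proof.
move=> t0 lf x y _ _; rewrite /Dc -mulrBl normrM normfV (gtr0_norm (_ : 0 < 2 * t)) ?mulr_gt0//.
rewrite ler_pdivrMr ?mulr_gt0//.
have -> : L / t * `|x - y| * (2 * t) = L * `|x - y| + L * `|x - y|.
  by field; rewrite gt_eqF.
have -> : f (x + t *: e_ i) - f (x - t *: e_ i) - (f (y + t *: e_ i) - f (y - t *: e_ i)) =
  (f (x + t *: e_ i) - f (y + t *: e_ i)) - (f (x - t *: e_ i) - f (y - t *: e_ i)) by ring.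
by rewrite (le_trans (ler_normB _ _))// lerD//; apply: (lip_shift _ lf).
Qed.

Lemma partial_is_derive f x i : differentiable f x ->
  is_derive (0 : R) (1 : R) (fun s => f (x + s *: e_ i)) (partial i f x).
Proof.
move=> df; have df' : differentiable f (x + (0 : R) *: e_ i) by rewrite scale0r addr0.
apply: (is_derive_eq (is_derive_line df')).
rewrite (bigD1 i)//= big1 ?addr0 => [|j ij].
  by rewrite mxE !eqxx mul1r scale0r addr0.
by rewrite mxE eqxx (negbTE ij) mul0r.
Qed.

Lemma partial_coord i j x : partial i (fun y : E => y ord0 j) x = (i == j)%:R.
Proof.
have h := partial_is_derive i (differentiable_coord x (ord0 : 'I_1) j).
have h2 : is_derive (0 : R) (1 : R) (fun s => (i == j)%:R * s + x ord0 j) ((i == j)%:R : R).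
  have h3 := is_derive_affine (f := idfun) (a := (i == j)%:R) (b := x ord0 j) (is_derive_id _ _).
  by apply: (is_derive_eq (h3 0)); rewrite mul1r.
have e : (fun s : R => (x + s *: e_ i) ord0 j) = (fun s => (i == j)%:R * s + x ord0 j).
  by apply/funext => s; rewrite !mxE eqxx/= addrC mulrC eq_sym.
rewrite e in h.
by rewrite -(@derive_val _ _ _ _ _ _ _ h) (@derive_val _ _ _ _ _ _ _ h2).
Qed.

Lemma Dc_cvg i f x : differentiable f x ->
  Dc k.+1%:R^-1 i f x @[k --> \oo] --> partial i f x.
Proof.
move=> df; apply/cvgrPdist_le => e e0.
have [r r0 rP] := differentiable_eps df e0.
near=> k.
have tr : k.+1%:R^-1 < r by near: k; exact: (near_infty_natSinv_lt (PosNum r0)).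
set t := k.+1%:R^-1 in tr *.
have t0 : 0 < t by rewrite invr_gt0 ltr0n.
have sumE (s : R) : \sum_j (s *: e_ i) ord0 j * partial j f x = s * partial i f x.
  rewrite (bigD1 i)//= big1 ?addr0 => [|j ij]; first by rewrite !mxE !eqxx mulr1.
  by rewrite !mxE eqxx (negbTE ij) mulr0 mul0r.
have nt : `|t *: e_ i| = t by rewrite normrZ norm_delta mulr1 gtr0_norm.
have h1 := rP (t *: e_ i); have h2 := rP (- (t *: e_ i)).
rewrite normrN nt in h2; rewrite nt in h1; move: (h1 tr) (h2 tr) => {h1 h2}.
rewrite -scaleNr !sumE scaleNr => h1 h2.
rewrite -(ler_pM2r (_ : 0 < 2 * t)) ?mulr_gt0//.
rewrite -[X in _ * X](@gtr0_norm _ (2 * t)) ?mulr_gt0// -normrM.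
have -> : (partial i f x - Dc t i f x) * (2 * t) =
  - (f (x + t *: e_ i) - f x - t * partial i f x)
  + (f (x - t *: e_ i) - f x - - t * partial i f x).
  by rewrite /Dc; field; rewrite gt_eqF.
rewrite (le_trans (ler_normD _ _))// normrN.
have -> : e * (2 * t) = e * t + e * t by ring.
exact: lerD.
Unshelve. all: by end_near. Qed.

Lemma Rint_support (D : set E) f : (forall x, ~ D x -> f x = 0) ->
  \int[lebesgue_rV n]_(x in D) f x = \int[lebesgue_rV n]_x f x.
Proof.
move=> fD; rewrite Rintegral_mkcond; apply: eq_Rintegral => x _.
by rewrite patchE; case: ifPn => //; rewrite notin_setE => /fD.
Qed.

Section commutation.
Variables (f g : E -> R) (L M r : R).
Hypotheses (r0 : 0 < r) (lf : lip L f) (lg : lip M g).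
Hypothesis fr : forall x, r <= `|x| -> f x = 0.
Local Notation D := (rbox (0 : E) (r + 2)).
Local Notation mu := (lebesgue_rV n).

Let r20 : 0 < r + 2. Proof. by rewrite addr_gt0. Qed.

Lemma rbox0P x : D x <-> `|x| < r + 2.
Proof. by rewrite rbox_norm// subr0. Qed.

Let mD : measurable D. Proof. exact: measurable_rbox. Qed.

Let b (y z : E) x := f (x + y) * g (x + z).

Let bb y z : bmeas D (b y z).
Proof.
apply: bmeasM.
  by apply: (lip_bmeas (r := r + 2) mD) (lip_shift _ lf) => x /rbox0P.
by apply: (lip_bmeas (r := r + 2) mD) (lip_shift _ lg) => x /rbox0P.
Qed.

Let mb y z : measurable_fun setT (b y z).
Proof.
apply: measurable_funM; apply: continuous_rV_measurable.
  exact: lip_continuous (lip_shift _ lf).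
exact: lip_continuous (lip_shift _ lg).
Qed.

Let Ib y z : `|y| <= 1 ->
  \int[mu]_(x in D) b y z x = \int[mu]_x (f x * g (x + (z - y))).
Proof.
move=> y1; rewrite Rint_support => [|x Dx].
  rewrite -(Rintegral_shift (- y) (mb y z)); apply: eq_Rintegral => x _.
  by rewrite /b subrK -addrA (addrC (- y)).
rewrite /b fr ?mul0r// leNgt; apply/negP => xy; apply: Dx; apply/rbox0P.
rewrite -[x](addrK y) (le_lt_trans (ler_normB _ _))//.
by rewrite ltr_leD// (le_trans y1)// ler1n.
Qed.

(** A discrete integration by parts. After translation the integral of f(x + y) g(x + z) depends on
    z - y only, and the eight values at sums and differences of the two steps cancel. The box
    contains the support of f with a margin larger than any step. *)
Lemma int_Dc_comm (t : R) i j : 0 < t <= 1 ->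
  \int[mu]_(x in D) (Dc t i f x * Dc t j g x - Dc t j f x * Dc t i g x) = 0.
Proof.
move=> /andP[t0 t1]; set u := t *: e_ i; set v := t *: e_ j.
have nu : `|u| <= 1 by rewrite normrZ norm_delta mulr1 gtr0_norm.
have nv : `|v| <= 1 by rewrite normrZ norm_delta mulr1 gtr0_norm.
have nu' : `|- u| <= 1 by rewrite normrN.
have nv' : `|- v| <= 1 by rewrite normrN.
have -> : (fun x => Dc t i f x * Dc t j g x - Dc t j f x * Dc t i g x) =
  (fun x => ((2 * t) ^+ 2)^-1 * ((b u v x - b u (- v) x) - (b (- u) v x - b (- u) (- v) x)
    - ((b v u x - b v (- u) x) - (b (- v) u x - b (- v) (- u) x)))).
  apply/funext => x; rewrite /Dc /b -/u -/v.
  by field; rewrite gt_eqF.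
have fD := rbox_lt_pinfty (0 : E) (r + 2).
rewrite RintZ//; last by do ! apply: bmeasB => //.
rewrite !RintB//; try by do ! apply: bmeasB => //.
rewrite !Ib// !opprK.
rewrite (addrC v u) (addrC (- v) (- u)) (addrC (- v) u) (addrC (- u) v).
pose q w := \int[mu]_x (f x * g (x + w)); rewrite -!/(q _).
move: (q (v - u)) (q (- u - v)) (q (u + v)) (q (u - v)) => q1 q2 q3 q4.
by ring.
Qed.

End commutation.

(** Measurability and the bound L are inherited from the difference quotients, which are continuous,
    bounded by L and converge on G. *)
Lemma lip_partial L f (G : set E) r i : measurable G -> (forall x, G x -> `|x| < r) ->
  lip L f -> (forall x, G x -> differentiable f x) ->
  bmeas G (partial i f) /\ forall x, G x -> `|partial i f x| <= L.
Proof.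
move=> mG Gr lf df.
have tp k : 0 < (k.+1%:R^-1 : R) by rewrite invr_gt0 ltr0n.
have cv x : G x -> Dc k.+1%:R^-1 i f x @[k --> \oo] --> partial i f x.
  by move=> Gx; apply: Dc_cvg; exact: df.
have mDc k : measurable_fun G (Dc k.+1%:R^-1 i f).
  by apply: measurable_funTS; apply: continuous_rV_measurable; exact: lip_continuous (Dc_lip i (tp k) lf).
have fG : (lebesgue_rV n G < +oo)%E by exact: (bounded_lt_pinfty mG Gr).
have [bp _] := bounded_cvg mG fG mDc (fun k x _ => Dc_le i x (tp k) lf) cv.
split => // x Gx.
have cvn : (fun k => `|Dc k.+1%:R^-1 i f x|) @ \oo --> `|partial i f x| by apply: cvg_norm; exact: cv.
rewrite -(cvg_lim _ cvn)//; apply: limr_le; first by apply/cvg_ex; eexists; exact: cvn.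
by apply: nearW => k; exact: Dc_le _ _ (tp k) lf.
Qed.

Section limit.
Variables (f g : E -> R) (L M r : R) (A G N : set E).
Local Notation mu := (lebesgue_rV n).
Hypotheses (r0 : 0 < r) (lf : lip L f) (lg : lip M g).
Hypotheses (cA : closed A) (Ar : forall x, A x -> `|x| < r).
Hypothesis (fA : forall x, ~ A x -> f x = 0).
Hypotheses (mG : measurable G) (Gr : forall x, G x -> `|x| < r).
Hypotheses (mN : measurable N) (N0 : mu N = 0%E).
Hypothesis AGN : forall x, A x -> G x \/ N x.
Hypotheses (df : forall x, G x -> differentiable f x).
Hypotheses (dg : forall x, G x -> differentiable g x).
Local Notation D := (rbox (0 : E) (r + 2)).

Let fr x : r <= `|x| -> f x = 0.
Proof. by move=> rx; apply: fA => /Ar; rewrite ltNge rx. Qed.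

Let fD := rbox_lt_pinfty (0 : E) (r + 2).
Let mD : measurable D. Proof. exact: measurable_rbox. Qed.
Let GD : G `<=` D.
Proof. by move=> x /Gr xr; apply/(rbox0P r0 _); rewrite (lt_trans xr)// ltrDl. Qed.

(** The limit of [int_Dc_comm] as the step tends to 0. Off the null set N the integrand converges
    everywhere: to the derivatives on G, and to 0 at the remaining points, which lie outside the
    closed set A and hence have a neighbourhood where f vanishes. Differentiability is thus asked
    only almost everywhere, which admits the faces of a mesh. *)
Lemma int_partial_comm i j :
  \int[mu]_(x in G) (partial i f x * partial j g x - partial j f x * partial i g x) = 0.
Proof.
pose h x := partial i f x * partial j g x - partial j f x * partial i g x.
pose H k x := Dc k.+1%:R^-1 i f x * Dc k.+1%:R^-1 j g x
  - Dc k.+1%:R^-1 j f x * Dc k.+1%:R^-1 i g x.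
have t01 k : 0 < (k.+1%:R^-1 : R) <= 1.
  by rewrite invr_gt0 ltr0n/= invf_le1 ?ltr0n// ler1n.
have tp k : 0 < (k.+1%:R^-1 : R) by case/andP: (t01 k).
have bDc (f1 : E -> R) (L1 : R) k (j1 : 'I_n) : lip L1 f1 -> bmeas D (Dc k.+1%:R^-1 j1 f1).
  move=> l1; apply: (lip_bmeas (r := r + 2) mD) (Dc_lip j1 (tp k) l1).
  by move=> x /(rbox0P r0 _).
have bH k : bmeas D (H k).
  by apply: bmeasB; apply: bmeasM; first [exact: bDc lf|exact: bDc lg].
have L0 : 0 <= L by have := Dc_le i 0 ltr01 lf; exact: le_trans.
have M0 : 0 <= M by have := Dc_le i 0 ltr01 lg; exact: le_trans.
have mDN : measurable (D `\` N) by exact: measurableD.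
have fDN : (mu (D `\` N) < +oo)%E.
  by apply: le_lt_trans fD; apply: le_measure; rewrite ?inE// => x [].
have H0 k : \int[mu]_(x in D `\` N) H k x = 0.
  by rewrite -(Rint_null mD fD mN N0 (bH k)); exact: (int_Dc_comm r0 lf lg fr).
have HM k x : `|H k x| <= L * M + L * M.
  rewrite (le_trans (ler_normB _ _))//.
  by apply: lerD; rewrite normrM; apply: ler_pM => //;
    first [exact: (Dc_le _ _ (tp k) lf)|exact: (Dc_le _ _ (tp k) lg)].
have cvH x : (D `\` N) x -> H ^~ x @ \oo --> (h \_ G) x.
  move=> [Dx Nx]; rewrite patchE; case: ifPn => [|]; rewrite ?inE ?notin_setE => Gx.
    by apply: cvgB; apply: cvgM; apply: Dc_cvg; first [exact: df|exact: dg].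
  have Ax : ~ A x by move=> /AGN[].
  have oA : open (~` A) by rewrite openC.
  have [d d0 dA] := (open_normP _).1 oA _ Ax.
  apply: cvg_near_cst; near=> k.
  have kd : k.+1%:R^-1 < d by near: k; exact: (near_infty_natSinv_lt (PosNum d0)).
  have z (l : 'I_n) : Dc k.+1%:R^-1 l f x = 0.
    rewrite /Dc !fA ?subrr ?mul0r//; apply: dA.
      by rewrite addrAC subrr add0r normrN normrZ norm_delta mulr1 gtr0_norm.
    by rewrite addrAC subrr add0r normrZ norm_delta mulr1 gtr0_norm.
  by rewrite /H !z !mul0r subrr.
have [_ cv] := bounded_cvg mDN fDN (fun k => (bmeasS mD (@subDsetl _ D N) (bH k)).1)
  (fun k x _ => HM k x) cvH.
have E0 : (fun k => \int[mu]_(x in D `\` N) H k x) = (fun=> 0) by apply/funext.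
rewrite E0 in cv.
have h0 : \int[mu]_(x in D `\` N) (h \_ G) x = 0.
  exact: cvg_seq_cst_eq cv.
rewrite -Rintegral_mkcondr in h0.
have GN : (D `\` N) `&` G = G `\` N.
  apply/seteqP; split=> x /=; first by move=> [[_ ?] ?].
  by move=> [Gx Nx]; split => //; split => //; exact: GD.
rewrite GN in h0; rewrite -[RHS]h0; apply: Rint_null => //.
  by apply: le_lt_trans fD; apply: le_measure; rewrite ?inE.
have bf l := (lip_partial l mG Gr lf df).1; have bg l := (lip_partial l mG Gr lg dg).1.
exact: (bmeasB (bmeasM (bf i) (bg j)) (bmeasM (bf j) (bg i))).
Unshelve. all: by end_near. Qed.

End limit.

(* The choice of a second coordinate as [g] turns the commutation identity into
   the vanishing of the integral of a derivative, hence [1 < n]. *)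
Lemma int_partial (f : E -> R) (L r : R) (A G N : set E) i : (1 < n)%N ->
  0 < r -> lip L f -> closed A -> (forall x, A x -> `|x| < r) ->
  (forall x, ~ A x -> f x = 0) -> measurable G -> (forall x, G x -> `|x| < r) ->
  measurable N -> lebesgue_rV n N = 0%E -> (forall x, A x -> G x \/ N x) ->
  (forall x, G x -> differentiable f x) ->
  \int[lebesgue_rV n]_(x in G) partial i f x = 0.
Proof.
move=> n1 r0 lf cA Ar fA mG Gr mN N0 AGN df.
have [j ij] : exists j : 'I_n, i != j.
  have [i0|i0] := eqVneq i (Ordinal (ltnW n1)); first by exists (Ordinal n1); rewrite i0.
  by exists (Ordinal (ltnW n1)).
pose g (x : E) := x ord0 j.
have lg : lip 1 g.
  by move=> x y _ _; rewrite mul1r /g (le_trans _ (coord_norm_le _ j))// !mxE.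
have dg x : differentiable g x by exact: differentiable_coord.
have pg k x : partial k g x = (k == j)%:R.
  by rewrite /g partial_coord.
have := int_partial_comm r0 lf lg cA Ar fA mG Gr mN N0 AGN df (fun x _ => dg x) i j.
move=> <-; apply: eq_Rintegral => x _.
by rewrite !pg eqxx (negbTE ij) mulr1 mulr0 subr0.
Qed.

End lipschitz.

(** * The Piola identity *)

Section compact_margin.
Context {R : realType} {n : nat}.
Local Notation E := 'rV[R]_n.

(** The distance to the complement of U is 1-Lipschitz and attains a positive minimum on A. *)
Lemma compact_margin (A U : set E) (r : R) : compact A -> open U -> A `<=` U ->
  (forall x, U x -> `|x| < r) ->
  exists2 d : R, 0 < d & forall x v, A x -> `|v| < d -> U (x + v).
Proof.
move=> cA oU AU Ur.
have [A0|] := pselect (A !=set0); last first.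
  by move=> nA; exists 1 => // x v Ax; exfalso; apply: nA; exists x.
have [C0|] := pselect ((~` U) !=set0); last first.
  by move=> nC; exists 1 => // x v _ _; apply: contrapT => H; apply: nC; exists (x + v).
have l0 : lip_on (~` U) 1 (fun=> 0 : R).
  by move=> x y _ _; rewrite subrr normr0 mul1r.
pose S x : set R := [set `|x - y| | y in ~` U].
have lbS x : lbound (S x) 0 by move=> _ [y _ <-].
have iS x : has_inf (S x).
  by case: C0 => y Uy; split; [exists `|x - y|; exists y|exists 0].
have key x y : inf (S x) - inf (S y) <= `|x - y|.
  rewrite lerBlDl -lerBlDr; apply: lb_le_inf; first by have [] := iS y.
  move=> _ [z Uz <-]; rewrite lerBlDr.
  apply: (@le_trans _ _ `|x - z|).
    by apply: ge_inf; [exists 0|exists z].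
  have -> : x - z = (y - z) + (x - y) by rewrite [RHS]addrC addrA subrK.
  exact: ler_normD.
have lipS : lip 1 (fun x => inf (S x)).
  by move=> x y _ _; rewrite mul1r ler_norml key andbT lerNl opprB distrC key.
have [c /set_mem Ac cmin] := EVT_min_rV A0 cA
  (continuous_subspaceT (lip_continuous lipS)).
have [d d0 dU] := (open_normP U).1 oU _ (AU _ Ac).
have dS : d <= inf (S c).
  apply: lb_le_inf; first by have [] := iS c.
  move=> _ [y Uy <-]; rewrite leNgt; apply/negP => yd; apply: Uy.
  by apply: dU; rewrite distrC.
exists d => // x v Ax vd; apply: contrapT => Uxv.
have := cmin x (mem_set Ax); apply/negP; rewrite -ltNge.
apply: (lt_le_trans _ dS); apply: (@le_lt_trans _ _ `|v|) => //.
by apply: ge_inf; [exists 0|exists (x + v) => //; rewrite opprD addNKr normrN].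
Qed.

End compact_margin.

Section lip_mul.
Context {R : realType} {n : nat}.
Local Notation E := 'rV[R]_n.

Lemma lip_on_bounded (U : set E) (L r : R) (f : E -> R) : 0 <= L ->
  (forall x, U x -> `|x| < r) -> lip_on U L f ->
  exists2 C : R, 0 <= C & forall x, U x -> `|f x| <= C.
Proof.
move=> L0 Ur lf.
have [[a Ua]|nU] := pselect (U !=set0); last first.
  by exists 0 => // x Ux; exfalso; apply: nU; exists x.
have r0 : 0 <= r by rewrite (le_trans _ (ltW (Ur _ Ua))).
exists (L * (2 * r) + `|f a|); first by rewrite addr_ge0// mulr_ge0// mulr_ge0.
move=> x Ux; rewrite -[f x](subrK (f a)) (le_trans (ler_normD _ _))// lerD2r.
rewrite (le_trans (lf _ _ Ux Ua))// ler_wpM2l// (le_trans (ler_normB _ _))//.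
by rewrite mulrDl mul1r lerD// ltW// Ur.
Qed.

(** Only f is globally Lipschitz; g is controlled on A, outside which f vanishes. For a pair with
    one point outside A the increment of f alone is estimated. *)
Lemma lip_mul (A : set E) (L M C F : R) (f g : E -> R) : 0 <= L -> 0 <= M ->
  0 <= C -> 0 <= F -> lip L f -> (forall x, ~ A x -> f x = 0) -> lip_on A M g ->
  (forall x, A x -> `|g x| <= C) -> (forall x, A x -> `|f x| <= F) ->
  lip (L * C + F * M) (fun x => f x * g x).
Proof.
move=> L0 M0 C0 F0 lf fA lg gC fF.
have one x y : A x -> ~ A y -> `|f x * g x - f y * g y| <= (L * C + F * M) * `|x - y|.
  move=> Ax Ay; rewrite (fA y Ay) mul0r subr0 normrM.
  have -> : `|f x| = `|f x - f y| by rewrite (fA y Ay) subr0.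
  rewrite mulrDl (@le_trans _ _ (L * C * `|x - y|))//; last first.
    by rewrite lerDl mulr_ge0// mulr_ge0.
  by rewrite mulrAC ler_pM//; [exact: lf|exact: gC].
move=> x y _ _; have [Ax|Ax] := pselect (A x); have [Ay|Ay] := pselect (A y).
- have -> : f x * g x - f y * g y = (f x - f y) * g x + f y * (g x - g y) by ring.
  rewrite (le_trans (ler_normD _ _))// !normrM mulrDl lerD//.
    by rewrite mulrAC ler_pM//; [exact: lf|exact: gC].
  by rewrite -mulrA ler_pM//; [exact: fF|exact: lg].
- exact: one.
- by rewrite distrC [`|x - y|]distrC; exact: one.
- by rewrite !fA// !mul0r subrr normr0 mulr_ge0// addr_ge0// mulr_ge0.
Qed.

End lip_mul.

Lemma shift_partial {R : realType} {n : nat} (f : 'rV[R]_n -> R) (w x : 'rV[R]_n) :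
  differentiable f (x + w) -> differentiable (fun y => f (y + w)) x /\
    forall i, partial i (fun y => f (y + w)) x = partial i f (x + w).
Proof.
move=> df; have dfw : differentiable (fun y : 'rV[R]_n => f (y + w)) x.
  have dw : differentiable (fun y : 'rV[R]_n => y + w) x by exact: differentiableD.
  exact: (@differentiable_comp _ _ _ _ (fun y : 'rV[R]_n => y + w) f).
split => // i; have h1 := partial_is_derive i dfw; have h2 := partial_is_derive i df.
have e : (fun s : R => f (x + s *: delta_mx ord0 i + w)) =
    (fun s => f (x + w + s *: delta_mx ord0 i)).
  by apply/funext => s; rewrite addrAC.
rewrite e in h1.
by rewrite -(@derive_val _ _ _ _ _ _ _ h1) (@derive_val _ _ _ _ _ _ _ h2).
Qed.

Lemma Rint_sum3_eq0 d (T : measurableType d) (R : realType)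
    (mu : {measure set T -> \bar R}) (D : set T) (f1 f2 f3 : T -> R) :
  measurable D -> (mu D < +oo)%E -> bmeas D f1 -> bmeas D f2 -> bmeas D f3 ->
  \int[mu]_(x in D) f1 x = 0 -> \int[mu]_(x in D) f2 x = 0 ->
  \int[mu]_(x in D) f3 x = 0 -> \int[mu]_(x in D) (f1 x + f2 x + f3 x) = 0.
Proof.
move=> mD fD b1 b2 b3 z1 z2 z3.
by rewrite (RintD mD fD (bmeasD b1 b2) b3) (RintD mD fD b1 b2) z1 z2 z3 !addr0.
Qed.

Section null_lagrangian.
Context {R : realType} {n : nat}.
Local Notation E := 'rV[R]_n.
Local Notation e_ i := (delta_mx (ord0 : 'I_1) i : E).
Local Notation mu := (@lebesgue_rV R n).
Variables (r : R) (A G N : set E).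
Hypotheses (r0 : 0 < r).
Hypotheses (cA : closed A) (Ar : forall x, A x -> `|x| < r).
Hypotheses (mG : measurable G) (Gr : forall x, G x -> `|x| < r).
Hypotheses (mN : measurable N) (N0 : mu N = 0%E).
Hypothesis AGN : forall x, A x -> G x \/ N x.

Let fG : (mu G < +oo)%E. Proof. exact: (bounded_lt_pinfty mG Gr). Qed.

Lemma partial_off_support (f : E -> R) i x : (forall x, ~ A x -> f x = 0) -> ~ A x ->
  partial i f x = 0.
Proof.
move=> fA Ax; rewrite (@eq_near_partial _ _ f (fun=> 0)); first exact: partial_cst.
have oA : open (~` A) by rewrite openC.
have [d d0 dA] := (open_normP _).1 oA _ Ax.
by apply/near_normP; exists d => // y /dA /fA.
Qed.

(* Integrating the derivatives of [c] by parts leaves only mixed second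
   derivatives of the potential, which cancel by antisymmetry. *)
Lemma int_curl_free (L M K : R) (f b : E -> R) (c : 'I_3 -> E -> R) (d : 'I_3 -> 'I_n) :
  lip L f -> (forall x, ~ A x -> f x = 0) -> lip M b -> (forall k, lip K (c k)) ->
  (forall x, G x -> differentiable f x) ->
  (forall x, G x -> differentiable b x) ->
  (forall x k, G x -> differentiable (c k) x) ->
  (forall x i k, G x -> partial (d i) (c k) x = partial (d k) (c i) x) ->
  let o0 : 'I_3 := inord 0 in let o1 : 'I_3 := inord 1 in let o2 : 'I_3 := inord 2 in
  \int[mu]_(x in G)
   (partial (d o0) f x * (partial (d o1) b x * c o2 x - partial (d o2) b x * c o1 x)
  + partial (d o1) f x * (partial (d o2) b x * c o0 x - partial (d o0) b x * c o2 x)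
  + partial (d o2) f x * (partial (d o0) b x * c o1 x - partial (d o1) b x * c o0 x)) = 0.
Proof.
move=> lf fA lb lc df db dc sym o0 o1 o2.
have n0 : 'I_n by exact: d o0.
have L0 : 0 <= L by have := Dc_le n0 0 ltr01 lf; exact: le_trans.
have M0 : 0 <= M by have := Dc_le n0 0 ltr01 lb; exact: le_trans.
have K0 : 0 <= K by have := Dc_le n0 0 ltr01 (lc o0); exact: le_trans.
have lfA : lip_on A L f by move=> x y _ _; exact: lf.
have [F F0 fF] := lip_on_bounded L0 Ar lfA.
have lfc k : exists K', lip K' (fun x => f x * c k x).
  have lcA : lip_on A K (c k) by move=> x y _ _; exact: lc.
  have [C C0 cC] := lip_on_bounded K0 Ar lcA.
  by exists (L * C + F * K); exact: (lip_mul L0 K0 C0 F0 lf fA lcA cC fF).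
(* Commutators of f c_k with b, each of integral 0. In their cyclic sum the terms that contain f
   itself carry the curl of c and cancel by [sym]; the others form the claim. *)
pose z k i j x := partial i (fun y => f y * c k y) x * partial j b x
   - partial j (fun y => f y * c k y) x * partial i b x.
have zero k i j : \int[mu]_(x in G) z k i j x = 0.
  have [K' lK'] := lfc k.
  apply: (int_partial_comm r0 lK' lb cA Ar _ mG Gr mN N0 AGN _ db).
    by move=> x Ax; rewrite fA// mul0r.
  by move=> x Gx; apply: differentiableM; [exact: df|exact: dc].
have bz k i j : bmeas G (z k i j).
  have [K' lK'] := lfc k.
  have dfc x : G x -> differentiable (fun y => f y * c k y) x.
    by move=> Gx; apply: differentiableM; [exact: df|exact: dc].
  have b1 i' := (lip_partial i' mG Gr lK' dfc).1.
  have b2 i' := (lip_partial i' mG Gr lb db).1.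
  exact: bmeasB (bmeasM (b1 i) (b2 j)) (bmeasM (b1 j) (b2 i)).
apply: etrans (Rint_sum3_eq0 mG fG (bz o2 (d o0) (d o1)) (bz o0 (d o1) (d o2))
  (bz o1 (d o2) (d o0)) (zero _ _ _) (zero _ _ _) (zero _ _ _)).
rewrite /z.
apply: eq_Rintegral => x /set_mem Gx.
have pM i k : partial i (fun y => f y * c k y) x = f x * partial i (c k) x + c k x * partial i f x.
  by apply: partialM; [exact: df|exact: dc].
rewrite !pM (sym x o0 o1 Gx) (sym x o0 o2 Gx) (sym x o1 o2 Gx).
have alg (f0 f1 f2 b0 b1 b2 c0 c1 c2 F' p02 p12 p01 : R) :
  f0 * (b1 * c2 - b2 * c1) + f1 * (b2 * c0 - b0 * c2) + f2 * (b0 * c1 - b1 * c0) =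
  (F' * p02 + c2 * f0) * b1 - (F' * p12 + c2 * f1) * b0
  + ((F' * p01 + c0 * f1) * b2 - (F' * p02 + c0 * f2) * b1)
  + ((F' * p12 + c1 * f2) * b0 - (F' * p01 + c1 * f0) * b2) by ring.
exact: alg.
Qed.

End null_lagrangian.

Section piola3.
Context {R : realType} {n : nat}.
Local Notation E := 'rV[R]_n.
Local Notation e_ i := (delta_mx (ord0 : 'I_1) i : E).
Local Notation mu := (@lebesgue_rV R n).
Variables (r : R) (U A G N : set E).
Hypotheses (r0 : 0 < r) (oU : open U) (Ur : forall x, U x -> `|x| < r).
Hypotheses (cA : compact A) (AU : A `<=` U).
Hypotheses (oG : open G) (GU : G `<=` U).
Hypotheses (mN : measurable N) (N0 : mu N = 0%E).
Hypothesis UGN : forall x, U x -> G x \/ N x.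
Variables (L M : R) (f b : E -> R) (a : 'I_3 -> E -> R) (d : 'I_3 -> 'I_n) (m : 'I_3).
Hypotheses (lf : lip L f) (fA : forall x, ~ A x -> f x = 0).
Hypotheses (lb : lip M b) (la : forall k, lip M (a k)).
Hypothesis (df : forall x, G x -> differentiable f x).
Hypothesis (db : forall x, G x -> differentiable b x).
Hypothesis (da : forall x k, G x -> differentiable (a k) x).
Hypothesis sym : forall x i k, G x -> partial (d i) (a k) x = partial (d k) (a i) x.

Let o0 : 'I_3 := inord 0. 
Let o1 : 'I_3 := inord 1.
Let o2 : 'I_3 := inord 2.

Let mG : measurable G. Proof. exact: open_rV_measurable. Qed.
Let Gr x : G x -> `|x| < r. Proof. by move/GU/Ur. Qed.
Let fG : (mu G < +oo)%E. Proof. exact: (bounded_lt_pinfty mG Gr). Qed.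
Let clA : closed A. Proof. by apply: compact_closed => //; exact: norm_hausdorff. Qed.
Let Ar x : A x -> `|x| < r. Proof. by move/AU/Ur. Qed.

(** The scalar triple product of Df, Db and g along the coordinates [d]. *)
Definition triple (g : 'I_3 -> E -> R) (x : E) : R :=
  partial (d o0) f x * (partial (d o1) b x * g o2 x - partial (d o2) b x * g o1 x)
  + partial (d o1) f x * (partial (d o2) b x * g o0 x - partial (d o0) b x * g o2 x)
  + partial (d o2) f x * (partial (d o0) b x * g o1 x - partial (d o1) b x * g o0 x).

(* The curl-free field is the central difference of [a] in direction [m], which
   is Lipschitz and tends to the derivative of [a]. *)
Lemma int_triple : \int[mu]_(x in G) triple (fun k => partial (d m) (a k)) x = 0.
Proof.
have [e e0 Ae] := compact_margin cA oU AU Ur.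
(* Steps shorter than the margin e of A in U keep both translates of the support of f inside U. *)
have [k0 k0e] : exists k0 : nat, k0.+1%:R^-1 < e.
  have [k _ /(_ k (leqnn k))] := near_infty_natSinv_lt (PosNum e0); by exists k.
pose t k : R := (k + k0).+1%:R^-1.
have tp k : 0 < t k by rewrite invr_gt0 ltr0n.
have te k : t k < e.
  apply: le_lt_trans k0e; rewrite lef_pV2 ?posrE ?ltr0n// ler_nat ltnS; exact: leq_addl.
pose H k := triple (fun j => Dc (t k) (d m) (a j)).
have n0 : 'I_n by exact: d o0.
have L0 : 0 <= L by have := Dc_le n0 0 ltr01 lf; exact: le_trans.
have M0 : 0 <= M by have := Dc_le n0 0 ltr01 lb; exact: le_trans.
have bf i := (lip_partial i mG Gr lf df).
have bb i := (lip_partial i mG Gr lb db).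
have bD k j : bmeas G (Dc (t k) (d m) (a j)).
  exact: (lip_bmeas mG Gr (Dc_lip (d m) (tp k) (la j))).
have btriple g : (forall j, bmeas G (g j)) -> bmeas G (triple g).
  move=> bg.
  have b1 p q u v w := bmeasM (bf p).1 (bmeasB (bmeasM (bb q).1 (bg u)) (bmeasM (bb v).1 (bg w))).
  exact: bmeasD (bmeasD (b1 _ _ _ _ _) (b1 _ _ _ _ _)) (b1 _ _ _ _ _).
have HG k : \int[mu]_(x in G) H k x = 0.
  pose v := t k *: e_ (d m).
  have nv : `|v| < e by rewrite normrZ norm_delta mulr1 gtr0_norm.
  (* The quotient of a is differentiable where both translates of x lie in G; the exceptional set is
     the union of N with two of its translates, all null. *)
  pose G' := G `&` [set x | G (x + v)] `&` [set x | G (x + (- v))].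
  pose N' := N `|` [set x | N (x + v)] `|` [set x | N (x + (- v))].
  have mG' : measurable G' by apply: measurableI; [apply: measurableI|] => //; exact: measurable_shift_set.
  have mN' : measurable N' by apply: measurableU; [apply: measurableU|] => //; exact: measurable_shift_set.
  have N'0 : mu N' = 0%E.
    have z w : mu [set x | N (x + w)] = 0%E by rewrite -N0; exact: measure_shift.
    have mz w : measurable [set x | N (x + w)] by exact: measurable_shift_set.
    exact: (null_set_setU (measurableU _ _ mN (mz v)) (mz (- v))
      (null_set_setU mN (mz v) N0 (z v)) (z (- v))).
  have AGN' x : A x -> G' x \/ N' x.
    move=> Ax; have Ux := AU Ax; have Uv := Ae _ _ Ax nv.
    have Uv' : U (x + - v) by apply: Ae => //; rewrite normrN.
    have [|] := UGN Ux; last by right; left; left.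
    have [|] := UGN Uv; last by right; left; right.
    have [|] := UGN Uv'; last by right; right.
    by left.
  have G'r x : G' x -> `|x| < r by move=> [[/Gr]].
  have dD x j : G' x -> differentiable (Dc (t k) (d m) (a j)) x /\
      forall i, partial i (Dc (t k) (d m) (a j)) x =
        (partial i (a j) (x + v) - partial i (a j) (x - v)) / (2 * t k).
    move=> [[Gx Gp] Gm].
    have [dp pp] := shift_partial (da j Gp).
    have [dm pm] := shift_partial (da j Gm).
    have -> : Dc (t k) (d m) (a j) = (fun y => (2 * t k)^-1 * (a j (y + v) - a j (y + (- v)))).
      by apply/funext => y; rewrite /Dc mulrC.
    split; first by apply: differentiableM => //; exact: differentiableB.
    move=> i; rewrite partialZ; last exact: differentiableB.
    by rewrite partialB// pp pm mulrC.
  have := int_curl_free r0 clA Ar mG' G'r mN' N'0 AGN' lf fA lb (fun j => Dc_lip (d m) (tp k) (la j)).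
  move=> /(_ d) /= curl.
  have {}curl : \int[mu]_(x in G') H k x = 0.
    apply: curl => [x [[/df]]|x [[/db]]|x j /(dD x j)[]|x i j G'x]//.
    rewrite (dD x j G'x).2 (dD x i G'x).2.
    by move: G'x => [[Gx Gp] Gm]; rewrite !(sym i j).
  rewrite (Rint_null mG fG mN' N'0 (btriple _ (bD k))).
  have bH' : bmeas G' (H k) by apply: (bmeasS mG _ (btriple _ (bD k))) => x [[]].
  have fG' : (mu G' < +oo)%E by exact: (bounded_lt_pinfty mG' G'r).
  rewrite (Rint_null mG' fG' mN' N'0 bH') in curl.
  rewrite -[RHS]curl Rintegral_mkcond [RHS]Rintegral_mkcond; apply: eq_Rintegral => x _.
  rewrite !patchE; case: ifPn => [/set_mem[Gx Nx]|/negP h1]; case: ifPn => [/set_mem|/negP h2]//.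
  - have Ax : ~ A x.
      by move=> Ax; apply: h2; apply/mem_set; split => //; case: (AGN' x Ax).
    by rewrite /H /triple !(partial_off_support clA _ fA Ax) !mul0r !addr0.
  - by move=> [[[Gx _] _] Nx]; exfalso; apply: h1; apply/mem_set.
have cvH x : G x -> H ^~ x @ \oo --> triple (fun k => partial (d m) (a k)) x.
  move=> Gx; rewrite /H /triple.
  have cvD j : (fun k => Dc (t k) (d m) (a j) x) @ \oo --> partial (d m) (a j) x.
    by have := Dc_cvg (i := d m) (da j Gx); rewrite -(cvg_shiftn k0).
  have cvT (p q s : R) j l : (fun k => p * (q * Dc (t k) (d m) (a j) x - s * Dc (t k) (d m) (a l) x))
      @ \oo --> p * (q * partial (d m) (a j) x - s * partial (d m) (a l) x).
    exact: cvgM (cvg_cst p) (cvgB (cvgM (cvg_cst q) (cvD j)) (cvgM (cvg_cst s) (cvD l))).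
  exact: cvgD (cvgD (cvT _ _ _ _ _) (cvT _ _ _ _ _)) (cvT _ _ _ _ _).
have HM k x : G x -> `|H k x| <= 3 * (L * (M * M + M * M)).
  move=> Gx; rewrite /H /triple.
  have tm i j p q l : `|partial i f x * (partial j b x * Dc (t k) (d m) (a p) x
      - partial q b x * Dc (t k) (d m) (a l) x)| <= L * (M * M + M * M).
    rewrite normrM; apply: ler_pM => //; first exact: (bf i).2.
    rewrite (le_trans (ler_normB _ _))//; apply: lerD; rewrite normrM; apply: ler_pM => //.
    - exact: (bb j).2.
    - exact: (Dc_le _ _ (tp k) (la p)).
    - exact: (bb q).2.
    - exact: (Dc_le _ _ (tp k) (la l)).
  have -> : 3 * (L * (M * M + M * M)) =
    L * (M * M + M * M) + L * (M * M + M * M) + L * (M * M + M * M) by ring.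
  rewrite (le_trans (ler_normD _ _))//; apply: lerD; last exact: tm.
  rewrite (le_trans (ler_normD _ _))//; apply: lerD; exact: tm.
have [_ cv] := bounded_cvg mG fG (fun k => (btriple _ (bD k)).1) HM cvH.
have E0 : (fun k => \int[mu]_(x in G) H k x) = (fun=> 0) by apply/funext.
rewrite E0 in cv; exact: cvg_seq_cst_eq cv.
Qed.

End piola3.

Lemma near_eq_differentiable {R : realType} {n : nat} (f g : 'rV[R]_n -> R) (x : 'rV[R]_n) :
  (\forall y \near x, f y = g y) -> differentiable g x -> differentiable f x.
Proof.
move=> /near_normP[r r0 fg] dg.
have [cg /eqaddoP hg] := (diff_locallyP _ _).1 dg.
have fx : f x = g x by apply: fg; rewrite subrr normr0.
have hf : f \o shift x = cst (f x) + 'd g x +o_ (0 : 'rV[R]_n) id.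
  apply/eqaddoP => e e0; have /near_normP[s s0 sP] := hg e e0.
  apply/near_normP; exists (Num.min r s); first by rewrite lt_min r0.
  move=> y; rewrite lt_min => /andP[yr ys].
  have := sP y ys; rewrite !fctE /= fx (fg (y + x))//.
  by move: yr; rewrite subr0 addrK.
have e : 'd f x = 'd g x :> ('rV[R]_n -> R) by exact: diff_unique.
by apply/diff_locallyP; rewrite e.
Qed.

(** * Explicit cofactors in dimensions 2 and 3 *)

Section cofactors.
Context {R : realType}.

(** With entries indexed by natural numbers, [lift] becomes the computable [bump], and cofactor
    identities become identities for [ring]. *)
Lemma mx_entries n (A : 'M[R]_n.+1) : exists a : nat -> nat -> R, forall i j, A i j = a i j.
Proof. by exists (fun p q => A (inord p) (inord q)) => i j; rewrite !inord_val. Qed.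

Lemma det2E (A : 'M[R]_2) (a : nat -> nat -> R) : (forall i j, A i j = a i j) ->
  \det A = a 0%N 0%N * a 1%N 1%N - a 0%N 1%N * a 1%N 0%N.
Proof.
move=> aE; rewrite (expand_det_row A ord0) !big_ord_recl big_ord0 /cofactor !det_mx11 !mxE !aE /=.
by rewrite /bump /= ?expr0 ?expr1; ring.
Qed.

Lemma cof2E (A : 'M[R]_2) (a : nat -> nat -> R) : (forall i j, A i j = a i j) ->
  forall i j : 'I_2, cof A i j = (-1) ^+ (i + j) * a (bump i 0) (bump j 0).
Proof. by move=> aE i j; rewrite mxE /cofactor det_mx11 !mxE aE. Qed.

Lemma cof3E (A : 'M[R]_3) (a : nat -> nat -> R) : (forall i j, A i j = a i j) ->
  forall i j : 'I_3, cof A i j = (-1) ^+ (i + j) *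
   (a (bump i 0) (bump j 0) * a (bump i 1) (bump j 1)
    - a (bump i 0) (bump j 1) * a (bump i 1) (bump j 0)).
Proof.
move=> aE i j; rewrite mxE /cofactor.
by rewrite (@det2E _ (fun p q => a (bump i p) (bump j q)))// => p q; rewrite !mxE aE.
Qed.

End cofactors.

Lemma cof_mul_sum {R : realType} n (A : 'M[R]_n) j :
  \sum_i cof A i j * A i j = \det A.
Proof.
by rewrite (expand_det_col A j); apply: eq_bigr => i _; rewrite mxE mulrC.
Qed.

Lemma hessianE {R : realType} n (v : 'rV[R]_n -> R) x i j :
  hessian v x i j = partial i (partial j v) x.
Proof. by rewrite mxE. Qed.

Section piola.
Context {R : realType}.

Lemma lip_on_extension n (L : R) (U G : set 'rV[R]_n) (g : 'rV[R]_n -> R) :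
  open U -> 0 <= L -> G `<=` U -> lip_on U L g -> (forall x, G x -> differentiable g x) ->
  exists2 h, lip L h & forall x, G x -> [/\ h x = g x, differentiable h x &
    forall i, partial i h x = partial i g x].
Proof.
move=> oU L0 GU lg dg; have [U0|nU] := pselect (U !=set0); last first.
  exists (fun=> 0); first by move=> x y _ _; rewrite subrr normr0 mulr_ge0.
  by move=> x /GU Ux; exfalso; apply: nU; exists x.
have [h lh hg] := mcshane U0 L0 lg.
exists h => // x Gx; have nhg : \forall y \near x, h y = g y.
  by have [d d0 dU] := (open_normP U).1 oU x (GU _ Gx); apply/near_normP; exists d => // y /dU /hg.
split; first exact: hg (GU _ Gx).
  exact: near_eq_differentiable nhg (dg _ Gx).
by move=> i; exact: eq_near_partial.
Qed.

(** For n = 2 a column of the cofactor matrix is a rotated gradient of one first derivative of v, so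
    the integrand is a commutator as in [int_partial_comm]. For n = 3, with (j, jb, jm) cyclic,
    column j is the cross product of the gradients of the derivatives of v in directions jb and jm,
    so the integrand is a [triple]. *)
Lemma piola n (r L M : R) (U A G N : set 'rV[R]_n) (f v : 'rV[R]_n -> R) (j : 'I_n) :
  n = 2%N \/ n = 3%N ->
  0 < r -> open U -> (forall x, U x -> `|x| < r) ->
  compact A -> A `<=` U -> open G -> G `<=` U ->
  measurable N -> lebesgue_rV n N = 0%E -> (forall x, U x -> G x \/ N x) ->
  lip L f -> (forall x, ~ A x -> f x = 0) -> (forall x, G x -> differentiable f x) ->
  0 <= M -> (forall k, lip_on U M (partial k v)) ->
  (forall x k, G x -> differentiable (partial k v) x) ->
  (forall x i k, G x -> partial i (partial k v) x = partial k (partial i v) x) ->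
  \int[lebesgue_rV n]_(x in G) (\sum_i cof (hessian v x) i j * partial i f x) = 0.
Proof.
move=> n23 r0 oU Ur cA AU oG GU mN N0 UGN lf fA df M0 lv dv sym.
(* Difference quotients leave U, so each first derivative of v is replaced by a globally Lipschitz
   function with the same values and derivatives on G. *)
have /choice[a aP'] k : exists h, lip M h /\ forall x, G x -> [/\ h x = partial k v x,
    differentiable h x & forall i, partial i h x = partial i (partial k v) x].
  by have [h lh hP] := lip_on_extension oU M0 GU (lv k) (fun x => dv x k); exists h.
have la k : lip M (a k) by case: (aP' k).
have aP k := (aP' k).2.
have da x k : G x -> differentiable (a k) x by move=> /(aP k)[].
have pa x k i : G x -> partial i (a k) x = hessian v x i k by move=> /(aP k)[_ _ ->]; rewrite mxE.
have syma x i k : G x -> partial i (a k) x = partial k (a i) x.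
  by move=> Gx; rewrite !pa// !mxE sym.
case: n23 => n2; subst n.
- pose o1 : 'I_2 := inord 1.
  have clA : closed A by apply: compact_closed => //; exact: norm_hausdorff.
  have Ar x : A x -> `|x| < r by move/AU/Ur.
  have mG := open_rV_measurable oG.
  have Gr x : G x -> `|x| < r by move/GU/Ur.
  have AGN x : A x -> G x \/ N x by move/AU/UGN.
  have H b db' lb := int_partial_comm r0 lf (lb : lip M b) clA Ar fA mG Gr mN N0 AGN df db'.
  have [j0|j1] : j = ord0 \/ j = o1.
    by case: j => [[|[|//]] p]; [left|right]; apply: val_inj; rewrite //= inordK.
  + rewrite -[RHS](H (a o1) (fun x => da x o1) (la o1) ord0 o1).
    apply: eq_Rintegral => x /set_mem Gx; rewrite !pa//.
    have [h hE] := mx_entries (hessian v x).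
    rewrite !big_ord_recl big_ord0 !(cof2E hE) !hE j0 /= inordK//= /bump/=.
    rewrite (_ : lift ord0 ord0 = o1 :> 'I_2); last by apply: val_inj; rewrite /= inordK.
    by rewrite !addn0 expr0 expr1; ring.
  + rewrite -[RHS](H (a ord0) (fun x => da x ord0) (la ord0) o1 ord0).
    apply: eq_Rintegral => x /set_mem Gx; rewrite !pa//.
    have [h hE] := mx_entries (hessian v x).
    rewrite !big_ord_recl big_ord0 !(cof2E hE) !hE j1 /= inordK//= /bump/=.
    rewrite (_ : lift ord0 ord0 = o1 :> 'I_2); last by apply: val_inj; rewrite /= inordK.
    by rewrite expr1 sqrrN expr1n; ring.
- have T jb jm := int_triple r0 oU Ur cA AU oG GU mN N0 UGN (d := id) jm
    lf fA (la jb) la df (fun x => da x jb) da syma.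
  have e0 : ord0 = inord 0 :> 'I_3 by apply: val_inj; rewrite /= inordK.
  have e1 : lift ord0 ord0 = inord 1 :> 'I_3 by apply: val_inj; rewrite /= inordK.
  have e2 : lift ord0 (lift ord0 ord0) = inord 2 :> 'I_3 by apply: val_inj; rewrite /= inordK.
  have j3 : [\/ j = inord 0, j = inord 1 | j = inord 2].
    by case: j => [[|[|[|//]]] p]; [constructor 1|constructor 2|constructor 3]; apply: val_inj; rewrite /= inordK.
  have [jb [jm jj]] : exists jb jm : 'I_3,
    [\/ [/\ j = inord 0, jb = inord 1 & jm = inord 2],
        [/\ j = inord 1, jb = inord 2 & jm = inord 0] |
        [/\ j = inord 2, jb = inord 0 & jm = inord 1]].
    by case: j3 => ->; [exists (inord 1), (inord 2)|exists (inord 2), (inord 0)|exists (inord 0), (inord 1)];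
      [constructor 1|constructor 2|constructor 3].
  rewrite -[RHS](T jb jm); apply: eq_Rintegral => x /set_mem Gx; rewrite /triple !pa//.
  have [h hE] := mx_entries (hessian v x).
  have sh p q : (p < 3)%N -> (q < 3)%N -> h p q = h q p.
    move=> p3 q3; have := syma x (inord p) (inord q) Gx.
    by rewrite !pa// !hE !inordK.
  rewrite !big_ord_recl big_ord0 !(cof3E hE) !hE ?e2 ?e1 ?e0.
  move: (partial _ f x) (partial _ f x) (partial _ f x) => f0 f1 f2.
  case: jj => -[-> -> ->]; rewrite !inordK//= /bump/= ?addn0 ?add0n ?addn1;
    rewrite ?(sh 1%N 0%N)// ?(sh 2%N 0%N)// ?(sh 2%N 1%N)//; ring.
Qed.

End piola.

(** * Quasi-interpolation by translates *)

Section partition_1d.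
Context {R : realType}.

Lemma is_derive_const_on (F f : R -> R) (a b : R) : a <= b ->
  (forall x, is_derive x (1 : R) F (f x)) -> (forall x, a < x -> x < b -> f x = 0) ->
  F a = F b.
Proof.
rewrite le_eqVlt => /orP[/eqP->//|ab] dF f0.
have cF : {within `[a, b], continuous F}.
  apply: continuous_subspaceT => x; apply: differentiable_continuous.
  by apply/derivable1_diffP; case: (dF x).
have [c /itvP cab] := MVT ab (fun x _ => dF x) cF.
rewrite f0 ?cab// mul0r => /eqP; rewrite subr_eq0 => /eqP ->//.
Qed.

Lemma is_derive_nondecr (F f : R -> R) (a b : R) : a <= b ->
  (forall x, is_derive x (1 : R) F (f x)) -> (forall x, 0 <= f x) -> F a <= F b.
Proof.
rewrite le_eqVlt => /orP[/eqP->//|ab] dF f0.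
have cF : {within `[a, b], continuous F}.
  apply: continuous_subspaceT => x; apply: differentiable_continuous.
  by apply/derivable1_diffP; case: (dF x).
have [c /itvP cab] := MVT ab (fun x _ => dF x) cF.
by rewrite -subr_ge0 => ->; rewrite mulr_ge0// subr_ge0 ltW.
Qed.

Lemma is_derive_shift1 (F f : R -> R) (c x : R) :
  (forall x, is_derive x (1 : R) F (f x)) -> is_derive x (1 : R) (fun t => F (t - c)) (f (x - c)).
Proof.
move=> dF; have h := @is_derive_affine _ F 1 (- c) x (f (x - c)).
have e : (fun t => F (1 * t - c)) = (fun t => F (t - c)) by apply/funext => t; rewrite mul1r.
by rewrite -[f _]mulr1 -e; apply: h; rewrite mul1r.
Qed.

Lemma smooth1_shift (f : R -> R) (c : R) : smooth1 f -> smooth1 (fun t => f (t - c)).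
Proof.
move=> sf; have -> : (fun t => f (t - c)) = (fun t => f (1 * t - c)).
  by apply/funext => t; rewrite mul1r.
exact: smooth1_affine.
Qed.

Lemma smooth_step : exists2 S : R -> R, smooth1 S &
  [/\ forall t, 0 <= S t, forall t, t <= 0 -> S t = 0, forall t, 1 <= t -> S t = 1 &
      forall s t, s <= t -> S s <= S t].
Proof.
pose chi (t : R) := ebump t * ebump (-1 * t + 1).
have schi : smooth1 chi by apply: smooth1M; [|apply: smooth1_affine]; exact: ebump_smooth.
have chi0 t : 0 <= chi t by rewrite mulr_ge0// ebump_ge0.
have chiN t : t <= 0 -> chi t = 0 by move=> t0; rewrite /chi ebump_le0// mul0r.
have chi1 t : 1 < t -> chi t = 0.
  by move=> t1; rewrite /chi [X in _ * X]ebump_le0 ?mulr0//; lra.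
have [S dS S0] := antiderivative (smooth1_continuous schi) chiN.
have mS s t : s <= t -> S s <= S t by move=> st; exact: is_derive_nondecr st dS chi0.
have S1 t : 1 <= t -> S t = S 1.
  by move=> t1; apply/esym/(is_derive_const_on t1 dS) => x x1 _; exact: chi1.
(* Were the integral of the bump zero, the nondecreasing S would vanish on (0, 1), against its
   positive derivative there. *)
have c0 : 0 < S 1.
  rewrite lt_def; apply/andP; split; last by rewrite -(S0 0)// mS.
  apply/negP => /eqP S10.
  have Sz t : 0 < t < 1 -> S t = 0.
    move=> /andP[t0 t1]; apply/eqP; rewrite eq_le -{1}S10 mS ?(ltW t1)//=.
    by rewrite -(S0 0)// mS// ltW.
  have ab : (4^-1 : R) < 2^-1 by lra.
  have cS : {within `[4^-1 : R, 2^-1], continuous S}.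
    apply: continuous_subspaceT => x; apply: differentiable_continuous.
    by apply/derivable1_diffP; case: (dS x).
  have [c] := MVT ab (fun x _ => dS x) cS.
  rewrite in_itv/= => /andP[c1 c2] /eqP; rewrite !Sz ?subrr; [|lra|lra].
  rewrite eq_sym mulf_eq0; apply/negP; rewrite negb_or /chi mulf_neq0 ?gt_eqF ?ebump_gt0//; lra.
exists (fun t => S t * (S 1)^-1).
  by apply: smooth1M; [exact: smooth1_antideriv schi dS|exact: smooth1_cst].
split=> [t|t t0|t t1|s t st].
- rewrite mulr_ge0 ?invr_ge0 ?(ltW c0)//.
  by have [t0|t0] := leP t 0; [rewrite S0|rewrite -(S0 0)// mS// ltW].
- by rewrite S0// mul0r.
- by rewrite S1// mulfV// gt_eqF.
- by rewrite ler_wpM2r ?invr_ge0 ?(ltW c0)// mS.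
Qed.

Lemma telescope_shift (G : R -> R) (t : R) N :
  \sum_(k < N) (G (t - k%:R) - G (t - k%:R - 1)) = G t - G (t - N%:R).
Proof.
elim: N => [|N IH]; first by rewrite big_ord0 subr0 subrr.
rewrite big_ord_recr/= IH.
have -> : t - N.+1%:R = t - N%:R - 1 by rewrite -[N.+1]addn1 natrD opprD addrA.
by ring.
Qed.

(** Here eta = B - B(. - 1) with B = P - P(. - 1) and P' a smooth step S. As B' = S - S(. - 1) is
    itself a difference of translates, the translates of eta not only sum to 1 but also reproduce
    the slope of linear functions: the sum of k eta'(t - k) is 1. *)
Lemma partition_fn : exists eta eta' : R -> R,
  [/\ smooth1 eta, forall x, is_derive x (1 : R) eta (eta' x), forall x, 0 <= eta x &
      forall x, x <= 0 \/ 3 <= x -> eta x = 0 /\ eta' x = 0] /\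
  forall N (t : R), 2 <= t <= N%:R ->
  [/\ \sum_(k < N) eta (t - k%:R) = 1, \sum_(k < N) eta' (t - k%:R) = 0,
      \sum_(k < N) k%:R * eta' (t - k%:R) = 1 & \sum_(k < N) `|eta' (t - k%:R)| <= 2].
Proof.
have [S sS [S0 Sneg Spos mS]] := smooth_step.
have [P dP P0] := antiderivative (smooth1_continuous sS) Sneg.
have P1 t : 1 <= t -> P t = P 1 + (t - 1).
  move=> t1; have h : P 1 - 1 = P t - t.
    apply: (@is_derive_const_on (fun t => P t - t) (fun t => S t - 1) 1 t t1) => x x1 _.
    by rewrite Spos ?subrr// ltW.
  lra.
pose B t := P t - P (t - 1); pose b t := S t - S (t - 1).
have dB x : is_derive x (1 : R) B (b x).
  by apply: is_deriveB; exact: is_derive_shift1.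
have b0 t : 0 <= b t by rewrite subr_ge0 mS// gerBl.
have sB : smooth1 B.
  have sP := smooth1_antideriv sS dP.
  have -> : B = fun t => P t + (-1) * P (t - 1) by apply/funext => t; rewrite mulN1r.
  by apply: smooth1D => //; apply: smooth1M; [exact: smooth1_cst|exact: smooth1_shift].
have mB s t : s <= t -> B s <= B t by move=> st; exact: is_derive_nondecr st dB b0.
have B0 t : t <= 0 -> B t = 0 by move=> t0; rewrite /B !P0 ?subrr//; lra.
have B2 t : 2 <= t -> B t = 1 by move=> t2; rewrite /B P1 1?(P1 (t - 1)); lra.
have b0' t : t <= 0 -> b t = 0 by move=> t0; rewrite /b !Sneg ?subrr//; lra.
have b2 t : 2 <= t -> b t = 0 by move=> t2; rewrite /b !Spos ?subrr//; lra.
exists (fun t => B t - B (t - 1)), (fun t => b t - b (t - 1)); split.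
  split.
  - have -> : (fun t => B t - B (t - 1)) = fun t => B t + (-1) * B (t - 1).
      by apply/funext => t; rewrite mulN1r.
    by apply: smooth1D => //; apply: smooth1M; [exact: smooth1_cst|exact: smooth1_shift].
  - by move=> x; apply: is_deriveB; exact: is_derive_shift1.
  - by move=> x; rewrite subr_ge0 mB// gerBl.
  - by move=> x [x0|x3]; [rewrite !B0 ?b0'|rewrite !B2 ?b2]; rewrite ?subrr//; lra.
move=> N t /andP[t2 tN]; split.
- by rewrite telescope_shift B2// B0 ?subr0//; lra.
- by rewrite telescope_shift b2// b0' ?subr0//; lra.
- have -> : \sum_(k < N) k%:R * (b (t - k%:R) - b (t - k%:R - 1)) =
      S (t - 1) - S (t - N%:R) - (N%:R - 1) * b (t - N%:R).
    elim: N {tN} => [|N IH]; first by rewrite big_ord0 !subr0 /b; ring.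
    rewrite big_ord_recr/= IH /b.
    have -> : t - N.+1%:R = t - N%:R - 1 by rewrite -[N.+1]addn1 natrD opprD addrA.
    by rewrite -[N.+1]addn1 natrD; ring.
  rewrite (b0' (t - N%:R)) ?mulr0 ?subr0; last by lra.
  rewrite (Spos (t - 1)); last by lra.
  by rewrite (Sneg (t - N%:R)) ?subr0//; lra.
- apply: (@le_trans _ _ (\sum_(k < N) (b (t - k%:R) + b (t - 1 - k%:R)))).
    apply: ler_sum => k _; rewrite (le_trans (ler_normB _ _))// !ger0_norm//.
    by rewrite [t - 1 - _]addrAC.
  rewrite big_split/= /b.
  rewrite (telescope_shift S t N).
  rewrite (telescope_shift S (t - 1) N).
  have h1 : S t = 1 by apply: Spos; lra.
  have h2 : S (t - 1) = 1 by apply: Spos; lra.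
  have h3 : S (t - N%:R) = 0 by apply: Sneg; lra.
  have h4 : S (t - 1 - N%:R) = 0 by apply: Sneg; lra.
  rewrite h1 h2 h3 h4.
  by rewrite !subr0.
Qed.

End partition_1d.

Section quasi_interpolant.
Context {R : realType} {n : nat}.
Local Notation E := 'rV[R]_n.
Variables (eta eta' : R -> R).
Hypotheses (seta : smooth1 eta) (deta : forall x, is_derive x (1 : R) eta (eta' x)).
Hypotheses (eta0 : forall x, 0 <= eta x).
Hypothesis supp : forall x, x <= 0 \/ 3 <= x -> eta x = 0 /\ eta' x = 0.
Hypothesis part : forall N (t : R), 2 <= t <= N%:R ->
  [/\ \sum_(k < N) eta (t - k%:R) = 1, \sum_(k < N) eta' (t - k%:R) = 0,
      \sum_(k < N) k%:R * eta' (t - k%:R) = 1 & \sum_(k < N) `|eta' (t - k%:R)| <= 2].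
Variables (N : nat) (a : E) (e : R).
Hypothesis e0 : 0 < e.
Local Notation K := {ffun 'I_n -> 'I_N}.

Definition node (k : K) : E := a + e *: \row_i (k i : nat)%:R.

Let sc (x : E) i : R := (x ord0 i - a ord0 i) / e.

Definition shape_fn (k : K) : E -> R :=
  tensor (fun i t => eta (e^-1 * t + (- (a ord0 i / e) - (k i : nat)%:R))).

Let arg (x : E) i (k : K) : e^-1 * x ord0 i + (- (a ord0 i / e) - (k i : nat)%:R) = sc x i - (k i : nat)%:R.
Proof. by rewrite /sc mulrBl; ring. Qed.

Lemma shape_fnE k x : shape_fn k x = \prod_i eta (sc x i - (k i : nat)%:R).
Proof. by apply: eq_bigr => i _; rewrite arg. Qed.

Lemma shape_fn_cinf k : cinf (shape_fn k).
Proof. by apply: cinf_tensor => i; exact: smooth1_affine. Qed.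

Lemma shape_fn_ge0 k x : 0 <= shape_fn k x.
Proof. by apply: prodr_ge0 => i _; exact: eta0. Qed.

Definition dfactor (j i : 'I_n) (t : R) : R := if i == j then eta' t else eta t.

Lemma partial_shape_fn j k x :
  partial j (shape_fn k) x = e^-1 * \prod_i dfactor j i (sc x i - (k i : nat)%:R).
Proof.
rewrite partial_tensor; last by move=> i; exact: smooth1_affine.
rewrite /tensor (bigD1 j)//= [in RHS](bigD1 j)//= mulrA; congr (_ * _).
  rewrite /dtensor /dfactor eqxx -arg.
  have hd := @is_derive_affine R eta e^-1 (- (a ord0 j / e) - (k j : nat)%:R) (x ord0 j) _ (deta _).
  by rewrite (@derive_val _ _ _ _ _ _ _ hd) mulrC.
by apply: eq_bigr => i ij; rewrite /dtensor /dfactor (negbTE ij) arg.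
Qed.

Lemma shape_fn_support (k : K) (x : E) : (exists i, 3 * e <= `|x ord0 i - node k ord0 i|) ->
  shape_fn k x = 0 /\ forall j, partial j (shape_fn k) x = 0.
Proof.
move=> [i xi].
have h : sc x i - (k i : nat)%:R <= 0 \/ 3 <= sc x i - (k i : nat)%:R.
  have E1 : x ord0 i - node k ord0 i = (sc x i - (k i : nat)%:R) * e.
    by rewrite !mxE /sc; field; rewrite gt_eqF.
  move: xi; rewrite E1 normrM (gtr0_norm e0) ler_pM2r// ler_normr.
  by move=> /orP[?|?]; [right|left; lra].
split; first by rewrite shape_fnE (bigD1 i)//= (supp h).1 mul0r.
move=> j; rewrite partial_shape_fn (bigD1 i)//= /dfactor.
by case: ifP => _; rewrite ?(supp h).1 ?(supp h).2 mul0r mulr0.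
Qed.

Variable x : E.
Hypothesis xrange : forall i, 2 <= sc x i <= N%:R.

Lemma sum_shape_fn : \sum_(k : K) shape_fn k x = 1.
Proof.
under eq_bigr do rewrite shape_fnE.
rewrite -(bigA_distr_bigA (fun i (k : 'I_N) => eta (sc x i - k%:R))).
by rewrite big1// => i _; case: (part (xrange i)).
Qed.

Lemma sum_partial_shape_fn j : \sum_(k : K) partial j (shape_fn k) x = 0.
Proof.
under eq_bigr do rewrite partial_shape_fn.
rewrite -mulr_sumr -(bigA_distr_bigA (fun i (k : 'I_N) => dfactor j i (sc x i - k%:R))).
rewrite (bigD1 j)//= (_ : \sum_k _ = 0) ?mul0r ?mulr0//.
by under eq_bigr do rewrite /dfactor eqxx; case: (part (xrange j)).
Qed.

Lemma sum_norm_partial_shape_fn j : \sum_(k : K) `|partial j (shape_fn k) x| <= 2 * e^-1.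
Proof.
under eq_bigr do rewrite partial_shape_fn normrM (gtr0_norm (_ : 0 < e^-1)) ?invr_gt0// normr_prod.
rewrite -mulr_sumr -(bigA_distr_bigA (fun i (k : 'I_N) => `|dfactor j i (sc x i - k%:R)|)).
rewrite mulrC ler_wpM2r ?invr_ge0 ?(ltW e0)//.
rewrite (bigD1 j)//= [X in _ * X](_ : _ = 1) ?mulr1.
  by under eq_bigr do rewrite /dfactor eqxx; case: (part (xrange j)).
rewrite big1// => i ij.
under eq_bigr do rewrite /dfactor (negbTE ij) ger0_norm//.
by case: (part (xrange i)).
Qed.

(** A sum over grid functions of a product over coordinates is the product of one-dimensional sums;
    the weight changes the factor of coordinate i only. *)
Lemma sum_node_partial_shape_fn i j :
  \sum_(k : K) (node k ord0 i - x ord0 i) * partial j (shape_fn k) x = (i == j)%:R.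
Proof.
have -> : \sum_(k : K) (node k ord0 i - x ord0 i) * partial j (shape_fn k) x =
  e * \sum_(k : K) (k i : nat)%:R * partial j (shape_fn k) x.
  have z : (a ord0 i - x ord0 i) * \sum_(k : K) partial j (shape_fn k) x = 0.
    by rewrite sum_partial_shape_fn mulr0.
  transitivity (e * \sum_(k : K) (k i : nat)%:R * partial j (shape_fn k) x
    + (a ord0 i - x ord0 i) * \sum_(k : K) partial j (shape_fn k) x); last by rewrite z addr0.
  rewrite !mulr_sumr -big_split/=.
  by apply: eq_bigr => k _; rewrite !mxE; ring.
under eq_bigr do rewrite partial_shape_fn mulrCA.
rewrite -mulr_sumr mulVKf; last by rewrite gt_eqF.
transitivity (\sum_(k : K) \prod_i' ((if i' == i then (k i' : nat)%:R else 1) * dfactor j i' (sc x i' - (k i' : nat)%:R))).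
  apply: eq_bigr => k _; rewrite big_split/=; congr (_ * _).
  by rewrite (bigD1 i)//= eqxx big1 ?mulr1// => i' /negbTE ->.
rewrite -(bigA_distr_bigA (fun i' (k : 'I_N) => (if i' == i then k%:R else 1) * dfactor j i' (sc x i' - k%:R))).
have [ij|ij] := boolP (i == j).
  rewrite -(eqP ij) (bigD1 i)//= -[RHS]mulr1; congr (_ * _).
    under eq_bigr do rewrite eqxx /dfactor eqxx.
    by case: (part (xrange i)).
  apply: big1 => i' ii'.
  under eq_bigr do rewrite (negbTE ii') /dfactor (negbTE ii') mul1r.
  by case: (part (xrange i')).
rewrite (bigD1 j)//= -[RHS](mul0r (\prod_(i0 < n | i0 != j) \sum_(j0 < N)
   ((if i0 == i then j0%:R else 1) * dfactor j i0 (sc x i0 - j0%:R)))); congr (_ * _).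
under eq_bigr do rewrite eq_sym (negbTE ij) mul1r /dfactor eqxx.
by case: (part (xrange j)).
Qed.

Variable c : K -> R.

(** A substitute for convolution: a finite sum whose coefficients are meant as values at the nodes,
    so that smoothness and partial derivatives are immediate. *)
Definition qinterp : E -> R := fun y => \sum_(k : K) c k * shape_fn k y.

Lemma qinterp_cinf : cinf qinterp.
Proof. by apply: cinf_sum => k; apply: cinfZ; exact: shape_fn_cinf. Qed.

Lemma partial_qinterp j y : partial j qinterp y = \sum_(k : K) c k * partial j (shape_fn k) y.
Proof.
rewrite (partial_sum _ _ _).2 => [|k _].
  by apply: eq_bigr => k _; rewrite partialZ//; exact: cinf_differentiable (shape_fn_cinf k).
by apply: differentiableZ; exact: cinf_differentiable (shape_fn_cinf k).
Qed.

Let near_node (k : K) := forall i, `|x ord0 i - node k ord0 i| < 3 * e.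

Lemma qinterp_value (l w : R) : (forall k, near_node k -> `|c k - l| <= w) ->
  `|qinterp x - l| <= w.
Proof.
move=> H; have -> : qinterp x - l = \sum_(k : K) (c k - l) * shape_fn k x.
  rewrite -{1}[l]mulr1 -sum_shape_fn mulr_sumr -sumrB.
  by apply: eq_bigr => k _; rewrite mulrBl.
rewrite (le_trans (ler_norm_sum _ _ _))// -[w]mulr1 -sum_shape_fn mulr_sumr.
apply: ler_sum => k _; rewrite normrM (ger0_norm (shape_fn_ge0 _ _)).
have [nk|/existsNP[i /negP]] := pselect (near_node k).
  by rewrite ler_wpM2r ?shape_fn_ge0 ?H.
by rewrite -leNgt => xi; rewrite (shape_fn_support _).1 ?mulr0//; exists i.
Qed.

(** By the two moment identities affine data are differentiated exactly, so only the deviation of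
    the coefficients from an affine function counts. It is at most w e near x, and the derivatives
    of the shape functions sum to at most 2 / e. *)
Lemma partial_qinterp_value j (l : R) (d : E) (w : R) : 0 <= w ->
  (forall k, near_node k -> `|c k - l - \sum_i d ord0 i * (node k ord0 i - x ord0 i)| <= w * e) ->
  `|partial j qinterp x - d ord0 j| <= 2 * w.
Proof.
move=> w0' H.
have -> : partial j qinterp x - d ord0 j = \sum_(k : K)
   (c k - l - \sum_i d ord0 i * (node k ord0 i - x ord0 i)) * partial j (shape_fn k) x.
  rewrite partial_qinterp.
  under [RHS]eq_bigr do rewrite !mulrBl.
  rewrite !sumrB -mulr_sumr sum_partial_shape_fn mulr0 subr0; congr (_ - _).
  under eq_bigr do rewrite mulr_suml.
  rewrite exchange_big/=.
  under eq_bigr => i _.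
    under eq_bigr do rewrite -mulrA.
    rewrite -mulr_sumr sum_node_partial_shape_fn.
    over.
  rewrite (bigD1 j)//= eqxx mulr1 big1 ?addr0// => i /negbTE ->; exact: mulr0.
rewrite (le_trans (ler_norm_sum _ _ _))//.
apply: (@le_trans _ _ (\sum_k (w * e) * `|partial j (shape_fn k) x|)).
  apply: ler_sum => k _; rewrite normrM.
  have [nk|/existsNP[i /negP]] := pselect (near_node k).
    by rewrite ler_wpM2r ?H.
  by rewrite -leNgt => xi; rewrite (shape_fn_support _).2 ?normr0 ?mulr0//; exists i.
rewrite -mulr_sumr.
have w0 : 0 <= w * e by rewrite mulr_ge0// ltW.
rewrite (le_trans (ler_wpM2l w0 (sum_norm_partial_shape_fn j)))//.
by rewrite mulrACA mulfV ?gt_eqF// mulr1 mulrC.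
Qed.

End quasi_interpolant.

(** * Mean values and integration by parts *)

Section mean_value.
Context {R : realType} {n : nat}.
Local Notation E := 'rV[R]_n.
Implicit Types (f v : E -> R) (x y : E) (U : set E).

Lemma dist_le_of_half (e P P' a b : R) : P = P' ->
  `|P - b| < e / 2 -> `|P' - a| < e / 2 -> `|a - b| <= e.
Proof.
move=> -> H1 H2; rewrite (_ : a - b = (P' - b) - (P' - a)); last by ring.
by rewrite (le_trans (ler_normB _ _))// [leRHS]splitr lerD// ltW.
Qed.

Definition convexset U := forall x y (t : R), U x -> U y -> 0 <= t <= 1 ->
  U (x + t *: (y - x)).

Lemma mvt_line f x y :
  (forall t : R, 0 <= t <= 1 -> differentiable f (x + t *: (y - x))) ->
  exists2 t : R, 0 < t < 1 &
    f y - f x = \sum_i (y - x) ord0 i * partial i f (x + t *: (y - x)).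
Proof.
move=> df; pose g (t : R) := f (x + t *: (y - x)).
have dg (t : R) : 0 <= t <= 1 -> is_derive t (1 : R) g
    (\sum_i (y - x) ord0 i * partial i f (x + t *: (y - x))).
  by move=> t01; apply: is_derive_line; exact: df.
have cg : {within `[0 : R, 1], continuous g}.
  apply: derivable_within_continuous => t; rewrite in_itv/= => t01.
  by case: (dg t t01).
have dg' (t : R) : t \in `](0:R), 1[%R -> is_derive t (1 : R) g
    (\sum_i (y - x) ord0 i * partial i f (x + t *: (y - x))).
  by rewrite in_itv/= => /andP[t0 t1]; apply: dg; rewrite !ltW.
have [c] := @MVT R g (fun t => \sum_i (y - x) ord0 i * partial i f (x + t *: (y - x)))
  0 1 ltr01 dg' cg.
rewrite in_itv/= subr0 mulr1 => c01 H; exists c => //.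
by rewrite -H /g scale1r scale0r addr0 [x + (y - x)]addrC subrK.
Qed.

Lemma lip_on_of_partial U f (M : R) : convexset U -> (forall x, U x -> differentiable f x) ->
  (forall x i, U x -> `|partial i f x| <= M) -> lip_on U (n%:R * M) f.
Proof.
move=> cU df fM x y Ux Uy.
have [t|t /andP[t0 t1]] := @mvt_line f y x.
  by move=> t01; apply: df; exact: cU.
move=> ->; rewrite (le_trans (ler_norm_sum _ _ _))//.
apply: (@le_trans _ _ (\sum_(i < n) `|x - y| * M)).
  apply: ler_sum => i _; rewrite normrM ler_pM//; first exact: coord_norm_le.
  by apply: fM; apply: cU => //; rewrite !ltW.
by rewrite sumr_const card_ord -[leLHS]mulr_natl (mulrC `|x - y|) mulrA.
Qed.

Lemma mvt_dir f x j (s : R) : 0 < s ->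
  (forall t : R, 0 <= t <= s -> differentiable f (x + t *: delta_mx ord0 j)) ->
  exists2 t : R, 0 < t < s &
    f (x + s *: delta_mx ord0 j) - f x = s * partial j f (x + t *: delta_mx ord0 j).
Proof.
move=> s0 df.
have sub : x + s *: delta_mx ord0 j - x = s *: delta_mx ord0 j by rewrite addrAC subrr add0r.
have [t|t /andP[t0 t1]] := @mvt_line f x (x + s *: delta_mx ord0 j).
  rewrite sub scalerA => /andP[t0 t1]; apply: df.
  by rewrite mulr_ge0 ?(ltW s0)//= ler_piMl// ltW.
rewrite sub scalerA => H; exists (t * s); first by rewrite mulr_gt0//= gtr_pMl.
rewrite H (bigD1 j)//= big1 ?addr0 => [|l lj].
  by rewrite !mxE !eqxx mulr1.
by rewrite !mxE eqxx (negbTE lj) mulr0 mul0r.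
Qed.

(** The second mixed difference with step s is symmetric in the two directions; two mean value
    theorems write it as s^2 times a mixed derivative, in either order, at points within 2 s of x,
    and continuity of both mixed derivatives concludes. *)
Lemma schwarz U f x i k : open U -> C2 U f -> U x ->
  partial i (partial k f) x = partial k (partial i f) x.
Proof.
move=> oU [C1f C2f] Ux.
have [d d0 dU] := (open_normP U).1 oU _ Ux.
have key (j l : 'I_n) (s : R) : 0 < s -> 2 * s < d ->
  exists2 z : E, `|z - x| <= 2 * s &
    f (x + s *: delta_mx ord0 j + s *: delta_mx ord0 l) - f (x + s *: delta_mx ord0 j)
     - (f (x + s *: delta_mx ord0 l) - f x)
    = s * (s * partial l (partial j f) z).
  move=> s0 sd; pose ej : E := delta_mx ord0 j; pose el : E := delta_mx ord0 l.
  have close (a b : R) : 0 <= a <= s -> 0 <= b <= s -> `|x + a *: ej + b *: el - x| <= 2 * s.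
    move=> /andP[a0 as_] /andP[b0 bs].
    rewrite (_ : x + a *: ej + b *: el - x = a *: ej + b *: el); last first.
      by rewrite -(addrA x) addrAC subrr add0r.
    rewrite (le_trans (ler_normD _ _))// !normrZ !norm_delta !mulr1.
    by rewrite !ger0_norm// mulr2n mulrDl mul1r lerD.
  have inU (a b : R) : 0 <= a <= s -> 0 <= b <= s -> U (x + a *: ej + b *: el).
    by move=> ha hb; apply: dU; exact: le_lt_trans (close _ _ ha hb) sd.
  have ss : 0 <= s <= s by rewrite ltW//= lexx.
  have s00 : 0 <= (0 : R) <= s by rewrite lexx ltW.
  have inU0 (a : R) : 0 <= a <= s -> U (x + a *: ej).
    by move=> ha; rewrite -[x + _]addr0 -(scale0r el); exact: inU.
  pose p y := f (y + s *: el) - f y.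
  have dp (a : R) : 0 <= a <= s -> differentiable p (x + a *: ej) /\
      partial j p (x + a *: ej) = partial j f (x + a *: ej + s *: el) - partial j f (x + a *: ej).
    move=> ha; have [d1 e1] := shift_partial (C1f _ (inU a s ha ss)).1.
    have d2 := (C1f _ (inU0 a ha)).1.
    split; first exact: differentiableB.
    by rewrite -e1; exact: (partialB j d1 d2).
  have [t /andP[t0 ts] Ht] := mvt_dir s0 (fun t ht => (dp t ht).1).
  have ht : 0 <= t <= s by rewrite !ltW.
  have [t' /andP[t'0 t's] Ht'] := @mvt_dir (partial j f) (x + t *: ej) l s s0
    (fun b hb => (C2f j _ (inU t b ht hb)).1).
  exists (x + t *: ej + t' *: el); first by apply: close => //; rewrite !ltW.
  have {}Ht : p (x + s *: ej) - p x = s * partial j p (x + t *: ej) := Ht.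
  by rewrite (dp t ht).2 Ht' in Ht; rewrite -Ht /p; ring.
apply/eqP; rewrite -subr_eq0 -normr_eq0; apply/eqP/le_anti; rewrite normr_ge0 andbT.
apply/ler_addgt0Pr => e e0; rewrite add0r.
have e2 : 0 < e / 2 by rewrite divr_gt0.
have [r1 r10 h1] := (continuous_epsP _ _).1 ((C2f k _ Ux).2 i) _ e2.
have [r2 r20 h2] := (continuous_epsP _ _).1 ((C2f i _ Ux).2 k) _ e2.
pose s := Num.min d (Num.min r1 r2) / 4.
have m0 : 0 < Num.min d (Num.min r1 r2) by rewrite !lt_min d0 r10.
have s0 : 0 < s by rewrite divr_gt0.
have sm : 2 * s < Num.min d (Num.min r1 r2) by rewrite /s; lra.
move: (sm); rewrite !lt_min => /and3P[sd sr1 sr2].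
have [z zx Hz] := key i k s s0 sd; have [z' z'x Hz'] := key k i s s0 sd.
have E : partial k (partial i f) z = partial i (partial k f) z'.
  have alg (a b c e' t P P' : R) : t != 0 -> a - b - (c - e') = t * (t * P) ->
      a - c - (b - e') = t * (t * P') -> P = P'.
    move=> t0 H H'; apply: (mulfI t0); apply: (mulfI t0); rewrite -H -H'; ring.
  apply: alg Hz _; first by rewrite gt_eqF.
  by rewrite (addrAC x); exact: Hz'.
have := h1 z' (le_lt_trans z'x sr1); have := h2 z (le_lt_trans zx sr2).
exact: dist_le_of_half E.
Qed.

End mean_value.

Section test_functions.
Context {R : realType} {n : nat}.
Local Notation E := 'rV[R]_n.
Implicit Types (f v phi : E -> R) (x y : E) (U : set E).

Lemma test_function_cinf U phi : test_function U phi -> cinf phi.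
Proof. by case. Qed.

Lemma closed_bounded_compact (A : set E) (r : R) : closed A -> (forall x, A x -> `|x| <= r) ->
  compact A.
Proof.
move=> cA Ar; apply: bounded_closed_compact => //.
exists `|r|; split; first exact: num_real.
move=> M rM x Ax /=; rewrite (le_trans (Ar _ Ax))// (le_trans (ler_norm _))//; exact: ltW.
Qed.

Lemma compactP (A : set E) : compact A <-> closed A /\ exists r : R, forall x, A x -> `|x| < r.
Proof.
split=> [cA|[clA [r Ar]]].
  split; first by apply: compact_closed => //; exact: norm_hausdorff.
  have := compact_bounded cA => -[M [Mr MA]].
  exists (`|M| + 2) => x Ax; rewrite (le_lt_trans (MA (`|M| + 1) _ _ Ax))//.
    by rewrite (le_lt_trans (ler_norm _))// ltrDl.
  by rewrite ltrD2l ltr1n.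
by apply: closed_bounded_compact clA _ => x /Ar /ltW; exact.
Qed.

Lemma continuous_compact_bound (A : set E) f : compact A -> continuous f ->
  exists2 M : R, 0 <= M & forall x, A x -> `|f x| <= M.
Proof.
move=> cA cf; have [A0|nA] := pselect (A !=set0); last first.
  by exists 0 => // x Ax; exfalso; apply: nA; exists x.
have [] := @EVT_max_rV R n (fun x => `|f x|) A A0 cA.
  by apply: continuous_subspaceT => x; exact: (cvg_norm (cf x)).
move=> c _ H; exists `|f c| => // x Ax.
by apply: H; exact: mem_set.
Qed.

Lemma test_function_bounds U phi : test_function U phi ->
  exists A L, [/\ compact A, A `<=` U, forall x, ~ A x -> phi x = 0, 0 <= L &
    lip L phi /\ forall x i, `|partial i phi x| <= L].
Proof.
move=> [cphi [A [cA AU phiA]]]; exists A.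
have clA := ((compactP A).1 cA).1.
have /choice[M HM] (i : 'I_n) : exists M : R, 0 <= M /\ forall x, A x -> `|partial i phi x| <= M.
  have [M M0 MA] := continuous_compact_bound cA (cinf_continuous (cinf_partial i cphi)).
  by exists M.
pose L := \sum_i M i.
have L0 : 0 <= L by apply: sumr_ge0 => i _; case: (HM i).
have pL x i : `|partial i phi x| <= L.
  have [Ax|Ax] := pselect (A x); last by rewrite (partial_off_support clA) ?normr0.
  rewrite (le_trans ((HM i).2 _ Ax))// /L (bigD1 i)//= lerDl.
  by apply: sumr_ge0 => j _; case: (HM j).
have LL : lip (n%:R * L) phi.
  by apply: lip_on_of_partial => // x _; exact: cinf_differentiable.
have [n0|n0] := posnP n.
  exists L; split => //; split => // x y _ _.
  have -> : x = y by apply/rowP => i; exfalso; move: i; rewrite n0 => -[].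
  by rewrite !subrr !normr0 mulr0.
exists (n%:R * L); split => //; first by rewrite mulr_ge0.
split => // x i; rewrite (le_trans (pL x i))// ler_peMl// ler1n//.
Qed.

Lemma test_function_partial U phi i : test_function U phi -> test_function U (partial i phi).
Proof.
move=> [cphi [A [cA AU phiA]]]; split; first exact: cinf_partial.
exists A; split => // x; have clA := ((compactP A).1 cA).1.
exact: partial_off_support.
Qed.

Section by_parts.
Variables (r : R) (U G N : set E).
Hypotheses (n1 : (1 < n)%N) (r0 : 0 < r) (oU : open U) (Ur : forall x, U x -> `|x| < r).
Hypotheses (oG : open G) (GU : G `<=` U).
Hypotheses (mN : measurable N) (N0 : lebesgue_rV n N = 0%E).
Hypothesis UGN : forall x, U x -> G x \/ N x.

Lemma test_mul_lip phi v (M : R) : test_function U phi -> 0 <= M -> lip_on U M v ->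
  exists A L, [/\ compact A, A `<=` U, forall x, ~ A x -> phi x = 0 & lip L (fun x => phi x * v x)].
Proof.
move=> tphi M0 lv; have [A [L [cA AU phiA L0 [lphi _]]]] := test_function_bounds tphi.
have Ar x : A x -> `|x| < r by move/AU/Ur.
have [C C0 vC] := lip_on_bounded M0 Ur lv.
have [F F0 phiF] := lip_on_bounded L0 Ar (fun x y _ _ => lphi x y I I).
exists A, (L * C + F * M); split => //; apply: (lip_mul (A := A)) => //.
- by move=> x y /AU Ux /AU Uy; exact: lv.
- by move=> x /AU /vC.
Qed.

(** The product of phi and v is globally Lipschitz and vanishes off a compact subset of U, so the
    integral of its derivative is zero by [int_partial]. *)
Lemma by_parts phi v (M : R) i : test_function U phi -> 0 <= M -> lip_on U M v ->
  (forall x, G x -> differentiable v x) ->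
  \int[lebesgue_rV n]_(x in G) (v x * partial i phi x) =
  - \int[lebesgue_rV n]_(x in G) (partial i v x * phi x).
Proof.
move=> tphi M0 lv dv.
have [A [L [cA AU phiA lphiv]]] := test_mul_lip tphi M0 lv.
have [clA _] := (compactP A).1 cA.
have cphi := test_function_cinf tphi.
have mG := open_rV_measurable oG.
have Gr x : G x -> `|x| < r by move/GU/Ur.
have fG := bounded_lt_pinfty mG Gr.
have Ar x : A x -> `|x| < r by move/AU/Ur.
have AGN x : A x -> G x \/ N x by move/AU/UGN.
have phivA x : ~ A x -> phi x * v x = 0 by move/phiA => ->; rewrite mul0r.
have dphiv x : G x -> differentiable (fun y => phi y * v y) x.
  by move=> Gx; apply: differentiableM; [exact: cinf_differentiable|exact: dv].
have := int_partial i n1 r0 lphiv clA Ar phivA mG Gr mN N0 AGN dphiv.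
have [h lh hP] := lip_on_extension oU M0 GU lv dv.
have [_ [Lp [_ _ _ _ [lphi _]]]] := test_function_bounds tphi.
have bphi : bmeas G phi by exact: lip_bmeas mG Gr lphi.
have bpphi : bmeas G (partial i phi).
  have [_ [Lp' [_ _ _ _ [lphi' _]]]] := test_function_bounds (test_function_partial i tphi).
  exact: lip_bmeas mG Gr lphi'.
have bv : bmeas G v.
  by apply: (eq_bmeas _ (lip_bmeas mG Gr lh)) => x /hP[].
have bpv : bmeas G (partial i v).
  have dh x : G x -> differentiable h x by move=> /hP[].
  by apply: (eq_bmeas _ (lip_partial i mG Gr lh dh).1) => x /hP[].
move=> E0; apply/eqP; rewrite -subr_eq0 opprK -(RintD mG fG (bmeasM bv bpphi) (bmeasM bpv bphi)).
apply/eqP; rewrite -[RHS]E0; apply: eq_Rintegral => x /set_mem Gx.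
rewrite partialM; [|exact: cinf_differentiable|exact: dv].
by rewrite addrC (mulrC (phi x)).
Qed.

End by_parts.
End test_functions.

(** * Mollification and lower bounds of norms *)

Section inner_sets.
Context {R : realType} {n : nat}.
Local Notation E := 'rV[R]_n.
Implicit Types (U : set E) (x y : E).

(** The erosion of U by a sup-norm ball. For e = 1 / (k + 1) these sets exhaust an open U, and for
    bounded U they are compact. *)
Definition inner U (e : R) : set E := [set x | forall y : E, `|y - x| < e -> U y].

Lemma inner_sub U e : 0 < e -> inner U e `<=` U.
Proof. by move=> e0 x; apply; rewrite subrr normr0. Qed.

Lemma inner_closed U e : closed (inner U e).
Proof.
rewrite -openC; apply/open_normP => x /= nx.
have [y [yx Uy]] : exists y : E, `|y - x| < e /\ ~ U y.
  apply: contrapT => H; apply: nx => y yx; apply: contrapT => Uy; apply: H.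
  by exists y.
exists (e - `|y - x|); first by rewrite subr_gt0.
move=> x' x'x Ix'; apply: Uy; apply: Ix'.
rewrite (_ : y - x' = (y - x) - (x' - x)); last by rewrite opprB addrA subrK.
by rewrite (le_lt_trans (ler_normB _ _))// -ltrBrDl.
Qed.

Lemma inner_compact U e (r : R) : 0 < e -> (forall x, U x -> `|x| < r) -> compact (inner U e).
Proof.
move=> e0 Ur; apply: (closed_bounded_compact (r := r) (@inner_closed U e)).
by move=> x /(inner_sub e0)/Ur/ltW.
Qed.

Lemma inner_cover U x : open U -> U x ->
  exists k0, forall k, (k0 <= k)%N -> inner U k.+1%:R^-1 x.
Proof.
move=> /open_normP oU /oU[d d0 dU].
exists (Num.trunc d^-1) => k kk y yx; apply: dU; apply: (lt_le_trans yx).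
rewrite -[leRHS]invrK lef_pV2 ?posrE ?invr_gt0//.
rewrite ltW// (lt_le_trans (truncnS_gt _))// ler_nat ltnS//.
Qed.

Lemma loc_integrable_measurable U r v : open U -> (forall x, U x -> `|x| < r) ->
  locally_integrable_on U v -> measurable_fun U v.
Proof.
move=> oU Ur lv.
have -> : U = \bigcup_k inner U k.+1%:R^-1.
  apply/seteqP; split => [x Ux|x [k _]].
    by have [k0 /(_ k0 (leqnn _)) ?] := inner_cover oU Ux; exists k0.
  by apply: inner_sub; rewrite invr_gt0.
have mI k : measurable (inner U k.+1%:R^-1).
  rewrite -(setCK (inner _ _)); apply: measurableC; apply: open_rV_measurable.
  by rewrite openC; exact: inner_closed.
apply/measurable_fun_bigcup => // k; apply/measurable_EFinP.
have k0 : 0 < k.+1%:R^-1 :> R by rewrite invr_gt0.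
by have /integrableP[] := lv _ (inner_compact k0 Ur) (inner_sub k0).
Qed.

End inner_sets.

Section mollifier.
Context {R : realType} {n : nat}.
Local Notation E := 'rV[R]_n.
Implicit Types (U : set E) (x y : E) (F phi : E -> R).

Lemma bump_exists (a : E) (r : R) : 0 < r -> exists phi,
  [/\ cinf phi, forall x, 0 <= phi x, forall x, `|x - a| < r -> 0 < phi x &
      forall x, ~ (`|x - a| < r) -> phi x = 0].
Proof.
move=> r0.
pose g i (t : R) := ebump (1 * t + (r - a ord0 i)) * ebump (- 1 * t + (r + a ord0 i)).
have gs i : smooth1 (g i).
  by apply: smooth1M; apply: smooth1_affine; exact: ebump_smooth.
exists (tensor g); split.
- exact: cinf_tensor.
- by move=> x; apply: prodr_ge0 => i _; rewrite mulr_ge0// ebump_ge0.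
- move=> x /(rV_norm_ltP _ r0) xa; apply: prodr_gt0 => i _.
  by have := xa i; rewrite !mxE ltr_norml => /andP[h1 h2]; apply: mulr_gt0; apply: ebump_gt0; lra.
- move=> x xa; have [i xi] : exists i, r <= `|(x - a) ord0 i|.
    apply: contrapT => H; apply: xa; apply/(rV_norm_ltP _ r0) => i.
    by rewrite ltNge; apply/negP => ?; apply: H; exists i.
  rewrite /tensor (bigD1 i)//= /g; move: xi; rewrite !mxE ler_normr => /orP[] h.
    by rewrite (@ebump_le0 _ (-1 * _ + _)) ?mulr0 ?mul0r//; lra.
  by rewrite (@ebump_le0 _ (1 * _ + _)) ?mulr0 ?mul0r//; lra.
Qed.

(** The interpolant of F on a grid of width e. Its values average those of F within distance 3 e,
    and its gradient is close to d as soon as F is close there to an affine function of slope d; F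
    may be discontinuous. *)
Lemma mollify U (r e : R) F : (forall x, U x -> `|x| < r) -> 0 < e <= 1 ->
  (forall x, F x != 0 -> inner U (4 * e) x) ->
  exists phi, [/\ test_function U phi,
    forall x (l w : R), U x -> (forall y : E, `|y - x| < 3 * e -> `|F y - l| <= w) ->
      `|phi x - l| <= w &
    forall x j (l : R) (d : E) (w : R), U x -> 0 <= w ->
      (forall y : E, `|y - x| < 3 * e ->
         `|F y - l - \sum_i d ord0 i * (y ord0 i - x ord0 i)| <= w * e) ->
      `|partial j phi x - d ord0 j| <= 2 * w].
Proof.
move=> Ur /andP[e0 e1] FU.
have [eta [eta' [[se de eta0 etas] etaN]]] := @partition_fn R.
(* The grid starts two units before the box that contains U and N cells reach past its far side, so
   [partition_fn] applies at every point of U; as e <= 1, two units are at least two cells. *)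
pose a : E := \row_i (- `|r| - 2).
pose N := (Num.trunc ((2 * `|r| + 2) / e)).+1.
pose c (k : {ffun 'I_n -> 'I_N}) := F (node a e k).
have e30 : 0 < 3 * e by rewrite mulr_gt0.
have rng x : U x -> forall i : 'I_n, 2 <= (x ord0 i - a ord0 i) / e <= N%:R.
  move=> Ux i; have := le_lt_trans (coord_norm_le x i) (lt_le_trans (Ur _ Ux) (ler_norm r)).
  rewrite ltr_norml => /andP[x1 x2]; rewrite mxE ler_pdivlMr//; apply/andP; split.
    by move: (x ord0 i) x1 x2 => t ? ?; lra.
  apply: le_trans (ltW (truncnS_gt _)); rewrite ler_pM2r ?invr_gt0//.
  by move: (x ord0 i) x1 x2 => t ? ?; lra.
have near k x : (forall i : 'I_n, `|x ord0 i - node a e k ord0 i| < 3 * e) ->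
    `|node a e k - x| < 3 * e.
  by move=> H; apply/(rV_norm_ltP _ e30) => i; rewrite !mxE distrC; have := H i; rewrite !mxE.
exists (qinterp eta a e c); split.
- split; first exact: qinterp_cinf.
  exists (inner U e); split; [exact: inner_compact Ur|exact: inner_sub|].
  move=> x nI; rewrite /qinterp big1// => k _.
  have [->|Fk] := eqVneq (c k) 0; first by rewrite mul0r.
  have [s0 _] : shape_fn eta a e k x = 0 /\ (forall j, partial j (shape_fn eta a e k) x = 0).
    apply: (shape_fn_support se de etas e0); apply: contrapT => H; apply: nI => y yx.
    apply: (FU _ Fk).
    have /near nx : forall i : 'I_n, `|x ord0 i - node a e k ord0 i| < 3 * e.
      by move=> i; rewrite ltNge; apply/negP => ?; apply: H; exists i.
    rewrite (_ : y - _ = (y - x) - (node a e k - x)); last by rewrite opprB addrA subrK.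
    rewrite (le_lt_trans (ler_normB _ _))// (_ : 4 * e = e + 3 * e); last by ring.
    exact: ltrD.
  by rewrite s0 mulr0.
- move=> x l w Ux H.
  by apply: (qinterp_value se de eta0 etas etaN e0 (rng _ Ux)) => k /near; exact: H.
- move=> x j l d w Ux w0 H.
  apply: (@partial_qinterp_value _ _ _ _ se de eta0 etas etaN _ _ _ e0 _ (rng _ Ux) c j l d w w0).
  by move=> k /near; exact: H.
Qed.

Lemma inner_small U x : open U -> U x -> exists2 e0 : R, 0 < e0 & inner U e0 x.
Proof. by move=> /open_normP oU /oU[d d0 dU]; exists d. Qed.

Lemma natinv_small (e : R) : 0 < e -> exists k0, forall k, (k0 <= k)%N -> k.+1%:R^-1 < e.
Proof.
move=> e0; exists (Num.trunc e^-1) => k kk.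
rewrite -[ltRHS]invrK ltf_pV2 ?posrE ?invr_gt0//.
by rewrite (lt_le_trans (truncnS_gt _))// ler_nat ltnS.
Qed.

Lemma cvgn_epsP (f : nat -> R) (l : R) :
  (forall e, 0 < e -> exists k0, forall k, (k0 <= k)%N -> `|f k - l| <= e) ->
  f k @[k --> \oo] --> l.
Proof.
move=> H; apply/cvgrPdist_le => e e0; have [k0 Hk] := H _ e0.
by exists k0 => // k /= kk; rewrite distrC; exact: Hk.
Qed.

(** F cuts w0 off outside the 4 e erosion of U, which leaves room for the support of the shape
    functions; every x finally lies deep enough for the cut-off to be invisible near it. *)
Lemma test_density U (r M : R) (w0 : E -> R) : open U -> (forall x, U x -> `|x| < r) ->
  (forall x, U x -> {for x, continuous w0}) -> 0 <= M -> (forall x, U x -> `|w0 x| <= M) ->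
  exists phi : nat -> E -> R, [/\ forall m, test_function U (phi m),
    forall m x, U x -> `|phi m x| <= M &
    forall x, U x -> phi m x @[m --> \oo] --> w0 x].
Proof.
move=> oU Ur cw M0 wM.
pose F (e : R) x := if `[< inner U (4 * e) x >] then w0 x else 0.
have e01 m : 0 < (m.+1%:R^-1 : R) <= 1 by rewrite invr_gt0 ltr0n/= invf_le1// ler1n.
have FU m x : F m.+1%:R^-1 x != 0 -> inner U (4 * m.+1%:R^-1) x.
  by rewrite /F; case: asboolP => //; rewrite eqxx.
have /choice[phi Hphi] m := mollify Ur (e01 m) (FU m).
exists phi; split.
- by move=> m; case: (Hphi m).
- move=> m x Ux; case: (Hphi m) => _ H _; rewrite -[phi m x]subr0; apply: H => // y _.
  rewrite subr0 /F; case: asboolP => [Iy|_]; last by rewrite normr0.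
  by apply: wM; apply: inner_sub Iy; have /andP[e0 _] := e01 m; rewrite mulr_gt0.
- move=> x Ux; apply: cvgn_epsP => e e0.
  have [d d0 dU] := inner_small oU Ux.
  have [rho rho0 Hr] := (continuous_epsP _ _).1 (cw _ Ux) _ e0.
  (* A point within 3 h of x must have its 4 h neighbourhood inside U, hence 7 h. *)
  have m0 : 0 < Num.min d rho / 7 by rewrite divr_gt0// lt_min d0.
  have [k0 Hk] := natinv_small m0; exists k0 => k kk.
  case: (Hphi k) => _ H _; apply: H => // y yx.
  have /andP[h0 _] := e01 k; have := Hk k kk; move: yx h0; set h := k.+1%:R^-1 => yx h0 hm.
  have h7 : 7 * h < Num.min d rho by lra.
  move: h7; rewrite lt_min => /andP[hd hrho].
  rewrite /F asboolT; first by apply/ltW/Hr/(lt_trans yx); lra.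
  move=> z zy; apply: dU; rewrite (_ : z - x = (z - y) + (y - x)); last by rewrite addrA subrK.
  by rewrite (le_lt_trans (ler_normD _ _))//; lra.
Qed.

End mollifier.

Section lower_bounds.
Context {R : realType} {n : nat}.
Local Notation E := 'rV[R]_n.
Local Notation mu := (lebesgue_rV n : {measure set 'rV[R]_n -> \bar R}).
Implicit Types (U V : set E) (x y : E) (v w phi : E -> R).

Lemma norm_ball_open (a : E) (r : R) : open [set x : E | `|x - a| < r].
Proof.
apply/open_normP => x /= xr; exists (r - `|x - a|); first by rewrite subr_gt0.
move=> y yx /=; rewrite (_ : y - a = (y - x) + (x - a)); last by rewrite addrA subrK.
by rewrite (le_lt_trans (ler_normD _ _))// -ltrBrDr.
Qed.

Lemma closed_ball_compact (a : E) (r : R) : compact [set x : E | `|x - a| <= r].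
Proof.
apply: (@closed_bounded_compact _ _ _ (r + `|a|)) => [|x /= xa].
  rewrite -openC; apply/open_normP => x /= /negP; rewrite -ltNge => xr.
  exists (`|x - a| - r); first by rewrite subr_gt0.
  move=> y yx /= ya; have : `|x - a| <= `|y - x| + `|y - a|.
    by rewrite (distrC y) (_ : x - a = (x - y) + (y - a)) ?ler_normD// addrA subrK.
  by move: yx; lra.
by rewrite -[x](subrK a) (le_trans (ler_normD _ _))// lerD2r.
Qed.

Lemma bump_test U (a : E) (r : R) : 0 < r -> (forall x : E, `|x - a| <= r -> U x) ->
  exists phi, [/\ test_function U phi, forall x, 0 <= phi x,
    forall x, `|x - a| < r -> 0 < phi x & forall x, ~ (`|x - a| < r) -> phi x = 0].
Proof.
move=> r0 BU; have [phi [cphi p0 pB pnB]] := bump_exists a r0.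
exists phi; split => //; split=> //; exists [set x : E | `|x - a| <= r]; split => //.
  exact: closed_ball_compact.
by move=> x /= /negP; rewrite -ltNge => h; apply: pnB => /lt_trans/(_ h); rewrite ltxx.
Qed.

Lemma Linfty_ae U v (B : R) : U !=set0 -> open U ->
  (Lpnorm U +oo v <= B%:E)%E -> {ae mu, forall x, U x -> `|v x| <= B}.
Proof.
move=> U0 oU; rewrite /Lpnorm unlock.
have muT : (0 < mu [set: E])%E.
  by apply: open_measure_gt0; [exact: openT|exists point].
rewrite muT => /ess_supP; apply: filterS => x /= H Ux.
by move: H; rewrite patchE mem_set// lee_fin.
Qed.

(** Nothing is known of w but its integrals against test functions. If |w0 x| exceeded B, then |w0|
    would be at least B + eta on a small ball, and a bump supported there would give an integral too
    large for a function bounded by B almost everywhere. *)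
Lemma linfty_lower U V w (w0 : E -> R) x (B : R) : open U -> open V -> V `<=` U -> V x ->
  (forall y, V y -> {for y, continuous w0}) -> locally_integrable_on U w ->
  (forall phi, test_function V phi ->
    \int[mu]_(y in U) (w y * phi y) = \int[mu]_(y in U) (w0 y * phi y)) ->
  (Lpnorm U +oo w <= B%:E)%E -> `|w0 x| <= B.
Proof.
move=> oU oV VU Vx cw lw tw LB.
have U0 : U !=set0 by exists x; exact: VU.
have aeB := Linfty_ae U0 oU LB.
have B0 : 0 <= B by rewrite -lee_fin; apply: le_trans LB; exact: Lnorm_ge0.
rewrite leNgt; apply/negP => Bw.
pose eta := (`|w0 x| - B) / 2.
have eta0 : 0 < eta by rewrite divr_gt0// subr_gt0.
have [r1 r10 H1] := (continuous_epsP _ _).1 (cw _ Vx) _ eta0.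
have [r2 r20 H2] := (open_normP V).1 oV _ Vx.
pose r := Num.min r1 r2 / 2.
have rm : 0 < Num.min r1 r2 by rewrite lt_min r10.
have r0 : 0 < r by rewrite divr_gt0.
have : r < Num.min r1 r2 by rewrite /r; lra.
rewrite lt_min => /andP[rr1 rr2].
have [phi [tphi p0 pB pnB]] : exists phi, [/\ test_function V phi, forall x, 0 <= phi x,
    forall y, `|y - x| < r -> 0 < phi y & forall y, ~ (`|y - x| < r) -> phi y = 0].
  by apply: bump_test => // y yr; apply: H2; exact: le_lt_trans rr2.
pose D := [set y : E | `|y - x| < r].
have oD : open D := @norm_ball_open x r.
have mD := open_rV_measurable oD.
have DV : D `<=` V by move=> y /= yr; apply: H2; exact: lt_trans rr2.
have Dr y : D y -> `|y| < r + `|x|.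
  by move=> /= yr; rewrite -[y](subrK x) (le_lt_trans (ler_normD _ _))// ltrD2r.
have fD := bounded_lt_pinfty mD Dr.
have Dx : D x by rewrite /D /= subrr normr0.
have toD g : \int[mu]_(y in U) (g y * phi y) = \int[mu]_(y in D) (g y * phi y).
  rewrite [LHS]Rint_support; last first.
    move=> y Uy; rewrite pnB ?mulr0// => yr; apply: Uy; apply: VU; exact: DV.
  by rewrite [RHS]Rint_support// => y /pnB ->; rewrite mulr0.
have := tw _ tphi; rewrite !toD => Etw.
have [A [L [_ _ _ _ [lphi _]]]] := test_function_bounds tphi.
have bphi : bmeas D phi := lip_bmeas mD Dr lphi.
have cphi y : D y -> {for y, continuous phi} by move=> _; exact: (lip_continuous lphi).
pose I := \int[mu]_(y in D) phi y.
have I0 : 0 < I.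
  rewrite lt_neqAle; apply/andP; split; last first.
    by apply: Rintegral_ge0 => y _; exact: p0.
  apply/eqP => /esym I0; have := Rint_eq0_open oD Dr cphi bphi (fun y _ => p0 y) I0 Dx.
  by move/eqP; rewrite gt_eqF// pB// subrr normr0.
have bw0 : bmeas D w0.
  split; first by apply: continuous_on_measurable => // y /DV; exact: cw.
  exists (`|w0 x| + eta) => y Dy; rewrite -[w0 y](subrK (w0 x)).
  rewrite (le_trans (ler_normD _ _))// addrC lerD2l ltW//; apply: H1.
  by apply: (lt_trans _ rr1); exact: Dy.
have low : (B + eta) * I <= `|\int[mu]_(y in D) (w0 y * phi y)|.
  (* Multiplication by the sign of w0 x turns the lower bound for |w0| into one for the
     integrand. *)
  pose s := Num.sg (w0 x).
  have s1 : `|s| <= 1 by rewrite normr_sg; case: eqP; rewrite ?ler01.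
  apply: (@le_trans _ _ (s * \int[mu]_(y in D) (w0 y * phi y))); last first.
    by rewrite (le_trans (ler_norm _))// normrM ler_piMl.
  rewrite /I -(RintZ mD fD _ bphi) -(RintZ mD fD s (bmeasM bw0 bphi)); apply: le_Rint => //; [exact: bmeasZ|by apply: bmeasZ; exact: bmeasM|].
  move=> y Dy; rewrite mulrA ler_wpM2r//.
  have h : `|w0 y - w0 x| < eta by apply: H1; apply: (lt_trans _ rr1); exact: Dy.
  have : s * w0 x - s * w0 y <= eta.
    rewrite -mulrBr (le_trans (ler_norm _))// normrM distrC (le_trans _ (ltW h))//.
    by rewrite ler_piMl.
  rewrite (_ : s * w0 x = `|w0 x|); last by rewrite normrEsg.
  by rewrite /eta; lra.
have up : `|\int[mu]_(y in D) (w y * phi y)| <= B * I.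
  pose cB := [set y : E | `|y - x| <= r].
  have cBU : cB `<=` U by move=> y /= yr; apply: VU; apply: H2; exact: le_lt_trans rr2.
  have DcB : D `<=` cB by move=> y /= /ltW.
  have mw : measurable_fun D w.
    apply: (@measurable_funS _ _ _ _ cB) => //.
      rewrite -(setCK cB); apply: measurableC; apply: open_rV_measurable; rewrite openC.
      by have /compactP[] := @closed_ball_compact x r.
    by have /integrableP[/measurable_EFinP] := lw _ (@closed_ball_compact x r) cBU.
  have mwphi : measurable_fun D (EFin \o (fun y => w y * phi y)).
    by apply/measurable_EFinP; apply: measurable_funM => //; case: bphi.
  have iphi : mu.-integrable D (EFin \o (fun y => B * phi y)).
    by apply: bmeas_integrable => //; exact: bmeasZ.
  have H : (\int[mu]_(y in D) `|(w y * phi y)%:E| <= \int[mu]_(y in D) (B * phi y)%:E)%E.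
    apply: ae_ge0_le_integral => //.
    - exact: measurableT_comp.
    - by move=> y Dy; rewrite lee_fin mulr_ge0.
    - by case/integrableP: iphi.
    - apply: filterS aeB => y H Dy; rewrite lee_fin normrM (ger0_norm (p0 y)).
      by rewrite ler_wpM2r//; apply: H; exact: VU (DV _ Dy).
  have IE : (\int[mu]_(y in D) (B * phi y)%:E)%E = (B * I)%:E.
    by rewrite /I -RintZ// /Rintegral fineK//; exact: integrable_fin_num.
  rewrite -lee_fin -IE; apply: (le_trans _ H).
  have le1 := le_abse_integral mu mD mwphi.
  have fin : (\int[mu]_(y in D) (w y * phi y)%:E)%E \is a fin_num.
    rewrite fin_num_abs (le_lt_trans le1)// (le_lt_trans H)// IE ltry//.
  by apply: le_trans le1; rewrite /Rintegral -[X in (_ <= `|X|)%E](fineK fin).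
by rewrite Etw in up; have := le_trans low up; rewrite (ler_pM2r I0); lra.
Qed.

Lemma Lpnorm2E U v : measurable U -> (mu U < +oo)%E -> bmeas U v ->
  Lpnorm U 2%:E v = (Num.sqrt (\int[mu]_(x in U) v x ^+ 2))%:E.
Proof.
move=> mU fU bv; rewrite /Lpnorm unlock.
have bv2 : bmeas U (fun x => v x ^+ 2).
  by apply: (eq_bmeas _ (bmeasM bv bv)) => x _; rewrite expr2.
have -> : (\int[mu]_x `|(EFin \o v \_ U) x| `^ 2 = (\int[mu]_(x in U) v x ^+ 2)%:E)%E.
  rewrite /Rintegral fineK; last first.
    by apply: integrable_fin_num => //; exact: bmeas_integrable.
  rewrite [RHS]integral_mkcond; apply: eq_integral => x _.
  rewrite /= !patchE; case: ifP => _.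
    by rewrite powR_mulrn// real_normK ?num_real.
  by rewrite normr0 powR0.
by rewrite poweR12_sqrt// lee_fin; apply: Rintegral_ge0 => x _; exact: sqr_ge0.
Qed.

Lemma Rint_cvgM U (M M' : R) (F G : nat -> E -> R) (f g : E -> R) :
  measurable U -> (mu U < +oo)%E -> (forall m, bmeas U (F m)) ->
  (forall m, bmeas U (G m)) -> (forall m y, U y -> `|F m y| <= M) ->
  (forall m y, U y -> `|G m y| <= M') ->
  (forall y, U y -> F m y @[m --> \oo] --> f y) ->
  (forall y, U y -> G m y @[m --> \oo] --> g y) ->
  \int[mu]_(y in U) (F m y * G m y) @[m --> \oo] --> \int[mu]_(y in U) (f y * g y).
Proof.
move=> mU fU bF bG FM GM cF cG.
have FGM m y : U y -> `|F m y * G m y| <= M * M'.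
  by move=> Uy; rewrite normrM ler_pM// ?FM ?GM.
have cFG y : U y -> F m y * G m y @[m --> \oo] --> f y * g y.
  by move=> Uy; exact: (cvgM (cF _ Uy) (cG _ Uy)).
by have [] := @bounded_cvg _ _ _ mu U mU fU _ (fun m y => F m y * G m y) _
  (fun m => (bmeasM (bF m) (bG m)).1) FGM cFG.
Qed.

(** Duality. Let I be the integral of w0^2, s the norm of w and phi_m test functions tending
    boundedly to w0. By Hoelder's inequality the squared integral of w0 phi_m is at most s^2 times
    the integral of phi_m^2, and in the limit I^2 <= s^2 I. *)
Lemma l2_lower U (r M : R) w (w0 : E -> R) : open U -> (forall x, U x -> `|x| < r) ->
  (forall y, U y -> {for y, continuous w0}) -> 0 <= M -> (forall y, U y -> `|w0 y| <= M) ->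
  locally_integrable_on U w ->
  (forall phi, test_function U phi ->
    \int[mu]_(y in U) (w y * phi y) = \int[mu]_(y in U) (w0 y * phi y)) ->
  ((Num.sqrt (\int[mu]_(x in U) w0 x ^+ 2))%:E <= Lpnorm U 2%:E w)%E.
Proof.
move=> oU Ur cw M0 wM lw tw.
have mU := open_rV_measurable oU; have fU := bounded_lt_pinfty mU Ur.
have mw := loc_integrable_measurable oU Ur lw.
have [phi [tphi pM pc]] := test_density oU Ur cw M0 wM.
have bw0 : bmeas U w0 by split; [exact: continuous_on_measurable|exists M].
have bphi m : bmeas U (phi m).
  by have [A [L [_ _ _ _ [lphi _]]]] := test_function_bounds (tphi m); exact: lip_bmeas mU Ur lphi.
have : (0 <= Lpnorm U 2%:E w)%E by exact: Lnorm_ge0.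
case E : (Lpnorm U 2%:E w) => [s| |] // s0; last by rewrite leey.
rewrite lee_fin in s0; rewrite lee_fin.
pose I := \int[mu]_(x in U) w0 x ^+ 2.
have Iphi m : (\int[mu]_(y in U) (w0 y * phi m y)) ^+ 2 <=
    s ^+ 2 * \int[mu]_(y in U) phi m y ^+ 2.
  rewrite -(tw _ (tphi m)).
  have := @hoelder _ _ _ mu (w \_ U) (phi m \_ U) 2 2.
  have mwU : measurable_fun setT (w \_ U) by exact/(measurable_restrictT _ _).1.
  have mpU : measurable_fun setT (phi m \_ U).
    by apply/(measurable_restrictT _ _).1 => //; case: (bphi m).
  have h2 : 0 < 2 :> R by [].
  move=> /(_ mwU mpU h2 h2); rewrite -[X in (_ <= X * _)%E]/(Lpnorm U 2%:E w).
  rewrite -[X in (_ <= _ * X)%E]/(Lpnorm U 2%:E (phi m)) E (Lpnorm2E mU fU (bphi m)).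
  have h12 : 2^-1 + 2^-1 = 1 :> R by lra.
  move=> /(_ h12); rewrite Lnorm1 -EFinM => H.
  have P0 : 0 <= \int[mu]_(y in U) phi m y ^+ 2 by apply: Rintegral_ge0 => y _; exact: sqr_ge0.
  rewrite -[leRHS](_ : (s * Num.sqrt (\int[mu]_(y in U) phi m y ^+ 2)) ^+ 2 = _); last first.
    by rewrite exprMn sqr_sqrtr.
  rewrite -real_normK ?num_real// ler_sqr ?nnegrE ?mulr_ge0// ?sqrtr_ge0//.
  rewrite -lee_fin; apply: (le_trans _ H).
  have mwphi : measurable_fun U (EFin \o (fun y => w y * phi m y)).
    by apply/measurable_EFinP; apply: measurable_funM => //; case: (bphi m).
  have le1 := le_abse_integral mu mU mwphi.
  have HE : (\int[mu]_x `|(EFin \o (w \_ U \* phi m \_ U)%R) x| =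
      \int[mu]_(x in U) `|(EFin \o (fun y => w y * phi m y)%R) x|)%E.
    rewrite [RHS]integral_mkcond; apply: eq_integral => x _.
    by rewrite /= !patchE; case: ifP => _; rewrite ?mul0r ?normr0.
  rewrite HE; rewrite HE in H.
  have fin : (\int[mu]_(y in U) (w y * phi m y)%:E)%E \is a fin_num.
    by rewrite fin_num_abs (le_lt_trans le1)// (le_lt_trans H)// ltry.
  by apply: le_trans le1; rewrite /Rintegral -[X in (_ <= `|X|)%E](fineK fin).
have lim2 := Rint_cvgM mU fU.
have IE : I = \int[mu]_(y in U) (w0 y * w0 y) by apply: eq_Rintegral => y _; rewrite expr2.
have c1 : (\int[mu]_(y in U) (w0 y * phi m y)) ^+ 2 @[m --> \oo] --> I ^+ 2.
  have c : \int[mu]_(y in U) (w0 y * phi m y) @[m --> \oo] --> I.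
    by rewrite IE; exact: (@lim2 M M (fun=> w0) phi w0 w0 (fun=> bw0) bphi (fun _ => wM) pM (fun y _ => cvg_cst (w0 y)) pc).
  exact: (cvgM c c).
have c2 : s ^+ 2 * \int[mu]_(y in U) phi m y ^+ 2 @[m --> \oo] --> s ^+ 2 * I.
  have c := @lim2 M M phi phi w0 w0 bphi bphi pM pM pc pc.
  rewrite IE; apply: (cvgM (cvg_cst _)).
  by rewrite (_ : (fun m => _) = (fun m => \int[mu]_(y in U) (phi m y * phi m y))).
have : I ^+ 2 <= s ^+ 2 * I by apply: (ler_cvg_to c1 c2); exact: nearW.
have : 0 <= I by apply: Rintegral_ge0 => y _; exact: sqr_ge0.
rewrite -/I le_eqVlt => /predU1P[<-|I0]; first by rewrite sqrtr0.
by rewrite expr2 (ler_pM2r I0) => Is; rewrite -[s]ger0_norm// -sqrtr_sqr ler_wsqrtr.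
Qed.

End lower_bounds.

(** * Weak derivatives and Sobolev norms *)

Section mpartial.
Context {R : realType} {n : nat}.
Local Notation E := 'rV[R]_n.
Implicit Types (v : E -> R) (a : 'I_n -> nat).

Lemma mpartial_skip a v (s : seq 'I_n) : (forall j, j \in s -> a j = 0%N) ->
  foldr (fun (i : 'I_n) (w : E -> R) => iter (a i) (partial i) w) v s = v.
Proof.
elim: s => //= j s IH H; rewrite IH ?H ?mem_head// => k ks.
by apply: H; rewrite inE ks orbT.
Qed.

Lemma mpartial0 a v : (forall i, a i = 0%N) -> mpartial a v = v.
Proof. by move=> a0; exact: mpartial_skip. Qed.

Lemma mpartial1 i a v : (forall j, a j = (j == i) :> nat) -> mpartial a v = partial i v.
Proof.
move=> ai; rewrite /mpartial.
have := mem_enum predT i; have := enum_uniq 'I_n; rewrite inE/=.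
move: (enum 'I_n) => s us is_; case/splitPr: is_ us => s1 s2.
rewrite cat_uniq/= negb_or => /and3P[_ /andP[is1 _] /andP[is2 _]].
have nots (t : seq 'I_n) : i \notin t -> forall j, j \in t -> a j = 0%N.
  by move=> ns j js; rewrite ai (_ : (j == i) = false)//; apply/eqP => ji; rewrite ji (negbTE ns) in js.
by rewrite foldr_cat/= mpartial_skip ?ai ?eqxx/= ?mpartial_skip//; exact: nots.
Qed.

(** [mpartial] differentiates in the order of [enum], hence the two cases; [schwarz] identifies them
    where the function is C2. *)
Lemma mpartial2 i k a v : (forall j, a j = (j == i) + (j == k) :> nat)%N ->
  mpartial a v = partial i (partial k v) \/ mpartial a v = partial k (partial i v).
Proof.
move=> aik; rewrite /mpartial.
have := mem_enum predT k; have := mem_enum predT i; have := enum_uniq 'I_n; rewrite !inE/=.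
move: (enum 'I_n) => s us is_ ks; case/splitPr: is_ us ks => s1 s2.
rewrite cat_uniq/= negb_or => /and3P[us1 /andP[is1 /hasPn s12] /andP[is2 us2]].
have nots (t : seq 'I_n) : i \notin t -> k \notin t -> forall j, j \in t -> a j = 0%N.
  move=> ni nk j js; rewrite aik; case: eqP => [ji|_]; first by rewrite -ji js in ni.
  by case: eqP => [jk|_] //; rewrite -jk js in nk.
have one (t : seq 'I_n) w : uniq t -> i \notin t -> k \in t ->
    foldr (fun (i : 'I_n) (w : E -> R) => iter (a i) (partial i) w) w t = partial k w.
  move=> ut ns kt; case/splitPr: kt ut ns => t1 t2.
  rewrite cat_uniq/= negb_or mem_cat inE !negb_or.
  move=> /and3P[_ /andP[kt1 _] /andP[kt2 _]] /and3P[it1 ik it2].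
  rewrite foldr_cat/= mpartial_skip; last exact: nots.
  by rewrite aik eqxx (eq_sym k) (negbTE ik)/= mpartial_skip//; exact: nots.
rewrite mem_cat inE foldr_cat/= => /or3P[ks1|/eqP ki|ks2].
- right; rewrite (one s1)//; congr partial.
  have ks2 : k \notin s2 by apply/negP => h; have := s12 _ h; rewrite /= ks1.
  have ki : k != i by apply/eqP => h; rewrite -h ks1 in is1.
  by rewrite mpartial_skip ?aik ?eqxx 1?eq_sym ?(negbTE ki)//; exact: nots.
- left; rewrite mpartial_skip; last by apply: nots => //; rewrite ki.
  by rewrite mpartial_skip ?aik ?ki ?eqxx//; apply: nots => //; rewrite ki.
- left; have ks1 : k \notin s1 by apply/negP => h; have := s12 _ ks2; rewrite /= h.
  have ki : k != i by apply/eqP => h; rewrite -h ks2 in is2.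
  rewrite mpartial_skip; last exact: nots.
  by rewrite (one s2)// aik eqxx eq_sym (negbTE ki).
Qed.

Lemma mdeg_le1 (k : nat) (a : @mindex n k) : (mdeg a <= 1)%N ->
  (forall j, a j = 0%N :> nat) \/ exists i, forall j, a j = (j == i) :> nat.
Proof.
rewrite /mdeg => H; have [[i ai]|nH] := pselect (exists i, (0 < a i)%N); last first.
  by left => j; apply/eqP; rewrite -leqn0 leqNgt; apply/negP => aj; apply: nH; exists j.
right; exists i => j; move: H; rewrite (bigD1 i)//=.
have [->|ji] := eqVneq j i.
  by case: (nat_of_ord (a i)) ai => // -[].
by rewrite (bigD1 j)//= => /(leq_trans (leq_add ai (leq_addr _ _))); rewrite add1n ltnS leqn0 => /eqP.
Qed.

Lemma mindex_of (k : nat) (f : 'I_n -> nat) : (forall j, (f j <= k)%N) ->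
  exists a : @mindex n k, forall j, a j = f j :> nat.
Proof. by move=> fk; exists [ffun j => inord (f j)] => j; rewrite ffunE inordK// ltnS. Qed.

Lemma sum_delta (i : 'I_n) : (\sum_j (j == i))%N = 1%N.
Proof. by rewrite (bigD1 i)//= eqxx big1// => j /negbTE ->. Qed.

End mpartial.

Section norm_lists.
Context {R : realType}.
Implicit Types (s : seq (\bar R)) (x : \bar R).
Local Open Scope ereal_scope.

Lemma lpsum2_ge s x : (forall y, y \in s -> 0 <= y) -> x \in s -> x <= lpsum 2%:E s.
Proof.
move=> s0 xs; have x0 := s0 _ xs; rewrite /lpsum poweR12_sqrt; last first.
  by apply: sume_ge0 => y _; exact: poweR_ge0.
have -> : x = sqrte (x `^ 2).
  by rewrite -poweR12_sqrt ?poweR_ge0// -poweRrM mulfV// poweRe1.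
rewrite lee_sqrt; last by apply: sume_ge0 => y _; exact: poweR_ge0.
rewrite (big_rem x)//= leeDl//; apply: sume_ge0 => y _; exact: poweR_ge0.
Qed.

Lemma lpsum2_le s (c : R) : (forall y, y \in s -> 0 <= y <= c%:E) ->
  lpsum 2%:E s <= (Num.sqrt ((size s)%:R * c ^+ 2))%:E.
Proof.
move=> sc; rewrite /lpsum poweR12_sqrt; last first.
  by apply: sume_ge0 => y _; exact: poweR_ge0.
rewrite -[leRHS]/(sqrte ((size s)%:R * c ^+ 2)%:E) lee_sqrt; last first.
  by rewrite lee_fin mulr_ge0// sqr_ge0.
elim: s sc => [|y s IH] sc; first by rewrite big_nil mul0r.
have E : ((size (y :: s))%:R * c ^+ 2 = c ^+ 2 + (size s)%:R * c ^+ 2 :> R)%R.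
  by rewrite [size _]/= -[(size s).+1]add1n natrD mulrDl mul1r.
rewrite big_cons E EFinD addeC [leRHS]addeC leeD//.
  have /andP[] := sc y (mem_head _ _); case: y {sc E} => // t; rewrite !lee_fin => t0 tc.
  by rewrite powR_mulrn// lerXn2r// nnegrE (le_trans t0).
by apply: IH => z zs; apply: sc; rewrite inE zs orbT.
Qed.

Lemma lpsumy_ge s x : x \in s -> x <= lpsum +oo s.
Proof.
move=> xs; rewrite /lpsum; elim: s xs => // y s IH.
rewrite inE big_cons le_max => /predU1P[->|/IH ->]; first by rewrite lexx.
by rewrite orbT.
Qed.

Lemma lpsumy_lty s : (forall y, y \in s -> y < +oo) -> lpsum +oo s < +oo.
Proof.
move=> sc; rewrite /lpsum; elim: s sc => [|y s IH] sc; first by rewrite big_nil.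
rewrite big_cons gt_max sc ?mem_head//= IH// => z zs.
by apply: sc; rewrite inE zs orbT.
Qed.

Lemma lpsumy_ge0 s : 0 <= lpsum +oo s.
Proof.
rewrite /lpsum; elim: s => [|y s IH]; first by rewrite big_nil.
by rewrite big_cons le_max IH orbT.
Qed.

End norm_lists.

Section weak_derivatives.
Context {R : realType} {n : nat}.
Local Notation E := 'rV[R]_n.
Local Notation mu := (lebesgue_rV n : {measure set 'rV[R]_n -> \bar R}).
Implicit Types (U V : set E) (x y : E) (v w phi : E -> R).

Lemma near_eq_continuous v w x : (\near x, v x = w x) -> {for x, continuous w} ->
  {for x, continuous v}.
Proof.
move=> /near_normP[r r0 vw] /continuous_epsP cw; apply/continuous_epsP => e e0.
have [r' r'0 H] := cw _ e0; exists (Num.min r r'); first by rewrite lt_min r0.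
move=> y; rewrite lt_min => /andP[y1 y2]; rewrite !vw// ?subrr ?normr0//.
exact: H.
Qed.

Lemma C1_of_partial U v (p : 'I_n -> E -> R) : open U ->
  (forall x, U x -> differentiable v x /\
     forall i, partial i v x = p i x /\ {for x, continuous (p i)}) -> C1 U v.
Proof.
move=> oU H x Ux; have [dv _] := H _ Ux; split=> // i.
apply: (@near_eq_continuous _ (p i)); last by have [_ /(_ i)[]] := H _ Ux.
have [r r0 rU] := (open_normP U).1 oU _ Ux.
by apply/near_normP; exists r => // y /rU /H[_ /(_ i)[]].
Qed.

Lemma C1D U v w : open U -> C1 U v -> C1 U w -> C1 U (fun x => v x + w x).
Proof.
move=> oU Cv Cw; apply: (@C1_of_partial _ _ (fun i x => partial i v x + partial i w x) oU) => x Ux.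
have [dv cv] := Cv x Ux; have [dw cw] := Cw x Ux; split; first exact: differentiableD.
by move=> i; split; [exact: partialD|exact: (cvgD (cv i) (cw i))].
Qed.

Lemma C1B U v w : open U -> C1 U v -> C1 U w -> C1 U (fun x => v x - w x).
Proof.
move=> oU Cv Cw; apply: (@C1_of_partial _ _ (fun i x => partial i v x - partial i w x) oU) => x Ux.
have [dv cv] := Cv x Ux; have [dw cw] := Cw x Ux; split; first exact: differentiableB.
by move=> i; split; [exact: partialB|exact: (cvgB (cv i) (cw i))].
Qed.

Lemma C1Z U (c : R) v : open U -> C1 U v -> C1 U (fun x => c * v x).
Proof.
move=> oU Cv; apply: (@C1_of_partial _ _ (fun i x => c * partial i v x) oU) => x Ux.
have [dv cv] := Cv x Ux; split; first exact: differentiableZ.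
by move=> i; split; [exact: partialZ|exact: (cvgM (cvg_cst c) (cv i))].
Qed.

Lemma C1_eq U v w : open U -> (forall x, U x -> v x = w x) -> C1 U w -> C1 U v.
Proof.
move=> oU vw Cw.
have nvw x : U x -> \near x, v x = w x.
  move=> Ux; have [r r0 rU] := (open_normP U).1 oU _ Ux.
  by apply/near_normP; exists r => // y /rU /vw.
apply: (@C1_of_partial _ _ (fun i => partial i w) oU) => x Ux.
have [dw cw] := Cw _ Ux; split; first exact: near_eq_differentiable (nvw _ Ux) dw.
by move=> i; split => //; exact: eq_near_partial (nvw _ Ux).
Qed.

(** Functions whose classical first derivatives are also weak ones: on a bounded open set the global
    Lipschitz bound keeps values and gradient bounded. *)
Definition nice U v := C1 U v /\ exists2 M : R, 0 <= M & lip_on U M v.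

Lemma lip_onD U (L M : R) v w : lip_on U L v -> lip_on U M w ->
  lip_on U (L + M) (fun x => v x + w x).
Proof.
move=> lv lw x y Ux Uy; rewrite (_ : _ - _ = (v x - v y) + (w x - w y)); last by ring.
by rewrite (le_trans (ler_normD _ _))// mulrDl lerD ?lv ?lw.
Qed.

Lemma lip_onZ U (c L : R) v : lip_on U L v -> lip_on U (`|c| * L) (fun x => c * v x).
Proof.
by move=> lv x y Ux Uy; rewrite -mulrBr normrM -mulrA ler_wpM2l// lv.
Qed.

Lemma lip_onB U (L M : R) v w : lip_on U L v -> lip_on U M w ->
  lip_on U (L + M) (fun x => v x - w x).
Proof.
move=> lv lw x y Ux Uy; rewrite (_ : _ - _ = (v x - v y) - (w x - w y)); last by ring.
by rewrite (le_trans (ler_normB _ _))// mulrDl lerD ?lv ?lw.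
Qed.

Lemma niceB U v w : open U -> nice U v -> nice U w -> nice U (fun x => v x - w x).
Proof.
move=> oU [Cv [L L0 lv]] [Cw [M M0 lw]]; split; first exact: C1B.
by exists (L + M); [rewrite addr_ge0|exact: lip_onB].
Qed.

Lemma test_nice U phi : test_function U phi -> nice U phi.
Proof.
move=> tphi; split; first exact: cinf_C1 (test_function_cinf tphi).
have [A [L [_ _ _ L0 [lphi _]]]] := test_function_bounds tphi.
by exists L => // x y _ _; exact: lphi.
Qed.

Lemma test_functionS U V phi : V `<=` U -> test_function V phi -> test_function U phi.
Proof. by move=> VU [c [A [cA AV A0]]]; split=> //; exists A; split=> // x /AV/VU. Qed.

Lemma Rint_test U V phi v : V `<=` U -> test_function V phi ->
  \int[mu]_(x in U) (v x * phi x) = \int[mu]_(x in V) (v x * phi x).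
Proof.
move=> VU [_ [A [_ AV A0]]].
have off x : ~ V x -> v x * phi x = 0.
  by move=> Vx; rewrite A0 ?mulr0// => /AV.
by rewrite Rint_support => [|x Ux]; [rewrite [RHS]Rint_support|apply: off => /VU].
Qed.

Section bounded_open.
Variables (U : set E) (r : R).
Hypotheses (n1 : (1 < n)%N) (oU : open U) (Ur : forall x, U x -> `|x| < r).

Let mU : measurable U := open_rV_measurable oU.
Let fU : (mu U < +oo)%E := bounded_lt_pinfty mU Ur.

Lemma C1_continuous v x : C1 U v -> U x -> {for x, continuous v}.
Proof. by move=> Cv Ux; apply: differentiable_continuous; case: (Cv _ Ux). Qed.

Lemma nice_bound v : nice U v -> exists2 M : R, 0 <= M & forall x, U x ->
  `|v x| <= M /\ forall i, `|partial i v x| <= M.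
Proof.
move=> [Cv [M M0 lv]]; have [C C0 HC] := lip_on_bounded M0 Ur lv.
exists (C + M); first exact: addr_ge0.
move=> x Ux; split; first by rewrite (le_trans (HC _ Ux))// lerDl.
move=> i; have [h lh Hh] := lip_on_extension oU M0 (@subset_refl _ U) lv (fun x Ux => (Cv x Ux).1).
have [_ _ <-//] := Hh _ Ux.
apply: le_trans ((lip_partial i mU Ur lh _).2 _ Ux) _; last by rewrite lerDr.
by move=> y /Hh[].
Qed.

Lemma nice_bmeas v : nice U v -> bmeas U v /\ forall i, bmeas U (partial i v).
Proof.
move=> nv; have [M M0 HM] := nice_bound nv; have [Cv _] := nv.
split.
  split; first by apply: continuous_on_measurable => // x; exact: C1_continuous.
  by exists M => x /HM[].
move=> i; split; first by apply: continuous_on_measurable => // x /Cv[_].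
by exists M => x /HM[_].
Qed.

Lemma bmeas_loc_integrable v : bmeas U v -> locally_integrable_on U v.
Proof.
move=> bv A cA AU.
have mA : measurable A.
  rewrite -(setCK A); apply: measurableC; apply: open_rV_measurable; rewrite openC.
  by have /compactP[] := cA.
have fA : (mu A < +oo)%E by apply: (bounded_lt_pinfty mA (r := r)) => x /AU/Ur.
exact: bmeas_integrable mA fA (bmeasS mU AU bv).
Qed.

Lemma weak_deriv_self v a : (forall i, a i = 0%N) -> nice U v -> weak_deriv U a v v.
Proof.
move=> a0 nv; have [bv _] := nice_bmeas nv.
split; [exact: bmeas_loc_integrable|exact: bmeas_loc_integrable|].
by move=> phi tphi; rewrite mpartial0// big1 ?expr0 ?mul1r.
Qed.

Lemma by_parts_on V phi v (M : R) i : open V -> V `<=` U -> test_function V phi ->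
  0 <= M -> lip_on V M v -> (forall x, V x -> differentiable v x) ->
  \int[mu]_(x in V) (v x * partial i phi x) = - \int[mu]_(x in V) (partial i v x * phi x).
Proof.
move=> oV VU tphi M0 lv dv.
have V1 x : V x -> `|x| < `|r| + 1.
  by move=> /VU/Ur h; rewrite (lt_le_trans h)// (le_trans (ler_norm _))// lerDl.
have r1 : 0 < `|r| + 1 by rewrite ltr_wpDl.
exact: (@by_parts _ _ _ V V set0 n1 r1 oV V1 oV (@subset_refl _ V) measurable0
  (measure0 _) (fun x Vx => or_introl Vx) phi v M i tphi M0 lv dv).
Qed.

Lemma weak_deriv_partial v a i : (forall j, a j = (j == i) :> nat) -> nice U v ->
  weak_deriv U a v (partial i v).
Proof.
move=> ai nv; have [bv bpv] := nice_bmeas nv; have [Cv [M M0 lv]] := nv.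
split; [exact: bmeas_loc_integrable|exact: bmeas_loc_integrable|].
move=> phi tphi; rewrite (mpartial1 phi ai) (eq_bigr _ (fun j _ => ai j)) sum_delta expr1 mulN1r.
by apply: (by_parts_on i oU (@subset_refl _ U) tphi M0 lv) => x /Cv[].
Qed.

Lemma weak_test0 v a w : (forall i, a i = 0%N) -> weak_deriv U a v w ->
  forall phi, test_function U phi ->
  \int[mu]_(x in U) (w x * phi x) = \int[mu]_(x in U) (v x * phi x).
Proof.
move=> a0 [_ _ H] phi tphi; have := H _ tphi.
by rewrite mpartial0// big1 ?expr0 ?mul1r.
Qed.

(** Regularity of v is asked on V alone, since the test functions are supported there; with V a
    small ball this identifies a weak derivative locally. *)
Lemma weak_test1 V v a w i (M : R) : (forall j, a j = (j == i) :> nat) -> weak_deriv U a v w ->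
  open V -> V `<=` U -> 0 <= M -> lip_on V M v -> (forall x, V x -> differentiable v x) ->
  forall phi, test_function V phi ->
  \int[mu]_(x in U) (w x * phi x) = \int[mu]_(x in U) (partial i v x * phi x).
Proof.
move=> ai [_ _ H] oV VU M0 lv dv phi tphi; have := H _ (test_functionS VU tphi).
rewrite (mpartial1 phi ai) (eq_bigr _ (fun j _ => ai j)) sum_delta expr1 mulN1r.
rewrite (Rint_test _ VU (test_function_partial i tphi)).
rewrite (by_parts_on i oV VU tphi M0 lv dv) => /oppr_inj <-.
by rewrite (Rint_test _ VU tphi).
Qed.

Lemma weak_test2 V v a w i k (M : R) : (forall j, a j = (j == i) + (j == k) :> nat)%N ->
  weak_deriv U a v w -> open V -> V `<=` U -> C2 V v -> 0 <= M -> lip_on V M v ->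
  (forall j, lip_on V M (partial j v)) ->
  forall phi, test_function V phi ->
  \int[mu]_(x in U) (w x * phi x) = \int[mu]_(x in U) (partial i (partial k v) x * phi x).
Proof.
move=> aik [_ _ H] oV VU C2v M0 lv lpv phi tphi; have := H _ (test_functionS VU tphi).
rewrite (eq_bigr _ (fun j _ => aik j)) big_split/= !sum_delta sqrrN expr1n mul1r => <-.
rewrite [RHS](Rint_test _ VU tphi).
have two j l : \int[mu]_(x in U) (v x * partial j (partial l phi) x) =
    \int[mu]_(x in V) (partial l (partial j v) x * phi x).
  rewrite (Rint_test _ VU (test_function_partial j (test_function_partial l tphi))).
  rewrite (by_parts_on j oV VU (test_function_partial l tphi) M0 lv); last first.
    by move=> x Vx; case: (C2v.1 _ Vx).
  rewrite (by_parts_on l oV VU tphi M0 (lpv j)) ?opprK//.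
  by move=> x Vx; case: (C2v.2 j _ Vx).
case: (mpartial2 phi aik) => ->; last exact: two.
rewrite two; apply: eq_Rintegral => x /set_mem Vx.
by rewrite (schwarz i k oV C2v Vx).
Qed.

(** A C1 function on U may fail to be Lipschitz there. On a small ball its derivatives stay within 1
    of their values at the centre, which gives the bound that [weak_test1] and [weak_test2] ask
    for. *)
Lemma C1_local_lip v x : C1 U v -> U x -> exists2 rho : R, 0 < rho &
  (forall y : E, `|y - x| < rho -> U y) /\
  exists2 M : R, 0 <= M & lip_on [set y : E | `|y - x| < rho] M v.
Proof.
move=> Cv Ux; have [d d0 dU] := (open_normP U).1 oU _ Ux.
have /choice[rr Hr] (i : 'I_n) : exists s : R, 0 < s /\
    forall y : E, `|y - x| < s -> `|partial i v y - partial i v x| < 1.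
  by have [s s0 H] := (continuous_epsP _ _).1 ((Cv _ Ux).2 i) _ ltr01; exists s.
pose rho := \big[Num.min/d]_i rr i.
have rho0 : 0 < rho by apply: lt_bigmin => // i _; case: (Hr i).
exists rho => //.
have rhoU y : `|y - x| < rho -> U y.
  by move=> yx; apply: dU; rewrite (lt_le_trans yx)// bigmin_le_id.
split=> //.
pose K := \sum_i (1 + `|partial i v x|).
have K0 : 0 <= K by apply: sumr_ge0 => i _; rewrite addr_ge0.
exists (n%:R * K); first by rewrite mulr_ge0.
apply: lip_on_of_partial.
- move=> y z t /= yx zx /andP[t0 t1].
  rewrite (_ : _ - x = (1 - t) *: (y - x) + t *: (z - x)); last first.
    by apply/rowP => j; rewrite !mxE; ring.
  rewrite (le_lt_trans (ler_normD _ _))// !normrZ ger0_norm ?subr_ge0// ger0_norm//.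
  move: (`|y - x|) (`|z - x|) yx zx => a b ax bx.
  have [->|tn] := eqVneq t 1; first by rewrite subrr mul0r mul1r add0r.
  have t1' : t < 1 by rewrite lt_neqAle tn.
  rewrite (_ : rho = (1 - t) * rho + t * rho); last by ring.
  by apply: ltr_leD; [rewrite ltr_pM2l// subr_gt0|rewrite ler_wpM2l// ltW].
- by move=> y /rhoU /Cv[].
- move=> y i /= yx; rewrite -[partial i v y](subrK (partial i v x)).
  rewrite (le_trans (ler_normD _ _))//.
  apply: (@le_trans _ _ (1 + `|partial i v x|)).
    rewrite lerD2r ltW//; apply: (Hr i).2; rewrite (lt_le_trans yx)//.
    exact: bigmin_le_cond.
  by rewrite /K (bigD1 i)//= lerDl; apply: sumr_ge0 => j _; rewrite addr_ge0.
Qed.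

Lemma weak_norm_ge (c : R) p v a : (0 <= c)%R ->
  (forall w (B : R), weak_deriv U a v w -> (Lpnorm U p w <= B%:E)%E -> c <= B) ->
  (c%:E <= weak_deriv_norm U p v a)%E.
Proof.
move=> c0 H; apply: le_ereal_inf_tmp => _ [w ww <-].
have : (0 <= Lpnorm U p w)%E by exact: Lnorm_ge0.
case E : (Lpnorm U p w) => [B| |] h; [|by rewrite leey|by []].
by rewrite lee_fin; apply: (H _ _ ww); rewrite E.
Qed.

Lemma weak_norm_le p v a w : weak_deriv U a v w -> (weak_deriv_norm U p v a <= Lpnorm U p w)%E.
Proof. by move=> ww; apply: ereal_inf_lbound; exists w. Qed.

Lemma weak_norm_ge0 p v a : (0 <= weak_deriv_norm U p v a)%E.
Proof. by apply: weak_norm_ge => // w B _ H; rewrite -lee_fin (le_trans _ H)// Lnorm_ge0. Qed.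

Lemma weak_norm_infty0 v a x : C1 U v -> U x -> (forall j, a j = 0%N) ->
  (`|v x|%:E <= weak_deriv_norm U +oo v a)%E.
Proof.
move=> Cv Ux a0; apply: weak_norm_ge => // w B ww LB.
apply: (linfty_lower oU oU (@subset_refl _ U) Ux _ _ _ LB).
- by move=> y; exact: C1_continuous.
- by case: ww.
- exact: weak_test0 ww.
Qed.

Lemma weak_norm_infty1 v a i x : C1 U v -> U x -> (forall j, a j = (j == i) :> nat) ->
  (`|partial i v x|%:E <= weak_deriv_norm U +oo v a)%E.
Proof.
move=> Cv Ux ai; apply: weak_norm_ge => // w B ww LB.
have [rho rho0 [VU [M M0 lv]]] := C1_local_lip Cv Ux.
apply: (linfty_lower oU (@norm_ball_open _ _ x rho) VU _ _ _ _ LB).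
- by rewrite /= subrr normr0.
- by move=> y /VU /Cv[].
- by case: ww.
- apply: (weak_test1 ai ww (@norm_ball_open _ _ x rho) VU M0 lv).
  by move=> y /VU /Cv[].
Qed.

Lemma weak_norm_infty2 v a i k x : C2 U v -> U x ->
  (forall j, a j = (j == i) + (j == k) :> nat)%N ->
  (`|partial i (partial k v) x|%:E <= weak_deriv_norm U +oo v a)%E.
Proof.
move=> C2v Ux aik; apply: weak_norm_ge => // w B ww LB.
have [rho rho0 [VU [M M0 lv]]] := C1_local_lip C2v.1 Ux.
have /choice[rr Hr] (j : 'I_n) : exists s : R, 0 < s /\ exists2 M : R, 0 <= M &
    lip_on [set y : E | `|y - x| < s] M (partial j v).
  by have [s s0 [_ [M' M'0 H]]] := C1_local_lip (C2v.2 j) Ux; exists s; split=> //; exists M'.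
pose s := \big[Num.min/rho]_j rr j.
have s0 : 0 < s by apply: lt_bigmin => // j _; case: (Hr j).
have /choice[MM HM] (j : 'I_n) : exists M' : R, 0 <= M' /\
    lip_on [set y : E | `|y - x| < rr j] M' (partial j v).
  by have [_ [M' M'0 H]] := Hr j; exists M'.
have W y : `|y - x| < s -> `|y - x| < rho by move/lt_le_trans; apply; exact: bigmin_le_id.
have WU : [set y : E | `|y - x| < s] `<=` U by move=> y /W /VU.
have M'0 : 0 <= M + \sum_j MM j.
  by rewrite addr_ge0//; apply: sumr_ge0 => j _; case: (HM j).
apply: (linfty_lower oU (@norm_ball_open _ _ x s) WU _ _ _ _ LB).
- by rewrite /= subrr normr0.
- by move=> y /WU /(C2v.2 k)[].
- by case: ww.
- apply: (weak_test2 aik ww (@norm_ball_open _ _ x s) WU _ M'0).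
  + by split; [move=> y /WU /C2v.1|move=> j y /WU /(C2v.2 j)].
  + move=> y z /W yx /W zx; rewrite (le_trans (lv _ _ yx zx))// ler_wpM2r// lerDl.
    by apply: sumr_ge0 => j _; case: (HM j).
  + move=> j y z yx zx; have sj : s <= rr j by exact: bigmin_le_cond.
    rewrite (le_trans ((HM j).2 _ _ (lt_le_trans yx sj) (lt_le_trans zx sj)))// ler_wpM2r//.
    rewrite (bigD1 j)//= addrCA lerDl addr_ge0//.
    by apply: sumr_ge0 => l _; case: (HM l).
Qed.

Lemma sob_mem (k : nat) p v (a : @mindex n k) : (mdeg a <= k)%N ->
  weak_deriv_norm U p v (fun i => a i) \in
   [seq weak_deriv_norm U p v (fun i => a i) |
            a : @mindex n k <- enum {: @mindex n k} & (mdeg a <= k)%N].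
Proof.
by move=> ak; apply/mapP; exists a => //; rewrite mem_filter ak mem_enum.
Qed.

Lemma sob_semimem (k : nat) p v (a : @mindex n k) : (mdeg a == k)%N ->
  weak_deriv_norm U p v (fun i => a i) \in
   [seq weak_deriv_norm U p v (fun i => a i) |
            a : @mindex n k <- enum {: @mindex n k} & (mdeg a == k)].
Proof.
by move=> ak; apply/mapP; exists a => //; rewrite mem_filter ak mem_enum.
Qed.

Lemma mdegE (k : nat) (a : @mindex n k) (f : 'I_n -> nat) : (forall j, a j = f j :> nat) ->
  mdeg a = (\sum_j f j)%N.
Proof. by move=> af; rewrite /mdeg; apply: eq_bigr. Qed.

Lemma sob_norm_infty0 (k : nat) v x : C1 U v -> U x -> (`|v x|%:E <= sob_norm U k +oo v)%E.
Proof.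
move=> Cv Ux; have [a a0] := @mindex_of n k (fun=> 0%N) (fun=> leq0n _).
apply: le_trans (lpsumy_ge (sob_mem +oo v (a := a) _)).
  exact: weak_norm_infty0.
by rewrite (mdegE a0) big1.
Qed.

Lemma sob_norm_infty1 (k : nat) v i x : (0 < k)%N -> C1 U v -> U x ->
  (`|partial i v x|%:E <= sob_norm U k +oo v)%E.
Proof.
move=> k0 Cv Ux; have [a ai] := @mindex_of n k (fun j => j == i) (fun j => leq_trans (leq_b1 _) k0).
apply: le_trans (lpsumy_ge (sob_mem +oo v (a := a) _)).
  exact: weak_norm_infty1.
by rewrite (mdegE ai) sum_delta.
Qed.

Lemma sob_norm_infty2 (k : nat) v i j x : (1 < k)%N -> C2 U v -> U x ->
  (`|partial i (partial j v) x|%:E <= sob_norm U k +oo v)%E.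
Proof.
move=> k1 Cv Ux; have [|a aij] := @mindex_of n k (fun l => (l == i) + (l == j))%N.
  by move=> l; rewrite (leq_trans _ k1)// (leq_add (leq_b1 _) (leq_b1 _)).
apply: le_trans (lpsumy_ge (sob_mem +oo v (a := a) _)).
  exact: weak_norm_infty2.
by rewrite (mdegE aij) big_split/= !sum_delta.
Qed.

Lemma sob_seminorm_infty2 v i j x : C2 U v -> U x ->
  (`|partial i (partial j v) x|%:E <= sob_seminorm U 2 +oo v)%E.
Proof.
move=> Cv Ux; have [|a aij] := @mindex_of n 2 (fun l => (l == i) + (l == j))%N.
  by move=> l; rewrite (leq_add (leq_b1 _) (leq_b1 _)).
apply: le_trans (lpsumy_ge (sob_semimem +oo v (a := a) _)).
  exact: weak_norm_infty2.
by rewrite (mdegE aij) big_split/= !sum_delta.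
Qed.

Lemma sob_seminorm_fin (k : nat) v : sobolev U k +oo v -> exists2 S : R, 0 <= S &
  sob_seminorm U k +oo v = S%:E.
Proof.
rewrite /sobolev => fv.
have : (sob_seminorm U k +oo v < +oo)%E.
  apply: lpsumy_lty => y /mapP[a]; rewrite mem_filter => /andP[/eqP ak _] ->.
  by apply: le_lt_trans fv; apply: (lpsumy_ge (sob_mem +oo v (a := a) _)); rewrite ak.
have : (0 <= sob_seminorm U k +oo v)%E by exact: lpsumy_ge0.
by case: (sob_seminorm _ _ _ _) => // S S0 _; exists S.
Qed.

Definition L2sq v : R := \int[mu]_(x in U) v x ^+ 2.

Lemma H1norm_ge0_mem v : forall y : \bar R, y \in
   [seq weak_deriv_norm U 2%:E v (fun i => a i) |
            a : @mindex n 1 <- enum {: @mindex n 1} & (mdeg a <= 1)%N] -> (0 <= y)%E.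
Proof. by move=> y /mapP[a _ ->]; exact: weak_norm_ge0. Qed.

(** Every weak derivative that competes in the infimum has the integrals of the classical one
    against test functions, so [l2_lower] bounds it below. *)
Lemma H1norm_ge v : nice U v -> ((Num.sqrt (L2sq v))%:E <= H1norm U v)%E /\
  forall i, ((Num.sqrt (L2sq (partial i v)))%:E <= H1norm U v)%E.
Proof.
move=> nv; have [M M0 HM] := nice_bound nv; have [Cv [L L0 lv]] := nv.
split.
  have [a a0] := @mindex_of n 1 (fun=> 0%N) (fun=> leq0n _).
  apply: le_trans (lpsum2_ge (@H1norm_ge0_mem v) (sob_mem 2%:E v (a := a) _)); last first.
    by rewrite (mdegE a0) big1.
  apply: weak_norm_ge; first exact: sqrtr_ge0.
  move=> w B ww; rewrite -lee_fin; apply: le_trans.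
  apply: (l2_lower oU Ur _ M0 (fun x Ux => (HM x Ux).1) _ (weak_test0 a0 ww)).
  - by move=> y; exact: C1_continuous.
  - by case: ww.
move=> i; have [a ai] := @mindex_of n 1 (fun j => j == i) (fun j => leq_b1 _).
apply: le_trans (lpsum2_ge (@H1norm_ge0_mem v) (sob_mem 2%:E v (a := a) _)); last first.
  by rewrite (mdegE ai) sum_delta.
apply: weak_norm_ge; first exact: sqrtr_ge0.
move=> w B ww; rewrite -lee_fin; apply: le_trans.
apply: (l2_lower oU Ur _ M0 (fun x Ux => (HM x Ux).2 i)).
- by move=> y /Cv[].
- by case: ww.
- by apply: (weak_test1 ai ww oU (@subset_refl _ U) L0 lv) => y /Cv[].
Qed.

Lemma H1norm_le v (S : R) : nice U v -> L2sq v <= S -> (forall i, L2sq (partial i v) <= S) ->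
  (H1norm U v <= (Num.sqrt (#|{: @mindex n 1}|%:R * S))%:E)%E.
Proof.
move=> nv vS pvS; have [bv bpv] := nice_bmeas nv.
have S0 : 0 <= S by apply: le_trans vS; apply: Rintegral_ge0 => x _; exact: sqr_ge0.
apply: (@le_trans _ _ (Num.sqrt ((size [seq weak_deriv_norm U 2%:E v (fun i => a i) |
   a : @mindex n 1 <- enum {: @mindex n 1} & (mdeg a <= 1)%N])%:R * Num.sqrt S ^+ 2))%:E).
  apply: lpsum2_le => y /mapP[a]; rewrite mem_filter => /andP[a1 _] ->.
  rewrite weak_norm_ge0/=; case: (mdeg_le1 a1) => [a0|[i ai]].
    apply: (le_trans (weak_norm_le 2%:E (weak_deriv_self a0 nv))).
    by rewrite Lpnorm2E// lee_fin ler_wsqrtr.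
  apply: (le_trans (weak_norm_le 2%:E (weak_deriv_partial ai nv))).
  by rewrite (Lpnorm2E mU fU (bpv i)) lee_fin ler_wsqrtr//; exact: pvS.
rewrite lee_fin ler_wsqrtr// sqr_sqrtr// ler_wpM2r// ler_nat size_map size_filter.
by rewrite (leq_trans (count_size _ _))// -cardE.
Qed.

End bounded_open.
End weak_derivatives.

(** * Convex sets and simplices *)

Section convex_geometry.
Context {R : realType} {n : nat}.
Local Notation E := 'rV[R]_n.
Implicit Types (S U : set E) (x y c : E).

Lemma interior_normP S x : S° x <-> exists2 r : R, 0 < r & forall y : E, `|y - x| < r -> S y.
Proof. exact: near_normP. Qed.

Lemma closure_normP S x : closure S x <->
  forall e : R, 0 < e -> exists2 y : E, S y & `|y - x| < e.
Proof.
split=> [clS e e0|H B /near_normP[r r0 rB]].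
  have /clS[y [Sy By]] : nbhs x [set y : E | `|y - x| < e].
    by apply/near_normP; exists e.
  by exists y.
by have [y Sy yx] := H _ r0; exists y; split=> //; exact: rB.
Qed.

(** A point y near x + t (c - x) is x' + t (c' - x') for some x' of S near x; solving for c' gives a
    point near c, hence in S. The radius r t is shared equally between the two errors. *)
Lemma convex_segment_interior S x c (t : R) : convexset S -> closure S x -> S° c ->
  0 < t <= 1 -> S° (x + t *: (c - x)).
Proof.
move=> cS /closure_normP clx /interior_normP[r r0 rS] /andP[t0 t1].
have rt : 0 < r * t / 2 by rewrite divr_gt0 ?mulr_gt0.
apply/interior_normP; exists (r * t / 2) => // y yp.
have [x' Sx' x'x] := clx _ rt.
have t0' : t != 0 by rewrite gt_eqF.
have -> : y = x' + t *: ((x' + t^-1 *: (y - x')) - x').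
  by apply/rowP => j; rewrite !mxE; field.
apply: cS => //; last by rewrite ltW.
apply: rS.
have -> : x' + t^-1 *: (y - x') - c =
    t^-1 *: ((y - (x + t *: (c - x))) - (1 - t) *: (x' - x)).
  by apply/rowP => j; rewrite !mxE; field.
rewrite normrZ gtr0_norm ?invr_gt0// mulrC ltr_pdivrMr//.
rewrite (_ : r * t = r * t / 2 + r * t / 2); last by field.
rewrite (le_lt_trans (ler_normB _ _))// ltr_leD// normrZ ger0_norm ?subr_ge0//.
rewrite (@le_trans _ _ `|x' - x|)//; last exact: ltW.
by rewrite ler_piMl// gerBl ltW.
Qed.

Lemma convex_interior S : convexset S -> convexset S°.
Proof.
move=> cS x y t Sx Sy /andP[t0 t1].
move: t0; rewrite le_eqVlt => /predU1P[<-|t0]; first by rewrite scale0r addr0.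
apply: convex_segment_interior => //; last by rewrite t0.
by apply: subset_closure; exact: interior_subset Sx.
Qed.

(** Slightly past x on the ray from c there is a point x' of the closure, and x lies strictly
    between x' and c. *)
Lemma interior_closure_convex S : convexset S -> S° !=set0 -> (closure S)° `<=` S°.
Proof.
move=> cS [c Sc] x /interior_normP[r r0 rS].
have [->//|xc] := eqVneq x c.
have xc0 : 0 < `|x - c| by rewrite normr_gt0 subr_eq0.
pose e := r / 2 / `|x - c|.
have e0 : 0 < e by rewrite !divr_gt0.
pose x' := x + e *: (x - c).
have clx' : closure S x'.
  apply: rS; rewrite /x' addrAC subrr add0r normrZ gtr0_norm// /e divfK ?gt_eqF//; lra.
have -> : x = x' + (e / (1 + e)) *: (c - x').
  by apply/rowP => j; rewrite !mxE; field; rewrite gt_eqF// addr_gt0.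
apply: convex_segment_interior => //.
by rewrite divr_gt0 ?addr_gt0//= ler_pdivrMr ?addr_gt0// mul1r lerDr.
Qed.

(** The exit parameter is the supremum of those up to which the segment stays in U; as U is open,
    the exit point is not in U. *)
Lemma segment_exits U x y : open U -> U x -> ~ U y ->
  exists2 t : R, 0 < t <= 1 & closure U (x + t *: (y - x)) /\ ~ U (x + t *: (y - x)).
Proof.
move=> oU Ux Uy.
pose A := [set t : R | 0 <= t <= 1 /\ forall s, 0 <= s <= t -> U (x + s *: (y - x))].
have yx0 : 0 < `|y - x|.
  by rewrite normr_gt0 subr_eq0; apply/eqP => yx; apply: Uy; rewrite yx.
have A0 : A 0.
  by split=> [|s]; [rewrite lexx ler01|rewrite -eq_le => /eqP <-; rewrite scale0r addr0].
have ubA : has_sup A by split; [exists 0|exists 1 => t [/andP[]]].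
pose T := sup A.
have T0 : 0 <= T by apply: ub_le_sup => //; case: ubA.
have T1 : T <= 1 by apply: ge_sup; [exists 0|move=> t [/andP[]]].
have below s : 0 <= s < T -> U (x + s *: (y - x)).
  move=> /andP[s0 sT]; have Ts : 0 < T - s by rewrite subr_gt0.
  have [t [_ At] st] := sup_adherent Ts ubA.
  by apply: At; rewrite s0 ltW//; move: st; rewrite -/T opprB addrC subrK.
have dist s t : `|x + s *: (y - x) - (x + t *: (y - x))| = `|s - t| * `|y - x|.
  by rewrite -normrZ; congr (`| _ |); apply/rowP => j; rewrite !mxE; ring.
have nT : ~ U (x + T *: (y - x)).
  move=> UT; have [r r0 rU] := (open_normP U).1 oU _ UT.
  have T1' : T < 1.
    rewrite lt_neqAle T1 andbT; apply/eqP => TE; apply: Uy; move: UT.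
    by rewrite TE scale1r addrC subrK.
  pose d := Num.min (1 - T) (r / 2 / `|y - x|).
  have d0 : 0 < d by rewrite lt_min subr_gt0 T1' !divr_gt0.
  suff : A (T + d) by move=> /(ub_le_sup ubA.2); rewrite -/T gerDl leNgt d0.
  split.
    rewrite addr_ge0//=; last exact: ltW.
    by rewrite -lerBrDl ge_min lexx.
  move=> s /andP[s0 sTd]; have [sT|Ts] := ltP s T; first by apply: below; rewrite s0.
  apply: rU; rewrite dist ger0_norm ?subr_ge0//.
  apply: (@le_lt_trans _ _ (r / 2 / `|y - x| * `|y - x|)).
    by rewrite ler_pM2r// lerBlDl (le_trans sTd)// lerD2l ge_min lexx orbT.
  by rewrite divfK ?gt_eqF//; lra.
have T0' : 0 < T.
  rewrite lt_neqAle T0 andbT; apply/eqP => TE; apply: nT.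
  by rewrite -TE scale0r addr0.
exists T; first by rewrite T0'.
split=> //; apply/closure_normP => e e0.
pose s := Num.max 0 (T - e / 2 / `|y - x|).
have ee : 0 < e / 2 / `|y - x| by rewrite !divr_gt0.
have sT : s < T by rewrite gt_max T0' gtrDl oppr_lt0.
exists (x + s *: (y - x)); first by apply: below; rewrite le_max lexx sT.
rewrite dist distrC gtr0_norm ?subr_gt0//.
apply: (@le_lt_trans _ _ (e / 2 / `|y - x| * `|y - x|)).
  by rewrite ler_pM2r// lerBlDl -lerBlDr le_max lexx orbT.
by rewrite divfK ?gt_eqF//; lra.
Qed.

Lemma hull_sizeP (s : seq E) m x : size s = m -> hull s x <-> exists c : 'I_m -> R,
  [/\ forall i, 0 <= c i, \sum_i c i = 1 & x = \sum_i c i *: s`_i].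
Proof. by move=> <-. Qed.

Lemma hull_convex (s : seq E) : convexset (hull s).
Proof.
move=> x y t [a [a0 a1 ->]] [b [b0 b1 ->]] /andP[t0 t1].
exists (fun i => (1 - t) * a i + t * b i); split.
- by move=> i; rewrite addr_ge0// mulr_ge0// subr_ge0.
- by rewrite big_split/= -!mulr_sumr a1 b1; ring.
- rewrite -sumrB scaler_sumr -big_split/=; apply: eq_bigr => i _.
  by apply/rowP => j; rewrite !mxE; ring.
Qed.

Lemma hull_bounded (s : seq E) : exists2 r : R, 0 < r & forall x, hull s x -> `|x| < r.
Proof.
exists (\sum_(i < size s) `|s`_i| + 1).
  by rewrite ltr_wpDl// sumr_ge0.
move=> _ [c [c0 c1 ->]]; rewrite (@le_lt_trans _ _ (\sum_(i < size s) `|s`_i|)) ?ltrDl//.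
rewrite (le_trans (ler_norm_sum _ _ _))//; apply: ler_sum => i _.
rewrite normrZ ger0_norm// ler_piMl// -c1 (bigD1 i)//= lerDl.
by apply: sumr_ge0 => j _.
Qed.

End convex_geometry.

Section null_sets.
Context {R : realType} {n : nat}.
Local Notation E := 'rV[R]_n.
Local Notation mu := (lebesgue_rV n : {measure set 'rV[R]_n -> \bar R}).

Definition nullset (N : set E) := measurable N /\ mu N = 0%E.

Lemma nullset0 : nullset set0.
Proof. by split; [exact: measurable0|exact: measure0]. Qed.

Lemma nullsetU A B : nullset A -> nullset B -> nullset (A `|` B).
Proof.
move=> [mA A0] [mB B0]; split; first exact: measurableU.
apply/eqP; rewrite eq_le measure_ge0 andbT.
by rewrite (le_trans (measureU2 _ _ _))// [X in (X + _)%E]A0 [X in (_ + X)%E]B0 adde0.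
Qed.

Lemma nullset_seq (I : eqType) (s : seq I) (A : I -> set E) : (forall i, i \in s -> nullset (A i)) ->
  nullset [set x | exists2 i, i \in s & A i x].
Proof.
elim: s => [|i s IH] H.
  by rewrite (_ : [set _ | _] = set0); [exact: nullset0|apply/seteqP; split => // x []].
have -> : [set x | exists2 j, j \in i :: s & A j x] = A i `|` [set x | exists2 j, j \in s & A j x].
  apply/seteqP; split => x /=.
    by move=> [j]; rewrite inE => /predU1P[->|js] Aj; [left|right; exists j].
  by move=> [Ai|[j js Aj]]; [exists i; rewrite ?mem_head|exists j => //; rewrite inE js orbT].
by apply: nullsetU; [apply: H; rewrite mem_head|apply: IH => j js; apply: H; rewrite inE js orbT].
Qed.

End null_sets.

Section simplex.
Context {R : realType} {n : nat}.
Local Notation E := 'rV[R]_n.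
Variable K : n.+1.-tuple E.
Hypothesis indK : affinely_independent K.

Let M : 'M[R]_n := \matrix_(i < n) (tnth K (lift ord0 i) - tnth K ord0).
Let unitM : M \in unitmx.
Proof. by rewrite -row_free_unit. Qed.

(* Barycentric coordinates relative to the vertices 1, ..., n. *)
Definition bary (x : E) : E := (x - tnth K ord0) *m invmx M.

Lemma baryE x : x = tnth K ord0 + \sum_i bary x ord0 i *: (tnth K (lift ord0 i) - tnth K ord0).
Proof.
have -> : \sum_i bary x ord0 i *: (tnth K (lift ord0 i) - tnth K ord0) = bary x *m M.
  by rewrite mulmx_sum_row; apply: eq_bigr => i _; rewrite rowK.
by rewrite /bary mulmxKV// addrC subrK.
Qed.

Lemma bary_sum (c : 'I_n -> R) :
  bary (tnth K ord0 + \sum_i c i *: (tnth K (lift ord0 i) - tnth K ord0)) = \row_i c i.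
Proof.
rewrite /bary addrAC subrr add0r.
rewrite (_ : \sum_i _ = (\row_i c i) *m M) ?mulmxK//.
by rewrite mulmx_sum_row; apply: eq_bigr => i _; rewrite rowK mxE.
Qed.

Lemma hull_baryP x : hull K x <-> (forall i, 0 <= bary x ord0 i) /\ \sum_i bary x ord0 i <= 1.
Proof.
rewrite (hull_sizeP x (size_tuple K)); split.
  move=> [c [c0 c1 xc]].
  have -> : x = tnth K ord0 + \sum_i c (lift ord0 i) *: (tnth K (lift ord0 i) - tnth K ord0).
    rewrite {1}xc (eq_bigr (fun i => c i *: tnth K i)); last first.
      by move=> i _; rewrite (tnth_nth 0).
    rewrite big_ord_recl/= (eq_bigr _ (fun i _ => scalerBr _ _ _)) sumrB -scaler_suml.
    have -> : c ord0 = 1 - \sum_i c (lift ord0 i) by rewrite -c1 big_ord_recl addrK.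
    by rewrite scalerBl scale1r addrAC addrA.
  rewrite bary_sum; split; first by move=> i; rewrite mxE.
  rewrite (eq_bigr (fun i => c (lift ord0 i))); last by move=> i _; rewrite mxE.
  by rewrite -c1 big_ord_recl lerDr.
move=> [b0 b1]; pose c (i : 'I_n.+1) := if unlift ord0 i is Some j then bary x ord0 j
  else 1 - \sum_i bary x ord0 i.
have cl i : c (lift ord0 i) = bary x ord0 i by rewrite /c liftK.
have c0 : c ord0 = 1 - \sum_i bary x ord0 i by rewrite /c unlift_none.
exists c; split.
- by move=> i; rewrite /c; case: unliftP => [j _|_] //; rewrite subr_ge0.
- by rewrite big_ord_recl c0 (eq_bigr _ (fun i _ => cl i)) subrK.
- rewrite {1}[x]baryE (eq_bigr (fun i => c i *: tnth K i)); last first.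
    by move=> i _; rewrite (tnth_nth 0).
  rewrite big_ord_recl c0 [in RHS](eq_bigr (fun i => bary x ord0 i *: tnth K (lift ord0 i))).
    rewrite (eq_bigr _ (fun i _ => scalerBr _ _ _)) sumrB -scaler_suml scalerBl scale1r.
    by rewrite addrA addrAC.
  by move=> i _; rewrite cl.
Qed.

Let lin (w : 'cV[R]_n) (x : E) : R := (bary x *m w) ord0 ord0.

Lemma lin_coord w x : lin w x =
  \sum_j (invmx M *m w) j ord0 * x ord0 j - \sum_j (invmx M *m w) j ord0 * tnth K ord0 ord0 j.
Proof.
rewrite /lin /bary -mulmxA mxE -sumrB; apply: eq_bigr => j _.
by rewrite !mxE mulrBl mulrC [X in _ - X]mulrC.
Qed.

Lemma continuous_lin w : continuous (lin w).
Proof.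
have -> : lin w = fun x => \sum_j (invmx M *m w) j ord0 * x ord0 j -
    \sum_j (invmx M *m w) j ord0 * tnth K ord0 ord0 j.
  by apply/funext => x; exact: lin_coord.
have lw : lip (\sum_j `|(invmx M *m w) j ord0|) (fun x => \sum_j (invmx M *m w) j ord0 * x ord0 j -
    \sum_j (invmx M *m w) j ord0 * tnth K ord0 ord0 j).
  move=> x y _ _; rewrite (_ : _ - _ = \sum_j (invmx M *m w) j ord0 * (x - y) ord0 j); last first.
    rewrite opprB addrA subrK -sumrB; apply: eq_bigr => j _.
    by rewrite !mxE; ring.
  rewrite (le_trans (ler_norm_sum _ _ _))// mulr_suml; apply: ler_sum => j _.
  by rewrite normrM ler_wpM2l//; exact: coord_norm_le.
exact: lip_continuous lw.
Qed.

(** Facets as level sets of affine functions: [Some j] is the facet where coordinate j is 0, [None]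
    the one where the coordinates sum to 1; the levels are in [wval]. *)
Let wvec (i : option 'I_n) : 'cV[R]_n := if i is Some j then delta_mx j ord0 else const_mx 1.
Let wval (i : option 'I_n) : R := if i is Some j then 0 else 1.

Lemma lin_some j x : lin (wvec (Some j)) x = bary x ord0 j.
Proof.
rewrite /lin/= mxE (bigD1 j)//= big1 => [|k kj]; last first.
  by rewrite !mxE (negbTE kj) mulr0.
by rewrite !mxE !eqxx mulr1 addr0.
Qed.

Lemma lin_none x : lin (wvec None) x = \sum_i bary x ord0 i.
Proof. by rewrite /lin/= mxE; apply: eq_bigr => j _; rewrite !mxE mulr1. Qed.

Lemma hull_closed : closed (hull K).
Proof.
have -> : hull K = \bigcap_(i in [set: option 'I_n])
   (if i is Some j then [set x | 0 <= lin (wvec (Some j)) x] else [set x | lin (wvec None) x <= 1]).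
  apply/seteqP; split => [x /hull_baryP[b0 b1] [j|] _ /=|x H].
  - by rewrite lin_some.
  - by rewrite lin_none.
  - apply/hull_baryP; split; last by have := H None I; rewrite /= lin_none.
    by move=> j; have := H (Some j) I; rewrite /= lin_some.
apply: closed_bigI => -[j|] _.
  by apply: (@preimage_closed _ _ (lin (wvec (Some j))) [set t : R | 0 <= t]);
   [move=> x _; exact: continuous_lin|exact: closed_ge].
by apply: (@preimage_closed _ _ (lin (wvec None)) [set t : R | t <= 1]);
  [move=> x _; exact: continuous_lin|exact: closed_le].
Qed.

Lemma open_simplex_interior x : (forall i, 0 < bary x ord0 i) -> \sum_i bary x ord0 i < 1 ->
  (hull K)° x.
Proof.
move=> b0 b1.
have h : 0 < 1 - lin (wvec None) x by rewrite subr_gt0 lin_none.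
have [r r0 Hr] := (continuous_epsP _ _).1 (@continuous_lin (wvec None) x) _ h.
have /choice[rr Hrr] (j : 'I_n) : exists s : R, 0 < s /\
    forall y : E, `|y - x| < s -> 0 < lin (wvec (Some j)) y.
  have hj : 0 < lin (wvec (Some j)) x by rewrite lin_some.
  have [s s0 H] := (continuous_epsP _ _).1 (@continuous_lin (wvec (Some j)) x) _ hj.
  exists s; split=> // y /H; rewrite distrC => yr.
  by move: (le_lt_trans (ler_norm _) yr); rewrite gtrBl.
apply/interior_normP; exists (\big[Num.min/r]_j rr j).
  by apply: lt_bigmin => // j _; case: (Hrr j).
move=> y yx; apply/hull_baryP; split.
  move=> i; rewrite -lin_some ltW//; apply: (Hrr i).2.
  by rewrite (lt_le_trans yx)//; exact: bigmin_le_cond.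
have yr : `|y - x| < r by rewrite (lt_le_trans yx)// bigmin_le_id.
by move: (le_lt_trans (ler_norm _) (Hr _ yr)); rewrite ltrD2r lin_none => /ltW.
Qed.

Lemma hull_interior_neq0 : (0 < n)%N -> (hull K)° !=set0.
Proof.
move=> n0; exists (tnth K ord0 + \sum_i n.+1%:R^-1 *: (tnth K (lift ord0 i) - tnth K ord0)).
apply: open_simplex_interior.
  by move=> i; rewrite bary_sum mxE invr_gt0.
rewrite bary_sum (eq_bigr (fun=> n.+1%:R^-1)); last by move=> i _; rewrite mxE.
by rewrite sumr_const card_ord -[_ *+ n]mulr_natl ltr_pdivrMr ?ltr0n// mul1r ltr_nat.
Qed.

(** The points of the simplex that are not interior lie in the n + 1 hyperplanes of the facets. *)
Lemma hull_boundary_null : (0 < n)%N -> exists2 N, nullset N & forall x, hull K x -> (hull K)° x \/ N x.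
Proof.
move=> n0.
exists [set x | exists2 i, i \in enum {: option 'I_n} & hull K x /\ lin (wvec i) x = wval i].
  apply: nullset_seq => i _.
  have [r r0 Kr] := hull_bounded K.
  have mN : measurable [set x | hull K x /\ lin (wvec i) x = wval i].
    rewrite -(setCK [set _ | _]); apply: measurableC; apply: open_rV_measurable.
    rewrite openC; apply: closedI; first exact: hull_closed.
    by apply: (@preimage_closed _ _ (lin (wvec i)) [set t : R | t = wval i]);
      [move=> x _; exact: continuous_lin|exact: closed_eq].
  split=> //.
  apply: (@hyperplane_null _ _ (invmx M *m wvec i)^T
    (wval i + \sum_j (invmx M *m wvec i) j ord0 * tnth K ord0 ord0 j) _ r) => //.
  - apply/eqP => /(congr1 trmx); rewrite trmxK trmx0 => /(congr1 (mulmx M)).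
    rewrite mulmxA mulmxV// mul1mx mulmx0 => /matrixP w0.
    case: i w0 {mN} => [j|] w0.
      by have := w0 j ord0; rewrite !mxE !eqxx => /eqP; rewrite oner_eq0.
    by have := w0 (Ordinal n0) ord0; rewrite !mxE => /eqP; rewrite oner_eq0.
  - by move=> x [/Kr].
  - move=> x [_ <-]; rewrite lin_coord subrK; apply: eq_bigr => j _.
    by rewrite !mxE.
move=> x Kx; have /hull_baryP[b0 b1] := Kx.
have [h|nh] := pselect (exists i, lin (wvec i) x = wval i).
  by right; case: h => i xi; exists i => //; rewrite mem_enum.
left; apply: open_simplex_interior.
  move=> i; rewrite lt_neqAle b0 andbT; apply/eqP => h; apply: nh.
  by exists (Some i); rewrite lin_some -h.
rewrite lt_neqAle b1 andbT; apply/eqP => h; apply: nh.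
by exists None; rewrite lin_none h.
Qed.

Lemma hull_interior_dense x : (0 < n)%N -> hull K x -> forall e : R, 0 < e ->
  exists2 y, (hull K)° y & `|y - x| < e.
Proof.
move=> n0 Kx e e0; have [c Kc] := hull_interior_neq0 n0.
pose t := Num.min 1 (e / 2 / (1 + `|c - x|)).
have d0 : 0 < 1 + `|c - x| by rewrite ltr_wpDr.
have t0 : 0 < t by rewrite lt_min ltr01 !divr_gt0.
exists (x + t *: (c - x)).
  apply: convex_segment_interior => //; first exact: hull_convex.
    exact: subset_closure.
  by rewrite t0 ge_min lexx.
rewrite addrAC subrr add0r normrZ gtr0_norm//.
apply: (@le_lt_trans _ _ (e / 2 / (1 + `|c - x|) * (1 + `|c - x|))); last first.
  by rewrite divfK ?gt_eqF//; lra.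
apply: ler_pM => //; [exact: ltW|by rewrite ge_min lexx orbT|by rewrite lerDr].
Qed.

End simplex.

(** * Splines on a triangulation *)

Section closed_covers.
Context {R : realType}.

Lemma closed_seq_union (I : eqType) (s : seq I) (F : I -> set R) :
  (forall i, i \in s -> closed (F i)) -> closed [set t | exists2 i, i \in s & F i t].
Proof.
elim: s => [|i s IH] cF.
  by rewrite (_ : [set _ | _] = set0); [exact: closed0|apply/seteqP; split => // x []].
have -> : [set t | exists2 j, j \in i :: s & F j t] = F i `|` [set t | exists2 j, j \in s & F j t].
  apply/seteqP; split => x /=.
    by move=> [j]; rewrite inE => /predU1P[->|js] Aj; [left|right; exists j].
  by move=> [Ai|[j js Aj]]; [exists i; rewrite ?mem_head|exists j => //; rewrite inE js orbT].
by apply: closedU; [apply: cF; rewrite mem_head|apply: IH => j js; apply: cF; rewrite inE js orbT].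
Qed.

Lemma closed_adherent (C : set R) (p : R) : closed C ->
  (forall e : R, 0 < e -> exists2 t, C t & `|t - p| < e) -> C p.
Proof.
move=> cC H; apply: cC => B /nbhs_ballP[e /= e0 eB].
have [t Ct tp] := H e e0; exists t; split=> //.
by apply: eB; rewrite /ball/= distrC.
Qed.

(** Induction on the cover. Let p and q be the first and last parameters in F i: the bound across
    [p, q] is immediate, whatever happens in between, and [a, p] and [q, b] are covered by the
    remaining sets. *)
Lemma lip_closed_cover (I : eqType) (s : seq I) (F : I -> set R) (phi : R -> R) (L a b : R) :
  0 <= L -> a <= b -> (forall i, i \in s -> closed (F i)) ->
  (forall i x y, i \in s -> a <= x <= b -> a <= y <= b -> F i x -> F i y ->
    `|phi x - phi y| <= L * `|x - y|) ->
  (forall t, a <= t <= b -> exists2 i, i \in s & F i t) ->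
  `|phi b - phi a| <= L * (b - a).
Proof.
move=> L0; elim: s a b => [|i s IH] a b ab cF lF cov.
  by have [|j] := cov a; rewrite ?lexx.
have cFs j : j \in s -> closed (F j) by move=> js; apply: cF; rewrite inE js orbT.
have lFs a' b' : a <= a' -> b' <= b -> forall j x y, j \in s -> a' <= x <= b' -> a' <= y <= b' ->
    F j x -> F j y -> `|phi x - phi y| <= L * `|x - y|.
  move=> aa bb j x y js /andP[x1 x2] /andP[y1 y2]; apply: lF; first by rewrite inE js orbT.
    by rewrite (le_trans aa)//= (le_trans x2).
  by rewrite (le_trans aa)//= (le_trans y2).
have [[t0 [t0ab Ft0]]|nF] := pselect (exists t, a <= t <= b /\ F i t); last first.
  apply: IH => //; first exact: lFs.
  move=> t tab; have [j] := cov t tab; rewrite inE => /predU1P[->|js] Fj; last by exists j.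
  by exfalso; apply: nF; exists t.
pose A := [set t | a <= t <= b /\ F i t].
have A0 : A !=set0 by exists t0.
have cFi : closed (F i) by apply: cF; rewrite mem_head.
have ubA : has_ubound A by exists b => t [/andP[]].
have lbA : has_lbound A by exists a => t [/andP[]].
have /andP[a_t0 t0_b] := t0ab.
have [ip0 pt0] : a <= inf A /\ inf A <= t0.
  by split; [apply: lb_le_inf => // t [/andP[]]|apply: ge_inf].
have [t0q qb] : t0 <= sup A /\ sup A <= b.
  by split; [apply: ub_le_sup|apply: ge_sup => // t [/andP[]]].
set p := inf A in ip0 pt0 *; set q := sup A in t0q qb *.
have Fp : F i p.
  apply: closed_adherent => // e e0.
  have [t [tab Ft] te] := inf_adherent e0 (conj A0 lbA).
  have pt : p <= t by apply: ge_inf.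
  by exists t => //; rewrite ger0_norm ?subr_ge0// ltrBlDl.
have Fq : F i q.
  apply: closed_adherent => // e e0.
  have [t [tab Ft] te] := sup_adherent e0 (conj A0 ubA).
  have tq : t <= q by apply: ub_le_sup.
  by exists t => //; rewrite distrC ger0_norm ?subr_ge0// ltrBlDl -ltrBlDr.
pose C := [set t | exists2 j, j \in s & F j t].
have cC : closed C by exact: closed_seq_union.
have offC t : a <= t <= b -> ~ F i t -> C t.
  move=> tab nt; have [j] := cov t tab; rewrite inE => /predU1P[->|js] Fj; last by exists j.
  by [].
have outl t : a <= t < p -> C t.
  move=> /andP[at_ tp]; have tb : t <= b by rewrite (le_trans (ltW tp))// (le_trans pt0).
  apply: offC; first by rewrite at_.
  move=> Ft; have : p <= t by apply: ge_inf => //; split=> //; rewrite at_.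
  by rewrite leNgt tp.
have outr t : q < t <= b -> C t.
  move=> /andP[qt tb]; have at_ : a <= t by rewrite (le_trans _ (ltW qt))// (le_trans a_t0).
  apply: offC; first by rewrite at_.
  move=> Ft; have : t <= q by apply: ub_le_sup => //; split=> //; rewrite at_.
  by rewrite leNgt qt.
(* The other sets cover [a, p), and being closed their union contains p too, so the induction
   hypothesis applies on [a, p]. *)
have left_ : `|phi p - phi a| <= L * (p - a).
  have [->|pa] := eqVneq p a; first by rewrite !subrr normr0 mulr0.
  have ap : a < p by rewrite lt_neqAle eq_sym pa.
  apply: IH => //; first by apply: lFs => //; rewrite (le_trans pt0).
  move=> t /andP[at_]; rewrite le_eqVlt => /predU1P[->|tp]; last by apply: outl; rewrite at_.
  suff : C p by [].
  apply: (closed_adherent cC) => e e0; exists (Num.max a (p - e / 2)).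
    by apply: outl; rewrite le_max lexx gt_max ap gtrBl divr_gt0.
  rewrite distrC ger0_norm ?subr_ge0 ?ge_max ?(ltW ap)//=; last by rewrite gerBl divr_ge0// ltW.
  rewrite ltrBlDl -ltrBlDr lt_max; apply/orP; right; lra.
have right_ : `|phi b - phi q| <= L * (b - q).
  have [->|bq] := eqVneq q b; first by rewrite !subrr normr0 mulr0.
  have qb' : q < b by rewrite lt_neqAle bq.
  apply: IH => //; first by apply: lFs => //; rewrite (le_trans a_t0).
  move=> t /andP[]; rewrite le_eqVlt => /predU1P[<-|qt] tb; last by apply: outr; rewrite qt.
  suff : C q by [].
  apply: (closed_adherent cC) => e e0; exists (Num.min b (q + e / 2)).
    by apply: outr; rewrite ge_min lexx lt_min qb' ltrDl divr_gt0.
  rewrite ger0_norm ?subr_ge0 ?le_min ?(ltW qb')//=; last by rewrite lerDl divr_ge0// ltW.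
  rewrite ltrBlDl gt_min; apply/orP; right; lra.
have pq : p <= q by rewrite (le_trans pt0).
have mid : `|phi q - phi p| <= L * (q - p).
  rewrite -[X in L * X]ger0_norm ?subr_ge0//; apply: (lF i) => //.
  - exact: mem_head.
  - by rewrite (le_trans a_t0).
  - by rewrite ip0 (le_trans pt0).
rewrite (_ : phi b - phi a = (phi b - phi q) + (phi q - phi p) + (phi p - phi a)); last by ring.
rewrite (_ : L * (b - a) = L * (b - q) + L * (q - p) + L * (p - a)); last by ring.
by rewrite (le_trans (ler_normD _ _))// lerD// (le_trans (ler_normD _ _))// lerD.
Qed.

End closed_covers.

Section triangulated_domain.
Context {R : realType} {n : nat}.
Local Notation E := 'rV[R]_n.
Variables (Omega : set E) (T : seq (n.+1.-tuple E)).
Hypotheses (n0 : (0 < n)%N) (domO : convex_polyhedral_domain Omega) (triT : triangulation Omega T).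

Definition mesh_interior : set E := \bigcup_(K in [set` T]) (hull K)°.

Lemma domain_open : open Omega.
Proof. by case: domO => _ [s ->]; exact: open_interior. Qed.

Lemma domain_convex : convexset Omega.
Proof. by case: domO => _ [s ->]; apply: convex_interior; exact: hull_convex. Qed.

Lemma interior_domain x : Omega x -> Omega° x.
Proof. by move=> Ox; rewrite (interior_id Omega).1//; exact: domain_open. Qed.

Lemma domain_bounded : exists2 r : R, 0 < r & forall x, closure Omega x -> `|x| < r.
Proof.
case: domO => _ [s Os]; have [r r0 sr] := hull_bounded s.
exists (r + 1); first by rewrite addr_gt0.
move=> x /closure_normP/(_ _ ltr01)[y Oy yx].
rewrite -(subrK y x) (le_lt_trans (ler_normD _ _))// addrC ltrD// 1?distrC//.
by apply: sr; rewrite Os in Oy; exact: interior_subset Oy.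
Qed.

Lemma simplex_indep K : K \in T -> affinely_independent K.
Proof. by case: triT => _ + _ _ _; apply. Qed.

Lemma simplex_sub K : K \in T -> hull K `<=` closure Omega.
Proof. by case: triT => _ _ -> _ _ KT x Kx; exists K. Qed.

Lemma closure_cover x : closure Omega x -> exists2 K, K \in T & hull K x.
Proof. by case: triT => _ _ -> _ _ [K KT Kx]; exists K. Qed.

Lemma domain_interior_neq0 : Omega° !=set0.
Proof. by case: domO => [[x Ox] _]; exists x; exact: interior_domain. Qed.

(** An open convex set is the interior of its closure, and the simplex lies in that closure. *)
Lemma simplex_interior_sub K : K \in T -> (hull K)° `<=` Omega.
Proof.
move=> KT x Kx; apply: interior_subset.
apply: (interior_closure_convex domain_convex domain_interior_neq0).
exact: interiorS (simplex_sub KT) _ Kx.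
Qed.

Lemma mesh_interior_sub : mesh_interior `<=` Omega.
Proof. by move=> x [K /= KT Kx]; exact: simplex_interior_sub KT _ Kx. Qed.

Lemma mesh_interior_open : open mesh_interior.
Proof. by apply: bigcup_open => K _; exact: open_interior. Qed.

Lemma mesh_boundary_null : exists2 N, nullset N & forall x, Omega x -> mesh_interior x \/ N x.
Proof.
have /choice[N HN] (K : n.+1.-tuple E) : exists N, nullset N /\ (K \in T ->
    forall x, hull K x -> (hull K)° x \/ N x).
  have [KT|] := boolP (K \in T); last by exists set0; split=> //; exact: nullset0.
  by have [N N0 H] := hull_boundary_null (simplex_indep KT) n0; exists N.
exists [set x | exists2 K, K \in T & N K x].
  by apply: nullset_seq => K _; case: (HN K).
move=> x Ox; have [K KT Kx] := closure_cover (subset_closure Ox).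
have [_ /(_ KT _ Kx)[Ki|NK]] := HN K; [left|right]; first by exists K.
by exists K.
Qed.

Lemma continuous_segment x (v : E) : continuous (fun t : R => x + t *: v).
Proof.
move=> t; apply: cvgD; first exact: cvg_cst.
by apply: cvgZr_tmp; exact: cvg_id.
Qed.

(** The gradient is controlled in the open simplex only, so both end points are moved by the same
    ratio towards an interior point c. This does not increase their distance, and continuity absorbs
    the displacement. *)
Lemma lip_on_simplex K g (L : R) : K \in T -> (forall x, Omega x -> {for x, continuous g}) ->
  (forall x, (hull K)° x -> differentiable g x /\ forall i, `|partial i g x| <= L) ->
  forall x y, hull K x -> Omega x -> hull K y -> Omega y -> `|g x - g y| <= n%:R * L * `|x - y|.
Proof.
move=> KT cg dg x y Kx Ox Ky Oy.
have [c Kc] := hull_interior_neq0 (simplex_indep KT) n0.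
have lK : lip_on (hull K)° (n%:R * L) g.
  apply: lip_on_of_partial.
  - by apply: convex_interior; exact: hull_convex.
  - by move=> z /dg[].
  - by move=> z i /dg[].
have L0 : 0 <= n%:R * L.
  by rewrite mulr_ge0//; have [_ /(_ (Ordinal n0))] := dg _ Kc; apply: le_trans.
apply/ler_addgt0Pr => e e0.
have e2 : 0 < e / 2 by rewrite divr_gt0.
have [r1 r10 H1] := (continuous_epsP _ _).1 (cg _ Ox) _ e2.
have [r2 r20 H2] := (continuous_epsP _ _).1 (cg _ Oy) _ e2.
pose D := 1 + `|c - x| + `|c - y|.
have D0 : 0 < D.
  by rewrite /D; have := normr_ge0 (c - x); have := normr_ge0 (c - y); lra.
pose r := Num.min r1 r2.
have r0 : 0 < r by rewrite lt_min r10.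
pose t := Num.min 1 (r / 2 / D).
have t0 : 0 < t by rewrite lt_min ltr01 !divr_gt0.
have t1 : t <= 1 by rewrite ge_min lexx.
have tD : t * D < r.
  rewrite (@le_lt_trans _ _ (r / 2 / D * D))//; first by rewrite ler_pM2r// ge_min lexx orbT.
  by rewrite divfK ?gt_eqF//; lra.
have near z : hull K z -> `|c - z| <= D ->
    (hull K)° (z + t *: (c - z)) /\ `|z + t *: (c - z) - z| < r.
  move=> Kz cz; split.
    apply: convex_segment_interior => //; [exact: hull_convex|exact: subset_closure|].
    by rewrite t0.
  rewrite addrAC subrr add0r normrZ gtr0_norm// (le_lt_trans _ tD)//.
  by rewrite ler_wpM2l// ltW.
have [|Kx' xr] := near x Kx; first by rewrite /D addrAC lerDr addr_ge0.
have [|Ky' yr] := near y Ky; first by rewrite /D lerDr addr_ge0.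
have := lK _ _ Kx' Ky'.
have rr1 : r <= r1 by rewrite ge_min lexx.
have rr2 : r <= r2 by rewrite ge_min lexx orbT.
have := H1 _ (lt_le_trans xr rr1); have := H2 _ (lt_le_trans yr rr2).
have : `|x + t *: (c - x) - (y + t *: (c - y))| <= `|x - y|.
  rewrite (_ : _ - _ = (1 - t) *: (x - y)); last by apply/rowP => j; rewrite !mxE; ring.
  by rewrite normrZ ger0_norm ?subr_ge0// ler_piMl// gerBl ltW.
move: (g (x + _)) (g (y + _)) => a b hn hb ha hab.
have {}hab : `|a - b| <= n%:R * L * `|x - y| by rewrite (le_trans hab)// ler_wpM2l.
rewrite (_ : g x - g y = (a - b) - (a - g x) + (b - g y)); last by ring.
rewrite (le_trans (ler_normD _ _))// [e]splitr addrA lerD//; last exact: ltW.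
by rewrite (le_trans (ler_normB _ _))// lerD// ltW.
Qed.

(** A segment in the convex domain is covered by the closed simplices, to which [lip_closed_cover]
    applies. For g a first derivative of a spline, this turns elementwise bounds of second
    derivatives into a global Lipschitz bound of the gradient. *)
Lemma lip_on_mesh g (L : R) : (forall x, Omega x -> {for x, continuous g}) ->
  (forall K x, K \in T -> (hull K)° x -> differentiable g x /\ forall i, `|partial i g x| <= L) ->
  lip_on Omega (n%:R * L) g.
Proof.
move=> cg dg x y Ox Oy.
have [K0 K0T _] := closure_cover (subset_closure Ox).
have [c Kc] := hull_interior_neq0 (simplex_indep K0T) n0.
have L0 : 0 <= n%:R * L.
  by rewrite mulr_ge0//; have [_ /(_ (Ordinal n0))] := dg _ _ K0T Kc; apply: le_trans.
have Og t : 0 <= t <= 1 -> Omega (y + t *: (x - y)) by exact: domain_convex.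
have := @lip_closed_cover R _ T (fun K => [set t : R | hull K (y + t *: (x - y))])
  (fun t => g (y + t *: (x - y))) (n%:R * L * `|x - y|) 0 1.
rewrite scale1r scale0r addr0 subr0 mulr1 [y + (x - y)]addrC subrK; apply => //.
- by rewrite mulr_ge0.
- move=> K KT; apply: (@preimage_closed _ _ (fun t : R => y + t *: (x - y)) (hull K)).
    by move=> t _; exact: continuous_segment.
  exact: hull_closed (simplex_indep KT).
- move=> K s t KT s01 t01 Ks Kt.
  apply: (le_trans (lip_on_simplex KT cg (fun z Kz => dg K z KT Kz) Ks (Og _ s01) Kt (Og _ t01))).
  rewrite (_ : _ - _ = (s - t) *: (x - y)); last by apply/rowP => j; rewrite !mxE; ring.
  by rewrite normrZ -!mulrA ler_wpM2l// mulrCA mulrC mulrA mulrC.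
- by move=> t /Og/subset_closure/closure_cover[K KT Kt]; exists K.
Qed.

Lemma seq_bound (I : eqType) (s : seq I) (P : I -> R -> Prop) :
  (forall i, i \in s -> exists2 B : R, 0 <= B & P i B) ->
  (forall i (B B' : R), B <= B' -> P i B -> P i B') ->
  exists2 B : R, 0 <= B & forall i, i \in s -> P i B.
Proof.
elim: s => [|i s IH] H mono; first by exists 0.
have [B B0 HB] := IH (fun j js => H j ltac:(by rewrite inE js orbT)) mono.
have [B' B'0 HB'] := H i (mem_head _ _).
exists (B + B'); first exact: addr_ge0.
move=> j; rewrite inE => /predU1P[->|js]; first by apply: mono HB'; rewrite lerDr.
by apply: mono (HB _ js); rewrite lerDl.
Qed.

Lemma poly_on_cinf d A v : poly_on d A v -> exists2 p : E -> R, cinf p & forall x, A x -> v x = p x.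
Proof.
move=> [c Hc]; exists (fun x => \sum_(a <- [seq a <- index_enum _ | (mdeg a <= d)%N])
   c a * tensor (fun i t => t ^+ a i) x).
  by apply: cinf_sum => a; apply: cinfZ; apply: cinf_tensor => i; exact: smooth1_exprn.
by move=> x Ax; rewrite Hc// big_filter.
Qed.

Lemma interior_near (A : set E) x : A° x -> \forall y \near x, A° y.
Proof. by move=> Ax; exact: (open_nbhs_nbhs (conj (@open_interior _ A) Ax)). Qed.

(** On a simplex the spline agrees with a polynomial, smooth on the whole space; agreement in a
    neighbourhood of interior points transfers the derivatives. *)
Lemma spline_simplex d v K : spline_space Omega T d v -> K \in T -> exists2 p : E -> R, cinf p &
  (forall x, hull K x -> v x = p x) /\ forall x, (hull K)° x ->
  [/\ \forall y \near x, v y = p y, forall i, partial i v x = partial i p x,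
      forall i, \forall y \near x, partial i v y = partial i p y &
      forall i k, partial i (partial k v) x = partial i (partial k p) x].
Proof.
move=> [_ pK] KT; have [p cp vp] := poly_on_cinf (pK K KT).
exists p; first exact: cp.
split; first exact: vp.
move=> x Kx.
have nvp y : (hull K)° y -> \forall z \near y, v z = p z.
  move=> /interior_near Ky; apply: filterS Ky => z Kz; apply: vp; exact: interior_subset Kz.
have pvp i y : (hull K)° y -> partial i v y = partial i p y.
  by move=> Ky; apply: eq_near_partial; exact: nvp.
have npvp i y : (hull K)° y -> \forall z \near y, partial i v z = partial i p z.
  by move=> /interior_near Ky; apply: filterS Ky => z; exact: pvp.
split.
- exact: nvp.
- by move=> i; exact: pvp.
- by move=> i; exact: npvp.
- by move=> i k; apply: eq_near_partial; exact: npvp.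
Qed.

Lemma spline_C2 d v K : spline_space Omega T d v -> K \in T -> C2 (hull K)° v.
Proof.
move=> sv KT; have [p cp [_ H]] := spline_simplex sv KT; split.
  move=> x Kx; have [h1 h2 h3 h4] := H x Kx; split.
    by apply: near_eq_differentiable h1 _; exact: cinf_differentiable.
  move=> i; apply: near_eq_continuous (h3 i) _.
  exact: cinf_continuous (cinf_partial i cp) x.
move=> k x Kx; have [h1 h2 h3 h4] := H x Kx; split.
  by apply: near_eq_differentiable (h3 k) _; apply: cinf_differentiable; exact: cinf_partial.
move=> i; apply: (@near_eq_continuous _ _ _ (partial i (partial k p))); last first.
  exact: cinf_continuous (cinf_partial i (cinf_partial k cp)) x.
have := interior_near Kx; apply: filterS => y Ky.
by have [_ _ _ ->] := H y Ky.
Qed.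

Lemma spline_bounds d v : spline_space Omega T d v -> exists2 B : R, 0 <= B &
  forall K, K \in T -> forall x, (hull K)° x -> [/\ `|v x| <= B, forall i, `|partial i v x| <= B &
    forall i k, `|partial i (partial k v) x| <= B].
Proof.
move=> sv; apply: seq_bound; last first.
  move=> K B B' BB' H x /H[h1 h2 h3].
  by split=> [|i|i k]; apply: le_trans BB'.
move=> K KT; have [p cp [_ H]] := spline_simplex sv KT.
have cK : compact (hull K).
  have [r r0 Kr] := hull_bounded K.
  apply: (closed_bounded_compact (r := r)); first exact: hull_closed (simplex_indep KT).
  by move=> x /Kr/ltW.
have [B0 B00 HB0] := continuous_compact_bound cK (cinf_continuous cp).
have /choice[B1 HB1] (i : 'I_n) : exists B : R, 0 <= B /\ forall x, hull K x -> `|partial i p x| <= B.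
  by have [B Bp HB] := continuous_compact_bound cK (cinf_continuous (cinf_partial i cp)); exists B.
have /choice[B2 HB2] (ik : 'I_n * 'I_n) : exists B : R, 0 <= B /\
    forall x, hull K x -> `|partial ik.1 (partial ik.2 p) x| <= B.
  have [B Bp HB] := continuous_compact_bound cK
    (cinf_continuous (cinf_partial ik.1 (cinf_partial ik.2 cp))).
  by exists B.
have s1 : 0 <= \sum_i B1 i by apply: sumr_ge0 => i _; case: (HB1 i).
have s2 : 0 <= \sum_ik B2 ik by apply: sumr_ge0 => i _; case: (HB2 i).
exists (B0 + \sum_i B1 i + \sum_ik B2 ik); first by rewrite !addr_ge0.
move=> x Kx; have Kx' := interior_subset Kx; have [h1 h2 h3 h4] := H x Kx; split.
- rewrite (nbhs_singleton h1) (le_trans (HB0 _ Kx'))// -addrA lerDl addr_ge0//.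
- move=> i; rewrite h2 (le_trans ((HB1 i).2 _ Kx'))// -addrA addrCA (bigD1 i)//= -addrA lerDl.
  by rewrite !addr_ge0//; apply: sumr_ge0 => j _; case: (HB1 j).
- move=> i k; rewrite h4 (le_trans ((HB2 (i, k)).2 _ Kx'))// addrC (bigD1 (i, k))//= -addrA lerDl.
  by rewrite !addr_ge0//; apply: sumr_ge0 => j _; case: (HB2 j).
Qed.

(** A common class for u and the splines: C1 with Lipschitz gradient on the domain, and C2 inside
    the elements. *)
Definition admissible v := [/\ C1 Omega v, C2 mesh_interior v &
  exists2 M : R, 0 <= M & lip_on Omega M v /\ forall k, lip_on Omega M (partial k v)].

Lemma C2_mesh v : (forall K, K \in T -> C2 (hull K)° v) -> C2 mesh_interior v.
Proof.
move=> H; split=> [x [K /= KT Kx]|i x [K /= KT Kx]]; first exact: (H K KT).1 Kx.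
exact: (H K KT).2 Kx.
Qed.

Lemma spline_admissible d v : spline_space Omega T d v -> admissible v.
Proof.
move=> sv; have [C1v _] := sv; split=> //.
  by apply: C2_mesh => K KT; exact: spline_C2 sv KT.
have [B B0 HB] := spline_bounds sv.
exists (n%:R * B); first by rewrite mulr_ge0.
split.
  apply: lip_on_mesh; first by move=> x Ox; exact: C1_continuous C1v Ox.
  move=> K x KT Kx; have [h1 h2 h3] := HB K KT x Kx; split=> //.
  by case: ((spline_C2 sv KT).1 _ Kx).
move=> k; apply: lip_on_mesh; first by move=> x /C1v[].
move=> K x KT Kx; have [h1 h2 h3] := HB K KT x Kx; split=> //.
by case: ((spline_C2 sv KT).2 k _ Kx).
Qed.

Lemma C2_admissible (B : R) v : C2 Omega v -> 0 <= B -> (forall x, Omega x ->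
  (forall i, `|partial i v x| <= B) /\ forall i k, `|partial i (partial k v) x| <= B) ->
  admissible v.
Proof.
move=> C2v B0 HB; split; first exact: C2v.1.
  by split=> [x /mesh_interior_sub /C2v.1|i x /mesh_interior_sub /(C2v.2 i)].
exists (n%:R * B); first by rewrite mulr_ge0.
split.
  apply: lip_on_of_partial; first exact: domain_convex.
    by move=> x /C2v.1[].
  by move=> x i /HB[].
move=> k; apply: lip_on_of_partial; first exact: domain_convex.
  by move=> x /(C2v.2 k)[].
by move=> x i /HB[].
Qed.

Lemma partial_congr (U : set E) v w i : open U -> (forall x, U x -> v x = w x) ->
  forall x, U x -> partial i v x = partial i w x.
Proof.
move=> oU vw x Ux; apply: eq_near_partial.
have [r r0 rU] := (open_normP U).1 oU _ Ux.
by apply/near_normP; exists r => // y /rU /vw.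
Qed.

Lemma lip_on_eq U (L : R) v w : (forall x : E, U x -> v x = w x) -> lip_on U L w -> lip_on U L v.
Proof. by move=> vw lw x y Ux Uy; rewrite !vw//; exact: lw. Qed.

Lemma lip_onW U (L L' : R) (v : E -> R) : L <= L' -> lip_on U L v -> lip_on U L' v.
Proof. by move=> LL' lv x y Ux Uy; rewrite (le_trans (lv _ _ Ux Uy))// ler_wpM2r. Qed.

Lemma admissibleD v w : admissible v -> admissible w -> admissible (fun x => v x + w x).
Proof.
have oO := domain_open; have oG := mesh_interior_open.
move=> [Cv C2v [M M0 [lv lpv]]] [Cw C2w [L L0 [lw lpw]]]; split; first exact: C1D.
  split; first exact: C1D oG C2v.1 C2w.1.
  move=> i; apply: (C1_eq oG _ (C1D oG (C2v.2 i) (C2w.2 i))).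
  by move=> x Gx; apply: partialD; [case: (C2v.1 _ Gx)|case: (C2w.1 _ Gx)].
exists (M + L); first exact: addr_ge0.
split; first exact: lip_onD.
move=> k; apply: lip_on_eq (lip_onD (lpv k) (lpw k)) => x Ox.
by apply: partialD; [case: (Cv _ Ox)|case: (Cw _ Ox)].
Qed.

Lemma admissibleZ (c : R) v : admissible v -> admissible (fun x => c * v x).
Proof.
have oO := domain_open; have oG := mesh_interior_open.
move=> [Cv C2v [M M0 [lv lpv]]]; split; first exact: C1Z.
  split; first exact: C1Z oG C2v.1.
  move=> i; apply: (C1_eq oG _ (C1Z c oG (C2v.2 i))).
  by move=> x Gx; apply: partialZ; case: (C2v.1 _ Gx).
exists (`|c| * M); first exact: mulr_ge0.
split; first exact: lip_onZ.
move=> k; apply: lip_on_eq (lip_onZ c (lpv k)) => x Ox.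
by apply: partialZ; case: (Cv _ Ox).
Qed.

Lemma admissible_nice v : admissible v -> nice Omega v.
Proof. by move=> [Cv _ [M M0 [lv _]]]; split=> //; exists M. Qed.

End triangulated_domain.

(** * Traces *)

Section boundary_values.
Context {R : realType} {n : nat}.
Local Notation E := 'rV[R]_n.
Local Notation mu := (lebesgue_rV n : {measure set 'rV[R]_n -> \bar R}).
Variables (Omega : set E) (T : seq (n.+1.-tuple E)).
Hypotheses (n1 : (1 < n)%N) (domO : convex_polyhedral_domain Omega) (triT : triangulation Omega T).
Variable r : R.
Hypotheses (r0 : 0 < r) (clr : forall x, closure Omega x -> `|x| < r).

Let n0 : (0 < n)%N := ltnW n1.
Let oO : open Omega := domain_open domO.
Let Or x : Omega x -> `|x| < r. Proof. by move/subset_closure/clr. Qed.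
Let mO : measurable Omega := open_rV_measurable oO.
Let fO : (mu Omega < +oo)%E := bounded_lt_pinfty mO Or.

Lemma closure_bdry x : closure Omega x -> ~ Omega x -> bdry Omega x.
Proof. by move=> cx nx; split=> // /interior_subset. Qed.

(** A point of the closure lies in a closed simplex, on which v is a polynomial, so its value is a
    limit of values inside the domain. *)
Lemma spline_lip_closure d v (M : R) : 0 <= M -> spline_space Omega T d v -> lip_on Omega M v ->
  lip_on (closure Omega) M v.
Proof.
move=> M0 sv lv.
have near x (e : R) : closure Omega x -> 0 < e ->
    exists2 x', Omega x' & `|x' - x| < e /\ `|v x' - v x| < e.
  move=> cx e0; have [K KT Kx] := closure_cover triT cx.
  have [p cp [vp _]] := spline_simplex sv KT.
  have [s s0 Hs] := (continuous_epsP _ _).1 (@cinf_continuous _ _ _ cp x) _ e0.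
  have m0 : 0 < Num.min s e by rewrite lt_min s0.
  have [x' Kx' x'x] := hull_interior_dense (simplex_indep triT KT) n0 Kx m0.
  exists x'; first exact: (simplex_interior_sub domO triT KT Kx').
  move: x'x; rewrite lt_min => /andP[h1 h2]; split=> //.
  by rewrite !vp//; [exact: Hs|exact: interior_subset Kx'].
move=> x y cx cy; apply/ler_addgt0Pr => e e0.
pose e' := e / (2 * M + 2).
have D0 : 0 < 2 * M + 2 by rewrite ltr_wpDl// mulr_ge0.
have e'0 : 0 < e' by rewrite divr_gt0.
have [x' Ox' [x1 x2]] := near x e' cx e'0; have [y' Oy' [y1 y2]] := near y e' cy e'0.
have h := lv _ _ Ox' Oy'.
have d1 : `|x' - y'| <= `|x - y| + 2 * e'.
  rewrite (_ : x' - y' = (x - y) + ((x' - x) - (y' - y))); last first.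
    by apply/rowP => j; rewrite !mxE; ring.
  rewrite (le_trans (ler_normD _ _))// lerD2l (le_trans (ler_normB _ _))//.
  by rewrite mulr2n mulrDl mul1r lerD// ltW.
have d2 : `|v x - v y| <= `|v x' - v y'| + 2 * e'.
  rewrite (_ : v x - v y = (v x' - v y') - ((v x' - v x) - (v y' - v y))); last by ring.
  rewrite (le_trans (ler_normB _ _))// lerD2l (le_trans (ler_normB _ _))//.
  by rewrite mulr2n mulrDl mul1r lerD// ltW.
have : M * `|x' - y'| <= M * (`|x - y| + 2 * e') by rewrite ler_wpM2l.
have -> : e = M * (2 * e') + 2 * e' by rewrite /e'; field; rewrite gt_eqF.
by move: d2 h; rewrite mulrDr; lra.
Qed.

Section vanishing.
Variables (v : E -> R) (M : R).
Hypotheses (M0 : 0 <= M) (C1v : C1 Omega v) (lv : lip_on (closure Omega) M v)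
  (v0 : forall x, bdry Omega x -> v x = 0).

Definition ext0 x := if `[< Omega x >] then v x else 0.

(** A segment that leaves the domain passes through a boundary point, where v is 0; extension by
    zero therefore keeps the constant M. *)
Lemma ext0_lip : lip M ext0.
Proof.
have key x y : Omega x -> ~ Omega y -> `|v x| <= M * `|x - y|.
  move=> Ox Oy; have [t /andP[t0 t1] [cp np]] := segment_exits oO Ox Oy.
  have := lv (subset_closure Ox) cp; rewrite (v0 (closure_bdry cp np)) subr0 => /le_trans; apply.
  rewrite ler_wpM2l// (_ : x - _ = - (t *: (y - x))); last first.
    by rewrite opprD addrA subrr add0r.
  by rewrite normrN normrZ gtr0_norm// distrC ler_piMl.
move=> x y _ _; rewrite /ext0; case: asboolP => Ox; case: asboolP => Oy.
- by apply: lv; exact: subset_closure.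
- by rewrite subr0; exact: key.
- by rewrite sub0r normrN distrC; exact: key.
- by rewrite subrr normr0 mulr_ge0.
Qed.

(** The zero extension is contracted towards x0 by the factor 1 + 1 / (m + 1), which by convexity
    moves its support into the open domain, and is then mollified at a scale e m that the margin
    allows. Values and gradients stay bounded and converge pointwise, which is enough for dominated
    convergence. *)
Lemma approx_vanishing : exists (phi : nat -> E -> R) (B : R), [/\ 0 <= B,
  forall m, test_function Omega (phi m),
  forall m x, Omega x -> `|phi m x| <= B /\ forall i, `|partial i (phi m) x| <= B,
  forall x, Omega x -> phi m x @[m --> \oo] --> v x &
  forall x i, Omega x -> partial i (phi m) x @[m --> \oo] --> partial i v x].
Proof.
have [x0 Ox0] : Omega !=set0 by case: domO.
pose lam (m : nat) : R := 1 + m.+1%:R^-1.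
pose z m (y : E) := x0 + lam m *: (y - x0).
pose F m y := ext0 (z m y).
have i0 m : 0 < (m.+1%:R^-1 : R) by rewrite invr_gt0.
have i1 m : (m.+1%:R^-1 : R) <= 1 by rewrite invf_le1// ler1n.
have lam0 m : 0 < lam m by rewrite /lam addr_gt0.
have lam2 m : lam m <= 2 by rewrite [leRHS]mulr2n /lam lerD2l; exact: i1.
have zB m y y' : z m y - z m y' = lam m *: (y - y').
  by apply/rowP => j; rewrite !mxE; ring.
have zx m y : z m y - y = m.+1%:R^-1 *: (y - x0).
  by apply/rowP => j; rewrite !mxE /lam; ring.
have /choice[e He] m : exists e : R, [/\ 0 < e, e <= m.+1%:R^-1 &
    forall y, F m y != 0 -> inner Omega (4 * e) y].
  (* The contracted closure is a compact subset of the open domain; a quarter of its margin bounds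
     the grid width. *)
  pose A := [set y : E | closure Omega (z m y)].
  have AO : A `<=` Omega.
    move=> y /= cy.
    have -> : y = z m y + (1 - (lam m)^-1) *: (x0 - z m y).
      by apply/rowP => j; rewrite !mxE; field; rewrite gt_eqF.
    apply: interior_subset; apply: convex_segment_interior => //.
    - exact: domain_convex.
    - exact: interior_domain.
    - by rewrite subr_gt0 invf_lt1// /lam ltrDl i0/= gerBl invr_ge0 ltW.
  have cA : closed A.
    rewrite -openC; apply/open_normP => y /= ny.
    have [s s0 Hs] := (open_normP (~` closure Omega)).1
      (ltac:(by rewrite openC; exact: closed_closure)) _ ny.
    exists (s / lam m); first by rewrite divr_gt0.
    move=> y' y'y; apply: Hs; rewrite zB normrZ gtr0_norm//.
    by rewrite mulrC -ltr_pdivlMr.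
  have kA : compact A by apply: (closed_bounded_compact (r := r)) => // x /AO/Or/ltW.
  have [d d0 Hd] := compact_margin kA oO AO Or.
  exists (Num.min (d / 4) m.+1%:R^-1); split.
  - by rewrite lt_min i0 divr_gt0.
  - by rewrite ge_min lexx orbT.
  - move=> y Fy w wy.
    have Ay : A y.
      rewrite /A /=; apply: subset_closure; move: Fy; rewrite /F /ext0.
      by case: asboolP => //; rewrite eqxx.
    rewrite -(subrK y w) addrC; apply: Hd => //; apply: (lt_le_trans wy).
    by rewrite mulrC -ler_pdivlMr// ge_min lexx.
have e01 m : 0 < e m <= 1 by case: (He m) => h1 h2 _; rewrite h1 (le_trans h2).
have /choice[phi Hphi] m := mollify Or (e01 m) (let: And3 _ _ h := He m in h).
have [C C0 HC] := lip_on_bounded M0 clr lv.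
have extC x : `|ext0 x| <= C.
  rewrite /ext0; case: asboolP => [Ox|_]; last by rewrite normr0.
  exact: HC (subset_closure Ox).
have n18 : 0 < 18 * n%:R :> R by rewrite mulr_gt0// ltr0n.
exists phi, (C + 12 * M); split.
- by rewrite addr_ge0// mulr_ge0.
- by move=> m; case: (Hphi m).
- move=> m x Ox; case: (Hphi m) => _ h1 h2; split.
    rewrite (@le_trans _ _ C) ?lerDl ?mulr_ge0// -[phi m x]subr0.
    by apply: h1 => // y _; rewrite subr0; exact: extC.
  move=> i; rewrite (@le_trans _ _ (12 * M)) ?lerDr//.
  (* The contracted function is 2 M-Lipschitz, so within 3 e it deviates from a constant by at most
     6 M e. *)
  have := h2 x i (F m x) 0 (6 * M) Ox; rewrite mxE subr0 mulrA -natrM; apply.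
    by rewrite mulr_ge0.
  move=> y yx; rewrite big1 ?subr0; last by move=> j _; rewrite mxE mul0r.
  rewrite /F (le_trans (ext0_lip _ _))// zB normrZ gtr0_norm//.
  rewrite (_ : 6 * M * e m = M * (2 * (3 * e m))); last by ring.
  by rewrite ler_wpM2l// ler_pM//; exact: ltW.
- move=> x Ox; apply: cvgn_epsP => a a0.
  pose D := M * (6 + `|x - x0|) + 1.
  have D0 : 0 < D by rewrite ltr_wpDl// mulr_ge0// addr_ge0.
  have [k0 Hk] := natinv_small (divr_gt0 a0 D0).
  exists k0 => m /Hk hm; case: (Hphi m) => _ h1 _; apply: h1 => // y yx.
  have -> : v x = ext0 x by rewrite /ext0 asboolT.
  rewrite /F (le_trans (ext0_lip _ _))//.
  have zyx : `|z m y - x| <= m.+1%:R^-1 * (6 + `|x - x0|).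
    rewrite (_ : z m y - x = lam m *: (y - x) + m.+1%:R^-1 *: (x - x0)); last first.
      by apply/rowP => j; rewrite !mxE /lam; ring.
    rewrite (le_trans (ler_normD _ _))// !normrZ !gtr0_norm// mulrDr lerD2r.
    have [e0 em _] := He m.
    rewrite (@le_trans _ _ (2 * (3 * e m)))//; first by rewrite ler_pM// ltW.
    by rewrite mulrA -natrM mulrC ler_wpM2r.
  rewrite (@le_trans _ _ (M * (m.+1%:R^-1 * (6 + `|x - x0|))))//; first by rewrite ler_wpM2l.
  rewrite mulrCA (@le_trans _ _ (m.+1%:R^-1 * D))//; first by rewrite ler_wpM2l ?lerDl// ltW.
  by rewrite -ler_pdivlMr// ltW.
- move=> x i Ox; apply: cvgn_epsP => a a0.
  (* Each of the n coordinates contributes at most 3 e * 3 b to the deviation from the affine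
     function, so w = 9 n b in [mollify] and the resulting bound 2 w is a. *)
  pose b := a / (18 * n%:R).
  have b0 : 0 < b by rewrite divr_gt0.
  have /choice[rr Hrr] (j : 'I_n) : exists s : R, 0 < s /\
      forall y : E, `|y - x| < s -> `|partial j v y - partial j v x| < b.
    by have [s s0 Hs] := (continuous_epsP _ _).1 ((C1v Ox).2 j) _ b0; exists s.
  have [d0 d00 dO] := (open_normP Omega).1 oO _ Ox.
  pose s := \big[Num.min/d0]_j rr j.
  have s0 : 0 < s by apply: lt_bigmin => // j _; case: (Hrr j).
  have sO y : `|y - x| < s -> Omega y.
    by move=> yx; apply: dO; rewrite (lt_le_trans yx)// bigmin_le_id.
  have sb y j : `|y - x| < s -> `|partial j v y - partial j v x| < b.
    by move=> yx; apply: (Hrr j).2; rewrite (lt_le_trans yx)//; exact: bigmin_le_cond.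
  pose M' := \sum_j `|partial j v x|.
  have M'0 : 0 <= M' by apply: sumr_ge0.
  have q0 : 0 < Num.min (b / (M' + 1)) (s / (7 + `|x - x0|)).
    have h1 : 0 < M' + 1 by rewrite ltr_wpDl.
    have h2 : 0 < 7 + `|x - x0| by rewrite ltr_wpDr.
    by rewrite lt_min !divr_gt0.
  have [k0 Hk] := natinv_small q0; exists k0 => m /Hk; rewrite lt_min => /andP[m1 m2].
  case: (Hphi m) => _ _ h2.
  have [e0 em _] := He m.
  have inv0 := i0 m.
  have zyx y : `|y - x| < 3 * e m -> `|z m y - x| < s.
    move=> yx; rewrite (_ : z m y - x = lam m *: (y - x) + m.+1%:R^-1 *: (x - x0)); last first.
      by apply/rowP => j; rewrite !mxE /lam; ring.
    rewrite (le_lt_trans (ler_normD _ _))// !normrZ !gtr0_norm//.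
    have : lam m * `|y - x| <= 2 * (3 * e m) by rewrite ler_pM// ltW.
    have : m.+1%:R^-1 * (7 + `|x - x0|) < s by rewrite -ltr_pdivlMr// ltr_wpDr.
    have alg (A B I' ee : R) : 0 < I' -> ee <= I' -> I' * (7 + B) < s ->
      A <= 2 * (3 * ee) -> A + I' * B < s by rewrite mulrDr; lra.
    exact: alg inv0 em.
  have -> : a = 2 * (9 * n%:R * b) by rewrite /b; field; rewrite gt_eqF// ltr0n.
  have -> : partial i v x = (gradient v x) ord0 i by rewrite /gradient mxE.
  apply: (h2 x i (F m x)) => //; first by rewrite !mulr_ge0// ltW.
  move=> y yx.
  have xs : `|z m x - x| < s by apply: zyx; rewrite subrr normr0 mulr_gt0.
  have ys := zyx _ yx.
  have conv t : 0 <= t <= 1 -> `|z m x + t *: (z m y - z m x) - x| < s.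
    move=> /andP[t0 t1].
    rewrite (_ : _ - x = (1 - t) *: (z m x - x) + t *: (z m y - x)); last first.
      by apply/rowP => j; rewrite !mxE; ring.
    rewrite (le_lt_trans (ler_normD _ _))// !normrZ ger0_norm ?subr_ge0// ger0_norm//.
    move: (`|z m x - x|) (`|z m y - x|) xs ys => A B As Bs.
    have [->|tn] := eqVneq t 1; first by rewrite subrr mul0r mul1r add0r.
    have t1' : t < 1 by rewrite lt_neqAle tn.
    rewrite (_ : s = (1 - t) * s + t * s); last by ring.
    by apply: ltr_leD; [rewrite ltr_pM2l// subr_gt0|rewrite ler_wpM2l// ltW].
  rewrite /F /ext0 !asboolT; [|exact: sO|exact: sO].
  have [t t01|t /andP[t0 t1] ->] := @mvt_line _ _ v (z m x) (z m y).
    by case: (C1v (sO _ (conv t t01))).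
  have xis := conv t (ltac:(by rewrite !ltW)).
  set xi := z m x + _ in xis *.
  have -> : \sum_j (z m y - z m x) ord0 j * partial j v xi -
      \sum_j (gradient v x) ord0 j * (y ord0 j - x ord0 j) =
      \sum_j (y - x) ord0 j * (lam m * (partial j v xi - partial j v x) +
         m.+1%:R^-1 * partial j v x).
    rewrite -sumrB; apply: eq_bigr => j _; rewrite zB !mxE /lam.
    by move: (y ord0 j) (x ord0 j) (partial j v xi) (partial j v x) => ? ? ? ?; ring.
  rewrite (le_trans (ler_norm_sum _ _ _))//.
  rewrite (@le_trans _ _ (\sum_(j < n) 3 * e m * (3 * b)))//; last first.
    rewrite sumr_const card_ord -[leLHS]mulr_natl.
    by rewrite le_eqVlt; apply/orP; left; apply/eqP; ring.
  apply: ler_sum => j _; rewrite normrM ler_pM//.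
    exact: le_trans (coord_norm_le _ _) (ltW yx).
  rewrite (le_trans (ler_normD _ _))// !normrM (gtr0_norm (lam0 m)) (gtr0_norm inv0).
  have l1 : lam m * `|partial j v xi - partial j v x| <= 2 * b.
    by rewrite ler_pM//; [exact: ltW|exact: ltW (sb _ _ xis)].
  have l2 : m.+1%:R^-1 * `|partial j v x| <= b.
    have hM : `|partial j v x| <= M' + 1.
      by rewrite /M' (bigD1 j)//= -addrA lerDl; apply: addr_ge0 => //; exact: sumr_ge0.
    have M1 : 0 < M' + 1 by rewrite ltr_wpDl.
    rewrite (@le_trans _ _ (m.+1%:R^-1 * (M' + 1)))//; first by rewrite ler_wpM2l// ltW.
    by rewrite -ler_pdivlMr// ltW.
  have -> : 3 * b = 2 * b + b by ring.
  exact: lerD l1 l2.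
Qed.

End vanishing.
End boundary_values.

(** * The Poincare inequality and zero traces of [H10] functions *)

Section zero_trace.
Context {R : realType} {n : nat}.
Local Notation E := 'rV[R]_n.
Local Notation mu := (lebesgue_rV n : {measure set 'rV[R]_n -> \bar R}).
Variables (Omega : set E).
Hypotheses (n1 : (1 < n)%N) (domO : convex_polyhedral_domain Omega).
Variable r : R.
Hypotheses (r0 : 0 < r) (clr : forall x, closure Omega x -> `|x| < r).

Let n0 : (0 < n)%N := ltnW n1.
Let oO : open Omega := domain_open domO.
Let Or x : Omega x -> `|x| < r. Proof. by move/subset_closure/clr. Qed.
Let mO : measurable Omega := open_rV_measurable oO.
Let fO : (mu Omega < +oo)%E := bounded_lt_pinfty mO Or.

Lemma bmeas_sqr (v : E -> R) : bmeas Omega v -> bmeas Omega (fun x => v x ^+ 2).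
Proof. by move=> bv; apply: (eq_bmeas _ (bmeasM bv bv)) => x _; rewrite expr2. Qed.

Lemma L2sq_ge0 v : 0 <= L2sq Omega v.
Proof. by apply: Rintegral_ge0 => x _; exact: sqr_ge0. Qed.

Lemma cauchy_schwarz_sqrt v w : bmeas Omega v -> bmeas Omega w ->
  `|\int[mu]_(x in Omega) (v x * w x)| <= Num.sqrt (L2sq Omega v) * Num.sqrt (L2sq Omega w).
Proof.
move=> bv bw; have := Rint_cauchy_schwarz mO fO bv bw.
rewrite -/(L2sq _ v) -/(L2sq _ w) => H.
rewrite -ler_sqr ?nnegrE ?mulr_ge0 ?sqrtr_ge0//.
by rewrite real_normK ?num_real// exprMn !sqr_sqrtr ?L2sq_ge0.
Qed.

Lemma L2sqD v w : bmeas Omega v -> bmeas Omega w ->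
  L2sq Omega (fun x => v x + w x) <= 2 * L2sq Omega v + 2 * L2sq Omega w.
Proof.
move=> bv bw; have bv2 := bmeas_sqr bv; have bw2 := bmeas_sqr bw.
rewrite /L2sq -(RintZ mO fO 2 bv2) -(RintZ mO fO 2 bw2) -(RintD mO fO (bmeasZ 2 bv2) (bmeasZ 2 bw2)).
apply: le_Rint => //.
- by apply: bmeas_sqr; exact: bmeasD.
- by apply: bmeasD; exact: bmeasZ.
- by move=> x _; move: (v x) (w x) => a b; have := sqr_ge0 (a - b); nra.
Qed.

Section vanishing_test.
Variables (v : E -> R) (phi : nat -> E -> R) (B : R).
Hypotheses (nv : nice Omega v) (B0 : 0 <= B) (tphi : forall m, test_function Omega (phi m)).
Hypothesis phiB : forall m x, Omega x -> `|phi m x| <= B /\ forall i, `|partial i (phi m) x| <= B.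
Hypothesis cphi : forall x, Omega x -> phi m x @[m --> \oo] --> v x.
Hypothesis cpphi : forall x i, Omega x -> partial i (phi m) x @[m --> \oo] --> partial i v x.

Let bphi m : bmeas Omega (phi m) /\ forall i, bmeas Omega (partial i (phi m)).
Proof. exact: (nice_bmeas oO Or (test_nice (tphi m))). Qed.
Let bv : bmeas Omega v /\ forall i, bmeas Omega (partial i v).
Proof. exact: (nice_bmeas oO Or nv). Qed.

Lemma cvg_sumn (I : Type) (s : seq I) (f : I -> nat -> R) (a : I -> R) :
  (forall i, f i m @[m --> \oo] --> a i) ->
  \sum_(i <- s) f i m @[m --> \oo] --> \sum_(i <- s) a i.
Proof.
move=> cf; elim: s => [|i s IH].
  by rewrite big_nil; under eq_fun do rewrite big_nil; exact: cvg_cst.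
rewrite big_cons; under eq_fun do rewrite big_cons.
exact: (cvgD (cf i) IH).
Qed.

Lemma L2sq_cvg (f : nat -> E -> R) g (C : R) : (forall m, bmeas Omega (f m)) ->
  (forall m x, Omega x -> `|f m x| <= C) ->
  (forall x, Omega x -> f m x @[m --> \oo] --> g x) ->
  L2sq Omega (f m) @[m --> \oo] --> L2sq Omega g.
Proof.
move=> bf fC cf; have := Rint_cvgM mO fO bf bf fC fC cf cf.
rewrite /L2sq (_ : (fun m => _) = (fun m => \int[mu]_(x in Omega) f m x ^+ 2)).
  by rewrite (_ : \int[mu]_(x in Omega) (g x * g x) = \int[mu]_(x in Omega) g x ^+ 2).
by [].
Qed.

Lemma L2sq_diff_cvg (f : nat -> E -> R) g (C : R) : bmeas Omega g -> (forall m, bmeas Omega (f m)) ->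
  (forall m x, Omega x -> `|f m x| <= C) ->
  (forall x, Omega x -> f m x @[m --> \oo] --> g x) ->
  L2sq Omega (fun x => g x - f m x) @[m --> \oo] --> 0.
Proof.
move=> bg bf fC cf; have [C' HC'] := bg.2.
have -> : 0 = L2sq Omega (fun x => g x - g x).
  rewrite /L2sq -(mul0r (\int[mu]_(x in Omega) g x)) -(RintZ mO fO 0 bg).
  by apply: eq_Rintegral => x _; rewrite subrr mul0r expr0n.
apply: (@L2sq_cvg (fun m x => g x - f m x) _ (C' + C)).
- by move=> m; apply: bmeasD; [exact: bg|apply: bmeasN; exact: bf].
- by move=> m x Ox; rewrite (le_trans (ler_normB _ _))// lerD ?HC' ?fC.
- by move=> x Ox; apply: cvgB; [exact: cvg_cst|exact: cf].
Qed.

(** Bounded pointwise convergence of values and gradients gives convergence in L^2, hence in the H^1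
    norm. *)
Lemma vanishing_H10 : H10 Omega v.
Proof.
split.
  pose S := L2sq Omega v + \sum_i L2sq Omega (partial i v).
  have := @H1norm_le _ _ _ _ n1 oO Or v S nv.
  rewrite /sobolev -/(H1norm Omega v) => H; apply: (le_lt_trans (H _ _)); last exact: ltry.
    by rewrite /S lerDl sumr_ge0// => i _; exact: L2sq_ge0.
  move=> i; rewrite /S (bigD1 i)//= addrCA lerDl addr_ge0 ?L2sq_ge0//.
  by apply: sumr_ge0 => j _; exact: L2sq_ge0.
move=> e e0.
pose S m := L2sq Omega (fun x => v x - phi m x) +
  \sum_i L2sq Omega (fun x => partial i v x - partial i (phi m) x).
have cS : S m @[m --> \oo] --> 0.
  rewrite -[X in _ --> X]addr0; apply: cvgD.
    by apply: L2sq_diff_cvg bv.1 (fun m => (bphi m).1) (fun m x Ox => (phiB m Ox).1) cphi.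
  rewrite -[X in _ --> X](@big1 R 0 +%R 'I_n (index_enum _) xpredT (fun=> 0))//.
  apply: cvg_sumn => i.
  have h := @L2sq_diff_cvg (fun m => partial i (phi m)) (partial i v) B (bv.2 i)
    (fun m => (bphi m).2 i) (fun m x Ox => (phiB m Ox).2 i) (fun x Ox => @cpphi x i Ox).
  exact: h.
pose N : R := #|{: @mindex n 1}|%:R.
have N0 : 0 < N by rewrite ltr0n; apply/card_gt0P; exists [ffun=> ord0].
have d0 : 0 < (e / 2) ^+ 2 / N by rewrite divr_gt0// exprn_gt0// divr_gt0.
have /cvgrPdist_lt/(_ _ d0)[k _ /(_ k (leqnn k))] := cS.
rewrite /= sub0r normrN => Sk.
exists (phi k); first exact: tphi.
have oOv : nice Omega (v \- phi k)%R := niceB oO nv (test_nice (tphi k)).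
have S0 : 0 <= S k.
  by rewrite addr_ge0 ?L2sq_ge0// sumr_ge0// => i _; exact: L2sq_ge0.
have le1 : (H1norm Omega (v \- phi k)%R <= (Num.sqrt (N * S k))%:E)%E.
  apply: (H1norm_le n1 oO Or oOv).
    by rewrite /S lerDl sumr_ge0// => i _; exact: L2sq_ge0.
  move=> i; rewrite (_ : L2sq Omega (partial i _) =
      L2sq Omega (fun x => partial i v x - partial i (phi k) x)); last first.
    apply: eq_Rintegral => x /set_mem Ox; congr (_ ^+ 2); apply: partialB.
      by case: (nv.1 _ Ox).
    exact: cinf_differentiable (test_function_cinf (tphi k)).
  rewrite /S (bigD1 i)//= addrCA lerDl addr_ge0 ?L2sq_ge0//.
  by apply: sumr_ge0 => j _; exact: L2sq_ge0.
apply: (le_lt_trans le1); rewrite lte_fin (@le_lt_trans _ _ (e / 2))//; last by lra.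
have e20 : 0 <= e / 2 by rewrite divr_ge0// ltW.
rewrite -[leRHS](ger0_norm e20) -sqrtr_sqr ler_wsqrtr// mulrC -ler_pdivlMr//.
by move: Sk; rewrite ger0_norm// => /ltW.
Qed.

(** For a test function phi, integrating by parts against x_i phi shows that the integral of phi^2
    is -2 times that of phi x_i d_i phi; then |x_i| <= r and Young's inequality give the constant 4
    r^2. The limit carries the inequality over to v. *)
Lemma vanishing_poincare (i : 'I_n) : L2sq Omega v <= 4 * r ^+ 2 * L2sq Omega (partial i v).
Proof.
have test m : L2sq Omega (phi m) <= 4 * r ^+ 2 * L2sq Omega (partial i (phi m)).
  have [bp bpp] := bphi m.
  have [A [L [cA AO A0 L0 [lp pL]]]] := test_function_bounds (tphi m).
  have Ar x : A x -> `|x| < r by move=> /AO/Or.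
  have [F F0 HF] := lip_on_bounded L0 Ar (fun x y _ _ => lp x y Logic.I Logic.I).
  have lc : lip_on A 1 (fun x : E => x ord0 i).
    by move=> x y _ _; rewrite mul1r; have := coord_norm_le (x - y) i; rewrite !mxE.
  have cr x : A x -> `|x ord0 i| <= r.
    by move=> /Ar/ltW; apply: le_trans; exact: coord_norm_le.
  have lpc := lip_mul L0 ler01 (ltW r0) F0 lp A0 lc cr HF.
  have dp x : differentiable (phi m) x by exact: cinf_differentiable (test_function_cinf (tphi m)).
  have dc x : differentiable (fun y : E => y ord0 i) x by exact: differentiable_coord.
  have dpc x : differentiable (fun y => phi m y * y ord0 i) x by exact: differentiableM.
  have K0 : 0 <= L * r + F * 1 by rewrite addr_ge0 ?mulr_ge0// ltW.
  have := @by_parts_on _ _ _ _ n1 Or _ (phi m) _ _ i oO (@subset_refl _ Omega) (tphi m) K0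
    (fun x y _ _ => lpc x y Logic.I Logic.I) (fun x _ => dpc x).
  have bc : bmeas Omega (fun x : E => x ord0 i).
    have lc' : lip 1 (fun x : E => x ord0 i).
      by move=> x y _ _; rewrite mul1r; have := coord_norm_le (x - y) i; rewrite !mxE.
    exact: lip_bmeas mO Or lc'.
  have bX := bmeasM (bmeasM bp bc) (bpp i).
  rewrite (_ : \int[mu]_(x in Omega) (partial i _ x * phi m x) =
    \int[mu]_(x in Omega) (phi m x ^+ 2 + phi m x * x ord0 i * partial i (phi m) x)); last first.
    apply: eq_Rintegral => x _; rewrite partialM// partial_coord eqxx (_ : true%:R = 1)//.
    by move: (phi m x) (x ord0 i) (partial i _ x) => a b c; ring.
  rewrite (RintD mO fO (bmeas_sqr bp) bX) => H.
  have {}H : L2sq Omega (phi m) = - 2 * \int[mu]_(x in Omega) (phi m x * x ord0 i * partial i (phi m) x).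
    by move: H; rewrite /L2sq; move: (\int[mu]_(x in Omega) _) (\int[mu]_(x in Omega) _) => a b; lra.
  have half : L2sq Omega (phi m) <= 2^-1 * L2sq Omega (phi m) + 2 * r ^+ 2 * L2sq Omega (partial i (phi m)).
    rewrite {1}H /L2sq -(RintZ mO fO (- 2) bX) -(RintZ mO fO 2^-1 (bmeas_sqr bp)).
    rewrite -(RintZ mO fO _ (bmeas_sqr (bpp i))).
    rewrite -(RintD mO fO (bmeasZ _ (bmeas_sqr bp)) (bmeasZ _ (bmeas_sqr (bpp i)))).
    apply: le_Rint => //; first exact: bmeasZ.
      by apply: bmeasD; apply: bmeasZ; exact: bmeas_sqr.
    move=> x Ox; have : `|x ord0 i| <= r by rewrite (le_trans (coord_norm_le x i))// ltW// Or.
    move: (phi m x) (x ord0 i) (partial i _ x) => a b c br.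
    have b2 : b ^+ 2 <= r ^+ 2 by rewrite -real_normK ?num_real// lerXn2r// ?nnegrE// ltW.
    have : b ^+ 2 * c ^+ 2 <= r ^+ 2 * c ^+ 2 by rewrite ler_wpM2r// sqr_ge0.
    have := sqr_ge0 (a + 2 * b * c).
    move: (r ^+ 2) => rr.
    rewrite (_ : (a + 2 * b * c) ^+ 2 = a ^+ 2 + 4 * (a * b * c) + 4 * (b ^+ 2 * c ^+ 2)); last by ring.
    rewrite -(mulrA 2 rr); move: (a ^+ 2) (a * b * c) (b ^+ 2 * c ^+ 2) (rr * c ^+ 2) => ? ? ? ?; lra.
  have alg (a b c : R) : a <= 2^-1 * a + 2 * b * c -> a <= 4 * b * c.
    by rewrite -(mulrA 2 b c) -(mulrA 4 b c); move: (b * c) => t; lra.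
  exact: alg half.
apply: (ler_cvg_to (L2sq_cvg (fun m => (bphi m).1) (fun m x Ox => (phiB m Ox).1) cphi) _ _).
  apply: (cvgM (cvg_cst _)).
  exact: (L2sq_cvg (fun m => (bphi m).2 i) (fun m x Ox => (phiB m Ox).2 i) (fun x Ox => @cpphi x i Ox)).
by apply: nearW => m; exact: test.
Qed.

End vanishing_test.

Lemma test_bounds_global (psi : E -> R) : test_function [set: E] psi -> exists2 L : R, 0 <= L &
  lip L psi /\ forall x i, `|partial i psi x| <= L.
Proof. by move=> /test_function_bounds[A [L [_ _ _ L0 H]]]; exists L. Qed.

(** Here psi may be nonzero on the boundary of the domain: this is the weak form of a zero trace,
    inherited from the test functions that approach z in the norm. *)
Lemma H10_by_parts z psi i : nice Omega z -> H10 Omega z -> test_function [set: E] psi ->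
  \int[mu]_(x in Omega) (z x * partial i psi x + partial i z x * psi x) = 0.
Proof.
move=> nz [_ H] tpsi.
have [L L0 [lpsi pL]] := test_bounds_global tpsi.
have [L' L'0 [lppsi _]] := test_bounds_global (test_function_partial i tpsi).
have bpsi : bmeas Omega psi := lip_bmeas mO Or lpsi.
have bppsi : bmeas Omega (partial i psi) := lip_bmeas mO Or lppsi.
have [bz bpz] := nice_bmeas oO Or nz.
pose C := Num.sqrt (L2sq Omega psi) + Num.sqrt (L2sq Omega (partial i psi)).
have C0 : 0 <= C by rewrite addr_ge0 ?sqrtr_ge0.
apply/eqP; rewrite -normr_eq0; apply/eqP/le_anti; rewrite normr_ge0 andbT.
apply/ler_addgt0Pr => e e0; rewrite add0r.
have d0 : 0 < e / (C + 1) by rewrite divr_gt0// ltr_wpDl.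
have [phi tphi Hphi] := H _ d0.
have [bp bpp] := nice_bmeas oO Or (test_nice tphi).
have nzp : nice Omega (z \- phi)%R := niceB oO nz (test_nice tphi).
have [bzp bpzp] := nice_bmeas oO Or nzp.
have [h0 hi] := H1norm_ge n1 oO Or nzp.
have s0 : Num.sqrt (L2sq Omega (z \- phi)%R) <= e / (C + 1).
  by rewrite -lee_fin (le_trans h0)// ltW.
have s1 : Num.sqrt (L2sq Omega (partial i (z \- phi)%R)) <= e / (C + 1).
  by rewrite -lee_fin (le_trans (hi i))// ltW.
have E0 : \int[mu]_(x in Omega) (phi x * partial i psi x + partial i phi x * psi x) = 0.
  have := @by_parts_on _ _ _ _ n1 Or _ phi psi L i oO (@subset_refl _ Omega) tphi L0
    (fun x y _ _ => lpsi x y Logic.I Logic.I) (fun x _ => cinf_differentiable x (test_function_cinf tpsi)).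
  rewrite (RintD mO fO (bmeasM bp bppsi) (bmeasM (bpp i) bpsi)) => H'.
  rewrite (_ : \int[mu]_(x in Omega) (partial i phi x * psi x) =
    \int[mu]_(x in Omega) (psi x * partial i phi x)); last first.
    by apply: eq_Rintegral => x _; rewrite mulrC.
  rewrite H' (_ : \int[mu]_(x in Omega) (phi x * partial i psi x) =
    \int[mu]_(x in Omega) (partial i psi x * phi x)) ?subrr//.
  by apply: eq_Rintegral => x _; rewrite mulrC.
have -> : \int[mu]_(x in Omega) (z x * partial i psi x + partial i z x * psi x) =
   \int[mu]_(x in Omega) ((z \- phi)%R x * partial i psi x) +
   \int[mu]_(x in Omega) (partial i (z \- phi)%R x * psi x).
  rewrite -(RintD mO fO (bmeasM bzp bppsi) (bmeasM (bpzp i) bpsi)).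
  rewrite -[LHS]subr0 -[X in _ - X]E0 -RintB//; last 2 first.
  - by apply: bmeasD; apply: bmeasM.
  - by apply: bmeasD; apply: bmeasM.
  apply: eq_Rintegral => x /set_mem Ox; rewrite partialB/=.
  - by move: (z x) (phi x) (partial _ _ _) (partial _ _ _) (partial _ _ _) (psi x) => *; ring.
  - by case: (nz.1 _ Ox).
  - exact: cinf_differentiable (test_function_cinf tphi).
have := cauchy_schwarz_sqrt bzp bppsi; have := cauchy_schwarz_sqrt (bpzp i) bpsi.
move=> c1 c2; rewrite (le_trans (ler_normD _ _))//.
apply: (@le_trans _ _ (e / (C + 1) * Num.sqrt (L2sq Omega (partial i psi)) +
    e / (C + 1) * Num.sqrt (L2sq Omega psi))).
  by apply: lerD; [apply: (le_trans c2)|apply: (le_trans c1)]; rewrite ler_wpM2r// sqrtr_ge0.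
rewrite -mulrDr (addrC (Num.sqrt _)) -/C -mulrA ler_piMr// ?ltW//.
by rewrite mulrC ltr_pdivrMr ?ltr_wpDl// mul1r ltrDl.
Qed.

Lemma dist_triangle_lt (x y p : E) (rho : R) : `|x - y| < rho - `|y - p| -> `|x - p| < rho.
Proof.
rewrite ltrBrDr; apply: le_lt_trans.
by rewrite (_ : x - p = (x - y) + (y - p)) ?ler_normD// addrA subrK.
Qed.

(** Near p there are x in the domain and y outside its closure. Replacing the coordinates of x by
    those of y one at a time, the first replacement that leaves the closure is an axis-parallel move
    from a point of the closure, which is then perturbed into the domain. An axis is wanted because
    the trace identity involves a single partial derivative. *)
Lemma bdry_exit p (rho : R) : bdry Omega p -> 0 < rho -> exists q i (tau : R),
  [/\ Omega q, tau != 0, ~ closure Omega (q + tau *: delta_mx ord0 i),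
      `|q - p| < rho & `|q + tau *: delta_mx ord0 i - p| < rho].
Proof.
move=> [cp np] rho0.
have [x Ox xp] := (closure_normP _ _).1 cp _ rho0.
have [y [yp ny]] : exists y : E, `|y - p| < rho /\ ~ closure Omega y.
  apply: contrapT => H; apply: np.
  apply: (interior_closure_convex (domain_convex domO) (domain_interior_neq0 domO)).
  apply/interior_normP; exists rho => // y yp; apply: contrapT => ny; apply: H.
  by exists y.
pose w k : E := \row_j (if (j < k)%N then y ord0 j else x ord0 j).
have w0 : w 0%N = x by apply/rowP => j; rewrite mxE.
have wn : w n = y by apply/rowP => j; rewrite mxE ltn_ord.
have wp k : `|w k - p| < rho.
  apply/(rV_norm_ltP _ rho0) => j; have := (rV_norm_ltP _ rho0).1 xp j.
  have := (rV_norm_ltP _ rho0).1 yp j; rewrite !mxE.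
  by case: ifP.
have ex : exists k, `[< ~ closure Omega (w k) >] by exists n; apply/asboolP; rewrite wn.
case: (ex_minnP ex) => -[|k] /asboolP nk mink.
  by exfalso; apply: nk; rewrite w0; exact: subset_closure.
have ck : closure Omega (w k).
  by apply: contrapT => h; have := mink k (introT (asboolP _) h); rewrite ltnn.
have kn : (k < n)%N.
  rewrite ltnNge; apply/negP => nk'; apply: nk.
  suff -> : w k.+1 = w k by [].
  by apply/rowP => j; rewrite !mxE !(leq_trans (ltn_ord j))// leqW.
pose i := Ordinal kn; pose tau := y ord0 i - x ord0 i.
have wk : w k.+1 = w k + tau *: delta_mx ord0 i.
  apply/rowP => j; rewrite !mxE eqxx/= ltnS leq_eqVlt.
  have [->|ji] := eqVneq j i; first by rewrite eqxx /= ltnn mulr1 /tau addrC subrK.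
  have jk : (j == k :> nat) = false.
    by apply/eqP => jk; move/eqP: ji; apply; exact: val_inj.
  by rewrite jk mulr0 addr0.
have [s s0 Hs] := (open_normP (~` closure Omega)).1
  (ltac:(by rewrite openC; exact: closed_closure)) _ nk.
pose d := Num.min s (Num.min (rho - `|w k - p|) (rho - `|w k.+1 - p|)).
have d0 : 0 < d by rewrite !lt_min s0 !subr_gt0 !wp.
have [q Oq] := (closure_normP _ _).1 ck _ d0.
rewrite !lt_min => /and3P[q1 q2 q3].
exists q, i, tau.
have qw : q + tau *: delta_mx ord0 i - w k.+1 = q - w k.
  by rewrite wk opprD addrACA subrr addr0.
have nq : ~ closure Omega (q + tau *: delta_mx ord0 i).
  by apply: Hs; rewrite qw.
split.
- exact: Oq.
- by apply/eqP => t0; apply: nq; rewrite t0 scale0r addr0; exact: subset_closure.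
- exact: nq.
- exact: dist_triangle_lt q2.
- by apply: (@dist_triangle_lt _ (w k.+1)); rewrite qw.
Qed.

Lemma ebump_affine_derive (a b t : R) : is_derive t (1 : R) (fun x => ebump (a * x + b))
  (a * ((a * t + b) ^- 2 * ebump (a * t + b))).
Proof.
by rewrite mulrC; apply: is_derive_affine; exact: ebump_derive.
Qed.

Lemma ebump2_derive (a b a' b' t : R) :
  'D_1 (fun x => ebump (a * x + b) * ebump (a' * x + b')) t =
  (a * (a * t + b) ^- 2 + a' * (a' * t + b') ^- 2) * (ebump (a * t + b) * ebump (a' * t + b')).
Proof.
have h1 := ebump_affine_derive a b t; have h2 := ebump_affine_derive a' b' t.
have h := is_deriveM h1 h2; rewrite (@derive_val _ _ _ _ _ _ _ h) /GRing.scale/=.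
by move: (ebump _) (ebump _) (_ ^- 2) (_ ^- 2) => *; ring.
Qed.

(** If z p > 0, then z >= c near p. The test function psi lives in a tube around an axis-parallel
    segment that leaves the domain; its derivative is kappa psi with s kappa >= (M + 1) / c inside
    the domain. Hence z s kappa + s d_i z >= 1 where psi is nonzero, and the vanishing integral
    forces that of psi to be at most 0, although psi is positive at a point of the domain. *)
Lemma zero_trace_pos z (M : R) p : 0 <= M -> nice Omega z -> lip_on (closure Omega) M z ->
  (forall x i, Omega x -> `|partial i z x| <= M) ->
  (forall psi i, test_function [set: E] psi ->
    \int[mu]_(x in Omega) (z x * partial i psi x + partial i z x * psi x) = 0) ->
  bdry Omega p -> z p <= 0.
Proof.
move=> M0 nz lz zM Hz bp; rewrite leNgt; apply/negP => zp.
pose c := z p / 2; have c0 : 0 < c by rewrite divr_gt0.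
pose rho := c / (M + 1).
have M1 : 0 < M + 1 by rewrite ltr_wpDl.
have rho0 : 0 < rho by rewrite divr_gt0.
have zc x : closure Omega x -> `|x - p| < rho -> c <= z x.
  move=> cx xp; have := lz _ _ bp.1 cx => /(le_trans (ler_norm _)).
  have : M * `|p - x| <= c.
    rewrite distrC (@le_trans _ _ (M * rho))//; first by rewrite ler_wpM2l// ltW.
    rewrite /rho mulrA ler_pdivrMr// mulrC ler_wpM2l// ?ltW//.
    by rewrite ltrDl.
  have zpE : z p = c + c by rewrite /c -splitr.
  by rewrite zpE; move: (M * _) => a; lra.
have [q [i [tau [Oq tau0 nq qp q'p]]]] := bdry_exit bp rho0.
set q' := q + _ in nq q'p.
have [r' r'0 Hr'] := (open_normP (~` closure Omega)).1
  (ltac:(by rewrite openC; exact: closed_closure)) _ nq.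
pose eta := Num.min r' (Num.min (rho - `|q - p|) (rho - `|q' - p|)) / 2.
have m0 : 0 < Num.min r' (Num.min (rho - `|q - p|) (rho - `|q' - p|)).
  by rewrite !lt_min r'0 !subr_gt0 qp q'p.
have eta0 : 0 < eta by rewrite divr_gt0.
have : eta < Num.min r' (Num.min (rho - `|q - p|) (rho - `|q' - p|)).
  by rewrite /eta ltr_pdivrMr// ltr_pMr// ltr1n.
rewrite !lt_min => /and3P[eta1 eta2 eta3].
pose s := Num.sg tau.
have ss : s * s = 1 by rewrite -expr2 sqr_sg tau0.
have s1 : `|s| = 1 by rewrite normr_sg tau0.
have stau : s * tau = `|tau| by rewrite normrEsg.
have t0 : 0 < `|tau| by rewrite normr_gt0.
have q'i : q' ord0 i = q ord0 i + tau by rewrite !mxE !eqxx mulr1.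
have q'j j : j != i -> q' ord0 j = q ord0 j.
  by move=> ji; rewrite !mxE eqxx (negbTE ji) mulr0 addr0.
pose y0 := s * q ord0 i.
have y1E : s * q' ord0 i = y0 + `|tau| by rewrite q'i mulrDr stau.
(* At distance a <= |tau| from its start the rising factor has logarithmic derivative 1 / (sigma
   a^2) >= K. The falling factor ends the tube beyond the exit point, at least 2 eta away from the
   part inside the domain, and costs at most (2 eta)^-2 there. *)
pose K := (M + 1) / c + (2 * eta) ^- 2.
have K0 : 0 < K by rewrite addr_gt0 ?divr_gt0// invr_gt0 exprn_gt0// mulr_gt0.
pose sigma := (`|tau| ^+ 2 * K)^-1.
have sigma0 : 0 < sigma by rewrite invr_gt0 mulr_gt0// exprn_gt0.
pose g j (t : R) := if j == i
  then ebump (sigma * s * t + - (sigma * (y0 - eta))) * ebump (- s * t + (y0 + `|tau| + eta))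
  else ebump (1 * t + (eta - q ord0 j)) * ebump (- 1 * t + (eta + q ord0 j)).
have sg j : smooth1 (g j).
  by rewrite /g; case: eqP => _; apply: smooth1M; apply: smooth1_affine; exact: ebump_smooth.
pose psi := tensor g.
have psi_ge0 x : 0 <= psi x.
  apply: prodr_ge0 => j _; rewrite /g; case: eqP => _; rewrite mulr_ge0//; exact: ebump_ge0.
have supp x : psi x != 0 -> [/\ y0 - eta < s * x ord0 i, s * x ord0 i < y0 + `|tau| + eta &
    forall j, j != i -> `|x ord0 j - q ord0 j| < eta].
  move=> px; have gx j : g j (x ord0 j) != 0.
    by apply: contra px => /eqP gj; rewrite /psi /tensor (bigD1 j)//= gj mul0r.
  have pos (t : R) : ebump t != 0 -> 0 < t.
    by apply: contraR; rewrite -leNgt => /ebump_le0 ->.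
  split.
  - have := gx i; rewrite /g eqxx mulf_eq0 negb_or => /andP[/pos h _].
    by move: h; rewrite -mulrA -mulrBr pmulr_rgt0// subr_gt0.
  - have := gx i; rewrite /g eqxx mulf_eq0 negb_or => /andP[_ /pos h].
    by move: h; rewrite mulNr addrC subr_gt0.
  - move=> j ji; have := gx j; rewrite /g (negbTE ji) mulf_eq0 negb_or => /andP[/pos h1 /pos h2].
    by move: h1 h2; rewrite mul1r mulN1r ltr_norml => h1 h2; apply/andP; split; lra.
have psi_near x : psi x != 0 -> `|x - p| < rho.
  move=> /supp[h1 h2 h3]; apply/(rV_norm_ltP _ rho0) => j; rewrite !mxE.
  have cw (w : E) k : `|w ord0 k - p ord0 k| <= `|w - p|.
    by have := coord_norm_le (w - p) k; rewrite !mxE.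
  have [->|ji] := eqVneq j i; last first.
    rewrite -(subrK (q ord0 j) (x ord0 j)) -addrA (le_lt_trans (ler_normD _ _))//.
    by have := h3 _ ji; have := cw q j; move: eta2 => *; lra.
  have := cw q i; have := cw q' i.
  have sc (a b : R) : `|a - b| = `|s * a - s * b| by rewrite -mulrBr normrM s1 mul1r.
  rewrite (sc (q' ord0 i)) (sc (q ord0 i)) (sc (x ord0 i)) y1E -/y0 !ler_norml => /andP[a1 a2] /andP[b1 b2].
  by rewrite ltr_norml; apply/andP; split; lra.
have tpsi : test_function [set: E] psi.
  split; first exact: cinf_tensor.
  exists [set x : E | `|x - p| <= rho]; split => //; first exact: closed_ball_compact.
  move=> x nx; apply/eqP; apply: contrapT => /negP h; apply: nx.
  exact: ltW (psi_near _ h).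
pose kappa (x : E) := sigma * s * (sigma * s * x ord0 i + - (sigma * (y0 - eta))) ^- 2 +
  - s * (- s * x ord0 i + (y0 + `|tau| + eta)) ^- 2.
have dpsi x : partial i psi x = kappa x * psi x.
  rewrite partial_tensor// /psi /tensor (bigD1 i)//= [in RHS](bigD1 i)//= mulrA; congr (_ * _).
    by rewrite /dtensor eqxx /g eqxx ebump2_derive.
  by apply: eq_bigr => j ji; rewrite /dtensor (negbTE ji).
have kappa_ge x : Omega x -> psi x != 0 -> (M + 1) / c <= s * kappa x.
  move=> Ox px; have [h1 h2 h3] := supp _ px.
  have far : s * x ord0 i < y0 + `|tau| - eta.
    rewrite ltNge; apply/negP => h; have : (~` closure Omega) x.
      apply: Hr'; apply/(rV_norm_ltP _ r'0) => j; rewrite 2!mxE.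
      have [->|ji] := eqVneq j i.
        have -> : `|x ord0 i - q' ord0 i| = `|s * x ord0 i - s * q' ord0 i|.
          by rewrite -mulrBr normrM s1 mul1r.
        by rewrite y1E ltr_norml; apply/andP; split; lra.
      by rewrite q'j// (lt_trans (h3 _ ji)).
    by apply; exact: subset_closure.
  have -> : s * kappa x = sigma * (sigma * (s * x ord0 i - (y0 - eta))) ^- 2 -
      (y0 + `|tau| + eta - s * x ord0 i) ^- 2.
    have eA : sigma * s * x ord0 i + - (sigma * (y0 - eta)) = sigma * (s * x ord0 i - (y0 - eta)).
      by move: (x ord0 i) => t; ring.
    have eB : - s * x ord0 i + (y0 + `|tau| + eta) = y0 + `|tau| + eta - s * x ord0 i.
      by move: (x ord0 i) => t; ring.
    have alg (P P' : R) : s * (sigma * s * P + - s * P') = (s * s) * (sigma * P) - (s * s) * P'.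
      by ring.
    by rewrite /kappa eA eB alg ss !mul1r.
  have u0 : 0 < s * x ord0 i - (y0 - eta) by rewrite subr_gt0.
  have ut : s * x ord0 i - (y0 - eta) <= `|tau| by lra.
  have w2 : 2 * eta <= y0 + `|tau| + eta - s * x ord0 i by lra.
  move: (s * x ord0 i - (y0 - eta)) (y0 + `|tau| + eta - s * x ord0 i) u0 ut w2 => a b a0 at_ be.
  have e20 : 0 < 2 * eta by rewrite mulr_gt0.
  have b0 : 0 < b by exact: lt_le_trans be.
  have hb : b ^- 2 <= (2 * eta) ^- 2.
    by rewrite lef_pV2 ?posrE ?exprn_gt0// lerXn2r// nnegrE ltW.
  have ha : K <= sigma * (sigma * a) ^- 2.
    have -> : sigma * (sigma * a) ^- 2 = (sigma * a ^+ 2)^-1.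
      by field; rewrite !gt_eqF.
    have -> : K = (sigma * `|tau| ^+ 2)^-1.
      rewrite /sigma; field; rewrite !gt_eqF// ?exprn_gt0//.
    rewrite lef_pV2 ?posrE ?mulr_gt0 ?exprn_gt0// ler_pM2l// lerXn2r// nnegrE ltW//.
  by move: ha; rewrite /K; move: hb; lra.
have [bz bpz] := nice_bmeas oO Or nz.
have [L L0 [lpsi pL]] := test_bounds_global tpsi.
have [L' L'0 [lppsi _]] := test_bounds_global (test_function_partial i tpsi).
have bpsi : bmeas Omega psi := lip_bmeas mO Or lpsi.
have bppsi : bmeas Omega (partial i psi) := lip_bmeas mO Or lppsi.
have bint := bmeasD (bmeasM bz bppsi) (bmeasM (bpz i) bpsi).
have le0 : \int[mu]_(x in Omega) psi x <= 0.
  rewrite -(mulr0 s) -(Hz psi i tpsi) -(RintZ mO fO s bint); apply: le_Rint => //.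
    exact: bmeasZ.
  move=> x Ox; rewrite dpsi.
  have [->|px] := eqVneq (psi x) 0; first by rewrite !mulr0 addr0 mulr0.
  have zcx := zc x (subset_closure Ox) (psi_near _ px).
  have kx := kappa_ge x Ox px.
  rewrite (_ : s * _ = (z x * (s * kappa x) + s * partial i z x) * psi x); last by ring.
  rewrite -[leLHS]mul1r ler_wpM2r//.
  have h1 : M + 1 <= z x * (s * kappa x).
    rewrite (@le_trans _ _ (c * ((M + 1) / c)))//; first by rewrite mulrC divfK// gt_eqF.
    by rewrite ler_pM// ?ltW// divr_gt0.
  have h2 : - M <= s * partial i z x.
    by have := zM x i Ox; rewrite -[`|_|]mul1r -s1 -normrM ler_norml => /andP[].
  by move: h1 h2; lra.
have ge0 : 0 <= \int[mu]_(x in Omega) psi x by apply: Rintegral_ge0.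
have I0 : \int[mu]_(x in Omega) psi x = 0 by apply/le_anti; rewrite le0.
have psiq := Rint_eq0_open oO Or (fun x _ => lip_continuous lpsi (x := x)) bpsi
  (fun x _ => psi_ge0 x) I0 Oq.
have : 0 < psi q.
  apply: prodr_gt0 => j _; rewrite /g; case: eqVneq => [->|ji]; apply: mulr_gt0; apply: ebump_gt0.
  - by rewrite -mulrA -mulrBr mulr_gt0// -/y0 subr_gt0 gtrBl.
  - by rewrite mulNr -/y0; lra.
  - by rewrite mul1r; lra.
  - by rewrite mulN1r; lra.
by rewrite psiq ltxx.
Qed.

Lemma zero_trace z (M : R) p : 0 <= M -> nice Omega z -> lip_on (closure Omega) M z ->
  H10 Omega z -> bdry Omega p -> z p = 0.
Proof.
move=> M0 nz lz hz bp.
have [M' M'0 HM'] := nice_bound oO Or nz.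
have MM : 0 <= M + M' by rewrite addr_ge0.
have lz' : lip_on (closure Omega) (M + M') z by apply: lip_onW lz; rewrite lerDl.
have pz x i : Omega x -> `|partial i z x| <= M + M'.
  by move=> /HM'[_ /(_ i)] h; rewrite (le_trans h)// lerDr.
have Hz psi i := @H10_by_parts z psi i nz hz.
apply/le_anti/andP; split; first exact: (zero_trace_pos MM nz lz' pz (fun psi i => Hz psi i) bp).
rewrite -oppr_le0.
have nNz : nice Omega (fun x => - z x).
  have h := niceB oO (v := fun=> 0) _ nz.
  have n00 : nice Omega (fun=> (0 : R)).
    split; last by exists 0 => // x y _ _; rewrite subrr normr0 mul0r.
    exact: cinf_C1 (cinf_cst 0).
  by have := niceB oO n00 nz; rewrite (_ : (fun x => 0 - z x) = (fun x => - z x))//; apply/funext => x; rewrite sub0r.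
have pN x i : Omega x -> partial i (fun y => - z y) x = - partial i z x.
  move=> Ox; have dz : differentiable z x by case: (nz.1 _ Ox).
  rewrite (_ : (fun y => - z y) = (fun y => - 1 * z y)); last by apply/funext => y; rewrite mulN1r.
  by rewrite partialZ// mulN1r.
apply: (zero_trace_pos MM nNz _ _ _ bp).
- by move=> x y cx cy; rewrite opprK addrC distrC lz'.
- by move=> x i Ox; rewrite pN// normrN pz.
- move=> psi i tpsi; have [bz bpz] := nice_bmeas oO Or nz.
  have [L L0 [lpsi pL]] := test_bounds_global tpsi.
  have [L' L'0 [lppsi _]] := test_bounds_global (test_function_partial i tpsi).
  have bpsi : bmeas Omega psi := lip_bmeas mO Or lpsi.
  have bppsi : bmeas Omega (partial i psi) := lip_bmeas mO Or lppsi.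
  rewrite -[RHS](mulr0 (- 1)) -(Hz psi i tpsi).
  rewrite -(RintZ mO fO (- 1) (bmeasD (bmeasM bz bppsi) (bmeasM (bpz i) bpsi))).
  apply: eq_Rintegral => x /set_mem Ox; rewrite pN//.
  by move: (z x) (partial _ _ _) (partial _ _ _) (psi x) => *; ring.
Qed.

End zero_trace.

(** * Cofactor matrices *)

Section cofactor_algebra.
Context {R : realType}.

Definition mxdot n (A B : 'M[R]_n) : R := \sum_j \sum_i A i j * B i j.

Lemma mxdot_cof n (A : 'M[R]_n) : mxdot (cof A) A = n%:R * \det A.
Proof.
rewrite /mxdot (eq_bigr (fun=> \det A)) => [|j _]; last exact: cof_mul_sum.
by rewrite sumr_const card_ord mulr_natl.
Qed.

(* Simpson's rule is exact for the derivative of a cubic polynomial in t, here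
   t |-> det (B + t (A - B)). *)
Lemma det_simpson n (A B : 'M[R]_n) : n = 2%N \/ n = 3%N ->
  6 * (\det A - \det B) =
  mxdot (cof A) (A - B) + 4 * mxdot (cof (2^-1 *: (A + B))) (A - B) + mxdot (cof B) (A - B).
Proof.
case=> n23; subst n.
  have [a Ha] := mx_entries A; have [b Hb] := mx_entries B.
  have Hc i j : (2^-1 *: (A + B)) i j = 2^-1 * (a i j + b i j) by rewrite !mxE Ha Hb.
  rewrite (det2E Ha) (det2E Hb) /mxdot !big_ord_recl !big_ord0 !(cof2E Ha) !(cof2E Hb).
  rewrite !(@cof2E _ _ (fun i j => 2^-1 * (a i j + b i j)) Hc) !mxE !Ha !Hb /=.
  by rewrite /bump /=; field.
have [a Ha] := mx_entries A; have [b Hb] := mx_entries B.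
have Hc i j : (2^-1 *: (A + B)) i j = 2^-1 * (a i j + b i j) by rewrite !mxE Ha Hb.
rewrite -(cof_mul_sum A ord0) -(cof_mul_sum B ord0).
rewrite /mxdot !big_ord_recl !big_ord0 !(cof3E Ha) !(cof3E Hb).
rewrite !(@cof3E _ _ (fun i j => 2^-1 * (a i j + b i j)) Hc) !mxE !Ha !Hb /=.
by rewrite /bump /=; field.
Qed.

(** One constant for both dimensions: cofactors have degree one in the entries for n = 2 and degree
    two for n = 3. *)
Lemma cof_bound n (A : 'M[R]_n) (S : R) : n = 2%N \/ n = 3%N -> 0 <= S ->
  (forall i j, `|A i j| <= S) -> forall i j, `|cof A i j| <= 2 * (S + 1) ^+ 2.
Proof.
case=> n23 S0 AS i j; subst n.
  have [a Ha] := mx_entries A; rewrite (cof2E Ha) normrM normrX normrN1 expr1n mul1r.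
  have h : `|a (bump i 0) (bump j 0)| <= S.
    by have := AS (lift i ord0) (lift j ord0); rewrite Ha.
  by rewrite (le_trans h)//; nra.
have [a Ha] := mx_entries A; rewrite (cof3E Ha) normrM normrX normrN1 expr1n mul1r.
have h (k l : 'I_2) : `|a (bump i k) (bump j l)| <= S.
  by have := AS (lift i k) (lift j l); rewrite Ha.
rewrite (le_trans (ler_normB _ _))// !normrM.
have h00 := h ord0 ord0; have h11 := h ord_max ord_max.
have h01 := h ord0 ord_max; have h10 := h ord_max ord0.
have m1 : `|a (bump i 0) (bump j 0)| * `|a (bump i 1) (bump j 1)| <= S * S by rewrite ler_pM.
have m2 : `|a (bump i 0) (bump j 1)| * `|a (bump i 1) (bump j 0)| <= S * S by rewrite ler_pM.
by rewrite (le_trans (lerD m1 m2))//; nra.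
Qed.

Lemma norm_mul_diff (a b a' b' S rho : R) : 0 <= S -> rho <= 1 -> `|a| <= S -> `|b| <= S ->
  `|a' - a| <= rho -> `|b' - b| <= rho -> `|a' * b' - a * b| <= (2 * S + 1) * rho.
Proof.
move=> S0 rho1 aS bS ar br.
rewrite (_ : a' * b' - a * b = (a' - a) * (b' - b) + (a' - a) * b + a * (b' - b)); last by ring.
have rho0 : 0 <= rho by apply: le_trans ar.
rewrite (le_trans (ler_normD _ _))//.
have h1 : `|a * (b' - b)| <= S * rho by rewrite normrM ler_pM.
have h2 : `|(a' - a) * b| <= rho * S by rewrite normrM ler_pM.
have h3 : `|(a' - a) * (b' - b)| <= rho * 1 by rewrite normrM ler_pM// (le_trans br).
have := ler_normD ((a' - a) * (b' - b)) ((a' - a) * b).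
move: h1 h2 h3; move: `|_| `|_| `|_| `|_| => x y z t; nra.
Qed.

Lemma cof_perturb n (A B : 'M[R]_n) (S rho : R) : n = 2%N \/ n = 3%N -> 0 <= S -> rho <= 1 ->
  (forall i j, `|A i j| <= S) -> (forall i j, `|B i j - A i j| <= rho) ->
  forall i j, `|cof B i j - cof A i j| <= (4 * S + 2) * rho.
Proof.
case=> n23 S0 rho1 AS AB i j; subst n.
  have [a Ha] := mx_entries A; have [b Hb] := mx_entries B.
  rewrite (cof2E Ha) (cof2E Hb) -mulrBr normrM normrX normrN1 expr1n mul1r.
  have h : `|b (bump i 0) (bump j 0) - a (bump i 0) (bump j 0)| <= rho.
    by have := AB (lift i ord0) (lift j ord0); rewrite Ha Hb.
  have rho0 : 0 <= rho by apply: le_trans h.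
  by rewrite (le_trans h)//; nra.
have [a Ha] := mx_entries A; have [b Hb] := mx_entries B.
rewrite (cof3E Ha) (cof3E Hb) -mulrBr normrM normrX normrN1 expr1n mul1r.
have h (k l : 'I_2) : `|a (bump i k) (bump j l)| <= S.
  by have := AS (lift i k) (lift j l); rewrite Ha.
have h' (k l : 'I_2) : `|b (bump i k) (bump j l) - a (bump i k) (bump j l)| <= rho.
  by have := AB (lift i k) (lift j l); rewrite Ha Hb.
have m1 := norm_mul_diff S0 rho1 (h ord0 ord0) (h ord_max ord_max) (h' ord0 ord0) (h' ord_max ord_max).
have m2 := norm_mul_diff S0 rho1 (h ord0 ord_max) (h ord_max ord0) (h' ord0 ord_max) (h' ord_max ord0).
move: m1 m2 => /=.
set x := b _ _ * b _ _; set y := a _ _ * a _ _; set x' := b _ _ * b _ _; set y' := a _ _ * a _ _.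
move=> m1 m2; rewrite (_ : _ - _ = (x - y) - (x' - y')); last by rewrite /x /y /x' /y' /=; ring.
by rewrite (le_trans (ler_normB _ _))// (le_trans (lerD m1 m2))//; lra.
Qed.

Definition dotv n (x y : 'rV[R]_n) : R := \sum_i x ord0 i * y ord0 i.

Lemma dotvE n (x y : 'rV[R]_n) : (x *m y^T) ord0 ord0 = dotv x y.
Proof. by rewrite mxE; apply: eq_bigr => i _; rewrite !mxE. Qed.

Lemma dotvC n (x y : 'rV[R]_n) : dotv x y = dotv y x.
Proof. by apply: eq_bigr => i _; rewrite mulrC. Qed.

Lemma dotvDl n (x y z : 'rV[R]_n) : dotv (x + y) z = dotv x z + dotv y z.
Proof. by rewrite -big_split; apply: eq_bigr => i _; rewrite mxE mulrDl. Qed.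

Lemma dotvZl n (a : R) (x y : 'rV[R]_n) : dotv (a *: x) y = a * dotv x y.
Proof. by rewrite mulr_sumr; apply: eq_bigr => i _; rewrite mxE mulrA. Qed.

Lemma dotvBl n (x y z : 'rV[R]_n) : dotv (x - y) z = dotv x z - dotv y z.
Proof. by rewrite dotvDl -scaleN1r dotvZl mulN1r. Qed.

Lemma dotvDr n (x y z : 'rV[R]_n) : dotv z (x + y) = dotv z x + dotv z y.
Proof. by rewrite dotvC dotvDl !(dotvC z). Qed.

Lemma dotvZr n (a : R) (x y : 'rV[R]_n) : dotv x (a *: y) = a * dotv x y.
Proof. by rewrite dotvC dotvZl dotvC. Qed.

Lemma dotv_ge0 n (x : 'rV[R]_n) : 0 <= dotv x x.
Proof. by apply: sumr_ge0 => i _; rewrite -expr2 sqr_ge0. Qed.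

Lemma dotv_eq0 n (x : 'rV[R]_n) : dotv x x = 0 -> x = 0.
Proof.
move=> /eqP; rewrite psumr_eq0 => [/allP h|i _]; last by rewrite -expr2 sqr_ge0.
apply/rowP => i; have := h i (mem_index_enum i); rewrite /= mulf_eq0 orbb mxE => /eqP.
by [].
Qed.

Lemma coord_sqr_le n (x : 'rV[R]_n) i : x ord0 i ^+ 2 <= dotv x x.
Proof.
rewrite /dotv (bigD1 i)//= -expr2 lerDl; apply: sumr_ge0 => j _.
by rewrite -expr2 sqr_ge0.
Qed.

(** At t = -b / (|c| + 1) the quadratic is negative unless b = 0. *)
Lemma quad_linear_nonneg (b c : R) : (forall t : R, 0 <= 2 * t * b + t ^+ 2 * c) -> b = 0.
Proof.
move=> H; have [//|b0] := eqVneq b 0; exfalso.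
have D : 0 < `|c| + 1 by rewrite ltr_wpDl.
have := H (- b / (`|c| + 1)).
rewrite (_ : 2 * _ * b + _ = b ^+ 2 / (`|c| + 1) ^+ 2 * (c - 2 * (`|c| + 1))); last first.
  by field; rewrite gt_eqF.
have h : 0 < b ^+ 2 / (`|c| + 1) ^+ 2.
  by apply: divr_gt0; [rewrite exprn_even_gt0|exact: exprn_gt0].
rewrite (pmulr_rge0 _ h).
by have := ler_norm c; lra.
Qed.

Lemma mulmx_sym_dot n (A : 'M[R]_n) (x y : 'rV[R]_n) : A^T = A ->
  dotv (x *m A) y = dotv x (y *m A).
Proof. by move=> sA; rewrite -!dotvE trmx_mul sA mulmxA. Qed.

Lemma lip_quad n (A : 'M[R]_n) : continuous (fun x : 'rV[R]_n => dotv (x *m A) x).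
Proof.
have cc i : continuous (fun x : 'rV[R]_n => x ord0 i).
  by move=> x; apply: differentiable_continuous; exact: differentiable_coord.
have cs (I : Type) (s : seq I) (F : I -> 'rV[R]_n -> R) : (forall i, continuous (F i)) ->
    continuous (fun x => \sum_(i <- s) F i x).
  move=> cF; elim: s => [|i s IH].
    rewrite (_ : (fun x => _) = fun=> 0); first exact: cst_continuous.
    by apply/funext => x; rewrite big_nil.
  rewrite (_ : (fun x => _) = (fun x => F i x + \sum_(j <- s) F j x)).
    by move=> x; exact: (cvgD (cF i x) (IH x)).
  by apply/funext => x; rewrite big_cons.
have cA i : continuous (fun x : 'rV[R]_n => (x *m A) ord0 i).
  rewrite (_ : (fun x => _) = fun x : 'rV[R]_n => \sum_j x ord0 j * A j i).
    by apply: cs => j x; exact: (cvgM (cc j x) (cvg_cst _)).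
  by apply/funext => y; rewrite mxE.
by apply: cs => i x; exact: (cvgM (cA i x) (cc i x)).
Qed.

(** A minimiser e of the quadratic form on the unit sphere is an eigenvector: with w = e A - lam e,
    the nonnegative expression at e + t w has linear coefficient 2 |w|^2, which must vanish. The
    eigenvalue bound therefore applies to the minimum. *)
Lemma rayleigh n (A : 'M[R]_n) (m : R) : (0 < n)%N -> A^T = A ->
  (forall a, eigenvalue A a -> m <= a) -> forall x, m * dotv x x <= dotv (x *m A) x.
Proof.
move=> n0 sA eigA.
pose S := [set x : 'rV[R]_n | dotv x x = 1].
have cdot : continuous (fun x : 'rV[R]_n => dotv x x).
  by have := @lip_quad n 1%:M; under eq_fun do rewrite mulmx1.
have cS : compact S.
  apply: (closed_bounded_compact (r := 1)).
    by apply: (@preimage_closed _ _ (fun x => dotv x x) [set t : R | t = 1]);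
      [move=> x _; exact: cdot|exact: closed_eq].
  move=> x Sx; apply/(rV_norm_leP _ ler01) => i.
  by rewrite -(@ler_sqr _ `|_|) ?nnegrE// expr1n real_normK ?num_real// -Sx coord_sqr_le.
have S0 : S !=set0.
  exists (delta_mx ord0 (Ordinal n0)); rewrite /S /= /dotv (bigD1 (Ordinal n0))//= big1.
    by rewrite !mxE !eqxx mulr1 addr0.
  by move=> j ji; rewrite !mxE (negbTE ji) mulr0.
have [e Se He] := EVT_min_rV S0 cS (continuous_subspaceT (@lip_quad n A)).
pose lam := dotv (e *m A) e.
have Se1 : dotv e e = 1 by exact: set_mem Se.
have minq x : lam * dotv x x <= dotv (x *m A) x.
  have [x0|x0] := eqVneq (dotv x x) 0.
    by rewrite (dotv_eq0 x0) mul0mx /dotv !big1 ?mulr0// => i _; rewrite !mxE mulr0.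
  have xp : 0 < dotv x x by rewrite lt_neqAle eq_sym x0 dotv_ge0.
  pose s := (Num.sqrt (dotv x x))^-1.
  have s2 : s * s * dotv x x = 1.
    by rewrite /s -invfM -expr2 sqr_sqrtr ?ltW// mulVf.
  have Ssx : S (s *: x) by rewrite /S /= dotvZl dotvC dotvZl mulrA.
  have := He _ (mem_set Ssx); rewrite -/lam -scalemxAl dotvZl dotvC dotvZl mulrA (dotvC x).
  by rewrite -(ler_pM2r xp) mulrAC s2 mul1r.
have eigen : e *m A = lam *: e.
  apply/eqP; rewrite -subr_eq0; apply/eqP.
  have [w wE] : exists w, w = e *m A - lam *: e by eexists.
  rewrite -wE; apply: dotv_eq0.
  apply: (@quad_linear_nonneg _ (dotv (w *m A) w - lam * dotv w w)) => t.
  have q1 : dotv (e + t *: w) (e + t *: w) = 1 + 2 * t * dotv e w + t ^+ 2 * dotv w w.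
    rewrite dotvDl dotvZl !dotvDr !dotvZr Se1 (dotvC w e).
    by move: (dotv e w) (dotv w w) => a b; ring.
  have q2 : dotv ((e + t *: w) *m A) (e + t *: w) =
      lam + 2 * t * dotv (e *m A) w + t ^+ 2 * dotv (w *m A) w.
    rewrite mulmxDl -scalemxAl dotvDl dotvZl !dotvDr !dotvZr -/lam.
    rewrite (mulmx_sym_dot w e sA) (dotvC w (e *m A)).
    by move: (dotv (e *m A) w) (dotv (w *m A) w) => a b; ring.
  have ew : dotv w w = dotv (e *m A) w - lam * dotv e w by rewrite {1}wE dotvBl dotvZl.
  have := minq (e + t *: w); rewrite q1 q2 -subr_ge0; congr (is_true (0 <= _)); rewrite ew.
  by move: (dotv (e *m A) w) (dotv e w) (dotv (w *m A) w) => a b c; ring.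
have : m <= lam.
  apply: eigA; apply/eigenvalueP; exists e => //.
  by apply/eqP => e0; move: Se1; rewrite e0 /dotv big1 => [/eqP|i _]; rewrite ?mxE ?mulr0// eq_sym oner_eq0.
by move=> mlam x; apply: le_trans (minq x); rewrite ler_wpM2r// dotv_ge0.
Qed.

Definition qform n (C : 'M[R]_n) (x y : 'rV[R]_n) : R := \sum_j \sum_i C i j * x ord0 i * y ord0 j.

Lemma qformE n (C : 'M[R]_n) (x y : 'rV[R]_n) : (x *m C *m y^T) ord0 ord0 = qform C x y.
Proof.
rewrite mxE; apply: eq_bigr => j _; rewrite !mxE mulr_suml; apply: eq_bigr => i _.
by rewrite (mulrC (x _ _)).
Qed.

Lemma sqr_sum_le n (F : 'I_n -> R) : (\sum_i F i) ^+ 2 <= n%:R * \sum_i F i ^+ 2.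
Proof.
have : 0 <= \sum_i \sum_j (F i - F j) ^+ 2.
  by apply: sumr_ge0 => i _; apply: sumr_ge0 => j _; rewrite sqr_ge0.
have -> : \sum_i \sum_j (F i - F j) ^+ 2 = 2 * (n%:R * \sum_i F i ^+ 2 - (\sum_i F i) ^+ 2).
  transitivity (\sum_i (n%:R * F i ^+ 2 + \sum_j F j ^+ 2 - 2 * F i * \sum_j F j)).
    apply: eq_bigr => i _.
    rewrite (eq_bigr (fun j => F i ^+ 2 + F j ^+ 2 - 2 * F i * F j)); last by move=> j _; ring.
    by rewrite sumrB big_split/= sumr_const card_ord -mulr_sumr -[_ *+ n]mulr_natl.
  rewrite sumrB big_split/= sumr_const card_ord -mulr_sumr -mulr_suml -mulr_sumr -[_ *+ n]mulr_natl.
  by ring.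
by rewrite pmulr_rge0// subr_ge0.
Qed.

Lemma qform_bound n (C : 'M[R]_n) (L : R) (x y : 'rV[R]_n) : 0 <= L ->
  (forall i j, `|C i j| <= L) ->
  qform C x y ^+ 2 <= (n%:R * L) ^+ 2 * (dotv x x * dotv y y).
Proof.
move=> L0 CL.
have h : `|qform C x y| <= L * (\sum_i `|x ord0 i|) * (\sum_j `|y ord0 j|).
  rewrite (le_trans (ler_norm_sum _ _ _))// mulr_sumr; apply: ler_sum => j _.
  rewrite (le_trans (ler_norm_sum _ _ _))// mulr_sumr mulr_suml; apply: ler_sum => i _.
  by rewrite !normrM !ler_wpM2r.
have sq (z : 'rV[R]_n) : (\sum_i `|z ord0 i|) ^+ 2 <= n%:R * dotv z z.
  apply: (le_trans (sqr_sum_le _)); rewrite ler_wpM2l//.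
  by apply: ler_sum => i _; rewrite real_normK ?num_real// expr2.
have s0 (z : 'rV[R]_n) : 0 <= \sum_i `|z ord0 i| by apply: sumr_ge0.
rewrite -real_normK ?num_real//.
apply: (@le_trans _ _ ((L * (\sum_i `|x ord0 i|) * (\sum_j `|y ord0 j|)) ^+ 2)).
  by rewrite lerXn2r// nnegrE !mulr_ge0.
rewrite !exprMn -mulrA.
have -> : n%:R ^+ 2 * L ^+ 2 * (dotv x x * dotv y y) =
  L ^+ 2 * ((n%:R * dotv x x) * (n%:R * dotv y y)) by ring.
by rewrite ler_wpM2l ?sqr_ge0// ler_pM ?sqr_ge0.
Qed.

(** With y = x adj A one has y A = (det A) x. So det A times the cofactor form at x is the form of A
    at y, at least m |y|^2, while det A |x| = |y A| <= n S |y|. *)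
Lemma cof_coercive n (A : 'M[R]_n) (m S c : R) : (0 < n)%N -> A^T = A -> 0 < m -> 0 < c ->
  0 < S -> (forall i j, `|A i j| <= S) -> c <= \det A ->
  (forall x, m * dotv x x <= dotv (x *m A) x) ->
  forall x, m * c / (n%:R * S) ^+ 2 * dotv x x <= qform (cof A) x x.
Proof.
move=> n0 sA m0 c0 S0 AS cA qA x.
have adjE : \adj A = (cof A)^T by apply/matrixP => i j; rewrite !mxE.
pose y := x *m \adj A.
have yA : y *m A = \det A *: x.
  by rewrite /y -mulmxA mul_adj_mx mul_mx_scalar.
have d0 : 0 < \det A by exact: lt_le_trans cA.
have qE : qform (cof A) x x = dotv y x.
  rewrite /dotv /qform exchange_big; apply: eq_bigr => i _; rewrite mxE mulr_suml.
  by apply: eq_bigr => j _; rewrite adjE !mxE; ring.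
have e1 : \det A * dotv y x = dotv (y *m A) y by rewrite yA dotvZl dotvC.
have e2 : \det A ^+ 2 * dotv x x <= (n%:R * S) ^+ 2 * dotv y y.
  have -> : \det A ^+ 2 * dotv x x = dotv (y *m A) (y *m A).
    by rewrite yA dotvZl dotvC dotvZl mulrA expr2.
  rewrite {1}/dotv.
  have hj j : (y *m A) ord0 j * (y *m A) ord0 j <= n%:R * S ^+ 2 * dotv y y.
    rewrite mxE -expr2 (le_trans (sqr_sum_le _))// -mulrA ler_wpM2l// mulr_sumr.
    apply: ler_sum => i _; rewrite exprMn mulrC -expr2 ler_wpM2r ?sqr_ge0//.
    by rewrite -real_normK ?num_real// lerXn2r// nnegrE// ltW.
  apply: (@le_trans _ _ (\sum_(j < n) (n%:R * S ^+ 2 * dotv y y))); first exact: ler_sum.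
  rewrite sumr_const card_ord -[leLHS]mulr_natl.
  by rewrite le_eqVlt; apply/orP; left; apply/eqP; ring.
have nS : 0 < (n%:R * S) ^+ 2 by rewrite exprn_gt0// mulr_gt0// ltr0n.
rewrite qE; have h1 := qA y; rewrite -e1 in h1.
rewrite mulrAC ler_pdivrMr//.
rewrite -(ler_pM2l d0).
have h2 : m * ((n%:R * S) ^+ 2 * dotv y y) <= (n%:R * S) ^+ 2 * (\det A * dotv y x).
  by rewrite mulrCA ler_wpM2l// ltW.
have h3 : m * (\det A ^+ 2 * dotv x x) <= m * ((n%:R * S) ^+ 2 * dotv y y).
  by rewrite ler_wpM2l// ltW.
have h4 : \det A * (m * c * dotv x x) <= m * (\det A ^+ 2 * dotv x x).
  rewrite (_ : \det A * _ = m * (\det A * c * dotv x x)); last by ring.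
  by rewrite ler_wpM2l ?(ltW m0)// ler_wpM2r ?dotv_ge0// expr2 ler_wpM2l// ltW.
apply: (le_trans h4); apply: (le_trans h3); apply: (le_trans h2).
by rewrite le_eqVlt; apply/orP; left; apply/eqP; ring.
Qed.

(** An entrywise change of the cofactors changes the form by at most n times its size, which is
    allowed to use up half of a. *)
Lemma cof_coercive_near n (A B : 'M[R]_n) (a S rho : R) : n = 2%N \/ n = 3%N -> 0 <= S ->
  rho <= 1 -> (forall i j, `|A i j| <= S) -> (forall i j, `|B i j - A i j| <= rho) ->
  (forall x, a * dotv x x <= qform (cof A) x x) ->
  n%:R * ((4 * S + 2) * rho) <= a / 2 ->
  forall x, a / 2 * dotv x x <= qform (cof B) x x.
Proof.
move=> n23 S0 rho1 AS AB qA small x.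
have rho0 : 0 <= rho by case: n23 A B AS AB qA x small => -> A B AS AB *; apply: le_trans (AB ord0 ord0).
have L0 : 0 <= (4 * S + 2) * rho by rewrite mulr_ge0// addr_ge0// mulr_ge0.
have P := cof_perturb n23 S0 rho1 AS AB.
have CL i j : `|(cof B - cof A) i j| <= (4 * S + 2) * rho by rewrite [X in `|X|]mxE [X in _ + X]mxE; exact: P.
have := qform_bound x x L0 CL.
rewrite -expr2 -exprMn -[X in X <= _]real_normK ?num_real// ler_sqr ?nnegrE ?mulr_ge0 ?dotv_ge0//.
rewrite ler_norml => /andP[lo _].
have -> : qform (cof B) x x = qform (cof A) x x + qform (cof B - cof A) x x.
  rewrite /qform -big_split; apply: eq_bigr => j _; rewrite -big_split; apply: eq_bigr => i _.
  by rewrite /= [(cof B - cof A) i j]mxE [(- cof A) i j]mxE; ring.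
have := qA x; have d0 := dotv_ge0 x.
have : n%:R * ((4 * S + 2) * rho) * dotv x x <= a / 2 * dotv x x by rewrite ler_wpM2r.
have alg (p q q' t : R) : p <= a / 2 * t -> a * t <= q -> - p <= q' -> a / 2 * t <= q + q'.
  have -> : a * t = a / 2 * t + a / 2 * t by field.
  by move: (a / 2 * t) => b; lra.
  by move=> h1 h2; exact: alg h1 h2 lo.
by rewrite addr_ge0// mulr_ge0.
Qed.

End cofactor_algebra.

(** * The Monge-Ampere form *)

Lemma bmeas_prod d (X : measurableType d) (R : realType) (D : set X) (I : Type) (s : seq I)
  (F : I -> X -> R) : (forall i, bmeas D (F i)) -> bmeas D (fun x => \prod_(i <- s) F i x).
Proof.
move=> bF; elim: s => [|i s IH].
  by apply: (eq_bmeas _ (@bmeas_cst _ X R D 1)) => x _; rewrite big_nil.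
by apply: (eq_bmeas _ (bmeasM (bF i) IH)) => x _; rewrite big_cons.
Qed.

Lemma bmeas_det d (X : measurableType d) (R : realType) (D : set X) n (A : X -> 'M[R]_n) :
  (forall i j, bmeas D (fun x => A x i j)) -> bmeas D (fun x => \det (A x)).
Proof.
move=> bA; apply: bmeas_sum => s _; apply: bmeasZ; apply: bmeas_prod => i; exact: bA.
Qed.

Lemma bmeas_cof d (X : measurableType d) (R : realType) (D : set X) n (A : X -> 'M[R]_n) i j :
  (forall i j, bmeas D (fun x => A x i j)) -> bmeas D (fun x => cof (A x) i j).
Proof.
move=> bA; apply: (eq_bmeas (f := fun x => (-1) ^+ (i + j) * \det (row' i (col' j (A x))))).
  by move=> x _; rewrite mxE.
apply: bmeasZ; apply: bmeas_det => k l.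
by apply: (eq_bmeas _ (bA (lift i k) (lift j l))) => x _; rewrite !mxE.
Qed.

Lemma lim_eq (R : realType) (a b : nat -> R) (x y : R) : (forall m, a m = b m) ->
  a m @[m --> \oo] --> x -> b m @[m --> \oo] --> y -> x = y.
Proof.
by move=> /funext -> ax bx; exact: (cvg_unique (@norm_hausdorff _ _) ax bx).
Qed.

Lemma mx_subE (R : realType) n (A B : 'M[R]_n) i j : (A - B) i j = A i j - B i j.
Proof. by rewrite !mxE. Qed.

Lemma mx_midE (R : realType) n (c : R) (A B : 'M[R]_n) i j :
  (c *: (A + B)) i j = c * (A i j + B i j).
Proof. by rewrite !mxE. Qed.

Section monge_ampere_form.
Context {R : realType} {n : nat}.
Local Notation E := 'rV[R]_n.
Local Notation mu := (lebesgue_rV n : {measure set 'rV[R]_n -> \bar R}).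
Variables (Omega : set E) (T : seq (n.+1.-tuple E)).
Hypotheses (n23 : n = 2%N \/ n = 3%N) (domO : convex_polyhedral_domain Omega)
  (triT : triangulation Omega T).
Variable r : R.
Hypotheses (r0 : 0 < r) (clr : forall x, closure Omega x -> `|x| < r).

Let n1 : (1 < n)%N. Proof. by case: n23 => ->. Qed.
Let n0 : (0 < n)%N := ltnW n1.
Let oO : open Omega := domain_open domO.
Let Or x : Omega x -> `|x| < r. Proof. by move/subset_closure/clr. Qed.
Let G := mesh_interior T.
Let oG : open G := @mesh_interior_open _ _ T.
Let GO : G `<=` Omega := @mesh_interior_sub _ _ _ _ domO triT.
Let Gr x : G x -> `|x| < r. Proof. by move/GO/Or. Qed.
Let mG : measurable G := open_rV_measurable oG.
Let fG : (mu G < +oo)%E := bounded_lt_pinfty mG Gr.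
Let mO : measurable Omega := open_rV_measurable oO.
Let fO : (mu Omega < +oo)%E := bounded_lt_pinfty mO Or.
Local Notation adm := (admissible Omega T).

Lemma Rint_mesh (f : E -> R) : bmeas Omega f ->
  \int[mu]_(x in Omega) f x = \int[mu]_(x in G) f x.
Proof.
move=> bf; have [N [mN N0] HN] := mesh_boundary_null n0 triT.
rewrite (Rint_null mO fO mN N0 bf) [RHS](Rint_null mG fG mN N0 (bmeasS mO GO bf)).
congr (Rintegral _ _ _); apply/seteqP; split => x [h1 h2]; split=> //; last exact: GO.
by case: (HN _ h1).
Qed.

Lemma adm_hess_bound v : adm v -> exists2 M : R, 0 <= M &
  forall x i k, G x -> `|partial i (partial k v) x| <= M.
Proof.
move=> [_ C2v [M M0 [_ lpv]]]; exists M => // x i k Gx.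
have dv y : G y -> differentiable (partial k v) y by move=> /(C2v.2 k)[].
have [h lh Hh] := lip_on_extension oO M0 GO (lpv k) dv.
have [_ _ <-] := Hh _ Gx.
by apply: ((lip_partial i mG Gr lh _).2 _ Gx) => y /Hh[].
Qed.

Lemma adm_hess_bmeas v i k : adm v -> bmeas G (partial i (partial k v)).
Proof.
move=> av; have [M M0 HM] := adm_hess_bound av; have [_ C2v _] := av.
split; last by exists M => x; exact: HM.
by apply: continuous_on_measurable => // x /(C2v.2 k)[_].
Qed.

Lemma adm_cof_bmeas v i j : adm v -> bmeas G (fun x => cof (hessian v x) i j).
Proof.
move=> av; apply: bmeas_cof => k l.
by apply: (eq_bmeas _ (adm_hess_bmeas k l av)) => x _; rewrite hessianE.
Qed.

Lemma adm_bmeas v : adm v -> bmeas G v /\ forall i, bmeas G (partial i v).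
Proof.
move=> /admissible_nice nv; have [h1 h2] := nice_bmeas oO Or nv.
by split=> [|i]; apply: (bmeasS mO GO).
Qed.

(** Coefficient, argument and test function are kept apart because Simpson's rule produces forms
    whose coefficient differs from the argument. *)
Definition mform v c w : R :=
  \int[mu]_(x in G) qform (cof (hessian v x)) (gradient w x) (gradient c x).

Lemma qform_gradE (v c w : E -> R) x : qform (cof (hessian v x)) (gradient w x) (gradient c x) =
  \sum_j \sum_i cof (hessian v x) i j * partial i w x * partial j c x.
Proof.
by apply: eq_bigr => j _; apply: eq_bigr => i _; rewrite /gradient [(\row_ _ _) _ _]mxE [in X in _ * X]mxE.
Qed.

Lemma qform_grad_bmeas v c w : adm v -> (forall i, bmeas G (partial i c)) ->
  (forall i, bmeas G (partial i w)) ->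
  bmeas G (fun x => qform (cof (hessian v x)) (gradient w x) (gradient c x)).
Proof.
move=> av bc bw.
apply: (eq_bmeas (f := fun x => \sum_j \sum_i cof (hessian v x) i j * partial i w x * partial j c x)).
  by move=> x _; rewrite qform_gradE.
apply: bmeas_sum => j _; apply: bmeas_sum => i _.
exact: (bmeasM (bmeasM (adm_cof_bmeas i j av) (bw i)) (bc j)).
Qed.

Definition cofhess v c (x : E) : R := mxdot (cof (hessian v x)) (hessian c x).

Lemma cofhess_bmeas v c : adm v -> adm c -> bmeas G (cofhess v c).
Proof.
move=> av ac; apply: bmeas_sum => j _; apply: bmeas_sum => i _.
apply: (bmeasM (adm_cof_bmeas i j av)).
by apply: (eq_bmeas _ (adm_hess_bmeas i j ac)) => x _; rewrite hessianE.
Qed.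

(** The Piola identity for column j, applied to phi times the j-th derivative of c, moves the
    derivative from phi to c. Derivatives of the cofactors never appear, so second derivatives
    suffice; summation over j gives the form in terms of cof D^2 v : D^2 c. *)
Lemma mform_test v c phi : adm v -> adm c -> test_function Omega phi ->
  mform v c phi = - \int[mu]_(x in G) (phi x * cofhess v c x).
Proof.
move=> av ac tphi.
have [N [mN N0] HN] := mesh_boundary_null n0 triT.
have [Cv C2v [M M0 [lv lpv]]] := av.
have [Cc C2c [M' M'0 [lc lpc]]] := ac.
have cphi x : differentiable phi x by exact: cinf_differentiable (test_function_cinf tphi).
have [bp bpp] := nice_bmeas oO Or (test_nice tphi).
have {}bp := bmeasS mO GO bp; have {}bpp i := bmeasS mO GO (bpp i).
have [bc bpc] := adm_bmeas ac.
pose g j (x : E) := \sum_i cof (hessian v x) i j * partial i phi x * partial j c x.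
pose h j (x : E) := phi x * \sum_i cof (hessian v x) i j * partial i (partial j c) x.
have bg j : bmeas G (g j).
  by apply: bmeas_sum => i _; exact: (bmeasM (bmeasM (adm_cof_bmeas i j av) (bpp i)) (bpc j)).
have bh j : bmeas G (h j).
  apply: (bmeasM bp); apply: bmeas_sum => i _.
  exact: (bmeasM (adm_cof_bmeas i j av) (adm_hess_bmeas i j ac)).
have P j : \int[mu]_(x in G) (h j x + g j x) = 0.
  have [A [L [cA AO A0 lf]]] := test_mul_lip Or tphi M'0 (lpc j).
  have off x : ~ A x -> phi x * partial j c x = 0 by move=> /A0 ->; rewrite mul0r.
  have df x : G x -> differentiable (fun y => phi y * partial j c y) x.
    by move=> Gx; apply: differentiableM => //; case: (C2c.2 j _ Gx).
  rewrite -(@piola _ _ r L M Omega A G N (fun x => phi x * partial j c x) v j n23 r0 oO Or cA AO oG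
    GO mN N0 HN lf off df M0 lpv (fun x k Gx => (C2v.2 k x Gx).1)
    (fun x i k Gx => schwarz i k oG C2v Gx)).
  apply: eq_Rintegral => x /set_mem Gx; rewrite /h /g mulr_sumr -big_split; apply: eq_bigr => i _.
  rewrite /= partialM//; last by case: (C2c.2 j _ Gx).
  by move: (cof _ _ _) (phi x) (partial _ _ _) (partial _ _ _) (partial _ _ _) => *; ring.
have -> : mform v c phi = \int[mu]_(x in G) \sum_j g j x.
  by apply: eq_Rintegral => x _; rewrite qform_gradE.
have -> : \int[mu]_(x in G) (phi x * cofhess v c x) = \int[mu]_(x in G) \sum_j h j x.
  apply: eq_Rintegral => x _; rewrite /cofhess /mxdot mulr_sumr; apply: eq_bigr => j _.
  by rewrite /h; congr (_ * _); apply: eq_bigr => i _; rewrite hessianE.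
have Eg : \int[mu]_(x in G) \sum_j g j x = \sum_j \int[mu]_(x in G) g j x.
  exact: (Rint_sum mG fG _ (fun j _ => bg j)).
have Eh : \int[mu]_(x in G) \sum_j h j x = \sum_j \int[mu]_(x in G) h j x.
  exact: (Rint_sum mG fG _ (fun j _ => bh j)).
rewrite Eg Eh.
rewrite -sumrN; apply: eq_bigr => j _.
by apply/eqP; rewrite -addr_eq0 addrC -(RintD mG fG (bh j) (bg j)) P.
Qed.

(** Bounded pointwise convergence of test functions with their gradients: what dominated convergence
    asks for to carry identities from test functions to w. *)
Definition test_approximable w := nice Omega w /\ exists (phi : nat -> E -> R) (B : R), [/\ 0 <= B,
  forall m, test_function Omega (phi m),
  forall m x, Omega x -> `|phi m x| <= B /\ forall i, `|partial i (phi m) x| <= B,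
  forall x, Omega x -> phi m x @[m --> \oo] --> w x &
  forall x i, Omega x -> partial i (phi m) x @[m --> \oo] --> partial i w x].

Lemma mform_cvg v c w (phi : nat -> E -> R) (B : R) : adm v -> adm c -> 0 <= B ->
  (forall m, test_function Omega (phi m)) ->
  (forall m x, Omega x -> forall i, `|partial i (phi m) x| <= B) ->
  (forall x i, Omega x -> partial i (phi m) x @[m --> \oo] --> partial i w x) ->
  mform v c (phi m) @[m --> \oo] --> mform v c w.
Proof.
move=> av ac B0 tphi phiB cphi.
have bphi m i : bmeas G (partial i (phi m)).
  have [_ h] := nice_bmeas oO Or (test_nice (tphi m)); exact: (bmeasS mO GO (h i)).
have [bc bpc] := adm_bmeas ac.
pose cf (x : E) i := \sum_j cof (hessian v x) i j * partial j c x.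
have bcf i : bmeas G (cf ^~ i).
  by apply: bmeas_sum => j _; exact: (bmeasM (adm_cof_bmeas i j av) (bpc j)).
have /choice[C HC] (i : 'I_n) : exists C : R, forall x, G x -> `|cf x i| <= C.
  by have [_ [C HC]] := bcf i; exists C.
have eqf f x : qform (cof (hessian v x)) (gradient f x) (gradient c x) =
    \sum_i cf x i * partial i f x.
  rewrite qform_gradE exchange_big; apply: eq_bigr => i _; rewrite mulr_suml.
  by apply: eq_bigr => j _; rewrite mulrAC.
have bF m : bmeas G (fun x => \sum_i cf x i * partial i (phi m) x).
  by apply: bmeas_sum => i _; exact: (bmeasM (bcf i) (bphi m i)).
have FB m x : G x -> `|\sum_i cf x i * partial i (phi m) x| <= \sum_i `|C i| * B.
  move=> Gx; rewrite (le_trans (ler_norm_sum _ _ _))//; apply: ler_sum => i _.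
  rewrite normrM ler_pM// ?phiB//; last exact: GO.
  by rewrite (le_trans (HC i _ Gx))// ler_norm.
have cF x : G x -> \sum_i cf x i * partial i (phi m) x @[m --> \oo] -->
    \sum_i cf x i * partial i w x.
  move=> Gx; apply: cvg_sumn => i; apply: cvgM; first exact: cvg_cst.
  by apply: cphi; exact: GO.
have [_ H] := @bounded_cvg _ _ _ mu G mG fG _ (fun m x => \sum_i cf x i * partial i (phi m) x) _
  (fun m => (bF m).1) FB cF.
have Ew f : mform v c f = \int[mu]_(x in G) \sum_i cf x i * partial i f x.
  by apply: eq_Rintegral => x _; exact: eqf.
have Ef : (fun m => mform v c (phi m)) =
    (fun m => \int[mu]_(x in G) \sum_i cf x i * partial i (phi m) x).
  by apply/funext => m; exact: Ew.
move: H; rewrite -Ew -Ef; apply.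
Qed.

(** As cof D^2 u : D^2 u = n det D^2 u, the form at u is the source term; the factor n cancels
    against the one in [ma_form]. *)
Lemma mform_source u f w : adm u -> (forall x, G x -> \det (hessian u x) = f x) ->
  test_approximable w -> mform u u w = - n%:R * \int[mu]_(x in G) (f x * w x).
Proof.
move=> au uf [nw [phi [B [B0 tphi phiB cphi cpphi]]]].
have bf : bmeas G f.
  apply: (eq_bmeas (f := fun x => \det (hessian u x))) => //.
  by apply: bmeas_det => i j; apply: (eq_bmeas _ (adm_hess_bmeas i j au)) => x _; rewrite hessianE.
have bphi m : bmeas G (phi m).
  have [h _] := nice_bmeas oO Or (test_nice (tphi m)); exact: (bmeasS mO GO h).
have E m : mform u u (phi m) = - n%:R * \int[mu]_(x in G) (f x * phi m x).
  rewrite mform_test// mulNr -(RintZ mG fG _ (bmeasM bf (bphi m))); congr (- _).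
  apply: eq_Rintegral => x /set_mem Gx; rewrite /cofhess mxdot_cof uf//.
  by rewrite mulrCA (mulrC (phi m x)).
have c1 := mform_cvg au au B0 tphi (fun m x Ox => (phiB m x Ox).2) cpphi.
have c2 : - n%:R * \int[mu]_(x in G) (f x * phi m x) @[m --> \oo] -->
    - n%:R * \int[mu]_(x in G) (f x * w x).
  apply: (cvgM (cvg_cst _)); have [_ [C HC]] := bf.
  apply: (@Rint_cvgM _ _ G C B (fun=> f) phi f w mG fG (fun=> bf) bphi (fun _ => HC)).
  - by move=> m y /GO /(phiB m)[].
  - by move=> y _; exact: cvg_cst.
  - by move=> y /GO; exact: cphi.
exact: (lim_eq E c1 c2).
Qed.

Definition mid v1 v2 (x : E) : R := 2^-1 * (v1 x + v2 x).

Lemma adm_mid v1 v2 : adm v1 -> adm v2 -> adm (mid v1 v2).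
Proof. by move=> a1 a2; apply: admissibleZ => //; exact: admissibleD. Qed.

Lemma adm_sub v1 v2 : adm v1 -> adm v2 -> adm (fun x => v1 x - v2 x).
Proof.
move=> a1 a2; have := admissibleD domO a1 (admissibleZ domO (- 1) a2).
by rewrite (_ : (fun x => v1 x + _) = (fun x => v1 x - v2 x))//; apply/funext => x; rewrite mulN1r.
Qed.

Lemma hessian_sub v1 v2 x : adm v1 -> adm v2 -> G x ->
  hessian (fun y => v1 y - v2 y) x = hessian v1 x - hessian v2 x.
Proof.
move=> [_ C1' _] [_ C2' _] Gx; apply/matrixP => i j.
apply: (etrans (hessianE _ _ _ _)); apply: (etrans _ (esym (mx_subE _ _ _ _))).
apply: (etrans _ (esym (f_equal2 (fun a b => a - b) (hessianE v1 x i j) (hessianE v2 x i j)))).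
have e y : G y -> partial j (fun z => v1 z - v2 z) y = partial j v1 y - partial j v2 y.
  by move=> Gy; apply: partialB; [case: (C1'.1 _ Gy)|case: (C2'.1 _ Gy)].
rewrite (partial_congr i oG e Gx) partialB//; first by case: (C1'.2 j _ Gx).
by case: (C2'.2 j _ Gx).
Qed.

Lemma hessian_mid v1 v2 x : adm v1 -> adm v2 -> G x ->
  hessian (mid v1 v2) x = 2^-1 *: (hessian v1 x + hessian v2 x).
Proof.
move=> [_ C1' _] [_ C2' _] Gx; apply/matrixP => i j.
apply: (etrans (hessianE _ _ _ _)); apply: (etrans _ (esym (mx_midE _ _ _ _ _))).
apply: (etrans _ (esym (f_equal2 (fun a b => _ * (a + b)) (hessianE v1 x i j) (hessianE v2 x i j)))).
have e y : G y -> partial j (mid v1 v2) y = 2^-1 * (partial j v1 y + partial j v2 y).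
  move=> Gy; have d1 : differentiable v1 y by case: (C1'.1 _ Gy).
  have d2 : differentiable v2 y by case: (C2'.1 _ Gy).
  by rewrite /mid partialZ ?partialD//; exact: differentiableD.
have d1 : differentiable (partial j v1) x by case: (C1'.2 j _ Gx).
have d2 : differentiable (partial j v2) x by case: (C2'.2 j _ Gx).
by rewrite (partial_congr i oG e Gx) partialZ ?partialD//; exact: differentiableD.
Qed.

Lemma simpson_integrals (F1 F2 A1 A2 A3 : E -> R) : bmeas G F1 -> bmeas G F2 -> bmeas G A1 ->
  bmeas G A2 -> bmeas G A3 ->
  (forall x, G x -> 6 * (F1 x - F2 x) = n%:R * (A1 x + 4 * A2 x + A3 x)) ->
  6 * (\int[mu]_(x in G) F1 x - \int[mu]_(x in G) F2 x) =
  n%:R * (\int[mu]_(x in G) A1 x + 4 * \int[mu]_(x in G) A2 x + \int[mu]_(x in G) A3 x).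
Proof.
move=> b1 b2 c1 c2 c3 H.
rewrite -(RintB mG fG b1 b2) -(RintZ mG fG 4 c2) -(RintD mG fG c1 (bmeasZ 4 c2)).
rewrite -(RintD mG fG (bmeasD c1 (bmeasZ 4 c2)) c3).
rewrite -(RintZ mG fG 6 (bmeasD b1 (bmeasN b2))).
rewrite -(RintZ mG fG _ (bmeasD (bmeasD c1 (bmeasZ 4 c2)) c3)).
by apply: eq_Rintegral => x /set_mem; exact: H.
Qed.

(** Against a test function all forms become integrals of phi times expressions in the Hessians,
    where [det_simpson] applies pointwise; the mean of the Hessians is the Hessian of
    [mid v1 v2]. *)
Lemma mform_diff_test v1 v2 phi : adm v1 -> adm v2 -> test_function Omega phi ->
  6 * (mform v1 v1 phi - mform v2 v2 phi) =
  n%:R * (mform v1 (fun x => v1 x - v2 x) phi + 4 * mform (mid v1 v2) (fun x => v1 x - v2 x) phi +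
    mform v2 (fun x => v1 x - v2 x) phi).
Proof.
move=> a1 a2 tphi; have am := adm_mid a1 a2; have az := adm_sub a1 a2.
have [bp _] := nice_bmeas oO Or (test_nice tphi).
have {}bp := bmeasS mO GO bp.
have b11 := bmeasM bp (cofhess_bmeas a1 a1); have b22 := bmeasM bp (cofhess_bmeas a2 a2).
have b1 := bmeasM bp (cofhess_bmeas a1 az); have b2 := bmeasM bp (cofhess_bmeas a2 az).
have bm := bmeasM bp (cofhess_bmeas am az).
rewrite !mform_test//.
have alg (a b c d e : R) : 6 * (a - b) = n%:R * (c + 4 * d + e) ->
    6 * (- a - - b) = n%:R * (- c + 4 * - d + - e).
  by rewrite (_ : - c + 4 * - d + - e = - (c + 4 * d + e)); [rewrite mulrN => <-|]; ring.
apply: alg; apply: simpson_integrals => // x Gx.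
have hs := hessian_sub a1 a2 Gx; have hm := hessian_mid a1 a2 Gx.
have e11 : cofhess v1 v1 x = n%:R * \det (hessian v1 x) by exact: mxdot_cof.
have e22 : cofhess v2 v2 x = n%:R * \det (hessian v2 x) by exact: mxdot_cof.
have e1 : cofhess v1 (fun y => v1 y - v2 y) x =
    mxdot (cof (hessian v1 x)) (hessian v1 x - hessian v2 x) := f_equal (mxdot _) hs.
have e2 : cofhess v2 (fun y => v1 y - v2 y) x =
    mxdot (cof (hessian v2 x)) (hessian v1 x - hessian v2 x) := f_equal (mxdot _) hs.
have em : cofhess (mid v1 v2) (fun y => v1 y - v2 y) x =
    mxdot (cof (2^-1 *: (hessian v1 x + hessian v2 x))) (hessian v1 x - hessian v2 x) :=
  f_equal2 (fun A B => mxdot (cof A) B) hm hs.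
rewrite e11 e22 e1 e2 em.
have alg' (d1 d2 m1 m2 m3 p : R) : 6 * (d1 - d2) = m1 + 4 * m2 + m3 ->
    6 * (p * (n%:R * d1) - p * (n%:R * d2)) = n%:R * (p * m1 + 4 * (p * m2) + p * m3).
  move=> H; transitivity (n%:R * p * (6 * (d1 - d2))); first by ring.
  by rewrite H; ring.
exact: (alg' _ _ _ _ _ _ (det_simpson (hessian v1 x) (hessian v2 x) n23)).
Qed.

Lemma mform_diff v1 v2 w : adm v1 -> adm v2 -> test_approximable w ->
  6 * (mform v1 v1 w - mform v2 v2 w) =
  n%:R * (mform v1 (fun x => v1 x - v2 x) w + 4 * mform (mid v1 v2) (fun x => v1 x - v2 x) w +
    mform v2 (fun x => v1 x - v2 x) w).
Proof.
move=> a1 a2 [nw [phi [B [B0 tphi phiB cphi cpphi]]]].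
have am := adm_mid a1 a2; have az := adm_sub a1 a2.
have C v c (av : adm v) (ac : adm c) :=
  mform_cvg av ac B0 tphi (fun m x Ox => (phiB m x Ox).2) cpphi.
have c1 : 6 * (mform v1 v1 (phi m) - mform v2 v2 (phi m)) @[m --> \oo] -->
    6 * (mform v1 v1 w - mform v2 v2 w).
  exact: (cvgM (cvg_cst _) (cvgB (C _ _ a1 a1) (C _ _ a2 a2))).
have c2 : n%:R * (mform v1 (fun x => v1 x - v2 x) (phi m) +
    4 * mform (mid v1 v2) (fun x => v1 x - v2 x) (phi m) +
    mform v2 (fun x => v1 x - v2 x) (phi m)) @[m --> \oo] -->
    n%:R * (mform v1 (fun x => v1 x - v2 x) w + 4 * mform (mid v1 v2) (fun x => v1 x - v2 x) w +
    mform v2 (fun x => v1 x - v2 x) w).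
  apply: cvgM; first exact: cvg_cst.
  apply: cvgD; last exact: C.
  apply: cvgD; first exact: C.
  by apply: cvgM; [exact: cvg_cst|exact: C].
by apply: (lim_eq _ c1 c2) => m; apply: mform_diff_test.
Qed.

(** The open simplices are disjoint, so the sum over the elements is one integral over their
    union. *)
Lemma ma_formE v w : adm v -> adm w -> ma_form T v w = - n%:R^-1 * mform v v w.
Proof.
move=> av aw; rewrite /ma_form; congr (_ * _).
have [bv bpv] := adm_bmeas av; have [bw bpw] := adm_bmeas aw.
have bq := qform_grad_bmeas av bpv bpw.
rewrite (eq_bigr (fun K : n.+1.-tuple E => \int[mu]_(x in (hull K)°)
    qform (cof (hessian v x)) (gradient w x) (gradient v x))); last first.
  by move=> K _; apply: eq_Rintegral => x _; rewrite qformE.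
rewrite /mform; move: (fun x => qform _ _ _) bq => q bq.
have GE : G = [set x | exists2 K, K \in T & (hull K)° x].
  by apply/seteqP; split => [x [K KT Kx]|x [K KT Kx]]; exists K.
have [uT _ _ disj _] := triT.
have : forall s : seq (n.+1.-tuple E), uniq s -> {subset s <= T} ->
    \sum_(K <- s) \int[mu]_(x in (hull K)°) q x =
    \int[mu]_(x in [set x | exists2 K, K \in s & (hull K)° x]) q x.
  elim=> [|K s IH] us sT.
    rewrite big_nil (_ : [set _ | _] = set0) ?Rintegral_set0//.
    by apply/seteqP; split => x // [].
  move: us => /= /andP[Ks us].
  have KT : K \in T by apply: sT; rewrite mem_head.
  have sT' : {subset s <= T} by move=> K' Ks'; apply: sT; rewrite inE Ks' orbT.
  have -> : [set x | exists2 K0, K0 \in K :: s & (hull K0)° x] =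
      (hull K)° `|` [set x | exists2 K0, K0 \in s & (hull K0)° x].
    apply/seteqP; split => x /=.
      by move=> [j]; rewrite inE => /predU1P[->|js] Aj; [left|right; exists j].
    by move=> [Ai|[j js Aj]]; [exists K; rewrite ?mem_head|exists j => //; rewrite inE js orbT].
  rewrite big_cons IH//.
  have oK : open (hull K)° by exact: open_interior.
  have os : open [set x | exists2 K0, K0 \in s & (hull K0)° x].
    rewrite (_ : [set _ | _] = \bigcup_(K0 in [set` s]) (hull K0)°); last first.
      by apply/seteqP; split => [x [K0 h1 h2]|x [K0 h1 h2]]; exists K0.
    by apply: bigcup_open => K0 _; exact: open_interior.
  have mK := open_rV_measurable oK; have ms := open_rV_measurable os.
  have UG : (hull K)° `|` [set x | exists2 K0, K0 \in s & (hull K0)° x] `<=` G.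
    by move=> x [Kx|[K0 h Kx]]; [exists K|exists K0 => //; exact: sT'].
  rewrite Rintegral_setU//.
  - apply: (integrableS mG _ UG); first exact: measurableU.
    exact: bmeas_integrable.
  - apply/disj_setPS => x [Kx [K0 K0s K0x]].
    have KK0 : K != K0 by apply/eqP => h; rewrite h K0s in Ks.
    by rewrite -(disj K K0 KT (sT' _ K0s) KK0).
by move=> /(_ T uT (fun _ => id)) ->; rewrite GE.
Qed.

End monge_ampere_form.

(** * Strongly monotone equations *)

Lemma sum_coord_continuous (R : realType) (m k : nat) (h : 'I_k -> 'rV[R]_m -> R) :
  (forall i, continuous (h i)) -> continuous (fun x => \sum_i h i x * h i x).
Proof.
move=> ch.
have : forall s : seq 'I_k, continuous (fun x => \sum_(i <- s) h i x * h i x).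
  elim=> [|i s IH].
    rewrite (_ : (fun x => _) = fun=> 0); first exact: cst_continuous.
    by apply/funext => x; rewrite big_nil.
  rewrite (_ : (fun x => _) = (fun x => h i x * h i x + \sum_(j <- s) h j x * h j x)).
    by move=> x; exact: (cvgD (cvgM (ch i x) (ch i x)) (IH x)).
  by apply/funext => x; rewrite big_cons.
exact.
Qed.

Lemma dotv0 (R : realType) m (x : 'rV[R]_m) : dotv 0 x = 0.
Proof. by rewrite /dotv big1// => i _; rewrite mxE mul0r. Qed.

Lemma dotv_sqrB (R : realType) m (x y : 'rV[R]_m) :
  dotv (x - y) (x - y) = dotv x x - 2 * dotv x y + dotv y y.
Proof.
rewrite dotvBl !(dotvC _ (x - y)) !dotvBl (dotvC y x).
by move: (dotv x x) (dotv x y) (dotv y y) => a b c; ring.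
Qed.

Lemma dotv_sqrD2 (R : realType) m (x y : 'rV[R]_m) :
  dotv (x - y) (x - y) <= 2 * dotv x x + 2 * dotv y y.
Proof.
have := dotv_ge0 (x + y); rewrite dotv_sqrB dotvDl !dotvDr (dotvC y x).
by move: (dotv x x) (dotv x y) (dotv y y) => a b c; lra.
Qed.

Lemma dotv_norm_le (R : realType) m (x : 'rV[R]_m) : dotv x x <= m%:R * `|x| ^+ 2.
Proof.
rewrite mulr_natl -[X in _ <= _ *+ X](card_ord m) -sumr_const; apply: ler_sum => i _.
by rewrite -expr2 -real_normK ?num_real// lerXn2r ?nnegrE// coord_norm_le.
Qed.

Lemma norm_dotv_le (R : realType) m (x : 'rV[R]_m) (a : R) : 0 <= a ->
  dotv x x <= a ^+ 2 -> `|x| <= a.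
Proof.
move=> a0 H; apply/(rV_norm_leP _ a0) => i.
rewrite -(@ler_sqr _ `|_|) ?nnegrE// real_normK ?num_real//.
exact: le_trans (coord_sqr_le x i) H.
Qed.

(* The step [x - (c / L) F x] would strictly decrease |F|^2 at a nonzero minimum of it on
   the ball; strong monotonicity keeps that minimum well inside the ball. *)
Lemma monotone_zero (R : realType) m (F : 'rV[R]_m -> 'rV[R]_m) (c L rho : R) :
  0 < c -> c ^+ 2 <= L -> 0 < rho ->
  (forall x y, dotv x x <= rho ^+ 2 -> dotv y y <= rho ^+ 2 ->
    c * dotv (x - y) (x - y) <= dotv (F x - F y) (x - y)) ->
  (forall x y, dotv x x <= rho ^+ 2 -> dotv y y <= rho ^+ 2 ->
    dotv (F x - F y) (F x - F y) <= L * dotv (x - y) (x - y)) ->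
  dotv (F 0) (F 0) <= (c * rho / 4) ^+ 2 ->
  exists2 x, dotv x x <= rho ^+ 2 & F x = 0.
Proof.
move=> c0 cL rho0 mono lipF F0.
have L0 : 0 < L by apply: lt_le_trans cL; rewrite exprn_gt0.
pose B := [set x : 'rV[R]_m | dotv x x <= rho ^+ 2].
have B0 : B 0 by rewrite /B /= dotv0 sqr_ge0.
have cdot : continuous (fun x : 'rV[R]_m => dotv x x).
  by apply: (@sum_coord_continuous _ _ _ (fun i (x : 'rV[R]_m) => x ord0 i)) => i x;
    apply: differentiable_continuous; exact: differentiable_coord.
have cB : compact B.
  apply: (closed_bounded_compact (r := rho)).
    by apply: (@preimage_closed _ _ (fun x => dotv x x) [set t : R | t <= rho ^+ 2]);
      [move=> x _; exact: cdot|exact: closed_le].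
  by move=> x; apply: norm_dotv_le; exact: ltW.
pose M := Num.sqrt (L * m%:R).
have lF i : lip_on B M (fun x => F x ord0 i).
  move=> x y Bx By; have M0 : 0 <= M * `|x - y| by rewrite mulr_ge0// sqrtr_ge0.
  have := norm_dotv_le M0 (x := F x - F y).
  have h : dotv (F x - F y) (F x - F y) <= (M * `|x - y|) ^+ 2.
    apply: (le_trans (lipF _ _ Bx By)); rewrite exprMn sqr_sqrtr ?mulr_ge0 ?(ltW L0)//.
    by rewrite -mulrA ler_pM2l// dotv_norm_le.
  by move=> /(_ h) /(rV_norm_leP _ M0) /(_ i); rewrite !mxE.
(* F is controlled on the ball only; Lipschitz extensions of its components make |F|^2 the
   restriction of a continuous function, which attains its minimum. *)
have /choice[h Hh] i : exists h : 'rV[R]_m -> R,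
    lip M h /\ forall x, B x -> h x = F x ord0 i.
  by have [h] := mcshane (ex_intro _ 0 B0) (sqrtr_ge0 _) (lF i); exists h.
have hE x : B x -> \sum_i h i x * h i x = dotv (F x) (F x).
  by move=> Bx; apply: eq_bigr => i _; rewrite (Hh i).2.
have ch := sum_coord_continuous (fun i => lip_continuous (Hh i).1).
have [x /set_mem Bx minx] := EVT_min_rV (ex_intro _ 0 B0) cB (continuous_subspaceT ch).
have {}minx y : B y -> dotv (F x) (F x) <= dotv (F y) (F y).
  by move=> By; rewrite -!hE//; apply: minx; exact: mem_set.
exists x => //; apply: dotv_eq0.
have phi0 := dotv_ge0 (F x).
have phi1 := le_trans (minx _ B0) F0.
(* Both |F x| and |F 0| are at most c rho / 4, so c |x| <= |F x - F 0| <= c rho / 2. *)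
have x2 : dotv x x <= rho ^+ 2 / 4.
  have h1 := mono _ _ Bx B0; rewrite subr0 in h1.
  have h2 := dotv_ge0 (F x - F 0 - c *: x).
  rewrite dotv_sqrB !dotvZr dotvZl in h2.
  have h3 := dotv_sqrD2 (F x) (F 0).
  have alg (p q s f g : R) : c * p <= q -> 0 <= s - 2 * (c * q) + c * (c * p) ->
      s <= 2 * f + 2 * g -> f <= (c * rho / 4) ^+ 2 -> g <= (c * rho / 4) ^+ 2 ->
      p <= rho ^+ 2 / 4.
    move=> e1 e2 e3 e4 e5; rewrite -(ler_pM2l (exprn_gt0 2 c0)).
    have e6 : c * (c * p) <= c * q by rewrite ler_pM2l.
    have -> : c ^+ 2 * (rho ^+ 2 / 4) = 4 * (c * rho / 4) ^+ 2 by field.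
    by rewrite expr2 -mulrA; move: e2 e3 e4 e5 e6; move: (_ ^+ 2) (c * q) (c * (c * p)) => a1 a2 a3; lra.
  exact: (alg _ _ _ _ _ h1 h2 h3 phi1 F0).
(* This step minimises the bound 1 - 2 c t + L t^2 on the ratio of |F y|^2 to |F x|^2; the minimum
   is 1 - c^2 / L. As t c <= 1, the point y remains in the ball. *)
pose t := c / L.
have t0 : 0 < t by rewrite divr_gt0.
have tc : t * c <= 1 by rewrite /t mulrAC ler_pdivrMr// mul1r -expr2.
pose y := x - t *: F x.
have By : B y.
  have := dotv_sqrD2 x (t *: F x); rewrite -/y dotvZl dotvZr /B /= => h1.
  have h2 : t * (t * dotv (F x) (F x)) <= rho ^+ 2 / 16.
    apply: (@le_trans _ _ (t * (t * (c * rho / 4) ^+ 2))).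
      by rewrite ler_pM2l// ler_pM2l.
    rewrite (_ : t * _ = (t * c) ^+ 2 * (rho ^+ 2 / 16)); last by field.
    rewrite ler_piMl// ?divr_ge0 ?sqr_ge0// expr_le1// mulr_ge0// ltW//.
  move: h1 h2 x2 (sqr_ge0 rho); move: (dotv y y) (t * _) (dotv x x) (rho ^+ 2) => a1 a2 a3 a4.
  by lra.
have h1 := mono _ _ By Bx; have h2 := lipF _ _ By Bx.
have yx : y - x = (- t) *: F x by rewrite /y addrAC subrr add0r scaleNr.
rewrite !yx !dotvZl !dotvZr in h1; rewrite yx !dotvZl !dotvZr in h2.
have h3 : dotv (F y) (F y) = dotv (F y - F x) (F y - F x) + 2 * dotv (F y - F x) (F x) + dotv (F x) (F x).
  rewrite dotv_sqrB !dotvBl; move: (dotv (F y) (F y)) (dotv (F y) (F x)) (dotv (F x) (F x)) => a1 a2 a3.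
  by ring.
have h4 := minx _ By.
have alg (p q s f : R) : c * (- t * (- t * p)) <= - t * q -> s <= L * (- t * (- t * p)) ->
    f = s + 2 * q + p -> p <= f -> 0 <= p -> p = 0.
  move=> e1 e2 e3 e4 e5; have e6 : q <= - (c * (t * p)).
    rewrite -(ler_pM2l t0); move: e1.
    rewrite (_ : c * _ = t * (c * (t * p))); last by ring.
    by rewrite mulrN mulNr; move: (t * _) (t * q) => z1 z2; lra.
  have e7 : L * (- t * (- t * p)) = c * (t * p).
    by rewrite /t; field; exact: lt0r_neq0.
  have e8 : c * (t * p) <= 0 by move: e2 e3 e4 e6; rewrite e7; move: (c * (t * p)) => z; lra.
  apply/eqP; rewrite eq_le e5 andbT.
  by move: e8; rewrite mulrA pmulr_rle0// mulr_gt0.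
exact: (alg _ _ _ _ h1 h2 h3 h4 phi0).
Qed.

(** * Reduction to finitely many coordinates *)

Section galerkin.
Context {R : realType} {V : lmodType R}.
Variables (W : set V) (ip : V -> V -> R) (N : nat).
Hypotheses (W0 : W 0) (WD : forall x y, W x -> W y -> W (x + y))
  (WZ : forall a x, W x -> W (a *: x)) (ipC : forall x y, ip x y = ip y x)
  (ipD : forall x y z, W x -> W y -> W z -> ip (x + y) z = ip x z + ip y z)
  (ipZ : forall a x z, W x -> W z -> ip (a *: x) z = a * ip x z)
  (ip_ge0 : forall x, W x -> 0 <= ip x x)
  (finW : forall m (e : 'I_m -> V), (N < m)%N -> (forall k, W (e k)) ->
    exists c : 'I_m -> R, (exists k, c k != 0) /\ ip (\sum_k c k *: e k) (\sum_k c k *: e k) = 0).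

Lemma W_sum m (c : 'I_m -> R) (e : 'I_m -> V) : (forall k, W (e k)) -> W (\sum_k c k *: e k).
Proof. by move=> We; apply: (big_ind W) => // k _; exact: WZ. Qed.

Lemma ip_sum m (c : 'I_m -> R) (e : 'I_m -> V) z : (forall k, W (e k)) -> W z ->
  ip (\sum_k c k *: e k) z = \sum_k c k * ip (e k) z.
Proof.
move=> We Wz; suff : W (\sum_k c k *: e k) /\ ip (\sum_k c k *: e k) z = \sum_k c k * ip (e k) z.
  by case.
apply: (big_rec2 (fun a b => W a /\ ip a z = b)) => [|k a b _ [Wb <-]].
  by split=> //; rewrite -(scale0r (0 : V)) ipZ// mul0r.
by split; [exact: WD (WZ _ (We k)) Wb|rewrite ipD ?ipZ//; exact: WZ].
Qed.

Definition orthonormal_in m (e : 'I_m -> V) :=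
  (forall k, W (e k)) /\ forall j k, ip (e j) (e k) = (j == k)%:R.

Lemma ip_orthonormal m (c c' : 'I_m -> R) (e : 'I_m -> V) : orthonormal_in e ->
  ip (\sum_k c k *: e k) (\sum_k c' k *: e k) = \sum_k c k * c' k.
Proof.
move=> [We oe]; rewrite ip_sum//; last exact: W_sum.
apply: eq_bigr => k _; congr (_ * _); rewrite ipC ip_sum// (bigD1 k)//= oe eqxx mulr1.
by rewrite big1 ?addr0// => j jk; rewrite oe (negbTE jk) mulr0.
Qed.

(** The product is only semidefinite, so a maximal orthonormal family replaces a basis. Its length
    is bounded by [finW], since a nontrivial combination of orthonormal vectors is not null; by
    maximality the remainder of a projection has norm 0. *)
Lemma orthonormal_basis : exists m (e : 'I_m -> V), orthonormal_in e /\
  forall w, W w -> ip (w - \sum_k ip w (e k) *: e k) (w - \sum_k ip w (e k) *: e k) = 0.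
Proof.
pose P m := `[< exists e : 'I_m -> V, orthonormal_in e >].
have P0 : exists m, P m.
  by exists 0; apply/asboolP; exists (fun=> 0); split; [move=> k|move=> [[]]].
have PN m : P m -> (m <= N)%N.
  move=> /asboolP[e oe]; rewrite leqNgt; apply/negP => Nm.
  have [c [[k ck] H]] := finW Nm oe.1; move: H; rewrite (ip_orthonormal _ _ oe) => /eqP.
  rewrite psumr_eq0 => [/allP/(_ k (mem_index_enum k))|j _]; last by rewrite -expr2 sqr_ge0.
  by rewrite mulf_eq0 orbb (negbTE ck).
case: (ex_maxnP P0 PN) => m /asboolP[e oe] maxm.
exists m, e; split=> // w Ww; set z := w - _.
have Wz : W z.
  rewrite /z -scaleN1r; apply: WD => //; apply: WZ; exact: (W_sum _ oe.1).
have ez k : ip (e k) z = 0.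
  rewrite ipC /z -scaleN1r ipD ?ipZ ?ip_sum//; try exact: oe.1; try exact: (W_sum _ oe.1).
    rewrite (bigD1 k)//= oe.2 eqxx big1 => [|j jk]; last by rewrite oe.2 (negbTE jk) mulr0.
    by rewrite mulr1 addr0 mulN1r subrr.
  by apply: WZ; exact: (W_sum _ oe.1).
apply/eqP; case: eqVneq => // zz; exfalso.
have zp : 0 < ip z z by rewrite lt_neqAle eq_sym zz ip_ge0.
pose s := (Num.sqrt (ip z z))^-1.
pose e' (k : 'I_m.+1) := oapp e (s *: z) (unlift ord0 k).
have Pm : P m.+1.
  apply/asboolP; exists e'; split=> [k|j k].
    by rewrite /e'; case: unliftP => [k'|] _ /=; [exact: oe.1|exact: WZ].
  rewrite /e'; case: unliftP => [j'|] -> /=; case: unliftP => [k'|] -> /=.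
  - by rewrite oe.2 (inj_eq lift_inj).
  - by rewrite (ipC (e j')) (ipZ s Wz (oe.1 j')) (ipC z) ez mulr0.
  - by rewrite (ipZ s Wz (oe.1 k')) (ipC z) ez mulr0.
  - rewrite (ipZ s Wz (WZ s Wz)) (ipC z) (ipZ s Wz Wz).
    by rewrite mulrA -invfM -expr2 sqr_sqrtr ?ltW// mulVf// eqxx.
by have := maxm _ Pm; rewrite ltnn.
Qed.

(** In the coordinates of the orthonormal family this is [monotone_zero] for the vector of the
    values F z (e k). The second argument of F ignores null vectors, so vanishing on the family
    means vanishing on W. *)
Lemma galerkin (F : V -> V -> R) (c L rho : R) : 0 < c -> c ^+ 2 <= L -> 0 < rho ->
  let B z := W z /\ ip z z <= rho ^+ 2 in
  (forall z x y, B z -> W x -> W y -> F z (x + y) = F z x + F z y) ->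
  (forall z a x, B z -> W x -> F z (a *: x) = a * F z x) ->
  (forall z w, B z -> W w -> ip w w = 0 -> F z w = 0) ->
  (forall x y, B x -> B y -> c * ip (x - y) (x - y) <= F x (x - y) - F y (x - y)) ->
  (forall x y w, B x -> B y -> W w ->
    (F x w - F y w) ^+ 2 <= L * (ip (x - y) (x - y) * ip w w)) ->
  (forall w, W w -> F 0 w ^+ 2 <= (c * rho / 4) ^+ 2 * ip w w) ->
  exists2 z, B z & forall w, W w -> F z w = 0.
Proof.
move=> c0 cL rho0 B FD FZ Fnull mono lipF res.
have [m [e [oe He]]] := orthonormal_basis.
pose Z (x : 'rV[R]_m) := \sum_k x ord0 k *: e k.
have WZx x : W (Z x) := W_sum _ oe.1.
have ipZx x y : ip (Z x) (Z y) = dotv x y by rewrite ip_orthonormal.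
have ZB x y : Z x - Z y = Z (x - y).
  by rewrite /Z -sumrB; apply: eq_bigr => k _; rewrite -scalerBl !mxE.
have Z0 : Z 0 = 0 by rewrite /Z big1// => k _; rewrite mxE scale0r.
have BZ x : dotv x x <= rho ^+ 2 -> B (Z x) by move=> h; split=> //; rewrite ipZx.
have Fsum z x : B z -> F z (Z x) = \sum_k x ord0 k * F z (e k).
  move=> Bz; suff : W (Z x) /\ F z (Z x) = \sum_k x ord0 k * F z (e k) by case.
  rewrite /Z; apply: (big_rec2 (fun a b => W a /\ F z a = b)) => [|k a b _ [Wb <-]].
    by split=> //; rewrite -(scale0r (0 : V)) FZ// mul0r.
  have We := oe.1 k.
  by split; [exact: WD (WZ _ We) Wb|rewrite FD ?FZ//; exact: WZ].
pose G (x : 'rV[R]_m) : 'rV[R]_m := \row_k F (Z x) (e k).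
have GE x y w : B (Z x) -> B (Z y) -> dotv (G x - G y) w = F (Z x) (Z w) - F (Z y) (Z w).
  move=> Bx By; rewrite !Fsum// -sumrB; apply: eq_bigr => k _.
  by rewrite !mxE mulrC mulrBr.
suff [x Bx Gx] : exists2 x, dotv x x <= rho ^+ 2 & G x = 0.
  exists (Z x); first exact: BZ.
  move=> w Ww; have BZx := BZ _ Bx.
  pose p := Z (\row_k ip w (e k)).
  have pE : p = \sum_k ip w (e k) *: e k by apply: eq_bigr => k _; rewrite mxE.
  have Wp : W p by exact: WZx.
  have Wwp : W (w - p) by rewrite -scaleN1r; apply: WD => //; exact: WZ.
  have -> : w = (w - p) + p by rewrite subrK.
  rewrite FD// (Fnull _ _ BZx Wwp) ?add0r; last by rewrite pE He.
  rewrite Fsum// big1// => k _.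
  have -> : F (Z x) (e k) = G x ord0 k by rewrite mxE.
  by rewrite Gx [in X in _ * X]mxE mulr0.
apply: (monotone_zero (L := L) c0 cL rho0).
- by move=> x y /BZ Bx /BZ By; rewrite GE// -ipZx -ZB; exact: mono.
- move=> x y /BZ Bx /BZ By; set w := G x - G y.
  have h : dotv w w ^+ 2 <= L * (dotv (x - y) (x - y) * dotv w w).
    have wE : dotv w w = F (Z x) (Z w) - F (Z y) (Z w) by exact: GE.
    rewrite {1}wE -(ipZx (x - y)) -(ipZx w) -ZB; exact: (lipF _ _ _ Bx By (WZx w)).
  have [w0|w0] := eqVneq (dotv w w) 0.
    by rewrite w0 mulr_ge0 ?dotv_ge0// (le_trans _ cL)// sqr_ge0.
  have wp : 0 < dotv w w by rewrite lt_neqAle eq_sym w0 dotv_ge0.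
  by rewrite -(ler_pM2r wp) -expr2 -mulrA.
- have B0 : B (Z 0) by apply: BZ; rewrite dotv0 sqr_ge0.
  have h : dotv (G 0) (G 0) ^+ 2 <= (c * rho / 4) ^+ 2 * dotv (G 0) (G 0).
    have -> : dotv (G 0) (G 0) = F (Z 0) (Z (G 0)).
      by rewrite Fsum//; apply: eq_bigr => k _; rewrite !mxE.
    apply: (le_trans (y := (c * rho / 4) ^+ 2 * ip (Z (G 0)) (Z (G 0)))).
      by rewrite {1}Z0; exact: res.
    rewrite ipZx Fsum//.
    suff -> : dotv (G 0) (G 0) = \sum_k G 0 ord0 k * F (Z 0) (e k) by [].
    by apply: eq_bigr => k _; rewrite [X in _ * X = _]mxE.
  have [w0|w0] := eqVneq (dotv (G 0) (G 0)) 0; first by rewrite w0 sqr_ge0.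
  have wp : 0 < dotv (G 0) (G 0) by rewrite lt_neqAle eq_sym w0 dotv_ge0.
  by rewrite -(ler_pM2r wp) -expr2.
Qed.

End galerkin.

(** * Energy estimates *)

Lemma bmeas_sqrt d (X : measurableType d) (R : realType) (D : set X) (f : X -> R) :
  bmeas D f -> bmeas D (fun x => Num.sqrt (f x)).
Proof.
move=> [mf [M HM]]; split.
  apply: (measurableT_comp _ mf); apply: continuous_measurable_fun.
  exact: sqrt_continuous.
exists (Num.sqrt M) => x Dx; rewrite ger0_norm ?sqrtr_ge0//; apply: ler_wsqrtr.
by apply: le_trans (HM _ Dx); exact: ler_norm.
Qed.

Section gradient_algebra.
Context {R : realType} {n : nat}.
Local Notation E := 'rV[R]_n.
Implicit Types (v w : E -> R).

Lemma gradientD v w x : differentiable v x -> differentiable w x ->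
  gradient (fun y => v y + w y) x = gradient v x + gradient w x.
Proof.
move=> dv dw; apply/rowP => i.
by apply: (etrans (mxE _ _ _ _)); rewrite partialD// [RHS]mxE; congr (_ + _);
  apply: esym; exact: mxE.
Qed.

Lemma gradientB v w x : differentiable v x -> differentiable w x ->
  gradient (fun y => v y - w y) x = gradient v x - gradient w x.
Proof.
move=> dv dw; apply/rowP => i.
apply: (etrans (mxE _ _ _ _)); rewrite partialB//; apply: esym; apply: (etrans (mxE _ _ _ _)).
by congr (_ + _); [exact: mxE|apply: (etrans (mxE _ _ _ _)); congr (- _); exact: mxE].
Qed.

Lemma gradientZ (c : R) v x : differentiable v x ->
  gradient (fun y => c * v y) x = c *: gradient v x.
Proof.
move=> dv; apply/rowP => i.
apply: (etrans (mxE _ _ _ _)); rewrite partialZ//; apply: esym; apply: (etrans (mxE _ _ _ _)).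
by congr (_ * _); exact: mxE.
Qed.

Lemma qformDl m (C : 'M[R]_m) (x y z : 'rV[R]_m) : qform C (x + y) z = qform C x z + qform C y z.
Proof.
rewrite /qform -big_split; apply: eq_bigr => j _; rewrite -big_split; apply: eq_bigr => i _.
by rewrite mxE /= mulrDr mulrDl.
Qed.

Lemma qformZl m (C : 'M[R]_m) (a : R) (x z : 'rV[R]_m) : qform C (a *: x) z = a * qform C x z.
Proof.
rewrite /qform mulr_sumr; apply: eq_bigr => j _; rewrite mulr_sumr; apply: eq_bigr => i _.
by rewrite mxE; ring.
Qed.

End gradient_algebra.

Lemma norm_shift (R : realType) (S p q : R) : `|p - q| <= 1 -> `|q| <= S -> `|p| <= S + 1.
Proof. by rewrite !ler_norml => /andP[? ?] /andP[? ?]; apply/andP; split; lra. Qed.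

Lemma mean_dist (R : realType) (rho p q s : R) : `|p - s| <= rho -> `|q - s| <= rho ->
  `|2^-1 * (p + q) - s| <= rho.
Proof. by rewrite !ler_norml => /andP[? ?] /andP[? ?]; apply/andP; split; lra. Qed.

Lemma simpson_lower (R : realType) n (k e x y p q s : R) : k * e <= q -> k * e <= s ->
  k * e <= p -> 6 * (x - y) = n%:R * (p + 4 * q + s) -> n%:R * k * e <= x - y.
Proof.
move=> e1 e2 e3 H; rewrite -(ler_pM2l (ltr0n R 6)) H -mulrA mulrCA ler_wpM2l ?ler0n//.
by move: e1 e2 e3; move: (k * e) => z; lra.
Qed.

Lemma simpson_upper (R : realType) n (k X Y x y p q s : R) : q ^+ 2 <= k ^+ 2 * (X * Y) ->
  s ^+ 2 <= k ^+ 2 * (X * Y) -> p ^+ 2 <= k ^+ 2 * (X * Y) ->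
  6 * (x - y) = n%:R * (p + 4 * q + s) -> (x - y) ^+ 2 <= (n%:R * k) ^+ 2 * (Y * X).
Proof.
rewrite (exprMn _ n%:R) -[_ ^+ 2 * _ ^+ 2 * _]mulrA (mulrC Y); move: (k ^+ 2 * (X * Y)) => e.
move=> e1 e2 e3 H; have e0 : 0 <= e by apply: le_trans e1; exact: sqr_ge0.
have sq z : z ^+ 2 <= e -> `|z| <= Num.sqrt e.
  by move=> ze; rewrite -sqrtr_sqr; exact: ler_wsqrtr.
have -> : x - y = n%:R * ((p + 4 * q + s) / 6) by rewrite mulrA -H; field.
rewrite exprMn ler_wpM2l ?sqr_ge0// -[X in _ <= X](sqr_sqrtr e0) -real_normK ?num_real//.
rewrite ler_sqr ?nnegrE ?sqrtr_ge0//.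
move: (sq _ e1) (sq _ e2) (sq _ e3); move: (Num.sqrt e) => z.
by rewrite !ler_norml => /andP[? ?] /andP[? ?] /andP[? ?]; apply/andP; split; lra.
Qed.

Lemma le_of_eq (R : realType) (x y : R) : x = y -> x <= y.
Proof. by move=> ->. Qed.

Section energy.
Context {R : realType} {n : nat}.
Local Notation E := 'rV[R]_n.
Local Notation mu := (lebesgue_rV n : {measure set 'rV[R]_n -> \bar R}).
Variables (Omega : set E) (T : seq (n.+1.-tuple E)).
Hypotheses (n23 : n = 2%N \/ n = 3%N) (domO : convex_polyhedral_domain Omega)
  (triT : triangulation Omega T).
Variable r : R.
Hypotheses (r0 : 0 < r) (clr : forall x, closure Omega x -> `|x| < r).

Let oO : open Omega := domain_open domO.
Let Or x : Omega x -> `|x| < r. Proof. by move/subset_closure/clr. Qed.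
Let G := mesh_interior T.
Let oG : open G := @mesh_interior_open _ _ T.
Let GO : G `<=` Omega := @mesh_interior_sub _ _ _ _ domO triT.
Let Gr x : G x -> `|x| < r. Proof. by move/GO/Or. Qed.
Let mG : measurable G := open_rV_measurable oG.
Let fG : (mu G < +oo)%E := bounded_lt_pinfty mG Gr.
Local Notation adm := (admissible Omega T).

Lemma adm_diff v x : adm v -> Omega x -> differentiable v x.
Proof. by move=> [C1v _ _] /C1v[]. Qed.

Definition energy v w : R := \int[mu]_(x in G) dotv (gradient v x) (gradient w x).

Lemma energy_bmeas v w : adm v -> adm w ->
  bmeas G (fun x => dotv (gradient v x) (gradient w x)).
Proof.
move=> av aw; have [_ bv] := adm_bmeas domO triT clr av; have [_ bw] := adm_bmeas domO triT clr aw.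
apply: bmeas_sum => i _.
apply: (eq_bmeas _ (bmeasM (bv i) (bw i))) => x _; rewrite /gradient [(\row_ _ _) _ _]mxE.
by rewrite [in RHS]mxE.
Qed.

Lemma energyC v w : energy v w = energy w v.
Proof. by apply: eq_Rintegral => x _; rewrite dotvC. Qed.

Lemma energy_ge0 v : 0 <= energy v v.
Proof. by apply: Rintegral_ge0 => x _; exact: dotv_ge0. Qed.

Lemma energyDl v1 v2 w : adm v1 -> adm v2 -> adm w ->
  energy (fun x => v1 x + v2 x) w = energy v1 w + energy v2 w.
Proof.
move=> a1 a2 aw; rewrite /energy -(RintD mG fG (energy_bmeas a1 aw) (energy_bmeas a2 aw)).
apply: eq_Rintegral => x /set_mem /GO Ox.
by rewrite gradientD ?dotvDl//; exact: adm_diff.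
Qed.

Lemma energyZl (a : R) v w : adm v -> adm w -> energy (fun x => a * v x) w = a * energy v w.
Proof.
move=> av aw; rewrite /energy -(RintZ mG fG a (energy_bmeas av aw)).
by apply: eq_Rintegral => x /set_mem /GO Ox; rewrite gradientZ ?dotvZl//; exact: adm_diff.
Qed.

Lemma mform_qbmeas v c w : adm v -> adm c -> adm w ->
  bmeas G (fun x => qform (cof (hessian v x)) (gradient w x) (gradient c x)).
Proof.
move=> av ac aw; apply: (qform_grad_bmeas domO triT clr av).
  exact: (adm_bmeas domO triT clr ac).2.
exact: (adm_bmeas domO triT clr aw).2.
Qed.

Lemma mformD v c w1 w2 : adm v -> adm c -> adm w1 -> adm w2 ->
  mform T v c (fun x => w1 x + w2 x) = mform T v c w1 + mform T v c w2.
Proof.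
move=> av ac a1 a2; rewrite /mform -(RintD mG fG (mform_qbmeas av ac a1) (mform_qbmeas av ac a2)).
by apply: eq_Rintegral => x /set_mem /GO Ox; rewrite gradientD ?qformDl//; exact: adm_diff.
Qed.

Lemma mformZ v c a w : adm v -> adm c -> adm w ->
  mform T v c (fun x => a * w x) = a * mform T v c w.
Proof.
move=> av ac aw; rewrite /mform -(RintZ mG fG a (mform_qbmeas av ac aw)).
by apply: eq_Rintegral => x /set_mem /GO Ox; rewrite gradientZ ?qformZl//; exact: adm_diff.
Qed.

Lemma mform_bound v c w (L : R) : adm v -> adm c -> adm w -> 0 <= L ->
  (forall x i j, G x -> `|cof (hessian v x) i j| <= L) ->
  mform T v c w ^+ 2 <= (n%:R * L) ^+ 2 * (energy w w * energy c c).
Proof.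
move=> av ac aw L0 HL; have nL0 : 0 <= n%:R * L by rewrite mulr_ge0.
have bw := energy_bmeas aw aw; have bc := energy_bmeas ac ac.
have bq := mform_qbmeas av ac aw.
pose f x := Num.sqrt (dotv (gradient w x) (gradient w x)).
pose g x := Num.sqrt (dotv (gradient c x) (gradient c x)).
have bf : bmeas G f by exact: bmeas_sqrt.
have bg : bmeas G g by exact: bmeas_sqrt.
have CS := Rint_cauchy_schwarz mG fG bf bg.
have Ef : \int[mu]_(x in G) f x ^+ 2 = energy w w.
  by apply: eq_Rintegral => x _; rewrite sqr_sqrtr// dotv_ge0.
have Eg : \int[mu]_(x in G) g x ^+ 2 = energy c c.
  by apply: eq_Rintegral => x _; rewrite sqr_sqrtr// dotv_ge0.
have {}CS := le_trans CS (le_of_eq (f_equal2 *%R Ef Eg)).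
have q x : G x -> `|qform (cof (hessian v x)) (gradient w x) (gradient c x)| <= n%:R * L * (f x * g x).
  move=> Gx; rewrite -ler_sqr ?nnegrE ?mulr_ge0 ?sqrtr_ge0//.
  rewrite real_normK ?num_real// !(exprMn _ (_ * _)) (exprMn _ (f x)) !sqr_sqrtr ?dotv_ge0//.
  by apply: qform_bound => // i j; exact: HL.
have bfg := bmeasZ (n%:R * L) (bmeasM bf bg).
have h1 : mform T v c w <= n%:R * L * \int[mu]_(x in G) (f x * g x).
  rewrite -(RintZ mG fG _ (bmeasM bf bg)); apply: (le_Rint mG fG bq bfg) => x Gx.
  exact: le_trans (ler_norm _) (q x Gx).
have h2 : - mform T v c w <= n%:R * L * \int[mu]_(x in G) (f x * g x).
  rewrite -(RintZ mG fG _ (bmeasM bf bg)) -(RintN mG fG bq).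
  apply: (le_Rint mG fG (bmeasN bq) bfg) => x Gx.
  by apply: le_trans (q x Gx); rewrite -normrN ler_norm.
have h3 : `|mform T v c w| <= n%:R * L * \int[mu]_(x in G) (f x * g x).
  by rewrite ler_norml h1 andbT lerNl.
rewrite -real_normK ?num_real//.
apply: (@le_trans _ _ ((n%:R * L * \int[mu]_(x in G) (f x * g x)) ^+ 2)).
  by rewrite ler_sqr ?nnegrE//; exact: le_trans h3.
by rewrite exprMn ler_wpM2l// sqr_ge0.
Qed.

Lemma mform_coercive v w (a : R) : adm v -> adm w ->
  (forall x, G x -> forall y, a * dotv y y <= qform (cof (hessian v x)) y y) ->
  a * energy w w <= mform T v w w.
Proof.
move=> av aw H; rewrite /energy -(RintZ mG fG a (energy_bmeas aw aw)).
by apply: (le_Rint mG fG (bmeasZ a (energy_bmeas aw aw)) (mform_qbmeas av aw aw)) => x /H.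
Qed.

Section near_solution.
Variables (u : E -> R) (S a rho : R).
Hypotheses (S0 : 0 <= S) (uS : forall x i k, G x -> `|partial i (partial k u) x| <= S)
  (ua : forall x, G x -> forall y, a * dotv y y <= qform (cof (hessian u x)) y y)
  (rho1 : rho <= 1) (rhoa : n%:R * ((4 * S + 2) * rho) <= a / 2).

Definition hess_near v := forall x i k, G x ->
  `|partial i (partial k v) x - partial i (partial k u) x| <= rho.

Let L : R := 2 * (S + 1 + 1) ^+ 2.
Let L0 : 0 <= L. Proof. by rewrite mulr_ge0// sqr_ge0. Qed.

Lemma near_coercive v x : hess_near v -> G x ->
  forall y, a / 2 * dotv y y <= qform (cof (hessian v x)) y y.
Proof.
move=> nv Gx; apply: (cof_coercive_near n23 S0 rho1 _ _ (ua Gx) rhoa) => i j.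
  by rewrite hessianE; exact: uS.
apply: (le_trans (le_of_eq _) (nv x i j Gx)); congr (`|_|).
exact: (f_equal2 (fun p q => p - q) (hessianE v x i j) (hessianE u x i j)).
Qed.

Lemma near_cof_bound v x i j : hess_near v -> G x -> `|cof (hessian v x) i j| <= L.
Proof.
move=> nv Gx; apply: cof_bound => //; first by rewrite addr_ge0.
move=> k l; rewrite (hessianE v).
have := uS k l Gx; have := le_trans (nv x k l Gx) rho1.
exact: norm_shift.
Qed.

(** Closeness to D^2 u is a convex condition, so the middle node of Simpson's rule inherits it. *)
Lemma hess_near_mid v1 v2 : adm v1 -> adm v2 -> hess_near v1 -> hess_near v2 ->
  hess_near (mid v1 v2).
Proof.
move=> a1 a2 h1 h2 x i k Gx.
have e : partial i (partial k (mid v1 v2)) x =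
    2^-1 * (partial i (partial k v1) x + partial i (partial k v2) x).
  apply: (etrans (esym (hessianE _ _ _ _))).
  apply: (etrans (f_equal (fun A : 'M[R]_n => A i k) (hessian_mid a1 a2 Gx))).
  apply: (etrans (mx_midE _ _ _ _ _)).
  exact: (f_equal2 (fun p q => _ * (p + q)) (hessianE v1 x i k) (hessianE v2 x i k)).
rewrite e; exact: (mean_dist (h1 x i k Gx) (h2 x i k Gx)).
Qed.

Lemma mform_monotone v1 v2 : adm v1 -> adm v2 -> hess_near v1 -> hess_near v2 ->
  test_approximable Omega (fun x => v1 x - v2 x) ->
  n%:R * (a / 2) * energy (fun x => v1 x - v2 x) (fun x => v1 x - v2 x) <=
  mform T v1 v1 (fun x => v1 x - v2 x) - mform T v2 v2 (fun x => v1 x - v2 x).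
Proof.
move=> a1 a2 h1 h2 tz; have hm := hess_near_mid a1 a2 h1 h2.
have E := mform_diff n23 domO triT r0 clr a1 a2 tz.
have az := adm_sub domO a1 a2; have am := adm_mid domO a1 a2.
have c1 := mform_coercive a1 az (fun x Gx => near_coercive h1 Gx).
have c2 := mform_coercive a2 az (fun x Gx => near_coercive h2 Gx).
have cm := mform_coercive am az (fun x Gx => near_coercive hm Gx).
exact: (simpson_lower cm c2 c1 E).
Qed.

Lemma mform_lip v1 v2 w : adm v1 -> adm v2 -> adm w -> hess_near v1 -> hess_near v2 ->
  test_approximable Omega w ->
  (mform T v1 v1 w - mform T v2 v2 w) ^+ 2 <=
  (n%:R * (n%:R * L)) ^+ 2 *
    (energy (fun x => v1 x - v2 x) (fun x => v1 x - v2 x) * energy w w).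
Proof.
move=> a1 a2 aw h1 h2 tw; have hm := hess_near_mid a1 a2 h1 h2.
have E := mform_diff n23 domO triT r0 clr a1 a2 tw.
have az := adm_sub domO a1 a2; have am := adm_mid domO a1 a2.
have c1 := mform_bound a1 az aw L0 (fun x i j Gx => near_cof_bound i j h1 Gx).
have c2 := mform_bound a2 az aw L0 (fun x i j Gx => near_cof_bound i j h2 Gx).
have cm := mform_bound am az aw L0 (fun x i j Gx => near_cof_bound i j hm Gx).
exact: (simpson_upper cm c2 c1 E).
Qed.

End near_solution.

End energy.

Section spline_algebra.
Context {R : realType} {n : nat}.
Local Notation E := 'rV[R]_n.
Variables (Omega : set E) (T : seq (n.+1.-tuple E)) (d : nat).
Hypothesis oO : open Omega.

Lemma spline_spaceD (v w : E -> R) : spline_space Omega T d v -> spline_space Omega T d w ->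
  spline_space Omega T d (fun x => v x + w x).
Proof.
move=> [C1v pv] [C1w pw]; split; first exact: C1D.
move=> K KT; have [a Ha] := pv K KT; have [b Hb] := pw K KT.
exists (fun k => a k + b k) => x Kx; rewrite Ha// Hb// -big_split.
by apply: eq_bigr => k _; rewrite mulrDl.
Qed.

Lemma spline_spaceZ (c : R) (v : E -> R) : spline_space Omega T d v ->
  spline_space Omega T d (fun x => c * v x).
Proof.
move=> [C1v pv]; split; first exact: C1Z.
move=> K KT; have [a Ha] := pv K KT.
exists (fun k => c * a k) => x Kx; rewrite Ha// mulr_sumr.
by apply: eq_bigr => k _; rewrite mulrA.
Qed.

Lemma spline_spaceB (v w : E -> R) : spline_space Omega T d v -> spline_space Omega T d w ->
  spline_space Omega T d (fun x => v x - w x).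
Proof.
move=> sv sw; have := spline_spaceD sv (spline_spaceZ (- 1) sw).
by rewrite (_ : (fun x => v x + _) = (fun x => v x - w x))//; apply/funext => x; rewrite mulN1r.
Qed.

End spline_algebra.

Lemma broken_norm_ge (R : realType) n (T : seq (n.+1.-tuple 'rV[R]_n)) k (v : 'rV[R]_n -> R) K :
  K \in T -> (sob_norm (hull K)° k +oo v <= broken_norm T k +oo v)%E.
Proof. by move=> KT; apply: lpsumy_ge; exact: map_f. Qed.

Lemma broken_seminorm_ge (R : realType) n (T : seq (n.+1.-tuple 'rV[R]_n)) k (v : 'rV[R]_n -> R) K :
  K \in T -> (sob_seminorm (hull K)° k +oo v <= broken_seminorm T k +oo v)%E.
Proof. by move=> KT; apply: lpsumy_ge; exact: map_f. Qed.

(** * Splines with zero boundary values *)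

Section vanishing_splines.
Context {R : realType} {n : nat}.
Local Notation E := 'rV[R]_n.
Local Notation mu := (lebesgue_rV n : {measure set 'rV[R]_n -> \bar R}).
Variables (Omega : set E) (T : seq (n.+1.-tuple E)) (d : nat).
Hypotheses (n23 : n = 2%N \/ n = 3%N) (domO : convex_polyhedral_domain Omega)
  (triT : triangulation Omega T).
Variable r : R.
Hypotheses (r0 : 0 < r) (clr : forall x, closure Omega x -> `|x| < r).

Let n1 : (1 < n)%N. Proof. by case: n23 => ->. Qed.
Let n0 : (0 < n)%N := ltnW n1.
Let oO : open Omega := domain_open domO.
Let Or x : Omega x -> `|x| < r. Proof. by move/subset_closure/clr. Qed.
Let G := mesh_interior T.
Let oG : open G := @mesh_interior_open _ _ T.
Let GO : G `<=` Omega := @mesh_interior_sub _ _ _ _ domO triT.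
Let Gr x : G x -> `|x| < r. Proof. by move/GO/Or. Qed.
Let mG : measurable G := open_rV_measurable oG.
Let fG : (mu G < +oo)%E := bounded_lt_pinfty mG Gr.
Let mO : measurable Omega := open_rV_measurable oO.
Let fO : (mu Omega < +oo)%E := bounded_lt_pinfty mO Or.
Local Notation adm := (admissible Omega T).
Local Notation spl := (spline_space Omega T d).

(** The pointwise counterpart of [spline_space0]; [spline0_space0] and [space0_spline0] identify the
    two. *)
Definition spline0 : set (E -> R) := [set w | spl w /\ forall x, bdry Omega x -> w x = 0].

Lemma spl_adm v : spl v -> adm v.
Proof. exact: (spline_admissible n0 domO triT). Qed.

Lemma spline0_adm w : spline0 w -> adm w.
Proof. by move=> [/spl_adm]. Qed.

Lemma spl_lip_closure v : spl v -> exists2 M : R, 0 <= M & lip_on (closure Omega) M v.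
Proof.
move=> sv; have [_ [M M0 lv]] := admissible_nice (spl_adm sv).
by exists M => //; exact: (spline_lip_closure n1 domO triT M0 sv lv).
Qed.

Lemma spline0_approx w : spline0 w -> test_approximable Omega w.
Proof.
move=> [sw w0]; have nw := admissible_nice (spl_adm sw); split; first exact: nw.
have [M M0 lw] := spl_lip_closure sw.
exact: (approx_vanishing n1 domO clr M0 nw.1 lw w0).
Qed.

Lemma spline0_space0 w : spline0 w -> spline_space0 Omega T d w.
Proof.
move=> Ww; have [nw [phi [B [B0 tphi phiB cphi cpphi]]]] := spline0_approx Ww.
split; first exact: Ww.1.
exact: (vanishing_H10 n1 domO clr nw tphi phiB cphi cpphi).
Qed.

Lemma space0_spline0 w : spline_space0 Omega T d w -> spline0 w.
Proof.
move=> [sw Hw]; split; first exact: sw.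
have [M M0 lw] := spl_lip_closure sw; have nw := admissible_nice (spl_adm sw).
by move=> x xb; exact: (zero_trace n1 domO clr M0 nw lw Hw xb).
Qed.

Lemma spline0D v w : spline0 v -> spline0 w -> spline0 (fun x => v x + w x).
Proof.
move=> [sv v0] [sw w0]; split; first exact: spline_spaceD.
by move=> x xb; rewrite v0// w0// addr0.
Qed.

Lemma spline0Z c v : spline0 v -> spline0 (fun x => c * v x).
Proof.
move=> [sv v0]; split; first exact: spline_spaceZ.
by move=> x xb; rewrite v0// mulr0.
Qed.

Lemma L2sq_mesh v : bmeas Omega v -> L2sq Omega v = \int[mu]_(x in G) v x ^+ 2.
Proof. by move=> bv; apply: (Rint_mesh n23 domO triT clr); exact: bmeas_sqr. Qed.

Lemma L2sq_partial w i : adm w -> L2sq Omega (partial i w) <= energy T w w.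
Proof.
move=> aw; have [_ bp] := nice_bmeas oO Or (admissible_nice aw).
rewrite (L2sq_mesh (bp i)); apply: (le_Rint mG fG).
- by apply: bmeas_sqr; exact: (bmeasS mO GO (bp i)).
- exact: (energy_bmeas domO triT clr aw aw).
- move=> x _; have := coord_sqr_le (gradient w x) i; apply: le_trans.
  by apply: le_of_eq; congr (_ ^+ 2); apply: esym; exact: mxE.
Qed.

Lemma poincare w : spline0 w -> L2sq Omega w <= 4 * r ^+ 2 * energy T w w.
Proof.
move=> Ww; have [nw [phi [B [B0 tphi phiB cphi cpphi]]]] := spline0_approx Ww.
apply: (le_trans (vanishing_poincare n1 domO r0 clr tphi phiB cphi cpphi (Ordinal n0))).
apply: ler_wpM2l; first by rewrite mulr_ge0 ?sqr_ge0.
exact: (L2sq_partial _ (spline0_adm Ww)).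
Qed.

Lemma energy_eq0 w : spline0 w -> energy T w w = 0 -> forall x, Omega x -> w x = 0.
Proof.
move=> Ww e0; have := poincare Ww; rewrite e0 mulr0 => H.
have nw := admissible_nice (spline0_adm Ww); have [bw _] := nice_bmeas oO Or nw.
have I0 : L2sq Omega w = 0 by apply/eqP; rewrite eq_le H L2sq_ge0.
have := Rint_eq0_open oO Or _ (bmeas_sqr bw) (fun x _ => sqr_ge0 (w x)) I0.
move=> h x Ox; apply/eqP; rewrite -sqrf_eq0; apply/eqP; apply: (h _ x Ox) => y Oy.
have cw := C1_continuous nw.1 Oy; rewrite (_ : (fun y => w y ^+ 2) = (fun y => w y * w y)).
  exact: (cvgM cw cw).
by apply/funext => z; rewrite expr2.
Qed.

Lemma energy_null w : (forall x, Omega x -> w x = 0) -> energy T w w = 0.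
Proof.
move=> w0; rewrite /energy (eq_Rintegral _ (g := fun=> 0)) ?Rintegral_cst ?mul0r//.
move=> x /set_mem /GO Ox; rewrite /dotv big1// => i _.
have -> : gradient w x ord0 i = 0.
  by apply: (etrans (mxE _ _ _ _)); rewrite (partial_congr (w := fun=> 0) i oO w0 Ox) partial_cst.
by rewrite mul0r.
Qed.

Lemma mesh_volume : fine (mu G) <= fine (mu Omega).
Proof.
apply: fine_le; [by rewrite ge0_fin_numE|by rewrite ge0_fin_numE|].
by apply: le_measure; rewrite ?inE.
Qed.

Lemma Rint_sqr_le (f : E -> R) (k : R) : bmeas G f -> (forall x, G x -> `|f x| <= k) ->
  \int[mu]_(x in G) f x ^+ 2 <= k ^+ 2 * fine (mu Omega).
Proof.
move=> bf fk; have h : forall x, G x -> `|f x ^+ 2| <= k ^+ 2.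
  move=> x Gx; rewrite normrX lerXn2r ?nnegrE ?fk//.
  by apply: le_trans (fk _ Gx).
apply: (le_trans (ler_norm _)); apply: (le_trans (Rint_bound mG fG (bmeas_sqr bf) h)).
by rewrite ler_wpM2l ?sqr_ge0// mesh_volume.
Qed.

Lemma energy_bound e (k : R) : adm e -> (forall x, G x -> forall i, `|partial i e x| <= k) ->
  energy T e e <= n%:R * (k ^+ 2 * fine (mu Omega)).
Proof.
move=> ae ek; have [_ bp] := adm_bmeas domO triT clr ae.
have -> : energy T e e = \sum_i \int[mu]_(x in G) partial i e x ^+ 2.
  rewrite -(Rint_sum mG fG _ (fun i _ => bmeas_sqr (bp i))).
  apply: eq_Rintegral => x _; apply: eq_bigr => i _; rewrite expr2.
  by congr (_ * _); exact: mxE.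
rewrite mulr_natl -[X in _ *+ X]card_ord -sumr_const; apply: ler_sum => i _.
by apply: (Rint_sqr_le (bp i)) => x Gx; exact: ek.
Qed.

(** The spline z is measured by its energy through the Poincare inequality, the remainder e by
    pointwise bounds and the volume. Both the error of the solution and its distance to Q u have
    this shape. *)
Lemma H1norm_split z e (k : R) : spline0 z -> nice Omega e ->
  (forall x, G x -> `|e x| <= k /\ forall i, `|partial i e x| <= k) ->
  (H1norm Omega (fun x => (z x + e x)%R) <=
    (Num.sqrt (#|{: @mindex n 1}|%:R * (2 * (4 * r ^+ 2 + 1) * energy T z z +
      2 * (k ^+ 2 * fine (mu Omega))))%R)%:E)%E.
Proof.
move=> Wz ne ek; have az := spline0_adm Wz; have nz := admissible_nice az.
have [bz bpz] := nice_bmeas oO Or nz; have [be bpe] := nice_bmeas oO Or ne.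
have e0 := energy_ge0 T z.
have Le : L2sq Omega e <= k ^+ 2 * fine (mu Omega).
  by rewrite (L2sq_mesh be); apply: (Rint_sqr_le (bmeasS mO GO be)) => x /ek[].
have Lpe i : L2sq Omega (partial i e) <= k ^+ 2 * fine (mu Omega).
  by rewrite (L2sq_mesh (bpe i)); apply: (Rint_sqr_le (bmeasS mO GO (bpe i))) => x /ek[_].
have r2 := sqr_ge0 r.
apply: (H1norm_le n1 oO Or).
- by split; [exact: (C1D oO nz.1 ne.1)|have [_ [M M0 lz]] := nz; have [_ [M' M'0 le]] := ne;
    exists (M + M'); [exact: addr_ge0|exact: lip_onD]].
- apply: (le_trans (L2sqD domO clr bz be)); apply: lerD; last by rewrite ler_pM2l.
  rewrite -mulrA ler_pM2l//; apply: (le_trans (poincare Wz)); rewrite ler_wpM2r// lerDl//.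
- move=> i; have -> : L2sq Omega (partial i (fun x => z x + e x)) =
      L2sq Omega (fun x => partial i z x + partial i e x).
    apply: eq_Rintegral => x /set_mem Ox; congr (_ ^+ 2).
    by apply: partialD; [case: (nz.1 _ Ox)|case: (ne.1 _ Ox)].
  apply: (le_trans (L2sqD domO clr (bpz i) (bpe i))).
  apply: lerD; last by rewrite ler_pM2l.
  rewrite -mulrA ler_pM2l//; apply: (le_trans (L2sq_partial i az)).
  by rewrite ler_peMl// lerDr mulr_ge0.
Qed.

Lemma spline0_finite m (e : 'I_m -> E -> R) : (size T * #|{: @mindex n d}| < m)%N ->
  (forall k, spline0 (e k)) -> exists c : 'I_m -> R, (exists k, c k != 0) /\
    forall x, Omega x -> \sum_k c k * e k x = 0.
Proof.
move=> Nm We.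
pose I := ('I_(size T) * {: @mindex n d})%type.
have cI : #|{: I}| = (size T * #|{: @mindex n d}|)%N by rewrite card_prod card_ord.
have /choice[a Ha] (k : 'I_m) : exists a : 'I_(size T) -> @mindex n d -> R,
    forall p x, hull (tnth (in_tuple T) p) x ->
      e k x = \sum_(b : @mindex n d | (mdeg b <= d)%N) a p b * \prod_i x ord0 i ^+ b i.
  have /choice[a Ha] (p : 'I_(size T)) : exists a : @mindex n d -> R,
      forall x, hull (tnth (in_tuple T) p) x ->
      e k x = \sum_(b : @mindex n d | (mdeg b <= d)%N) a b * \prod_i x ord0 i ^+ b i.
    by apply: (We k).1.2; exact: mem_tnth.
  by exists a.
pose A : 'M[R]_(m, #|{: I}|) := \matrix_(k, q) a k (enum_val q).1 (enum_val q).2.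
have : kermx A != 0.
  rewrite kermx_eq0 -row_leq_rank -ltnNge; apply: (leq_ltn_trans (rank_leq_col A)).
  by rewrite cI.
case/rowV0Pn => v /sub_kermxP vA v0.
exists (fun k => v ord0 k); split.
  by case/rV0Pn: v0 => k vk; exists k.
move=> x /subset_closure Ox; have [K KT Kx] := closure_cover triT Ox.
have [p pE] : exists p : 'I_(size T), tnth (in_tuple T) p = K.
  have h : (index K T < size T)%N by rewrite index_mem.
  by exists (Ordinal h); rewrite (tnth_nth K) /= nth_index.
rewrite -pE in Kx.
rewrite (eq_bigr (fun k => \sum_(b : @mindex n d | (mdeg b <= d)%N)
  (v ord0 k * a k p b) * \prod_i x ord0 i ^+ b i)); last first.
  by move=> k _; rewrite (Ha k p x Kx) mulr_sumr; apply: eq_bigr => b _; rewrite mulrA.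
rewrite exchange_big big1// => b _; rewrite -mulr_suml.
have -> : \sum_k v ord0 k * a k p b = (v *m A) ord0 (enum_rank (p, b)).
  by rewrite mxE; apply: eq_bigr => k _; rewrite mxE enum_rankK.
by rewrite vA mxE mul0r.
Qed.

Lemma spline_hess_le v x i k (c : R) : spl v -> (broken_seminorm T 2 +oo v <= c%:E)%E -> G x ->
  `|partial i (partial k v) x| <= c.
Proof.
move=> sv H [K KT Kx]; rewrite -lee_fin; apply: le_trans H.
apply: le_trans (broken_seminorm_ge 2 v KT).
have Kr y : (hull K)° y -> `|y| < r by move=> /(simplex_interior_sub domO triT KT)/Or.
exact: (sob_seminorm_infty2 n1 (@open_interior _ _) Kr i k (spline_C2 sv KT) Kx).
Qed.

Lemma broken1_le v x (c : R) : C1 Omega v -> (broken_norm T 1 +oo v <= c%:E)%E -> G x ->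
  `|v x| <= c /\ forall i, `|partial i v x| <= c.
Proof.
move=> C1v H [K KT Kx].
have KO := simplex_interior_sub domO triT KT.
have Kr y : (hull K)° y -> `|y| < r by move=> /KO/Or.
have C1K : C1 (hull K)° v by move=> y /KO; exact: C1v.
have H' := le_trans (broken_norm_ge 1 v KT) H.
split=> [|i]; rewrite -lee_fin; apply: le_trans H'.
  exact: (sob_norm_infty0 (@open_interior _ _) 1 C1K Kx).
exact: (sob_norm_infty1 n1 (@open_interior _ _) Kr i _ C1K Kx).
Qed.

Lemma broken2_le v x i k (c : R) : (forall K, K \in T -> C2 (hull K)° v) ->
  (broken_norm T 2 +oo v <= c%:E)%E -> G x -> `|partial i (partial k v) x| <= c.
Proof.
move=> C2v H [K KT Kx].
have KO := simplex_interior_sub domO triT KT.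
have Kr y : (hull K)° y -> `|y| < r by move=> /KO/Or.
rewrite -lee_fin; apply: le_trans H; apply: le_trans (broken_norm_ge 2 v KT).
exact: (sob_norm_infty2 n1 (@open_interior _ _) Kr i k _ (C2v K KT) Kx).
Qed.

End vanishing_splines.

(** * The discrete problem *)

Section convexity.
Context {R : realType} {n : nat}.
Local Notation E := 'rV[R]_n.
Implicit Types (Omega : set E) (f : E -> R).

Lemma convex_functionI Omega f : (forall x y (s : R), Omega x -> Omega y -> 0 <= s <= 1 ->
  f (x + s *: (y - x)) <= f x + s * (f y - f x)) -> convex_function Omega f.
Proof.
move=> H t y x /set_mem Oy /set_mem Ox; rewrite convRE.
have t01 : 0 <= t%:num <= 1 by apply/andP.
have := H x y t%:num Ox Oy t01.
have -> : t%:num * f y + (1 - t%:num) * f x = f x + t%:num * (f y - f x).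
  by move: (f x) (f y) (t%:num) => a b c; ring.
congr (is_true (f _ <= _)).
rewrite [RHS](_ : _ = t%:num *: (y : E) + (1 - t%:num) *: (x : E) :> E); last by [].
by rewrite scalerBl scale1r scalerBr addrCA.
Qed.

(** The mean value theorem writes the secant slopes left and right of the intermediate point as
    directional derivatives at parameters c1 <= c2, and monotonicity orders them. *)
Lemma convex_of_monotone_gradient Omega f : convexset Omega ->
  (forall x, Omega x -> differentiable f x) ->
  (forall x y, Omega x -> Omega y -> 0 <= dotv (y - x) (gradient f y - gradient f x)) ->
  convex_function Omega f.
Proof.
move=> cO df mono; apply: convex_functionI => x y s Ox Oy /andP[s0 s1].
pose p (a : R) := x + a *: (y - x).
have pO a : 0 <= a <= 1 -> Omega (p a) by move=> a01; exact: cO.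
have p0 : p 0 = x by rewrite /p scale0r addr0.
have p1 : p 1 = y by rewrite /p scale1r addrC subrK.
pose g (a : R) := dotv (y - x) (gradient f (p a)).
have pB a b : p b - p a = (b - a) *: (y - x).
  by rewrite /p opprD addrACA subrr add0r -scalerBl.
have mg a b : 0 <= a <= 1 -> 0 <= b <= 1 -> a < b -> g a <= g b.
  move=> a01 b01 ab; have := mono _ _ (pO a a01) (pO b b01).
  rewrite pB dotvZl pmulr_rge0 ?subr_gt0// (dotvC (y - x)) dotvBl subr_ge0.
  by rewrite !(dotvC (gradient _ _)).
have mv a b : 0 <= a -> a <= b -> b <= 1 -> exists2 c, a <= c <= b &
    f (p b) - f (p a) = (b - a) * g c.
  move=> a0; rewrite le_eqVlt => /predU1P[<- a1|ab b1].
    by exists a; rewrite ?lexx// !subrr mul0r.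
  have q t : p a + t *: (p b - p a) = p (a + t * (b - a)).
    by rewrite pB /p scalerA -addrA -scalerDl.
  have ba : 0 < b - a by rewrite subr_gt0.
  have [t t01|c /andP[c0 c1] H] := @mvt_line _ _ f (p a) (p b).
    move: t01 => /andP[t0 t1]; rewrite q; apply/df/pO.
    rewrite addr_ge0 ?mulr_ge0 ?(ltW ba)//=; apply: le_trans b1.
    by rewrite -lerBrDl ler_piMl// ltW.
  have l1 : a < a + c * (b - a) by rewrite ltrDl mulr_gt0.
  have l2 : a + c * (b - a) < b by rewrite -ltrBrDl -[ltRHS]mul1r ltr_pM2r.
  exists (a + c * (b - a)); first by rewrite !ltW.
  rewrite H; transitivity (dotv (p b - p a) (gradient f (p a + c *: (p b - p a)))).
    by apply: eq_bigr => i _; congr (_ * _); apply: esym; exact: mxE.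
  by rewrite q pB dotvZl.
have [c1 /andP[c10 c1s] H1] := mv _ _ (lexx 0) s0 s1.
have [c2 /andP[c2s c21] H2] := mv _ _ s0 s1 (lexx 1).
have g12 : g c1 <= g c2.
  have := le_trans c1s c2s; rewrite le_eqVlt => /predU1P[->//|c12].
  by apply: (mg _ _ _ _ c12); rewrite ?c10 ?c21 ?(le_trans c1s s1) ?(le_trans s0 c2s).
rewrite -/(p s); move: H1 H2; rewrite p0 p1 subr0.
move: (f (p s)) (f x) (f y) (g c1) (g c2) g12 => D X Y g1 g2 g12 H1 H2.
have -> : D = X + s * g1 by rewrite -H1 addrC subrK.
have -> : Y = X + s * g1 + (1 - s) * g2 by rewrite -H2 -H1; ring.
have : 0 <= s * (1 - s) * (g2 - g1) by rewrite !mulr_ge0 ?subr_ge0.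
rewrite -(@subr_ge0 _ (X + s * g1)); congr (is_true (0 <= _)); ring.
Qed.

End convexity.

Lemma four_point (V : zmodType) (a b c d : V) : a - b = (c - d) + ((a - c) - (b - d)).
Proof. by rewrite addrA (addrC (c - d)) subrKA opprB subrKA. Qed.

Section discrete_problem.
Context {R : realType} {n : nat}.
Local Notation E := 'rV[R]_n.
Local Notation mu := (lebesgue_rV n : {measure set 'rV[R]_n -> \bar R}).
Variables (Omega : set E) (T : seq (n.+1.-tuple E)) (d : nat).
Hypotheses (n23 : n = 2%N \/ n = 3%N) (domO : convex_polyhedral_domain Omega)
  (triT : triangulation Omega T).
Variable r : R.
Hypotheses (r0 : 0 < r) (clr : forall x, closure Omega x -> `|x| < r).

Let n1 : (1 < n)%N. Proof. by case: n23 => ->. Qed.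
Let n0 : (0 < n)%N := ltnW n1.
Let oO : open Omega := domain_open domO.
Let G := mesh_interior T.
Let oG : open G := @mesh_interior_open _ _ T.
Let GO : G `<=` Omega := @mesh_interior_sub _ _ _ _ domO triT.
Local Notation adm := (admissible Omega T).
Local Notation spl := (spline_space Omega T d).
Local Notation W := (spline0 Omega T d).

Lemma partial2D v w x i k : adm v -> adm w -> G x ->
  partial i (partial k (fun y => v y + w y)) x =
  partial i (partial k v) x + partial i (partial k w) x.
Proof.
move=> [_ C2v _] [_ C2w _] Gx.
have e y : G y -> partial k (fun z => v z + w z) y = partial k v y + partial k w y.
  by move=> Gy; apply: partialD; [case: (C2v.1 _ Gy)|case: (C2w.1 _ Gy)].
rewrite (partial_congr i oG e Gx) partialD//; first by case: (C2v.2 k _ Gx).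
by case: (C2w.2 k _ Gx).
Qed.

Lemma partial2B v w x i k : adm v -> adm w -> G x ->
  partial i (partial k (fun y => v y - w y)) x =
  partial i (partial k v) x - partial i (partial k w) x.
Proof.
move=> [_ C2v _] [_ C2w _] Gx.
have e y : G y -> partial k (fun z => v z - w z) y = partial k v y - partial k w y.
  by move=> Gy; apply: partialB; [case: (C2v.1 _ Gy)|case: (C2w.1 _ Gy)].
rewrite (partial_congr i oG e Gx) partialB//; first by case: (C2v.2 k _ Gx).
by case: (C2w.2 k _ Gx).
Qed.

Lemma convex_near (u v : E -> R) (m eta : R) : 0 <= eta -> C2 Omega u -> adm u -> adm v ->
  (forall x, Omega x -> forall y, m * dotv y y <= dotv (y *m hessian u x) y) ->
  (forall x i k, G x -> `|partial i (partial k v) x - partial i (partial k u) x| <= eta) ->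
  n%:R ^+ 2 * eta <= m -> convex_function Omega v.
Proof.
move=> eta0 C2u au av um vu etam.
apply: (convex_of_monotone_gradient (domain_convex domO) (fun x Ox => adm_diff av Ox)) => x y Ox Oy.
have aw := adm_sub domO av au; set w := (fun z => v z - u z) in aw.
have Gw z : Omega z -> gradient w z = gradient v z - gradient u z.
  by move=> Oz; apply: gradientB; [exact: (adm_diff av Oz)|exact: (adm_diff au Oz)].
have -> : gradient v y - gradient v x =
    (gradient u y - gradient u x) + (gradient w y - gradient w x).
  by rewrite !Gw//; exact: four_point.
rewrite dotvDr; set D := y - x.
have lw k : lip_on Omega (n%:R * eta) (partial k w).
  have [C1w C2w _] := aw.
  apply: (lip_on_mesh n0 domO triT) => [z Oz|K z KT Kz]; first by case: (C1w _ Oz) => _; exact.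
  have Gz : G z by exists K.
  split; first by case: (C2w.2 k _ Gz).
  by move=> i; rewrite partial2B//; exact: vu.
have sw : `|dotv D (gradient w y - gradient w x)| <= n%:R ^+ 2 * eta * dotv D D.
  have nD i : `|D ord0 i| <= `|D| by exact: coord_norm_le.
  have h : `|dotv D (gradient w y - gradient w x)| <= n%:R * (`|D| * (n%:R * eta * `|D|)).
    rewrite (le_trans (ler_norm_sum _ _ _))// mulr_natl -[X in _ *+ X]card_ord -sumr_const.
    apply: ler_sum => i _; rewrite normrM ler_pM//.
    have -> : (gradient w y - gradient w x) ord0 i = partial i w y - partial i w x.
      by rewrite mxE; congr (_ + _); [exact: mxE|apply: (etrans (mxE _ _ _ _)); congr (- _); exact: mxE].
    exact: lw.
  have alg (p q s : R) : p * (q * (p * s * q)) = p ^+ 2 * s * q ^+ 2 by ring.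
  apply: (le_trans h); rewrite alg.
  rewrite ler_wpM2l ?mulr_ge0 ?sqr_ge0//.
  rewrite -[leRHS](sqr_sqrtr (dotv_ge0 D)) lerXn2r ?nnegrE ?sqrtr_ge0//.
  by apply: norm_dotv_le; rewrite ?sqrtr_ge0// sqr_sqrtr// dotv_ge0.
have su : m * dotv D D <= dotv D (gradient u y - gradient u x).
  pose g z := \sum_k D ord0 k * partial k u z.
  have dg z : Omega z -> forall k, differentiable (fun z => D ord0 k * partial k u z) z.
    move=> Oz k; apply: differentiableM; first exact: differentiable_cst.
    by case: (C2u.2 k _ Oz).
  have [t t01|t /andP[t0 t1] H] := @mvt_line _ _ g x y.
    by apply: (@partial_sum _ _ _ _ _ _ _ (Ordinal n0) _).1 => k _; apply: dg; exact: (domain_convex domO).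
  have Oz : Omega (x + t *: (y - x)) by apply: (domain_convex domO) => //; rewrite !ltW.
  move: H Oz; set z := x + _ => H Oz.
  have -> : dotv D (gradient u y - gradient u x) = g y - g x.
    rewrite /g -sumrB; apply: eq_bigr => k _; rewrite -mulrBr; congr (_ * _).
    rewrite mxE; congr (_ + _); first exact: mxE.
    by apply: (etrans (mxE _ _ _ _)); congr (- _); exact: mxE.
  rewrite H; apply: (le_trans (um z Oz D)); apply: le_of_eq.
  rewrite /dotv; apply: eq_bigr => i _; rewrite mulrC; congr (_ * _).
  rewrite [LHS]mxE (partial_sum _ _ _).2 => [|k _]; last exact: dg.
  apply: eq_bigr => k _.
  rewrite partialZ; last by case: (C2u.2 k _ Oz).
  by congr (_ * _); rewrite (schwarz i k oO C2u Oz); exact: hessianE.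
have dD := dotv_ge0 D.
have h1 : - (n%:R ^+ 2 * eta * dotv D D) <= dotv D (gradient w y - gradient w x).
  by move: sw; rewrite ler_norml => /andP[].
have h2 : n%:R ^+ 2 * eta * dotv D D <= m * dotv D D by rewrite ler_wpM2r.
rewrite -(subrr (n%:R ^+ 2 * eta * dotv D D)); apply: lerD; last exact: h1.
exact: le_trans h2 su.
Qed.

Section solve.
Variables (u b : E -> R) (S a rho kappa H R0 : R).
Hypotheses (au : adm u) (S0 : 0 <= S) (uS : forall x i k, G x -> `|partial i (partial k u) x| <= S)
  (a0 : 0 < a) (ua : forall x, G x -> forall y, a * dotv y y <= qform (cof (hessian u x)) y y)
  (rho0 : 0 <= rho) (rho1 : rho <= 1) (rhoa : n%:R * ((4 * S + 2) * rho) <= a / 2).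
Local Notation near := (hess_near T u rho).

Lemma near_self : near u.
Proof. by move=> x i k _; rewrite subrr normr0. Qed.

(** Tested with v1 - v2, strong monotonicity leaves no energy, and the Poincare inequality does the
    rest. *)
Lemma discrete_unique v1 v2 : spl v1 -> spl v2 -> (forall x, bdry Omega x -> v1 x = v2 x) ->
  near v1 -> near v2 -> (forall w, W w -> mform T v1 v1 w = mform T v2 v2 w) ->
  forall x, Omega x -> v1 x = v2 x.
Proof.
move=> s1 s2 eb h1 h2 eqm.
have Wz : W (fun x => v1 x - v2 x).
  by split; [exact: spline_spaceB|move=> x /eb ->; rewrite subrr].
have a1 := spl_adm n23 domO triT s1; have a2 := spl_adm n23 domO triT s2.
have M := mform_monotone n23 domO triT r0 clr S0 uS ua rho1 rhoa a1 a2 h1 h2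
  (spline0_approx n23 domO triT clr Wz).
rewrite (eqm _ Wz) subrr in M.
have e0 : energy T (fun x => v1 x - v2 x) (fun x => v1 x - v2 x) = 0.
  apply/eqP; rewrite eq_le energy_ge0 andbT; move: M; rewrite pmulr_rle0//.
  by rewrite mulr_gt0 ?ltr0n// divr_gt0.
by move=> x Ox; apply/eqP; rewrite -subr_eq0; apply/eqP; exact: (energy_eq0 n23 domO triT r0 clr Wz e0 Ox).
Qed.

Hypotheses (sb : spl b) (R00 : 0 < R0)
  (bu : forall x i k, G x -> `|partial i (partial k b) x - partial i (partial k u) x| <= rho / 3)
  (bu1 : forall x, G x -> forall i, `|partial i (fun y => b y - u y) x| <= kappa)
  (H0 : 0 <= H) (WH : forall z, W z -> forall x i k, G x ->
    `|partial i (partial k z) x| <= H * Num.sqrt (energy T z z))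
  (HR : H * R0 <= rho / 3)
  (res : (n%:R * (n%:R * (2 * (S + 1 + 1) ^+ 2))) ^+ 2 *
     (n%:R * (kappa ^+ 2 * fine (mu Omega))) <= (n%:R * (a / 2) * R0 / 4) ^+ 2).

(** One third of the tolerance rho is spent on b and one on z; the last third is kept for the
    competitors in the local uniqueness. *)
Lemma small_near z : W z -> energy T z z <= R0 ^+ 2 -> forall x i k, G x ->
  `|partial i (partial k (fun y => b y + z y)) x - partial i (partial k u) x| <= 2 * (rho / 3).
Proof.
move=> Wz ez x i k Gx.
have ab := spl_adm n23 domO triT sb; have az := spline0_adm n23 domO triT Wz.
rewrite (partial2D i k ab az Gx).
have h : `|partial i (partial k z) x| <= rho / 3.
  apply: (le_trans (WH Wz i k Gx)); apply: le_trans HR; rewrite ler_wpM2l//.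
  by rewrite -(ger0_norm (ltW R00)) -sqrtr_sqr ler_wsqrtr.
have alg (p q s t : R) : `|p - q| <= t -> `|s| <= t -> `|p + s - q| <= 2 * t.
  by move=> e1 e2; rewrite addrAC (le_trans (ler_normD _ _))// mulrDl mul1r lerD.
exact: (alg _ _ _ _ (bu i k Gx) h).
Qed.

Lemma small_near1 z : W z -> energy T z z <= R0 ^+ 2 -> near (fun y => b y + z y).
Proof.
move=> Wz ez x i k Gx; apply: (le_trans (small_near Wz ez i k Gx)).
by rewrite mulrA ler_pdivrMr// [leRHS]mulrC ler_wpM2r// ler_nat.
Qed.

(** The unknown is the correction z to b, with zero boundary values. The functional compares the
    form at b + z with the one at u, so that its value at z = 0 measures b - u alone; the source
    enters later through [mform_source]. *)
Lemma discrete_solve : exists z, [/\ W z, energy T z z <= R0 ^+ 2 &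
  forall w, W w -> mform T (fun y => b y + z y) (fun y => b y + z y) w = mform T u u w].
Proof.
have n0R : 0 < n%:R :> R by rewrite ltr0n.
pose c := n%:R * (a / 2); pose K := n%:R * (n%:R * (2 * (S + 1 + 1) ^+ 2)).
have c0 : 0 < c by rewrite mulr_gt0// divr_gt0.
(* K^2 is the Lipschitz constant of [mform_lip]; c^2 is added to meet the condition c^2 <= L of
   [galerkin]. *)
pose L := c ^+ 2 + K ^+ 2.
have cL : c ^+ 2 <= L by rewrite lerDl sqr_ge0.
have KL : K ^+ 2 <= L by rewrite lerDr sqr_ge0.
have ab := spl_adm n23 domO triT sb.
have aW z (Wz : W z) := spline0_adm n23 domO triT Wz.
have aD z (Wz : W z) : adm (fun y => b y + z y) := admissibleD domO ab (aW z Wz).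
pose F (z w : E -> R) : R := mform T (fun y => b y + z y) (fun y => b y + z y) w - mform T u u w.
suff [z [Wz ez] Hz] : exists2 z, W z /\ energy T z z <= R0 ^+ 2 & forall w, W w -> F z w = 0.
  exists z; split; [exact: Wz|exact: ez|].
  by move=> w Ww; exact: (subr0_eq (Hz w Ww)).
have W0 : W (0 : E -> R).
  rewrite (_ : 0 = (fun x => 0 * b x)); last by apply/funext => x; rewrite mul0r.
  split; first exact: (spline_spaceZ oO 0 sb).
  by move=> x _; rewrite mul0r.
have WD (x y : E -> R) : W x -> W y -> W (x + y) by exact: spline0D.
have WZ (k : R) (x : E -> R) : W x -> W (k *: x) by exact: spline0Z.
have ipD (x y z : E -> R) : W x -> W y -> W z -> energy T (x + y) z = energy T x z + energy T y z.
  by move=> Wx Wy Wz; exact: (energyDl domO triT clr (aW x Wx) (aW y Wy) (aW z Wz)).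
have ipZ (k : R) (x z : E -> R) : W x -> W z -> energy T (k *: x) z = k * energy T x z.
  by move=> Wx Wz; exact: (energyZl domO triT clr k (aW x Wx) (aW z Wz)).
have finW m (e : 'I_m -> E -> R) : (size T * #|{: @mindex n d}| < m)%N -> (forall k, W (e k)) ->
    exists c : 'I_m -> R, (exists k, c k != 0) /\
      energy T (\sum_k c k *: e k) (\sum_k c k *: e k) = 0.
  move=> Nm We; have [cc [cc0 Hcc]] := spline0_finite triT Nm We.
  exists cc; split; first exact: cc0.
  apply: (energy_null domO triT) => x Ox; rewrite -[RHS](Hcc x Ox).
  by rewrite fct_sumE.
have nearB z : W z /\ energy T z z <= R0 ^+ 2 -> near (fun y => b y + z y).
  by case=> Wz ez; exact: small_near1.
have diffE (x y : E -> R) : (fun t => (b t + x t) - (b t + y t)) = (fun t => x t - y t).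
  by apply/funext => t; rewrite opprD addrACA subrr add0r.
have Flip (x y w : E -> R) : W x /\ energy T x x <= R0 ^+ 2 -> W y /\ energy T y y <= R0 ^+ 2 -> W w ->
    (F x w - F y w) ^+ 2 <= L * (energy T (x - y) (x - y) * energy T w w).
  move=> Bx By Ww; rewrite /F opprB addrA subrK.
  have := mform_lip n23 domO triT r0 clr S0 uS rho1 (aD x Bx.1) (aD y By.1)
    (aW w Ww) (nearB x Bx) (nearB y By) (spline0_approx n23 domO triT clr Ww).
  rewrite diffE => h; apply: (le_trans h); rewrite ler_wpM2r//.
  by rewrite mulr_ge0 ?energy_ge0.
apply: (@galerkin R (E -> R) W (energy T) _ W0 WD WZ (energyC T) ipD ipZ (fun x _ => energy_ge0 T x)
  finW F c L R0 c0 cL R00).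
- move=> z x y [Wz _] Wx Wy; rewrite /F.
  rewrite (mformD domO triT clr (aD z Wz) (aD z Wz) (aW x Wx) (aW y Wy)).
  rewrite (mformD domO triT clr au au (aW x Wx) (aW y Wy)).
  by rewrite opprD addrACA.
- move=> z k x [Wz _] Wx; rewrite /F.
  rewrite (mformZ domO triT clr k (aD z Wz) (aD z Wz) (aW x Wx)).
  by rewrite (mformZ domO triT clr k au au (aW x Wx)) mulrBr.
(* The functional is the difference of the forms at b + z and at u, and the Lipschitz bound for this
   difference contains the energy of w as a factor. *)
- move=> z w Bz Ww w0; apply/eqP; rewrite -sqrf_eq0 eq_le sqr_ge0 andbT /F.
  have := mform_lip n23 domO triT r0 clr S0 uS rho1 (aD z Bz.1) au
    (aW w Ww) (nearB z Bz) near_self (spline0_approx n23 domO triT clr Ww).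
  by rewrite w0 !mulr0.
- move=> x y Bx By.
  have Wxy : W (fun t => x t - y t).
    have := WD _ _ Bx.1 (WZ (- 1) _ By.1).
    by rewrite (_ : x + -1 *: y = (fun t => x t - y t))//; apply/funext => t /=; rewrite scaleN1r.
  have := mform_monotone n23 domO triT r0 clr S0 uS ua rho1 rhoa (aD x Bx.1) (aD y By.1)
    (nearB x Bx) (nearB y By).
  rewrite diffE => /(_ (spline0_approx n23 domO triT clr Wxy)) h.
  by rewrite /F opprB addrA subrK; exact: h.
- exact: Flip.
(* The residual at the centre is bounded by the same Lipschitz estimate with b - u, whose energy is
   controlled by kappa. *)
- move=> w Ww; rewrite /F.
  have -> : (fun y => b y + (0 : E -> R) y) = b by apply/funext => t; rewrite addr0.
  have nb : near b.
    move=> x i k Gx; apply: (le_trans (bu i k Gx)); rewrite ler_pdivrMr// ler_peMr//.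
    by rewrite ler1n.
  have := mform_lip n23 domO triT r0 clr S0 uS rho1 ab au
    (aW w Ww) nb near_self (spline0_approx n23 domO triT clr Ww).
  move=> h; apply: (le_trans h); rewrite mulrA ler_wpM2r ?energy_ge0//.
  apply: le_trans res; rewrite ler_wpM2l ?sqr_ge0//.
  exact: (energy_bound domO triT clr (adm_sub domO ab au) bu1).

Qed.

End solve.

End discrete_problem.

Section mesh_size.
Context {R : realType} {n : nat}.
Local Notation E := 'rV[R]_n.

Lemma enorm_le (x : E) (c : R) : 0 <= c -> `|x| <= c -> enorm x <= Num.sqrt n%:R * c.
Proof.
move=> c0 xc; rewrite /enorm -(ger0_norm c0) -sqrtr_sqr -sqrtrM ?ler0n//; apply: ler_wsqrtr.
rewrite mulr_natl -[X in _ *+ X]card_ord -sumr_const; apply: ler_sum => i _.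
rewrite -real_normK ?num_real// lerXn2r ?nnegrE//.
exact: le_trans (coord_norm_le x i) xc.
Qed.

Lemma diam_gt0 (s : seq E) : (0 < n)%N -> (hull s)° !=set0 -> 0 < diam (hull s).
Proof.
move=> n0 [x /interior_normP[e e0 He]].
have [r r0 Hr] := hull_bounded s.
pose y : E := x + (e / 2) *: delta_mx ord0 (Ordinal n0).
have e2 : 0 < e / 2 by rewrite divr_gt0.
have nd : `|(delta_mx ord0 (Ordinal n0) : E)| <= 1.
  apply/(rV_norm_leP _ ler01) => i; rewrite mxE eqxx /=.
  by case: eqP; rewrite ?normr1 ?normr0.
have Hy : hull s y.
  apply: He; rewrite /y addrAC subrr add0r normrZ gtr0_norm//.
  by apply: (@le_lt_trans _ _ (e / 2)); [rewrite ler_piMr// ltW|rewrite ltr_pdivrMr// ltr_pMr// ltr1n].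
have Hx : hull s x by apply: He; rewrite subrr normr0.
have d0 : 0 < enorm (y - x).
  rewrite /enorm sqrtr_gt0 (bigD1 (Ordinal n0))//= ltr_pwDl//; last first.
    by apply: sumr_ge0 => i _; exact: sqr_ge0.
  by rewrite /y addrAC subrr add0r !mxE !eqxx mulr1 exprn_gt0.
apply: (lt_le_trans d0); apply: ub_le_sup; last by exists (y, x).
exists (Num.sqrt n%:R * (r + r)) => t [[p q] /= [pH qH] <-].
apply: enorm_le; first by rewrite addr_ge0// ltW.
by rewrite (le_trans (ler_normB _ _))// lerD// ltW// Hr.
Qed.

(** Negative powers of the mesh size occur in the inverse estimate; a nondegenerate simplex has
    positive diameter. *)
Lemma mesh_size_gt0 (Omega : set E) (T : seq (n.+1.-tuple E)) : (0 < n)%N ->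
  convex_polyhedral_domain Omega -> triangulation Omega T -> 0 < mesh_size T.
Proof.
move=> n0 domO triT; have [x Ox] := domO.1.
have [K KT _] := closure_cover triT (subset_closure Ox).
have dK : 0 < diam (hull K).
  by apply: (diam_gt0 n0); exact: (hull_interior_neq0 (simplex_indep triT KT) n0).
apply: (lt_le_trans dK); rewrite /mesh_size.
elim: T {triT} KT => // K' T IH; rewrite inE big_cons => /predU1P[<-|/IH h].
  by rewrite le_max lexx.
by rewrite le_max h orbT.
Qed.

End mesh_size.

(** * Powers of the mesh size *)

Section powers.
Context {R : realType}.
Variables (h : R) (n l : nat).
Hypotheses (h0 : 0 < h) (h1 : h <= 1) (n3 : (n <= 3)%N) (l3 : (3 <= l)%N).

Lemma powR_exponent_le (a b : R) : a <= b -> h `^ b <= h `^ a.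
Proof.
move=> ab; rewrite -(subrK a b) addrC powRD; last by rewrite (gt_eqF h0) implybT.
rewrite ler_piMr ?powR_ge0//; apply: (@le_trans _ _ (1 `^ (b - a))); last by rewrite powR1.
by rewrite ge0_ler_powR ?subr_ge0 ?nnegrE// ltW.
Qed.

Lemma exprn_powR k : h ^+ k = h `^ k%:R.
Proof. by rewrite powR_mulrn// ltW. Qed.

(** For n <= 3 <= l the exponent l exceeds 1 + n / 2 by at least 1 / 2, with equality at n = l = 3.
    The factor h^(1/2) gained in this way absorbs the constants. *)
Lemma half_exponent : (1 + n%:R / 2 + 2^-1 <= l%:R :> R).
Proof.
have : (n%:R : R) <= 3 by rewrite ler_nat.
have : (3 : R) <= l%:R by rewrite ler_nat.
by move: (n%:R : R) (l%:R : R) => a b; lra.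
Qed.

Lemma mesh_power_sub : h ^+ (l.+1 - 2) <= h `^ 2^-1.
Proof.
rewrite exprn_powR; apply: powR_exponent_le.
apply: (@le_trans _ _ 1); first by rewrite invf_le1// ler1n.
by rewrite ler1n; move: l3; case: l => [|[|k]].
Qed.

Lemma mesh_power_inv : h ^+ l * h `^ (- 1 - n%:R / 2) <= h `^ 2^-1.
Proof.
rewrite exprn_powR -powRD; last by rewrite (gt_eqF h0) implybT.
by apply: powR_exponent_le; have := half_exponent; lra.
Qed.

Lemma mesh_power_mul : h ^+ l <= h `^ 2^-1 * h `^ (1 + n%:R / 2).
Proof.
rewrite exprn_powR -powRD; last by rewrite (gt_eqF h0) implybT.
by apply: powR_exponent_le; have := half_exponent; lra.
Qed.

End powers.

Lemma norm_third (R : realType) (p q s t : R) : `|p - q| <= t / 3 -> `|q - s| <= 2 * (t / 3) ->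
  `|p - s| <= t.
Proof. by rewrite !ler_norml => /andP[? ?] /andP[? ?]; apply/andP; split; lra. Qed.

(** * The discrete problem on a single mesh *)

Section one_mesh.
Context {R : realType} {n : nat}.
Local Notation E := 'rV[R]_n.
Local Notation mu := (lebesgue_rV n : {measure set 'rV[R]_n -> \bar R}).
Variables (Omega : set E) (T : seq (n.+1.-tuple E)) (d : nat).
Hypotheses (n23 : n = 2%N \/ n = 3%N) (domO : convex_polyhedral_domain Omega)
  (triT : triangulation Omega T).
Variable r : R.
Hypotheses (r0 : 0 < r) (clr : forall x, closure Omega x -> `|x| < r).
Local Notation G := (mesh_interior T).
Local Notation spl := (spline_space Omega T d).
Local Notation W := (spline0 Omega T d).
Local Notation m1 := (#|{: @mindex n 1}|%:R : R).
Local Notation vol := (fine (mu Omega)).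

Variables (u f b q gh : E -> R) (S a rho m H R0 k1 k3 : R).
Hypotheses (C2u : C2 Omega u) (au : admissible Omega T u) (S0 : 0 <= S)
  (uS : forall x i k, Omega x -> `|partial i (partial k u) x| <= S)
  (uf : forall x, Omega x -> \det (hessian u x) = f x)
  (a0 : 0 < a) (ua : forall x, Omega x -> forall y, a * dotv y y <= qform (cof (hessian u x)) y y)
  (um : forall x, Omega x -> forall y, m * dotv y y <= dotv (y *m hessian u x) y)
  (rho0 : 0 < rho) (rho1 : rho <= 1) (rhoa : n%:R * ((4 * S + 2) * rho) <= a / 2)
  (rhom : n%:R ^+ 2 * rho <= m)
  (sb : spl b) (bgh : forall x, bdry Omega x -> b x = gh x) (sq : spl q)
  (R00 : 0 < R0) (H0 : 0 < H)
  (bu2 : forall x i k, G x -> `|partial i (partial k b) x - partial i (partial k u) x| <= rho / 3)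
  (bu : forall x, G x -> `|b x - u x| <= k1 /\ forall i, `|partial i (fun y => b y - u y) x| <= k1)
  (uq : forall x, G x -> `|u x - q x| <= k3 /\ forall i, `|partial i (fun y => u y - q y) x| <= k3)
  (invH : forall v, spl v -> (broken_seminorm T 2 +oo v <= H%:E * H1norm Omega v)%E)
  (HR : H * (Num.sqrt (m1 * (2 * (4 * r ^+ 2 + 1))) * R0) <= rho / 3)
  (res : (n%:R * (n%:R * (2 * (S + 1 + 1) ^+ 2))) ^+ 2 *
     (n%:R * (k1 ^+ 2 * vol)) <= (n%:R * (a / 2) * R0 / 4) ^+ 2).

Let n1 : (1 < n)%N. Proof. by case: n23 => ->. Qed.
Let n0 : (0 < n)%N := ltnW n1.
Let oO : open Omega := domain_open domO.
Let Or x : Omega x -> `|x| < r. Proof. by move/subset_closure/clr. Qed.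
Let GO : G `<=` Omega := @mesh_interior_sub _ _ _ _ domO triT.
Let uSG x i k (Gx : G x) := uS i k (GO Gx).
Let uaG x (Gx : G x) := ua (GO Gx).

Lemma const_ge0 : 0 <= m1 * (2 * (4 * r ^+ 2 + 1)).
Proof.
exact: mulr_ge0 (ler0n _ _) (mulr_ge0 (ler0n _ 2)
  (addr_ge0 (mulr_ge0 (ler0n _ 4) (sqr_ge0 r)) ler01)).
Qed.

Lemma H1norm_bound z e k : W z -> nice Omega e -> energy T z z <= R0 ^+ 2 ->
  (forall x, G x -> `|e x| <= k /\ forall i, `|partial i e x| <= k) ->
  (H1norm Omega (fun x => (z x + e x)%R) <=
    (Num.sqrt (m1 * (2 * (4 * r ^+ 2 + 1) * R0 ^+ 2 + 2 * (k ^+ 2 * vol)))%R)%:E)%E.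
Proof.
move=> Wz ne ez ek; apply: (le_trans (H1norm_split n23 domO triT r0 clr Wz ne ek)).
rewrite lee_fin; apply: ler_wsqrtr; apply: (ler_wpM2l (ler0n _ _)); rewrite lerD2r.
apply: ler_wpM2l ez; exact: mulr_ge0 (ler0n _ 2)
  (addr_ge0 (mulr_ge0 (ler0n _ 4) (sqr_ge0 r)) ler01).
Qed.

(** The inverse estimate bounds second derivatives by the H^1 norm of z, and the Poincare inequality
    bounds that norm by the energy. *)
Lemma inverse_hess z : W z -> forall x i k, G x ->
  `|partial i (partial k z) x| <= H * Num.sqrt (m1 * (2 * (4 * r ^+ 2 + 1))) * Num.sqrt (energy T z z).
Proof.
move=> Wz x i k Gx; apply: (spline_hess_le n23 domO triT clr i k Wz.1 _ Gx).
apply: (le_trans (invH Wz.1)); rewrite -mulrA EFinM; apply: lee_wpmul2l.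
  by rewrite lee_fin ltW.
have n0' : nice Omega (fun=> 0 : R).
  split; last by exists 0 => // p q' _ _; rewrite subrr normr0 mul0r.
  by move=> p _; split=> [|j]; [exact: differentiable_cst|
    rewrite (_ : partial j (fun=> 0) = fun=> 0); [exact: cst_continuous|
      apply/funext => y; exact: partial_cst]].
have := H1norm_split n23 domO triT r0 clr Wz n0' (k := 0).
rewrite (_ : (fun x => z x + 0)%R = z); last by apply/funext => y; rewrite addr0.
move=> h; apply: (le_trans (h _)).
  by move=> y Gy; rewrite normr0; split=> // j; rewrite partial_cst normr0.
rewrite lee_fin -(sqrtrM _ const_ge0); apply: le_of_eq; congr (Num.sqrt _).
by rewrite expr0n /= mul0r mulr0 addr0 mulrA.
Qed.

Lemma source_bmeas w : nice Omega w -> bmeas Omega (fun x => f x * w x).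
Proof.
move=> nw; have [bw _] := nice_bmeas oO Or nw; apply: bmeasM bw.
apply: (eq_bmeas uf); apply: bmeas_det => i k.
apply: (eq_bmeas (f := partial i (partial k u))).
  by move=> x _; apply: esym; exact: hessianE.
split; last by exists S => x; exact: uS.
by apply: continuous_on_measurable => // x Ox; case: (C2u.2 k x Ox) => _; exact.
Qed.

(** Here the mesh size is hidden in H, R0, k1, k3 and the Hessian error of b; it remains for the
    caller to meet [HR], [res] and [bu2] for small h. *)
Lemma mesh_result : exists uh, [/\ discrete_solution Omega T d f gh uh,
  exists2 eps : R, 0 < eps & forall vh, discrete_solution Omega T d f gh vh ->
    (H1norm Omega (vh \- uh)%R < eps%:E)%E -> forall x, Omega x -> vh x = uh x,
  (H1norm Omega (u \- uh)%R <=
    (Num.sqrt (m1 * (2 * (4 * r ^+ 2 + 1) * R0 ^+ 2 + 2 * (k1 ^+ 2 * vol))))%:E)%E,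
  (H1norm Omega (uh \- q)%R <=
    (Num.sqrt (m1 * (2 * (4 * r ^+ 2 + 1) * R0 ^+ 2 + 2 * ((k1 + k3) ^+ 2 * vol))))%:E)%E &
  convex_function Omega uh].
Proof.
have ab := spl_adm n23 domO triT sb.
have HK0 : 0 <= H * Num.sqrt (m1 * (2 * (4 * r ^+ 2 + 1))) by rewrite mulr_ge0 ?sqrtr_ge0 ?ltW.
have HR' : H * Num.sqrt (m1 * (2 * (4 * r ^+ 2 + 1))) * R0 <= rho / 3 by rewrite -mulrA.
have [z [Wz ez Hz]] := discrete_solve n23 domO triT r0 clr au S0 uSG a0 uaG (ltW rho0) rho1 rhoa sb
  R00 bu2 (fun x Gx => (bu Gx).2) HK0 inverse_hess HR' res.
pose uh (y : E) := b y + z y.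
have suh : spl uh := spline_spaceD oO sb Wz.1.
have auh := spl_adm n23 domO triT suh.
have near2 := small_near n23 domO triT sb R00 bu2 HK0 inverse_hess HR' Wz ez.
have gb x : bdry Omega x -> uh x = gh x.
  by move=> xb; rewrite /uh Wz.2// addr0 bgh.
have sol : discrete_solution Omega T d f gh uh.
  split; [exact: suh|exact: gb|] => w /(space0_spline0 n23 domO triT clr) Ww.
  have aw := spline0_adm n23 domO triT Ww.
  rewrite (ma_formE domO triT clr auh aw) (Hz _ Ww).
  rewrite (mform_source n23 domO triT r0 clr au (fun x Gx => uf (GO Gx)) (spline0_approx n23 domO triT clr Ww)).
  rewrite (Rint_mesh n23 domO triT clr (source_bmeas (admissible_nice aw))).
  by rewrite mulrA mulrNN mulVf ?mul1r// pnatr_eq0 -lt0n.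
exists uh; split.
- exact: sol.
(* By the inverse estimate a competitor within this distance of uh has Hessians within rho / 3 of
   those of uh, hence within rho of D^2 u, where monotonicity holds. *)
- exists (rho / 3 / H); first by rewrite !divr_gt0.
  move=> vh [svh gvh Hvh] hv.
  have avh := spl_adm n23 domO triT svh.
  have near_vh : hess_near T u rho vh.
    move=> x i k Gx.
    have h1 : `|partial i (partial k (fun y => vh y - uh y)) x| <= rho / 3.
      apply: (spline_hess_le n23 domO triT clr i k (spline_spaceB oO svh suh) _ Gx).
      apply: (le_trans (invH (spline_spaceB oO svh suh))).
      apply: (@le_trans _ _ (H%:E * (rho / 3 / H)%:E)%E).
        by apply: lee_wpmul2l; [rewrite lee_fin ltW|exact: ltW].
      by rewrite -EFinM lee_fin mulrC divfK// gt_eqF.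
    rewrite (partial2B i k avh auh Gx) in h1.
    exact: (norm_third h1 (near2 x i k Gx)).
  have near_uh : hess_near T u rho uh.
    exact: (small_near1 n23 domO triT (ltW rho0) sb R00 bu2 HK0 inverse_hess HR' Wz ez).
  apply: (discrete_unique n23 domO triT r0 clr S0 uSG a0 uaG rho1 rhoa svh suh _ near_vh near_uh).
    by move=> x xb; rewrite gvh// gb.
  move=> w Ww; have aw := spline0_adm n23 domO triT Ww.
  have := Hvh _ (spline0_space0 n23 domO triT clr Ww).
  have [_ _ /(_ _ (spline0_space0 n23 domO triT clr Ww)) <-] := sol.
  rewrite (ma_formE domO triT clr auh aw) (ma_formE domO triT clr avh aw).
  by apply: mulfI; rewrite oppr_eq0 invr_eq0 pnatr_eq0 -lt0n.
- have E1 : (u \- uh)%R = (fun x => -1 * z x + (u x - b x)).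
    by apply/funext => x; rewrite /= /uh mulN1r opprD addrA addrC.
  have ne := admissible_nice (adm_sub domO au ab).
  rewrite E1; apply: (H1norm_bound (spline0Z domO (-1) Wz) ne).
    have az := spline0_adm n23 domO triT Wz.
    rewrite (energyZl domO triT clr (-1) az (admissibleZ domO (-1) az)) energyC.
    by rewrite (energyZl domO triT clr (-1) az az) mulrA mulrNN mul1r mul1r.
  move=> x Gx; have [h1 h2] := bu Gx; split; first by rewrite distrC.
  have dub : differentiable u x /\ differentiable b x.
    by split; [exact: (adm_diff au (GO Gx))|exact: (adm_diff ab (GO Gx))].
  by move=> i; have := h2 i; rewrite (partialB i dub.2 dub.1) (partialB i dub.1 dub.2) distrC.
- have E1 : (uh \- q)%R = (fun x => z x + (b x - q x)).
    by apply/funext => x; rewrite /= /uh addrAC addrC.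
  have aq := spl_adm n23 domO triT sq.
  rewrite E1; apply: (H1norm_bound Wz (admissible_nice (adm_sub domO ab aq)) ez).
  move=> x Gx; have [h1 h2] := bu Gx; have [h3 h4] := uq Gx; split.
    by rewrite -(subrKA (u x)) (le_trans (ler_normD _ _))// lerD.
  have du := adm_diff au (GO Gx); have db := adm_diff ab (GO Gx); have dq := adm_diff aq (GO Gx).
  move=> i; rewrite (partialB i db dq) -(subrKA (partial i u x)) (le_trans (ler_normD _ _))//.
  by apply: lerD; [rewrite -(partialB i db du)|rewrite -(partialB i du dq)].
- apply: (convex_near n23 domO triT (eta := 2 * (rho / 3)) _ C2u au auh um near2).
    by rewrite mulr_ge0 ?divr_ge0 ?ltW.
  apply: le_trans rhom; rewrite ler_wpM2l ?sqr_ge0//.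
  by rewrite mulrA ler_pdivrMr// [leRHS]mulrC ler_pM2r// ler_nat.
Qed.

End one_mesh.

Section difference_bounds.
Context {R : realType} {n : nat}.
Local Notation E := 'rV[R]_n.
Variables (Omega : set E) (T : seq (n.+1.-tuple E)).
Hypotheses (n23 : n = 2%N \/ n = 3%N) (domO : convex_polyhedral_domain Omega)
  (triT : triangulation Omega T).
Variable r : R.
Hypotheses (r0 : 0 < r) (clr : forall x, closure Omega x -> `|x| < r).
Local Notation G := (mesh_interior T).

Let n1 : (1 < n)%N. Proof. by case: n23 => ->. Qed.
Let oO : open Omega := domain_open domO.
Let Or x : Omega x -> `|x| < r. Proof. by move/subset_closure/clr. Qed.
Let GO : G `<=` Omega := @mesh_interior_sub _ _ _ _ domO triT.

Lemma broken1_diff (u b : E -> R) (c : R) : admissible Omega T u -> admissible Omega T b ->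
  (broken_norm T 1 +oo (u \- b)%R <= c%:E)%E -> forall x, G x ->
  (`|u x - b x| <= c /\ forall i, `|partial i (fun y => u y - b y) x| <= c) /\
  (`|b x - u x| <= c /\ forall i, `|partial i (fun y => b y - u y) x| <= c).
Proof.
move=> au ab H x Gx; have [C1w _ _] := adm_sub domO au ab.
have [h1 h2] := broken1_le n23 domO triT clr C1w H Gx.
split; [by split; [exact: h1|exact: h2]|split; first by rewrite distrC].
have du := adm_diff au (GO Gx); have db := adm_diff ab (GO Gx).
by move=> i; have := h2 i; rewrite (partialB i du db) (partialB i db du) distrC.
Qed.

Lemma broken2_diff (u b : E -> R) (c : R) : admissible Omega T u -> admissible Omega T b ->
  (broken_norm T 2 +oo (u \- b)%R <= c%:E)%E -> forall x i k, G x ->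
  `|partial i (partial k b) x - partial i (partial k u) x| <= c.
Proof.
move=> au ab H x i k Gx; have [_ C2w _] := adm_sub domO au ab.
have C2K K : K \in T -> C2 (hull K)° (fun x => u x - b x).
  move=> KT; have KG y : (hull K)° y -> G y by move=> Ky; exists K.
  by split=> [y /KG|j y /KG]; [exact: C2w.1|exact: C2w.2].
by rewrite distrC -(partial2B i k au ab Gx); exact: (broken2_le n23 domO triT clr i k C2K H Gx).
Qed.

Lemma sobolev_C2_bound (k : nat) (v : E -> R) : (1 < k)%N -> C2 Omega v ->
  sobolev Omega k +oo v -> exists2 S : R, 0 <= S & forall x, Omega x ->
  (forall i, `|partial i v x| <= S) /\ forall i j, `|partial i (partial j v) x| <= S.
Proof.
move=> k1 C2v fin; have p0 := lpsumy_ge0.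
have S0 : (0 <= sob_norm Omega k +oo v)%E by exact: lpsumy_ge0.
exists (fine (sob_norm Omega k +oo v)); first exact: fine_ge0.
have E : sob_norm Omega k +oo v = (fine (sob_norm Omega k +oo v))%:E.
  by rewrite fineK// ge0_fin_numE.
move=> x Ox; split=> [i|i j]; rewrite -lee_fin -E.
  exact: (sob_norm_infty1 n1 oO Or i (ltnW k1) C2v.1 Ox).
exact: (sob_norm_infty2 n1 oO Or i j k1 C2v Ox).
Qed.

Lemma hessian_sym (v : E -> R) x : C2 Omega v -> Omega x -> (hessian v x)^T = hessian v x.
Proof.
move=> C2v Ox; apply/matrixP => i j; apply: (etrans (mxE _ _ _ _)).
apply: (etrans (hessianE _ _ _ _)); apply: (etrans (schwarz j i oO C2v Ox)).
by apply: esym; exact: hessianE.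
Qed.

End difference_bounds.

(** The constants in the approximation hypotheses carry no sign, hence the absolute value. *)
Lemma scaled_bound (R : realType) (C Su N : R) (x y : \bar R) : 0 <= Su -> 0 <= N ->
  y = Su%:E -> (x <= (C * N)%:E * y)%E -> (x <= (`|C| * Su * N)%:E)%E.
Proof.
move=> S0 N0 -> H; apply: (le_trans H); rewrite -EFinM lee_fin mulrAC.
by rewrite !ler_wpM2r// ler_norm.
Qed.

(** The squared residual X N^2 of the interpolant has to stay below the threshold set by a ball of
    radius A N. The common factor N^2 drops out, which leaves a condition on A alone. *)
Lemma residual_small (R : realType) (n a X A N : R) : 0 < n -> 0 < a -> 0 <= X ->
  Num.sqrt X * 8 / (n * a) <= A -> X * N ^+ 2 <= (n * (a / 2) * (A * N) / 4) ^+ 2.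
Proof.
move=> n0 a0 X0 H; have na : 0 < n * a by rewrite mulr_gt0.
have -> : n * (a / 2) * (A * N) / 4 = (A * (n * a) / 8) * N by field.
rewrite exprMn ler_wpM2r ?sqr_ge0// -[leLHS](sqr_sqrtr X0).
rewrite lerXn2r ?nnegrE ?sqrtr_ge0//; last by rewrite ler_pdivlMr// -ler_pdivrMr.
apply: (@le_trans _ _ (Num.sqrt X)); first exact: sqrtr_ge0.
by rewrite ler_pdivlMr// -ler_pdivrMr.
Qed.

Lemma sqrt_scale (R : realType) (p q v A k N : R) : 0 <= N ->
  Num.sqrt (p * (q * (A * N) ^+ 2 + 2 * ((k * N) ^+ 2 * v))) =
  Num.sqrt (p * (q * A ^+ 2 + 2 * (k ^+ 2 * v))) * N.
Proof.
move=> N0; rewrite -{3}(ger0_norm N0) -(sqrtr_sqr N) [RHS]mulrC -sqrtrM ?sqr_ge0//.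
by congr Num.sqrt; ring.
Qed.

Lemma scaled_small (R : realType) (X D t s : R) : 0 <= X -> X <= D -> 0 < D -> 0 <= s ->
  s <= t / D -> X * s <= t.
Proof.
move=> X0 XD D0 s0; rewrite ler_pdivlMr// => H; apply: le_trans H.
by rewrite mulrC ler_wpM2l.
Qed.

Theorem mainTheorem2 (R : realType) (n : nat) (Omega : set 'rV[R]_n)
    (I : Type) (T : I -> seq (n.+1.-tuple 'rV[R]_n)) (d l : nat)
    (Q J : I -> ('rV[R]_n -> R) -> ('rV[R]_n -> R))
    (f g gext u : 'rV[R]_n -> R) (C0 c0 m' M' delta : R)
    (dim23 : n = 2%N \/ n = 3%N)
    (domOmega : convex_polyhedral_domain Omega)
    (triT : forall i, triangulation Omega (T i))
    (regT : shape_regular T)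
    (quT : quasi_uniform T)
    (ld : (3 <= l <= d)%N)
    (approxQ : quasi_interpolation Omega T d Q)
    (invV : inverse_estimates Omega T d)
    (C0_gt0 : 0 < C0)
    (invC0 : forall i v, spline_space Omega (T i) d v ->
      (broken_seminorm (T i) 2 +oo v <=
         (C0 * mesh_size (T i) `^ (- 1 - n%:R / 2))%:E * H1norm Omega v)%E)
    (interpJ : interpolation Omega T d l J)
    (c0_gt0 : 0 < c0)
    (f_ge : forall x, Omega x -> c0 <= f x)
    (u_smooth : smooth_on_closure Omega l u)
    (u_sconvex : strictly_convex Omega u)
    (u_eq : forall x, Omega x -> \det (hessian u x) = f x)
    (u_bdry : forall x, bdry Omega x -> u x = g x)
    (m'_gt0 : 0 < m') (M'_gt0 : 0 < M')
    (u_eig : forall x a, Omega x -> eigenvalue (hessian u x) a -> m' <= a <= M')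
    (delta_bnd : 0 < delta < Num.min 1 (m' / (2 * n%:R * C0)))
    (gext_smooth : smooth_on_closure Omega l gext)
    (gext_bdry : forall x, bdry Omega x -> gext x = g x) :
  exists C h0 : R, 0 < h0 /\
    forall i, mesh_size (T i) < h0 ->
      exists uh : 'rV[R]_n -> R,
        [/\ discrete_solution Omega (T i) d f (J i gext) uh,
            exists2 eps : R, 0 < eps & forall vh,
              discrete_solution Omega (T i) d f (J i gext) vh ->
              (H1norm Omega (vh \- uh)%R < eps%:E)%E ->
              forall x, Omega x -> vh x = uh x,
            (H1norm Omega (u \- uh)%R <= (C * mesh_size (T i) ^+ l)%:E)%E,
            Xh Omega T d delta Q u (fun j => J j gext) i uh &
            convex_function Omega uh].
Proof.
have n1 : (1 < n)%N by case: dim23 => ->.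
have n3 : (n <= 3)%N by case: dim23 => ->.
have n0 := ltnW n1.
have [l3 ld'] := andP ld.
have l1 : (1 <= l <= d)%N by rewrite (leq_trans _ l3).
have [r r0 clr] := domain_bounded domOmega.
have oO := domain_open domOmega.
have Or x : Omega x -> `|x| < r by move=> /subset_closure; exact: clr.
have mO := open_rV_measurable oO.
have fO := bounded_lt_pinfty mO Or.
have [cu C2u sob_u] := u_smooth.
have [Su Su0 Eu] := sob_seminorm_fin sob_u.
have [S S0 uS] := sobolev_C2_bound dim23 domOmega clr (leq_trans (isT : 1 < 3)%N (leqW l3)) C2u sob_u.
have au i := C2_admissible domOmega (triT i) C2u S0 uS.
have um x : Omega x -> forall y, m' * dotv y y <= dotv (y *m hessian u x) y.
  move=> Ox; apply: (rayleigh n0 (hessian_sym domOmega C2u Ox)) => a ev.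
  by have [] := andP (u_eig x a Ox ev).
(* The coercivity constant of [cof_coercive], with det D^2 u = f >= c0; S + 1 replaces S in order to
   be positive. *)
pose a := m' * c0 / (n%:R * (S + 1)) ^+ 2.
have S10 : 0 < S + 1 by rewrite ltr_wpDl.
have n0R : 0 < n%:R :> R by rewrite ltr0n.
have a0 : 0 < a by rewrite divr_gt0 ?mulr_gt0// exprn_gt0// mulr_gt0.
have uS1 x i k : Omega x -> `|partial i (partial k u) x| <= S by move=> /uS[_]; exact.
have ua x : Omega x -> forall y, a * dotv y y <= qform (cof (hessian u x)) y y.
  move=> Ox; apply: (cof_coercive n0 (hessian_sym domOmega C2u Ox) m'_gt0 c0_gt0 S10 _ _ (um x Ox)).
    move=> i k; rewrite hessianE; apply: (le_trans (uS1 x i k Ox)); by rewrite lerDl.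
  by rewrite u_eq//; exact: f_ge.
(* The tolerance for Hessians meets three demands: the cofactor perturbation bound, coercivity up to
   the factor 1 / 2, and convexity of the solution. *)
pose rho := Num.min 1 (Num.min (a / 2 / (n%:R * (4 * S + 2))) (m' / n%:R ^+ 2)).
have S42 : 0 < 4 * S + 2 by rewrite ltr_wpDl// mulr_ge0.
have rho0 : 0 < rho.
  rewrite !lt_min ltr01 /=; apply/andP; split.
    by apply: divr_gt0; [exact: divr_gt0|exact: mulr_gt0].
  by apply: divr_gt0 => //; exact: exprn_gt0.
have rho1 : rho <= 1 by rewrite ge_min lexx.
have rhoa : n%:R * ((4 * S + 2) * rho) <= a / 2.
  rewrite mulrA mulrC -ler_pdivlMr; last exact: mulr_gt0.
  by rewrite !ge_min lexx orbT.
have rhom : n%:R ^+ 2 * rho <= m'.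
  rewrite mulrC -ler_pdivlMr; last exact: exprn_gt0.
  by rewrite !ge_min lexx !orbT.
(* With p = +oo the approximation properties give bounds at every point of the open simplices;
   integral norms follow with the volume. *)
have [Q1 _ _ /(_ +oo%E 1 l (leey _) l1)[Cq HQ]] := approxQ.
have [J1 J2 J3] := interpJ.
have [Cj1 HJ1] := J3 1 (leq_trans (isT : 0 < 3)%N l3).
have [Cj2 HJ2] := J3 2 (leq_trans (isT : 1 < 3)%N l3).
pose k1 := `|Cj1| * Su; pose k2 := `|Cj2| * Su; pose k3 := `|Cq| * Su.
have k10 : 0 <= k1 by rewrite mulr_ge0.
have k20 : 0 <= k2 by rewrite mulr_ge0.
have k30 : 0 <= k3 by rewrite mulr_ge0.
pose vol := fine (lebesgue_rV n Omega).
have vol0 : 0 <= vol by exact: fine_ge0.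
pose m1 : R := #|{: @mindex n 1}|%:R.
pose X := (n%:R * (n%:R * (2 * (S + 1 + 1) ^+ 2))) ^+ 2 * (n%:R * (k1 ^+ 2 * vol)).
have X0 : 0 <= X by apply: mulr_ge0; [exact: sqr_ge0|rewrite mulr_ge0// mulr_ge0// sqr_ge0].
(* X h^(2 l) bounds the squared residual; A is the radius factor required by [residual_small],
   increased by 1 to be positive. *)
pose A := Num.sqrt X * 8 / (n%:R * a) + 1.
have XA : Num.sqrt X * 8 / (n%:R * a) <= A by rewrite lerDl.
have A0 : 0 < A.
  apply: ltr_wpDl => //; apply: divr_ge0; last by rewrite mulr_ge0// ltW.
  by rewrite mulr_ge0// sqrtr_ge0.
pose Ch := Num.sqrt (m1 * (2 * (4 * r ^+ 2 + 1))).
pose C k := Num.sqrt (m1 * (2 * (4 * r ^+ 2 + 1) * A ^+ 2 + 2 * (k ^+ 2 * vol))).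
pose C1 := C0 * Ch * A; pose C2 := C (k1 + k3).
have C10 : 0 <= C1 by rewrite /C1 !mulr_ge0 ?sqrtr_ge0 ?(ltW C0_gt0) ?(ltW A0).
have C20 : 0 <= C2 by exact: sqrtr_ge0.
(* One bound for the constants of the three quantities that must become small: the Hessian error of
   J u, the Hessians of the corrections in the ball, and the distance to Q u relative to h^(1 +
   n/2). *)
pose D := k2 + C1 + C2 + 1.
have D0 : 0 < D by rewrite ltr_wpDl// !addr_ge0.
have D1 : k2 <= D by rewrite /D -!addrA lerDl !addr_ge0.
have D2 : C1 <= D by rewrite /D (addrC k2) -!addrA lerDl !addr_ge0.
have D3 : C2 <= D by rewrite /D (addrC (k2 + C1)) -!addrA lerDl !addr_ge0.
have [delta0 _] := andP delta_bnd.
(* rho / 3 serves the two Hessian bounds; delta / 8 in place of delta / 4 makes the inequality in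
   [Xh] strict. *)
pose t := Num.min (rho / 3) (delta / 8).
have t0 : 0 < t by rewrite lt_min !divr_gt0.
have t1 : t <= rho / 3 by rewrite ge_min lexx.
have t2 : t <= delta / 8 by rewrite ge_min lexx orbT.
pose sigma := t / D.
have sigma0 : 0 < sigma by exact: divr_gt0.
(* For h < sigma^2 the spare factor h^(1/2) is at most t / D; h <= 1 allows powers of h to be
   compared by their exponents. *)
exists (C k1), (Num.min 1 (sigma ^+ 2)); split.
  by rewrite lt_min ltr01 exprn_gt0.
move=> i; pose h := mesh_size (T i); rewrite -/h => hlt.
have h0 : 0 < h := mesh_size_gt0 n0 domOmega (triT i).
have h1 : h <= 1 by apply: ltW; apply: (lt_le_trans hlt); rewrite ge_min lexx.
pose s := h `^ 2^-1; pose N := h ^+ l.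
have s0 : 0 <= s by exact: powR_ge0.
have N0 : 0 <= N by rewrite exprn_ge0// ltW.
have s_sigma : s <= sigma.
  rewrite /s powR12_sqrt ?(ltW h0)// -(ger0_norm (ltW sigma0)) -sqrtr_sqr; apply: ler_wsqrtr.
  by apply: ltW; apply: (lt_le_trans hlt); rewrite ge_min lexx orbT.
have small Y : 0 <= Y -> Y <= D -> Y * s <= t by move=> Y0 YD; exact: (scaled_small Y0 YD D0 s0).
have sJ := J1 i u u_smooth.
have Iu : (lebesgue_rV n).-integrable Omega (EFin \o u).
  by apply: bmeas_integrable => //; have [] := nice_bmeas oO Or (admissible_nice (au i)).
have sQ := Q1 i u Iu.
have aJ := spl_adm dim23 domOmega (triT i) sJ.
have aQ := spl_adm dim23 domOmega (triT i) sQ.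
have bJ1 : (broken_norm (T i) 1 +oo (u \- J i u)%R <= (k1 * N)%:E)%E.
  by apply: (scaled_bound Su0 N0 Eu); have := HJ1 i u u_smooth; rewrite subn1.
have bQ1 : (broken_norm (T i) 1 +oo (u \- Q i u)%R <= (k3 * N)%:E)%E.
  by apply: (scaled_bound Su0 N0 Eu); have := HQ i u sob_u; rewrite subn1.
have bJ2 : (broken_norm (T i) 2 +oo (u \- J i u)%R <= (k2 * h ^+ (l.+1 - 2))%:E)%E.
  by apply: (scaled_bound Su0 (exprn_ge0 _ (ltW h0)) Eu); exact: HJ2.
have J1d := broken1_diff dim23 domOmega (triT i) clr (au i) aJ bJ1.
have Q1d := broken1_diff dim23 domOmega (triT i) clr (au i) aQ bQ1.
pose H := C0 * h `^ (- 1 - n%:R / 2).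
have H0 : 0 < H by rewrite mulr_gt0// powR_gt0.
have R00 : 0 < A * N by rewrite mulr_gt0// exprn_gt0.
have HR : H * (Ch * (A * N)) <= rho / 3.
  (* The factor h^l from the radius of the ball meets h^(-1 - n/2) from the inverse estimate. *)
  rewrite (_ : _ * _ = C1 * (N * h `^ (- 1 - n%:R / 2))); last by rewrite /H /C1; ring.
  apply: le_trans t1; apply: le_trans (small _ C10 D2); apply: (ler_wpM2l C10).
  exact: (mesh_power_inv h0 h1 n3 l3).
have res : (n%:R * (n%:R * (2 * (S + 1 + 1) ^+ 2))) ^+ 2 * (n%:R * ((k1 * N) ^+ 2 * vol)) <=
    (n%:R * (a / 2) * (A * N) / 4) ^+ 2.
  apply: le_trans (residual_small N n0R a0 X0 XA); apply: le_of_eq; rewrite /X; ring.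
have J2d x j k : mesh_interior (T i) x ->
    `|partial j (partial k (J i u)) x - partial j (partial k u) x| <= rho / 3.
  move=> Gx; apply: (le_trans (broken2_diff dim23 domOmega (triT i) clr (au i) aJ bJ2 j k Gx)).
  apply: le_trans t1; apply: le_trans (small _ k20 D1); apply: (ler_wpM2l k20).
  exact: (mesh_power_sub h0 h1 l3).
(* u and the extension of g agree on the boundary, hence so do their interpolants: J u itself can
   serve as the centre of the ball with the prescribed boundary values. *)
have bd x : bdry Omega x -> J i u x = J i gext x.
  by apply: (J2 i u gext u_smooth gext_smooth) => y yb; rewrite u_bdry// gext_bdry.
have [uh [sol uniq err errQ cvx]] := mesh_result dim23 domOmega (triT i) r0 clr C2u (au i) S0 uS1 u_eq
  a0 ua um rho0 rho1 rhoa rhom sJ bd sQ R00 H0 J2d (fun x Gx => (J1d x Gx).2)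
  (fun x Gx => (Q1d x Gx).1) (invC0 i) HR res.
exists uh; split; [exact: sol|exact: uniq|..|exact: cvx].
  by apply: (le_trans err); rewrite lee_fin (sqrt_scale _ _ _ _ _ N0).
have [suh buh _] := sol; split; [exact: suh|exact: buh|].
apply: (le_lt_trans errQ); rewrite lte_fin -mulrDl (sqrt_scale _ _ _ _ _ N0) -/C2.
have P0 : 0 < h `^ (1 + n%:R / 2) by exact: powR_gt0.
apply: (@le_lt_trans _ _ (delta / 8 * h `^ (1 + n%:R / 2))).
  apply: (@le_trans _ _ (C2 * s * h `^ (1 + n%:R / 2))).
    rewrite -[leRHS]mulrA; change (C2 * N <= C2 * (s * h `^ (1 + n%:R / 2))).
    apply: (ler_wpM2l C20); exact: (mesh_power_mul h0 h1 n3 l3).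
  by rewrite ler_pM2r//; exact: le_trans (small _ C20 D3) t2.
change (delta / 8 * h `^ (1 + n%:R / 2) < delta * h `^ (1 + n%:R / 2) / 4).
rewrite [ltRHS]mulrAC ltr_pM2r// ltr_pM2l// ltf_pV2 ?posrE//.
by rewrite ltr_nat.
Qed.
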